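(* Let $g \in \mathrm{BMOA}$ and let $1 \le p < \infty$ with $p \neq 2$. If $M \subset H^p$ is an infinite-dimensional closed subspace and the restriction of $T_g$ to $M$ is bounded below (i.e. there is $c>0$ with $\|T_g f\|_{H^p} \ge c\|f\|_{H^p}$ for all $f \in M$), then $M$ contains a closed subspace linearly isomorphic to $\ell^p$.
   Context: $\mathbb{D}$ is the open unit disc and $\mathbb{T}=\partial\mathbb{D}$. For $0<p<\infty$, $H^p$ is the Hardy space of analytic functions on $\mathbb{D}$. For $a\in\mathbb{D}$ let $\sigma_a(z)=\frac{a-z}{1-\bar a z}$. $\mathrm{BMOA}$ is the space of analytic $f\colon\mathbb{D}\to\mathbb{C}$ with $\sup_{a\in\mathbb{D}}\|f\circ\sigma_a-f(a)\|_{H^2}<\infty$. For an analytic $g$ on $\mathbb{D}$, the generalised Volterra operator is $T_g f(z)=\int_0^z f(w)g'(w)\,dw$, $z\in\mathbb{D}$; for $g\in\mathrm{BMOA}$ it is bounded $H^p\to H^p$. *)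

(* Defs.v *)
From Stdlib Require Import Reals Lra ClassicalEpsilon.
Open Scope R_scope.

Definition Cx : Type := (R * R)%type.
Definition Cre (z : Cx) : R := fst z.
Definition Cim (z : Cx) : R := snd z.
Definition RtoC (x : R) : Cx := (x, 0).
Definition C0 : Cx := (0, 0).
Definition Cadd (z w : Cx) : Cx := (Cre z + Cre w, Cim z + Cim w).
Definition Copp (z : Cx) : Cx := (- Cre z, - Cim z).
Definition Csub (z w : Cx) : Cx := Cadd z (Copp w).
Definition Cmul (z w : Cx) : Cx :=
  (Cre z * Cre w - Cim z * Cim w, Cre z * Cim w + Cim z * Cre w).
Definition Cconj (z : Cx) : Cx := (Cre z, - Cim z).
Definition Cnorm (z : Cx) : R := sqrt (Cre z * Cre z + Cim z * Cim z).
Definition Cinv (z : Cx) : Cx :=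
  let d := Cre z * Cre z + Cim z * Cim z in (Cre z / d, - Cim z / d).
Definition Cdiv (z w : Cx) : Cx := Cmul z (Cinv w).
Fixpoint Cpow (z : Cx) (n : nat) : Cx :=
  match n with O => (1, 0) | S k => Cmul z (Cpow z k) end.
Definition Cexpi (t : R) : Cx := (cos t, sin t).
Fixpoint Csum (n : nat) (F : nat -> Cx) : Cx :=
  match n with O => C0 | S k => Cadd (Csum k F) (F k) end.

Definition inD (z : Cx) : Prop := Cnorm z < 1.

Definition rpow (x y : R) : R := if Rle_dec x 0 then 0 else Rpower x y.

Definition analytic (f : Cx -> Cx) : Prop :=
  exists a : nat -> Cx, forall z, inD z ->
    forall eps, eps > 0 -> exists N : nat, forall n, (n >= N)%nat ->
      Cnorm (Csub (Csum n (fun k => Cmul (a k) (Cpow z k))) (f z)) < eps.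

Definition has_Cderiv (g : Cx -> Cx) (z w : Cx) : Prop :=
  forall eps, eps > 0 -> exists delta, delta > 0 /\
    forall h, 0 < Cnorm h < delta ->
      Cnorm (Csub (Cdiv (Csub (g (Cadd z h)) (g z)) h) w) < eps.
Definition Cderiv (g : Cx -> Cx) (z : Cx) : Cx :=
  epsilon (inhabits C0) (fun w => has_Cderiv g z w).

Definition Rint (f : R -> R) (a b : R) : R :=
  epsilon (inhabits 0)
    (fun v => exists pr : Riemann_integrable f a b, RiemannInt pr = v).
Definition Cint (F : R -> Cx) (a b : R) : Cx :=
  (Rint (fun t => Cre (F t)) a b, Rint (fun t => Cim (F t)) a b).

Definition Mp (p r : R) (f : Cx -> Cx) : R :=
  rpow (Rint (fun t => rpow (Cnorm (f (Cmul (RtoC r) (Cexpi t)))) p) 0 (2 * PI)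
          / (2 * PI)) (1 / p).

Definition is_Hp (p : R) (f : Cx -> Cx) : Prop :=
  analytic f /\ exists K, forall r, 0 <= r < 1 -> Mp p r f <= K.

Definition Hp_norm (p : R) (f : Cx -> Cx) : R :=
  epsilon (inhabits 0)
    (is_lub (fun y => exists r, 0 <= r < 1 /\ y = Mp p r f)).

Definition sigma (a z : Cx) : Cx := Cdiv (Csub a z) (Csub (RtoC 1) (Cmul (Cconj a) z)).

Definition is_BMOA (g : Cx -> Cx) : Prop :=
  analytic g /\ exists K, forall a, inD a ->
    is_Hp 2 (fun z => Csub (g (sigma a z)) (g a)) /\
    Hp_norm 2 (fun z => Csub (g (sigma a z)) (g a)) <= K.

(** * Generalised Volterra operator
    T_g f (z) = int_0^z f(w) g'(w) dw = int_0^1 f(tz) g'(tz) z dt *)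
Definition Tg (g f : Cx -> Cx) (z : Cx) : Cx :=
  Cmul z (Cint (fun t => Cmul (f (Cmul (RtoC t) z)) (Cderiv g (Cmul (RtoC t) z))) 0 1).

(** * Subspaces of H^p (functions are identified with their values on D) *)
Definition closed_subspace (p : R) (M : (Cx -> Cx) -> Prop) : Prop :=
  (forall f, M f -> is_Hp p f) /\
  M (fun _ => C0) /\
  (forall f h, M f -> M h -> M (fun z => Cadd (f z) (h z))) /\
  (forall (c : Cx) f, M f -> M (fun z => Cmul c (f z))) /\
  (forall (fn : nat -> Cx -> Cx) f, (forall n, M (fn n)) -> is_Hp p f ->
     Un_cv (fun n => Hp_norm p (fun z => Csub (fn n z) (f z))) 0 -> M f).

Definition infinite_dimensional (M : (Cx -> Cx) -> Prop) : Prop :=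
  forall n : nat, exists f : nat -> Cx -> Cx,
    (forall i, (i < n)%nat -> M (f i)) /\
    (forall c : nat -> Cx,
       (forall z, inD z -> Csum n (fun i => Cmul (c i) (f i z)) = C0) ->
       forall i, (i < n)%nat -> c i = C0).

Definition in_lp (p : R) (x : nat -> Cx) : Prop :=
  exists s, infinite_sum (fun n => rpow (Cnorm (x n)) p) s.
Definition lp_norm (p : R) (x : nat -> Cx) : R :=
  rpow (epsilon (inhabits 0) (infinite_sum (fun n => rpow (Cnorm (x n)) p))) (1 / p).

(** N is linearly isomorphic to l^p: a linear bijection T : l^p -> N that is
    bounded and bounded below (equality in N is equality on D). *)
Definition isomorphic_to_lp (p : R) (N : (Cx -> Cx) -> Prop) : Prop :=
  exists T : (nat -> Cx) -> (Cx -> Cx),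
    (forall x, in_lp p x -> N (T x)) /\
    (forall x y (a b : Cx), in_lp p x -> in_lp p y -> forall z, inD z ->
        T (fun n => Cadd (Cmul a (x n)) (Cmul b (y n))) z
        = Cadd (Cmul a (T x z)) (Cmul b (T y z))) /\
    (forall h, N h -> exists x, in_lp p x /\ forall z, inD z -> T x z = h z) /\
    exists c K, 0 < c /\ 0 < K /\ forall x, in_lp p x ->
      c * lp_norm p x <= Hp_norm p (T x) <= K * lp_norm p x.

(* Main.v *)
(* Choose unit vectors f_n in M whose first n Taylor coefficients vanish. Then f_n, and with
   it F_n = T_g f_n, tends to 0 locally uniformly, while the norms of the F_n stay between two
   positive constants. The point is that F_n -> 0 in measure on all circles |z| = s, uniformly in
   s < 1; as each |F_k|^p is uniformly integrable over these circles, a subsequence of F_n is almost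
   disjointly supported, so ||sum x_k F_k||^p is comparable to sum |x_k|^p, and boundedness of
   T_g from above and below on M transfers this to sum x_k f_k.

   No boundary values are used: all estimates concern means over circles |z| = r, and rest on
   the fact that such means are nondecreasing in r for functions with nonnegative Laplacian.
   The BMOA condition enters as a smooth function v on D with 0 <= v <= K, K independent of
   rho, whose Laplacian cancels that of |g(rho z)|^2: up to approximating g by polynomials, v is
   the harmonic extension of |g(rho z)|^2 from T minus |g(rho z)|^2, and its value at a is the
   mean of |g(rho sigma_a) - g(rho a)|^2 over T. *)
From Coquelicot Require Import Coquelicot.
From Stdlib Require Import Reals Lra Lia ClassicalEpsilon FunctionalExtensionality.
Require Import Defs.
Open Scope R_scope.

(** * Complex arithmetic *)

(* The p-th means of the F_n stay away from 0, so they can only be small in a weaker mean;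
   convergence in measure is expressed by the exponent 1/2, which lies below every admissible p. Two
   facts about g give it. First, e^(-v) |f|^p gains at least a constant times |f|^p |g'|^2 in its
   Laplacian, so v does the work of the Carleson measure |g'|^2 dA; large values of f_n are charged
   to this term. Second, the H^2 means of g converge, so the mass of |g'|^2 outside a large compact
   disc is small; moderate values of f_n are charged to that.

   Powers of |f| are not smooth at zeros, hence the regularisation |f|^2 + eps, and the potential
   exists for dilates of g only; eps and the dilation are removed at the level of circle means.
   Laplacians are taken in the variable log z, where dilations and rotations are translations.
   Monotonicity of means then follows from symmetric second differences along these two flows,
   without differentiating under an integral sign. *)
Declare Scope cx_scope.
Delimit Scope cx_scope with X.
Infix "+" := Cadd : cx_scope.
Infix "-" := Csub : cx_scope.
Infix "*" := Cmul : cx_scope.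
Infix "/" := Cdiv : cx_scope.
Notation "- x" := (Copp x) : cx_scope.
Notation C1 := (RtoC 1).

Lemma Cx_eq (z w : Cx) : Cre z = Cre w -> Cim z = Cim w -> z = w.
Proof. destruct z, w; simpl; intros; subst; reflexivity. Qed.

Ltac cx_ring :=
  apply Cx_eq; unfold Csub, Cadd, Cmul, Copp, RtoC, C0, Cconj, Cre, Cim; simpl; ring.

Lemma Cx_nonzero (z : Cx) : z <> C0 -> 0 < Cre z * Cre z + Cim z * Cim z.
Proof.
  intros Hz. destruct z as [x y]; unfold Cre, Cim; simpl.
  destruct (Req_dec x 0) as [->|Hx]; [|nra].
  destruct (Req_dec y 0) as [->|Hy]; [|nra].
  now destruct Hz.
Qed.

Lemma Cx_field :
  field_theory C0 C1 Cadd Cmul Csub Copp Cdiv Cinv (@eq Cx).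
Proof.
  constructor.
  - constructor; intros; try reflexivity; cx_ring.
  - intros H. apply (f_equal fst) in H. simpl in H. lra.
  - reflexivity.
  - intros z Hz. pose proof (Cx_nonzero z Hz) as H.
    destruct z as [x y]. unfold Cre, Cim in H; simpl in H.
    apply Cx_eq; unfold Cinv, Cmul, Cre, Cim; simpl; field; lra.
Qed.
Add Field Cx_field_inst : Cx_field.

Lemma Cnorm_Cmod (z : Cx) : Cnorm z = Cmod z.
Proof. unfold Cnorm, Cmod, Cre, Cim. f_equal. ring. Qed.

Lemma Cnorm_ge0 (z : Cx) : 0 <= Cnorm z.
Proof. apply sqrt_pos. Qed.

Lemma Cnorm_sqr (z : Cx) : Cnorm z * Cnorm z = Cre z * Cre z + Cim z * Cim z.
Proof. unfold Cnorm. apply sqrt_sqrt. nra. Qed.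

Lemma Cnorm_add (z w : Cx) : Cnorm (z + w)%X <= Cnorm z + Cnorm w.
Proof. rewrite !Cnorm_Cmod. apply (Cmod_triangle z w). Qed.

Lemma Cnorm_mul (z w : Cx) : Cnorm (z * w)%X = Cnorm z * Cnorm w.
Proof. rewrite !Cnorm_Cmod. apply (Cmod_mult z w). Qed.

Lemma Cnorm_opp (z : Cx) : Cnorm (- z)%X = Cnorm z.
Proof. rewrite !Cnorm_Cmod. apply (Cmod_opp z). Qed.

Lemma Cnorm_conj (z : Cx) : Cnorm (Cconj z) = Cnorm z.
Proof. unfold Cnorm, Cconj, Cre, Cim; simpl. f_equal; ring. Qed.

Lemma Cnorm_RtoC (x : R) : Cnorm (RtoC x) = Rabs x.
Proof. rewrite Cnorm_Cmod. apply Cmod_R. Qed.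

Lemma Cnorm_0 : Cnorm C0 = 0.
Proof. change C0 with (RtoC 0). rewrite Cnorm_RtoC. apply Rabs_R0. Qed.

Lemma Cnorm_1 : Cnorm C1 = 1.
Proof. rewrite Cnorm_RtoC. apply Rabs_R1. Qed.

Lemma Cnorm_eq0 (z : Cx) : Cnorm z = 0 -> z = C0.
Proof. rewrite Cnorm_Cmod. intros H. apply (Cmod_eq_0 z H). Qed.

Lemma Cnorm_gt0 (z : Cx) : z <> C0 -> 0 < Cnorm z.
Proof.
  intros H. destruct (Cnorm_ge0 z) as [|E]; [assumption|].
  destruct H. apply Cnorm_eq0. now symmetry.
Qed.

Lemma Cnorm_sub_sym (z w : Cx) : Cnorm (z - w)%X = Cnorm (w - z)%X.
Proof. rewrite <- Cnorm_opp. f_equal. ring. Qed.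

Lemma Cnorm_sub (z w : Cx) : Cnorm (z - w)%X <= Cnorm z + Cnorm w.
Proof. unfold Csub. eapply Rle_trans; [apply Cnorm_add|]. rewrite Cnorm_opp. lra. Qed.

Lemma Cnorm_sub_tri (z w u : Cx) : Cnorm (z - w)%X <= Cnorm (z - u)%X + Cnorm (u - w)%X.
Proof. replace (z - w)%X with ((z - u) + (u - w))%X by ring. apply Cnorm_add. Qed.

Lemma Cnorm_rev (z w : Cx) : Cnorm z - Cnorm w <= Cnorm (z - w)%X.
Proof.
  assert (Cnorm z <= Cnorm (z - w)%X + Cnorm w); [|lra].
  replace z with ((z - w) + w)%X at 1 by ring. apply Cnorm_add.
Qed.

Lemma Cre_le (z : Cx) : Rabs (Cre z) <= Cnorm z.
Proof.
  apply Rsqr_incr_0_var; [|apply Cnorm_ge0]. rewrite <- Rsqr_abs. unfold Rsqr.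
  rewrite Cnorm_sqr. nra.
Qed.

Lemma Cim_le (z : Cx) : Rabs (Cim z) <= Cnorm z.
Proof.
  apply Rsqr_incr_0_var; [|apply Cnorm_ge0]. rewrite <- Rsqr_abs. unfold Rsqr.
  rewrite Cnorm_sqr. nra.
Qed.

Lemma Cnorm_le_ReIm (z : Cx) : Cnorm z <= Rabs (Cre z) + Rabs (Cim z).
Proof.
  apply Rsqr_incr_0_var; [|pose proof (Rabs_pos (Cre z)); pose proof (Rabs_pos (Cim z)); lra].
  unfold Rsqr. rewrite Cnorm_sqr.
  pose proof (Rabs_pos (Cre z)); pose proof (Rabs_pos (Cim z)).
  assert (Rabs (Cre z) * Rabs (Cre z) = Cre z * Cre z) by (rewrite <- Rabs_mult; apply Rabs_pos_eq; nra).
  assert (Rabs (Cim z) * Rabs (Cim z) = Cim z * Cim z) by (rewrite <- Rabs_mult; apply Rabs_pos_eq; nra).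
  nra.
Qed.

Lemma Cnorm_pow (z : Cx) (n : nat) : Cnorm (Cpow z n) = Cnorm z ^ n.
Proof.
  induction n; simpl; [apply Cnorm_1|]. now rewrite Cnorm_mul, IHn.
Qed.

Lemma Cnorm_inv (z : Cx) : z <> C0 -> Cnorm (Cinv z) = / Cnorm z.
Proof.
  intros Hz. pose proof (Cnorm_gt0 z Hz).
  apply Rmult_eq_reg_l with (Cnorm z); [|lra].
  rewrite <- Cnorm_mul, Rinv_r by lra. rewrite <- Cnorm_1. f_equal. field. exact Hz.
Qed.

Lemma Cnorm_div (z w : Cx) : w <> C0 -> Cnorm (z / w)%X = Cnorm z / Cnorm w.
Proof. intros Hw. unfold Cdiv. now rewrite Cnorm_mul, Cnorm_inv. Qed.

Lemma Cpow_mul (z w : Cx) (n : nat) : Cpow (z * w)%X n = (Cpow z n * Cpow w n)%X.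
Proof. induction n; simpl; [cx_ring|]. rewrite IHn. ring. Qed.

Lemma Cpow_add (z : Cx) (n m : nat) : Cpow z (n + m) = (Cpow z n * Cpow z m)%X.
Proof. induction n; simpl; [|rewrite IHn]; cx_ring. Qed.

Lemma Cexpi_add (s t : R) : Cexpi (s + t) = (Cexpi s * Cexpi t)%X.
Proof.
  unfold Cexpi. apply Cx_eq; unfold Cmul, Cre, Cim; simpl; rewrite ?cos_plus, ?sin_plus; ring.
Qed.

Lemma Cnorm_expi (t : R) : Cnorm (Cexpi t) = 1.
Proof.
  unfold Cnorm, Cexpi, Cre, Cim; simpl.
  pose proof (sin2_cos2 t) as H. unfold Rsqr in H.
  replace (cos t * cos t + sin t * sin t) with 1 by lra. apply sqrt_1.
Qed.

Lemma Cexpi_2PI (t : R) : Cexpi (t + 2 * PI) = Cexpi t.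
Proof. unfold Cexpi. now rewrite cos_plus, sin_plus, cos_2PI, sin_2PI, !Rmult_1_r, !Rmult_0_r, Rminus_0_r, Rplus_0_r. Qed.

Definition circ (r t : R) : Cx := (RtoC r * Cexpi t)%X.

Lemma Cnorm_circ (r t : R) : 0 <= r -> Cnorm (circ r t) = r.
Proof.
  intros Hr. unfold circ. rewrite Cnorm_mul, Cnorm_RtoC, Cnorm_expi, Rabs_pos_eq by lra. lra.
Qed.

(** * Finite sums and series *)

Lemma Csum_ext (n : nat) (u v : nat -> Cx) :
  (forall k, (k < n)%nat -> u k = v k) -> Csum n u = Csum n v.
Proof.
  induction n; intros H; simpl; [reflexivity|].
  rewrite IHn by (intros; apply H; lia). now rewrite H by lia.
Qed.

Lemma Csum_add (n : nat) (u v : nat -> Cx) :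
  Csum n (fun k => u k + v k)%X = (Csum n u + Csum n v)%X.
Proof. induction n; simpl; [cx_ring|]. rewrite IHn. ring. Qed.

Lemma Csum_mul (n : nat) (c : Cx) (u : nat -> Cx) :
  Csum n (fun k => c * u k)%X = (c * Csum n u)%X.
Proof. induction n; simpl; [cx_ring|]. rewrite IHn. ring. Qed.

Lemma Csum_zero (n : nat) (u : nat -> Cx) :
  (forall k, (k < n)%nat -> u k = C0) -> Csum n u = C0.
Proof.
  induction n; intros H; simpl; [reflexivity|].
  rewrite IHn by (intros; apply H; lia). rewrite H by lia. cx_ring.
Qed.

Lemma Csum_split (n m : nat) (u : nat -> Cx) :
  Csum (n + m) u = (Csum n u + Csum m (fun k => u (n + k)%nat))%X.
Proof.
  induction m; simpl.
  - rewrite Nat.add_0_r. cx_ring.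
  - rewrite Nat.add_succ_r. simpl. rewrite IHm. ring.
Qed.

Fixpoint Rsum (n : nat) (u : nat -> R) : R :=
  match n with O => 0 | S k => Rsum k u + u k end.

Lemma Rsum_ext (n : nat) (u v : nat -> R) :
  (forall k, (k < n)%nat -> u k = v k) -> Rsum n u = Rsum n v.
Proof.
  induction n; intros H; simpl; [reflexivity|].
  rewrite IHn by (intros; apply H; lia). now rewrite H by lia.
Qed.

Lemma Rsum_le (n : nat) (u v : nat -> R) :
  (forall k, (k < n)%nat -> u k <= v k) -> Rsum n u <= Rsum n v.
Proof.
  induction n; intros H; simpl; [lra|].
  specialize (IHn (fun k Hk => H k ltac:(lia))). specialize (H n ltac:(lia)). lra.
Qed.

Lemma Rsum_ge0 (n : nat) (u : nat -> R) :
  (forall k, (k < n)%nat -> 0 <= u k) -> 0 <= Rsum n u.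
Proof.
  induction n; intros H; simpl; [lra|].
  specialize (IHn (fun k Hk => H k ltac:(lia))). specialize (H n ltac:(lia)). lra.
Qed.

Lemma Rsum_add (n : nat) (u v : nat -> R) :
  Rsum n (fun k => u k + v k) = Rsum n u + Rsum n v.
Proof. induction n; simpl; [ring|]. rewrite IHn. ring. Qed.

Lemma Rsum_scal (n : nat) (c : R) (u : nat -> R) :
  Rsum n (fun k => c * u k) = c * Rsum n u.
Proof. induction n; simpl; [ring|]. rewrite IHn. ring. Qed.

Lemma Rsum_const (n : nat) (c : R) : Rsum n (fun _ => c) = INR n * c.
Proof. induction n; [simpl; ring|]. rewrite S_INR. simpl. rewrite IHn. ring. Qed.

Lemma Rsum_split (n m : nat) (u : nat -> R) :
  Rsum (n + m) u = Rsum n u + Rsum m (fun k => u (n + k)%nat).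
Proof.
  induction m; simpl.
  - rewrite Nat.add_0_r. ring.
  - rewrite Nat.add_succ_r. simpl. rewrite IHm. ring.
Qed.

Lemma Rsum_incr (n m : nat) (u : nat -> R) :
  (forall k, 0 <= u k) -> (n <= m)%nat -> Rsum n u <= Rsum m u.
Proof.
  intros H L. replace m with (n + (m - n))%nat by lia. rewrite Rsum_split.
  pose proof (Rsum_ge0 (m - n) (fun k => u (n + k)%nat) (fun k _ => H _)). lra.
Qed.

Lemma Rsum_term (n k : nat) (u : nat -> R) :
  (forall k, 0 <= u k) -> (k < n)%nat -> u k <= Rsum n u.
Proof.
  intros H L. apply Rle_trans with (Rsum (S k) u).
  - simpl. pose proof (Rsum_ge0 k u (fun k _ => H k)). lra.
  - now apply Rsum_incr.
Qed.

Lemma sum_f_R0_Rsum (n : nat) (u : nat -> R) : sum_f_R0 u n = Rsum (S n) u.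
Proof. induction n; simpl in *; [ring|]. rewrite IHn. reflexivity. Qed.

Lemma Cnorm_Csum (n : nat) (u : nat -> Cx) :
  Cnorm (Csum n u) <= Rsum n (fun k => Cnorm (u k)).
Proof.
  induction n; simpl; [rewrite Cnorm_0; lra|].
  eapply Rle_trans; [apply Cnorm_add|]. lra.
Qed.

Definition ccv (u : nat -> Cx) (l : Cx) : Prop :=
  forall eps, eps > 0 -> exists N : nat, forall n, (n >= N)%nat -> Cnorm (u n - l)%X < eps.

Lemma ccv_unique (u : nat -> Cx) (l m : Cx) : ccv u l -> ccv u m -> l = m.
Proof.
  intros Hl Hm. destruct (Req_dec (Cnorm (l - m)%X) 0) as [E|NE].
  - apply Cnorm_eq0 in E. replace l with ((l - m) + m)%X by ring. rewrite E. cx_ring.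
  - exfalso. pose proof (Cnorm_ge0 (l - m)%X).
    destruct (Hl (Cnorm (l - m)%X / 2)) as [N1 H1]; [lra|].
    destruct (Hm (Cnorm (l - m)%X / 2)) as [N2 H2]; [lra|].
    specialize (H1 (N1 + N2)%nat ltac:(lia)). specialize (H2 (N1 + N2)%nat ltac:(lia)).
    pose proof (Cnorm_sub_tri l m (u (N1 + N2)%nat)).
    rewrite (Cnorm_sub_sym l (u _)) in H0. lra.
Qed.

Lemma ccv_ext (u v : nat -> Cx) (l : Cx) : (forall n, u n = v n) -> ccv u l -> ccv v l.
Proof. intros E H eps He. destruct (H eps He) as [N HN]. exists N. intros n Hn. rewrite <- E. auto. Qed.

Lemma ccv_add (u v : nat -> Cx) (l m : Cx) :
  ccv u l -> ccv v m -> ccv (fun n => u n + v n)%X (l + m)%X.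
Proof.
  intros Hl Hm eps He.
  destruct (Hl (eps / 2)) as [N1 H1]; [lra|]. destruct (Hm (eps / 2)) as [N2 H2]; [lra|].
  exists (N1 + N2)%nat. intros n Hn.
  specialize (H1 n ltac:(lia)). specialize (H2 n ltac:(lia)).
  replace (u n + v n - (l + m))%X with ((u n - l) + (v n - m))%X by ring.
  eapply Rle_lt_trans; [apply Cnorm_add|]. lra.
Qed.

Lemma ccv_scal (c : Cx) (u : nat -> Cx) (l : Cx) :
  ccv u l -> ccv (fun n => c * u n)%X (c * l)%X.
Proof.
  intros Hl eps He. pose proof (Cnorm_ge0 c).
  destruct (Hl (eps / (Cnorm c + 1))) as [N H1]; [apply Rdiv_lt_0_compat; lra|].
  exists N. intros n Hn. specialize (H1 n Hn).
  replace (c * u n - c * l)%X with (c * (u n - l))%X by ring.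
  rewrite Cnorm_mul. pose proof (Cnorm_ge0 (u n - l)%X).
  apply (Rmult_lt_compat_r (Cnorm c + 1)) in H1; [|lra].
  unfold Rdiv in H1. rewrite Rmult_assoc, Rinv_l in H1 by lra. nra.
Qed.

Lemma ccv_const (c : Cx) : ccv (fun _ => c) c.
Proof.
  intros eps He. exists 0%nat. intros. replace (c - c)%X with C0 by ring. rewrite Cnorm_0. lra.
Qed.

Lemma ccv_norm_le (u : nat -> Cx) (l : Cx) (B : R) :
  (exists N, forall n, (n >= N)%nat -> Cnorm (u n) <= B) -> ccv u l -> Cnorm l <= B.
Proof.
  intros [N0 H] Hl. apply le_epsilon. intros eps He.
  destruct (Hl eps He) as [N HN]. specialize (HN (N0 + N)%nat ltac:(lia)).
  specialize (H (N0 + N)%nat ltac:(lia)).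
  pose proof (Cnorm_rev l (u (N0 + N)%nat)). rewrite (Cnorm_sub_sym l (u _)) in H0. lra.
Qed.

Lemma ccv_ReIm (u : nat -> Cx) (l : Cx) :
  ccv u l <-> is_lim_seq (fun n => Cre (u n)) (Cre l) /\ is_lim_seq (fun n => Cim (u n)) (Cim l).
Proof.
  split.
  - intros H; split; apply is_lim_seq_spec; intros eps;
      destruct (H eps (cond_pos eps)) as [N HN]; exists N; intros n Hn; specialize (HN n Hn).
    + eapply Rle_lt_trans; [|exact HN]. apply (Cre_le (u n - l)%X).
    + eapply Rle_lt_trans; [|exact HN]. apply (Cim_le (u n - l)%X).
  - intros [H1 H2] eps He. apply is_lim_seq_spec in H1. apply is_lim_seq_spec in H2.
    assert (He2 : 0 < eps / 2) by lra.
    destruct (H1 (mkposreal _ He2)) as [N1 K1]. destruct (H2 (mkposreal _ He2)) as [N2 K2].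
    exists (N1 + N2)%nat. intros n Hn. specialize (K1 n ltac:(lia)). specialize (K2 n ltac:(lia)).
    simpl in K1, K2. eapply Rle_lt_trans; [apply Cnorm_le_ReIm|].
    change (Rabs (Cre (u n) + - Cre l) + Rabs (Cim (u n) + - Cim l) < eps).
    unfold Rminus in *. lra.
Qed.

Lemma ccv_Cauchy (u : nat -> Cx) :
  (forall eps, eps > 0 -> exists N, forall n m, (n >= N)%nat -> (m >= N)%nat ->
     Cnorm (u n - u m)%X < eps) -> exists l, ccv u l.
Proof.
  intros H.
  assert (H1 : ex_lim_seq_cauchy (fun n => Cre (u n))).
  { intros eps. destruct (H eps (cond_pos eps)) as [N HN]. exists N. intros n m Hn Hm.
    eapply Rle_lt_trans; [apply (Cre_le (u n - u m)%X)|]. now apply HN. }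
  assert (H2 : ex_lim_seq_cauchy (fun n => Cim (u n))).
  { intros eps. destruct (H eps (cond_pos eps)) as [N HN]. exists N. intros n m Hn Hm.
    eapply Rle_lt_trans; [apply (Cim_le (u n - u m)%X)|]. now apply HN. }
  apply ex_lim_seq_cauchy_corr in H1. apply ex_lim_seq_cauchy_corr in H2.
  destruct H1 as [x Hx]. destruct H2 as [y Hy]. exists (x, y). now apply ccv_ReIm.
Qed.

Lemma Rsum_bounded_Cauchy (u : nat -> R) (B : R) :
  (forall k, 0 <= u k) -> (forall n, Rsum n u <= B) ->
  forall eps, eps > 0 -> exists N, forall n m, (N <= n)%nat -> (n <= m)%nat ->
    Rsum m u - Rsum n u < eps.
Proof.
  intros H0 HB eps He.
  destruct (completeness (fun y => exists n, y = Rsum n u)) as [l [Hu Hl]].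
  - exists B. intros y [n ->]. apply HB.
  - exists (Rsum 0 u). now exists 0%nat.
  - destruct (classic (exists N, l - eps < Rsum N u)) as [[N HN]|HN].
    + exists N. intros n m Hn Hm. assert (Rsum m u <= l) by (apply Hu; now exists m).
      pose proof (Rsum_incr N n u H0 Hn). lra.
    + assert (l <= l - eps); [|lra]. apply Hl. intros y [n ->].
      destruct (Rle_lt_dec (Rsum n u) (l - eps)) as [|L]; [assumption|]. destruct HN. now exists n.
Qed.

Lemma Csum_abs_cv (u : nat -> Cx) (B : R) :
  (forall n, Rsum n (fun k => Cnorm (u k)) <= B) ->
  exists l, ccv (fun n => Csum n u) l /\ Cnorm l <= B.
Proof.
  intros HB. destruct (ccv_Cauchy (fun n => Csum n u)) as [l Hl].
  - intros eps He.
    destruct (Rsum_bounded_Cauchy (fun k => Cnorm (u k)) B (fun k => Cnorm_ge0 _) HB eps He) as [N HN].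
    assert (K : forall n m, (N <= n)%nat -> (n <= m)%nat -> Cnorm (Csum m u - Csum n u)%X < eps).
    { intros n m Hn Hm. replace m with (n + (m - n))%nat by lia. rewrite Csum_split.
      replace (Csum n u + Csum (m - n) (fun k => u (n + k)%nat) - Csum n u)%X
        with (Csum (m - n) (fun k => u (n + k)%nat)) by ring.
      eapply Rle_lt_trans; [apply Cnorm_Csum|].
      specialize (HN n m Hn Hm). replace m with (n + (m - n))%nat in HN by lia.
      rewrite Rsum_split in HN. replace (n + (m - n) - n)%nat with (m - n)%nat in HN by lia. lra. }
    exists N. intros n m Hn Hm. destruct (Nat.le_ge_cases n m).
    + rewrite Cnorm_sub_sym. now apply K.
    + now apply K.
  - exists l. split; [assumption|]. apply ccv_norm_le with (fun n => Csum n u); [|assumption].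
    exists 0%nat. intros n _. eapply Rle_trans; [apply Cnorm_Csum|]. apply HB.
Qed.

(** * Power series *)

Definition absum (a : nat -> Cx) : Prop :=
  forall r, 0 <= r < 1 -> exists B, 0 < B /\ forall n, Rsum n (fun k => Cnorm (a k) * r ^ k) <= B.

Lemma Rsum_geom (q : R) (n : nat) : 0 <= q < 1 -> Rsum n (fun k => q ^ k) <= / (1 - q).
Proof.
  intros Hq. assert (E : Rsum n (fun k => q ^ k) * (1 - q) = 1 - q ^ n).
  { induction n; simpl; [ring|]. rewrite Rmult_plus_distr_r, IHn. ring. }
  apply Rmult_le_reg_r with (1 - q); [lra|]. rewrite E, Rinv_l by lra.
  pose proof (pow_le q n). lra.
Qed.

(** Boundedness at the larger radius (1 + r) / 2 makes the terms at radius r geometric. Most later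
    coefficient sequences are shown to be summable through this criterion. *)
Lemma absum_of_bounded (a : nat -> Cx) :
  (forall r, 0 < r < 1 -> exists B, forall n, Cnorm (a n) * r ^ n <= B) -> absum a.
Proof.
  intros H r Hr. set (s := (1 + r) / 2). assert (Hs : 0 < s < 1) by (unfold s; lra).
  destruct (H s Hs) as [B HB].
  assert (HB0 : 0 <= B).
  { eapply Rle_trans; [|apply (HB 0%nat)]. simpl. pose proof (Cnorm_ge0 (a 0%nat)). lra. }
  assert (Hq : 0 <= r / s < 1).
  { split; [apply Rmult_le_pos; [lra|left; apply Rinv_0_lt_compat; lra]|].
    apply Rmult_lt_reg_r with s; [lra|]. replace (r / s * s) with r by (field; lra). unfold s; lra. }
  exists (B * / (1 - r / s) + 1). split.
  - assert (0 <= B * / (1 - r / s)); [|lra]. apply Rmult_le_pos; [assumption|].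
    left; apply Rinv_0_lt_compat; lra.
  - intros n. apply Rle_trans with (Rsum n (fun k => B * (r / s) ^ k)).
    + apply Rsum_le. intros k _. replace r with (s * (r / s)) at 1 by (field; lra).
      rewrite Rpow_mult_distr, <- Rmult_assoc. apply Rmult_le_compat_r; [apply pow_le; lra|]. apply HB.
    + rewrite Rsum_scal. pose proof (Rsum_geom (r / s) n Hq) as HG.
      apply (Rmult_le_compat_l B) in HG; [eapply Rle_trans; [exact HG|lra]|assumption].
Qed.

Definition psum (a : nat -> Cx) (z : Cx) (n : nat) : Cx := Csum n (fun k => a k * Cpow z k)%X.

(** [analytic] only provides convergence at each point. A term is a difference of consecutive
    partial sums, hence eventually less than 2, and bounded terms at every radius suffice. *)
Lemma series_absum (a : nat -> Cx) (f : Cx -> Cx) :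
  (forall z, inD z -> ccv (psum a z) (f z)) -> absum a.
Proof.
  intros H. apply absum_of_bounded. intros r Hr.
  assert (Hz : inD (RtoC r)) by (unfold inD; rewrite Cnorm_RtoC, Rabs_pos_eq; lra).
  destruct (H _ Hz 1 ltac:(lra)) as [N HN].
  set (B := Rsum N (fun k => Cnorm (a k) * r ^ k)).
  assert (T : forall k, 0 <= Cnorm (a k) * r ^ k).
  { intros k. apply Rmult_le_pos; [apply Cnorm_ge0|apply pow_le; lra]. }
  exists (B + 2). intros n. destruct (Nat.lt_ge_cases n N) as [L|L].
  - pose proof (Rsum_term N n (fun k => Cnorm (a k) * r ^ k) T L). fold B in H0. simpl in H0. lra.
  - assert (0 <= B) by (apply Rsum_ge0; intros; apply T).
    pose proof (HN n L) as H1. pose proof (HN (S n) ltac:(lia)) as H2.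
    assert (E : (psum a (RtoC r) (S n) - psum a (RtoC r) n)%X = (a n * Cpow (RtoC r) n)%X).
    { unfold psum. simpl. ring. }
    pose proof (Cnorm_sub_tri (psum a (RtoC r) (S n)) (psum a (RtoC r) n) (f (RtoC r))) as H3.
    rewrite E, Cnorm_mul, Cnorm_pow, Cnorm_RtoC, Rabs_pos_eq in H3 by lra.
    rewrite (Cnorm_sub_sym (f _)) in H3. lra.
Qed.

Fixpoint pw1 (z : Cx) (n : nat) : Cx :=
  match n with O => C0 | S k => (Cpow z k + z * pw1 z k)%X end.
Fixpoint pw2 (z : Cx) (n : nat) : Cx :=
  match n with O => C0 | S k => (pw1 z k + z * pw2 z k)%X end.

Definition lims (u : nat -> Cx) : Cx := epsilon (inhabits C0) (ccv (fun n => Csum n u)).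
Definition PS (a : nat -> Cx) (z : Cx) : Cx := lims (fun k => a k * Cpow z k)%X.
(* [pw1 z n] = n z^(n-1) and [pw2 z n] = n(n-1)/2 z^(n-2): [PS1] is the derivative of [PS] and
   [PS2] half of its second derivative. *)
Definition PS1 (a : nat -> Cx) (z : Cx) : Cx := lims (fun k => a k * pw1 z k)%X.
Definition PS2 (a : nat -> Cx) (z : Cx) : Cx := lims (fun k => a k * pw2 z k)%X.

Lemma lims_eq (u : nat -> Cx) (l : Cx) : ccv (fun n => Csum n u) l -> lims u = l.
Proof.
  intros H. apply ccv_unique with (fun n => Csum n u); [|assumption].
  unfold lims. apply epsilon_spec. now exists l.
Qed.

Lemma lims_bound (u : nat -> Cx) (m : nat -> R) (B k : R) :
  0 <= k -> (forall n, Cnorm (u n) <= k * m n) -> (forall n, Rsum n m <= B) ->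
  ccv (fun n => Csum n u) (lims u) /\ Cnorm (lims u) <= k * B.
Proof.
  intros Hk Hu HB. destruct (Csum_abs_cv u (k * B)) as [l [Hl Hn]].
  - intros n. eapply Rle_trans; [apply Rsum_le; intros; apply Hu|].
    rewrite Rsum_scal. apply Rmult_le_compat_l; [assumption|apply HB].
  - rewrite (lims_eq u l Hl). now split.
Qed.

(* Each estimate is r^n/(r-R)^j, which reproduces itself under the recursion
   x(n+1) <= R x(n) + y(n); no polynomial factor in n is needed. *)
Lemma pow_bounds (R0 r : R) (z w : Cx) (n : nat) :
  0 <= R0 < r -> Cnorm z <= R0 -> Cnorm w <= R0 ->
  Cnorm (Cpow z n) <= r ^ n /\ Cnorm (pw1 z n) <= / (r - R0) * r ^ n /\
  Cnorm (pw2 z n) <= (/ (r - R0)) ^ 2 * r ^ n /\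
  Cnorm (Cpow w n - Cpow z n - pw1 z n * (w - z) - pw2 z n * ((w - z) * (w - z)))%X
    <= (/ (r - R0)) ^ 3 * Cnorm (w - z)%X ^ 3 * r ^ n.
Proof.
  intros HR Hz Hw. set (k := / (r - R0)).
  assert (Hk : k * (r - R0) = 1) by (unfold k; field; lra).
  assert (Hk0 : 0 < k) by (unfold k; apply Rinv_0_lt_compat; lra).
  set (h := (w - z)%X). pose proof (Cnorm_ge0 h) as Hh.
  pose proof (Cnorm_ge0 z) as Hz0. pose proof (Cnorm_ge0 w) as Hw0.
  assert (G : forall x b c, 0 <= b -> x <= R0 * (k * c * b) + c * b -> x <= k * c * (r * b)).
  { intros x b c Hb Hx. replace (k * c * (r * b)) with (R0 * (k * c * b) + (k * (r - R0)) * (c * b)) by ring.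
    rewrite Hk. lra. }
  induction n as [|n [I0 [I1 [I2 I3]]]].
  - change (Cpow z 0) with C1. change (Cpow w 0) with C1. change (pw1 z 0) with C0. change (pw2 z 0) with C0.
    replace (C1 - C1 - C0 * h - C0 * (h * h))%X with C0 by ring.
    rewrite Cnorm_1, Cnorm_0. change (r ^ 0) with 1.
    assert (0 <= k ^ 3) by (apply pow_le; lra). assert (0 <= k ^ 2) by (apply pow_le; lra).
    assert (0 <= Cnorm h ^ 3) by (apply pow_le; lra).
    repeat split; try lra. rewrite Rmult_1_r. now apply Rmult_le_pos.
  - assert (Hr : 0 <= r ^ n) by (apply pow_le; lra).
    assert (Hh3 : 0 <= Cnorm h ^ 3) by (apply pow_le; lra).
    split; [|split; [|split]].
    + simpl. rewrite Cnorm_mul. apply Rmult_le_compat; try apply Cnorm_ge0; lra.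
    + simpl. replace (k * (r * r ^ n)) with (k * 1 * (r * r ^ n)) by ring. apply G; [assumption|].
      eapply Rle_trans; [apply Cnorm_add|]. rewrite Cnorm_mul, Rmult_1_r, Rmult_1_l.
      rewrite Rplus_comm. apply Rplus_le_compat; [|assumption].
      apply Rmult_le_compat; try apply Cnorm_ge0; assumption.
    + change (r ^ S n) with (r * r ^ n). replace (k ^ 2) with (k * k) in * by ring.
      apply G; [assumption|]. simpl pw2.
      eapply Rle_trans; [apply Cnorm_add|]. rewrite Cnorm_mul.
      rewrite Rplus_comm. apply Rplus_le_compat; [|assumption].
      apply Rmult_le_compat; try apply Cnorm_ge0; assumption.
    + change (r ^ S n) with (r * r ^ n).
      replace (k ^ 3 * Cnorm h ^ 3) with (k * (k ^ 2 * Cnorm h ^ 3)) in * by ring.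
      apply G; [assumption|].
      (* The Taylor remainder satisfies the same first-order recursion, with source [pw2 z n] times
         the cube of h. *)
      replace (Cpow w (S n) - Cpow z (S n) - pw1 z (S n) * h - pw2 z (S n) * (h * h))%X
        with (w * (Cpow w n - Cpow z n - pw1 z n * h - pw2 z n * (h * h)) + pw2 z n * (h * h * h))%X
        by (simpl; unfold h; ring).
      eapply Rle_trans; [apply Cnorm_add|]. rewrite !Cnorm_mul.
      apply Rplus_le_compat.
      * apply Rmult_le_compat; try apply Cnorm_ge0; assumption.
      * replace (k ^ 2 * Cnorm h ^ 3 * r ^ n) with (k ^ 2 * r ^ n * (Cnorm h * Cnorm h * Cnorm h)) by ring.
        apply Rmult_le_compat_r; [|assumption]. repeat apply Rmult_le_pos; lra.
Qed.

(** A second-order Taylor expansion with one constant on each smaller disc; D2 stands for half of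
    the second derivative. It is the only property of power series that the differential calculus
    below relies on. *)
Definition tay (F D1 D2 : Cx -> Cx) : Prop :=
  forall R0, 0 <= R0 < 1 -> exists C, 0 < C /\ forall z w, Cnorm z <= R0 -> Cnorm w <= R0 ->
    Cnorm (F z) <= C /\ Cnorm (D1 z) <= C /\ Cnorm (D2 z) <= C /\
    Cnorm (F w - F z - D1 z * (w - z) - D2 z * ((w - z) * (w - z)))%X <= C * Cnorm (w - z)%X ^ 3.

Lemma PS_cv (a : nat -> Cx) (z : Cx) : absum a -> inD z -> ccv (psum a z) (PS a z).
Proof.
  intros Ha Hz. destruct (Ha (Cnorm z) (conj (Cnorm_ge0 z) Hz)) as [B [HB HS]].
  apply (lims_bound (fun k => a k * Cpow z k)%X (fun k => Cnorm (a k) * Cnorm z ^ k) B 1); [lra| |assumption].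
  intros n. rewrite Cnorm_mul, Cnorm_pow. lra.
Qed.

Lemma PS_tay (a : nat -> Cx) : absum a -> tay (PS a) (PS1 a) (PS2 a).
Proof.
  intros Ha R0 HR. set (r := (1 + R0) / 2). assert (Hr : R0 < r < 1) by (unfold r; lra).
  destruct (Ha r ltac:(lra)) as [B [HB HS]].
  set (k := / (r - R0)). assert (Hk : 0 < k) by (unfold k; apply Rinv_0_lt_compat; lra).
  exists (B + k * B + k ^ 2 * B + k ^ 3 * B).
  assert (Hk2 : 0 < k ^ 2 * B) by (apply Rmult_lt_0_compat; [apply pow_lt|]; lra).
  assert (Hk3 : 0 < k ^ 3 * B) by (apply Rmult_lt_0_compat; [apply pow_lt|]; lra).
  assert (Hk1 : 0 < k * B) by nra.
  split; [lra|]. intros z w Hz Hw.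
  set (h := (w - z)%X). pose proof (Cnorm_ge0 h) as Hh.
  assert (Hh3 : 0 <= Cnorm h ^ 3) by (apply pow_le; lra).
  assert (M : forall (c x : Cx) t y, Cnorm x <= t * y -> Cnorm (c * x)%X <= t * (Cnorm c * y)).
  { intros c x t y H. rewrite Cnorm_mul. replace (t * (Cnorm c * y)) with (Cnorm c * (t * y)) by ring.
    apply Rmult_le_compat_l; [apply Cnorm_ge0|assumption]. }
  pose proof (fun n => pow_bounds R0 r z w n (conj (proj1 HR) (proj1 Hr)) Hz Hw) as P.
  fold h in P. fold k in P.
  destruct (lims_bound (fun n => a n * Cpow z n)%X (fun n => Cnorm (a n) * r ^ n) B 1 ltac:(lra)) as [L0 N0];
    [intros n; apply M; destruct (P n) as [P0 _]; lra|assumption|].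
  destruct (lims_bound (fun n => a n * Cpow w n)%X (fun n => Cnorm (a n) * r ^ n) B 1 ltac:(lra)) as [L0' _];
    [intros n; apply M; destruct (pow_bounds R0 r w z n (conj (proj1 HR) (proj1 Hr)) Hw Hz) as [P0 _]; lra|assumption|].
  destruct (lims_bound (fun n => a n * pw1 z n)%X (fun n => Cnorm (a n) * r ^ n) B k ltac:(lra)) as [L1 N1];
    [intros n; apply M; apply (P n)|assumption|].
  destruct (lims_bound (fun n => a n * pw2 z n)%X (fun n => Cnorm (a n) * r ^ n) B (k ^ 2)) as [L2 N2];
    [apply pow_le; lra|intros n; apply M; apply (P n)|assumption|].
  destruct (lims_bound (fun n => a n * (Cpow w n - Cpow z n - pw1 z n * h - pw2 z n * (h * h)))%X
             (fun n => Cnorm (a n) * r ^ n) B (k ^ 3 * Cnorm h ^ 3)) as [L3 N3];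
    [apply Rmult_le_pos; [apply pow_le|]; lra|intros n; apply M; apply (P n)|assumption|].
  unfold PS, PS1, PS2. repeat split; try lra.
  (* Summing the termwise remainders gives the remainder of the sum, so the termwise cubic bound
     survives. *)
  assert (E : ccv (fun n => Csum n (fun n => a n * (Cpow w n - Cpow z n - pw1 z n * h - pw2 z n * (h * h)))%X)
    (lims (fun n => a n * Cpow w n) + (- C1) * lims (fun n => a n * Cpow z n)
     + (- h) * lims (fun n => a n * pw1 z n) + (- (h * h)) * lims (fun n => a n * pw2 z n))%X).
  { eapply ccv_ext; [|apply ccv_add; [apply ccv_add; [apply ccv_add; [exact L0'|apply ccv_scal; exact L0]
      |apply ccv_scal; exact L1]|apply ccv_scal; exact L2]].
    intros n. cbv beta. rewrite <- !Csum_mul, <- !Csum_add. apply Csum_ext. intros j _. ring. }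
  rewrite (ccv_unique _ _ _ L3 E) in N3.
  replace (k ^ 3 * Cnorm h ^ 3 * B) with ((k ^ 3 * B) * Cnorm h ^ 3) in N3 by ring.
  match type of N3 with Cnorm ?x <= _ => match goal with |- Cnorm ?y <= _ => replace y with x by ring end end.
  eapply Rle_trans; [exact N3|]. apply Rmult_le_compat_r; lra.
Qed.

Lemma tay_ext (F G D1 D2 : Cx -> Cx) : (forall z, inD z -> F z = G z) -> tay F D1 D2 -> tay G D1 D2.
Proof.
  intros E H R0 HR. destruct (H R0 HR) as [C [HC K]]. exists C. split; [assumption|].
  intros z w Hz Hw. rewrite <- !E by (unfold inD; lra). now apply K.
Qed.

Lemma tay_Lip (F D1 D2 : Cx -> Cx) (R0 : R) :
  tay F D1 D2 -> 0 <= R0 < 1 -> exists C, 0 < C /\ forall z w, Cnorm z <= R0 -> Cnorm w <= R0 ->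
    Cnorm (F w - F z)%X <= C * Cnorm (w - z)%X.
Proof.
  (* With |h| <= 2 the linear, quadratic and cubic terms cost C, 2C and 4C times |h|. *)
  intros H HR. destruct (H R0 HR) as [C [HC K]]. exists (7 * C). split; [lra|].
  intros z w Hz Hw. destruct (K z w Hz Hw) as [_ [K1 [K2 K3]]].
  set (h := (w - z)%X) in *. pose proof (Cnorm_ge0 h) as Hh.
  assert (Hh2 : Cnorm h <= 2) by (unfold h; pose proof (Cnorm_sub w z); lra).
  replace (F w - F z)%X with ((F w - F z - D1 z * h - D2 z * (h * h)) + (D1 z * h + D2 z * (h * h)))%X by ring.
  eapply Rle_trans; [apply Cnorm_add|].
  pose proof (Cnorm_add (D1 z * h)%X (D2 z * (h * h))%X) as K4. rewrite !Cnorm_mul in K4.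
  assert (Cnorm (D1 z) * Cnorm h <= C * Cnorm h) by (apply Rmult_le_compat_r; lra).
  assert (Cnorm (D2 z) * (Cnorm h * Cnorm h) <= C * (Cnorm h * Cnorm h)) by (apply Rmult_le_compat_r; nra).
  assert (Cnorm h * Cnorm h <= 2 * Cnorm h) by nra.
  assert (Cnorm h ^ 3 <= 4 * Cnorm h) by (simpl; nra). nra.
Qed.

Lemma inD_room (z : Cx) : inD z -> exists R0 d, 0 <= R0 < 1 /\ 0 < d <= 1 /\ Cnorm z <= R0 /\
  forall w, Cnorm (w - z)%X <= d -> Cnorm w <= R0.
Proof.
  intros Hz. unfold inD in Hz. pose proof (Cnorm_ge0 z).
  exists ((1 + Cnorm z) / 2), ((1 - Cnorm z) / 2). repeat split; try lra.
  intros w Hw. pose proof (Cnorm_rev w z). lra.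
Qed.

(** * Derivatives and integrals that are defined by choice *)

Lemma tay_Cderiv (F D1 D2 : Cx -> Cx) (z : Cx) : tay F D1 D2 -> inD z -> has_Cderiv F z (D1 z).
Proof.
  intros H Hz eps He. destruct (inD_room z Hz) as [R0 [d [HR [Hd [Hz0 Hw]]]]].
  destruct (H R0 HR) as [C [HC K]].
  exists (Rmin d (eps / (2 * C))). split; [apply Rmin_pos; [lra|apply Rdiv_lt_0_compat; lra]|].
  intros h [Hh0 Hh1]. pose proof (Rmin_l d (eps / (2 * C))). pose proof (Rmin_r d (eps / (2 * C))).
  assert (E : (Cadd z h - z)%X = h) by ring.
  destruct (K z (z + h)%X Hz0) as [_ [_ [K2 K3]]]; [apply Hw; rewrite E; lra|].
  rewrite E in K3.
  assert (Hn : h <> C0) by (intros ->; rewrite Cnorm_0 in Hh0; lra).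
  replace (Csub (Cdiv (Csub (F (Cadd z h)) (F z)) h) (D1 z))%X
    with ((F (z + h) - F z - D1 z * h - D2 z * (h * h)) / h + D2 z * h)%X by (field; assumption).
  eapply Rle_lt_trans; [apply Cnorm_add|]. rewrite Cnorm_div, Cnorm_mul by assumption.
  assert (Cnorm (F (z + h) - F z - D1 z * h - D2 z * (h * h))%X / Cnorm h <= C * Cnorm h * Cnorm h).
  { apply Rmult_le_reg_r with (Cnorm h); [assumption|]. unfold Rdiv. rewrite Rmult_assoc, Rinv_l by lra.
    simpl in K3. nra. }
  assert (Hlt : Cnorm h < eps / (2 * C)) by lra.
  assert (Hc : 2 * C * Cnorm h < eps).
  { apply (Rmult_lt_compat_l (2 * C)) in Hlt; [|lra]. replace (2 * C * (eps / (2 * C))) with eps in Hlt by (field; lra). lra. }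
  pose proof (Cnorm_ge0 (D2 z)). nra.
Qed.

Lemma has_Cderiv_unique (F : Cx -> Cx) (z u v : Cx) : has_Cderiv F z u -> has_Cderiv F z v -> u = v.
Proof.
  intros Hu Hv. destruct (Req_dec (Cnorm (u - v)%X) 0) as [E|NE].
  - apply Cnorm_eq0 in E. replace u with ((u - v) + v)%X by ring. rewrite E. ring.
  - exfalso. pose proof (Cnorm_ge0 (u - v)%X).
    destruct (Hu (Cnorm (u - v)%X / 2)) as [d1 [Hd1 K1]]; [lra|].
    destruct (Hv (Cnorm (u - v)%X / 2)) as [d2 [Hd2 K2]]; [lra|].
    assert (Hm : 0 < Rmin d1 d2) by (apply Rmin_pos; lra).
    pose proof (Rmin_l d1 d2). pose proof (Rmin_r d1 d2).
    assert (E : Cnorm (RtoC (Rmin d1 d2 / 2)) = Rmin d1 d2 / 2) by (rewrite Cnorm_RtoC, Rabs_pos_eq; lra).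
    specialize (K1 (RtoC (Rmin d1 d2 / 2)) ltac:(lra)). specialize (K2 (RtoC (Rmin d1 d2 / 2)) ltac:(lra)).
    match type of K1 with Cnorm (?x - _)%X < _ => pose proof (Cnorm_sub_tri u v x) as K3;
      rewrite (Cnorm_sub_sym u x) in K3 end. lra.
Qed.

Lemma Cderiv_eq (F : Cx -> Cx) (z w : Cx) : has_Cderiv F z w -> Cderiv F z = w.
Proof.
  intros H. apply has_Cderiv_unique with F z; [|assumption].
  unfold Cderiv. apply epsilon_spec. now exists w.
Qed.

(** The bridge from the integral selected by [epsilon] to [is_RInt], needed for the circle means and
    for the operator itself. *)
Lemma Rint_is (f : R -> R) (a b v : R) : is_RInt f a b v -> Rint f a b = v.
Proof.
  intros H.
  assert (E : exists pr : Riemann_integrable f a b, RiemannInt pr = Rint f a b).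
  { unfold Rint. apply epsilon_spec.
    exists (RiemannInt (ex_RInt_Reals_0 f a b (ex_intro _ v H))). now exists (ex_RInt_Reals_0 f a b (ex_intro _ v H)). }
  destruct E as [pr <-]. rewrite <- RInt_Reals. now apply is_RInt_unique.
Qed.

Definition ccont (phi : R -> Cx) (t : R) : Prop :=
  continuous (fun s => Cre (phi s)) t /\ continuous (fun s => Cim (phi s)) t.

Lemma ccont_eps (phi : R -> Cx) (t : R) :
  ccont phi t <-> forall eps, 0 < eps -> exists d, 0 < d /\ forall s, Rabs (s - t) < d -> Cnorm (phi s - phi t)%X < eps.
Proof.
  split.
  - intros [H1 H2] eps He. assert (He2 : 0 < eps / 2) by lra.
    destruct (proj1 (filterlim_locally _ _) H1 (mkposreal _ He2)) as [d1 K1].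
    destruct (proj1 (filterlim_locally _ _) H2 (mkposreal _ He2)) as [d2 K2].
    exists (Rmin d1 d2). split; [apply Rmin_pos; apply cond_pos|]. intros s Hs.
    pose proof (Rmin_l d1 d2). pose proof (Rmin_r d1 d2).
    specialize (K1 s). specialize (K2 s).
    assert (B1 : Rabs (Cre (phi s) - Cre (phi t)) < eps / 2) by (apply K1; unfold ball; simpl; unfold AbsRing_ball; unfold abs, minus, plus, opp; simpl; unfold Rminus in Hs; lra).
    assert (B2 : Rabs (Cim (phi s) - Cim (phi t)) < eps / 2) by (apply K2; unfold ball; simpl; unfold AbsRing_ball; unfold abs, minus, plus, opp; simpl; unfold Rminus in Hs; lra).
    eapply Rle_lt_trans; [apply Cnorm_le_ReIm|].
    change (Rabs (Cre (phi s) - Cre (phi t)) + Rabs (Cim (phi s) - Cim (phi t)) < eps). lra.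
  - intros H. split; apply filterlim_locally; intros eps;
      destruct (H eps (cond_pos eps)) as [d [Hd K]]; exists (mkposreal _ Hd); intros s Hs; specialize (K s Hs).
    + apply Rle_lt_trans with (2 := K). apply (Cre_le (phi s - phi t)%X).
    + apply Rle_lt_trans with (2 := K). apply (Cim_le (phi s - phi t)%X).
Qed.

Lemma tay_ccont (F D1 D2 : Cx -> Cx) (phi : R -> Cx) (t : R) :
  tay F D1 D2 -> inD (phi t) -> ccont phi t -> ccont (fun s => F (phi s)) t.
Proof.
  intros H Hz Hc. apply ccont_eps. intros eps He. rewrite ccont_eps in Hc.
  destruct (inD_room _ Hz) as [R0 [d [HR [Hd [Hz0 Hw]]]]].
  destruct (tay_Lip F D1 D2 R0 H HR) as [C [HC K]].
  destruct (Hc (Rmin d (eps / C))) as [e [He0 K1]]; [apply Rmin_pos; [lra|now apply Rdiv_lt_0_compat]|].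
  exists e. split; [assumption|]. intros s Hs. specialize (K1 s Hs).
  pose proof (Rmin_l d (eps / C)). pose proof (Rmin_r d (eps / C)).
  eapply Rle_lt_trans; [apply K; [assumption|apply Hw; lra]|].
  replace eps with (C * (eps / C)) by (field; lra). apply Rmult_lt_compat_l; lra.
Qed.

Lemma cmul_ccont (phi psi : R -> Cx) (t : R) :
  ccont phi t -> ccont psi t -> ccont (fun s => phi s * psi s)%X t.
Proof.
  intros [A1 A2] [B1 B2]. split; unfold Cmul, Cre at 1, Cim at 1; simpl.
  - apply (continuous_minus (fun s => Cre (phi s) * Cre (psi s)) (fun s => Cim (phi s) * Cim (psi s))); now apply @continuous_mult.
  - apply (continuous_plus (fun s => Cre (phi s) * Cim (psi s)) (fun s => Cim (phi s) * Cre (psi s))); now apply @continuous_mult.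
Qed.

Lemma RtoC_ccont (t : R) : ccont RtoC t.
Proof. split; simpl; [apply continuous_id|apply continuous_const]. Qed.

Lemma const_ccont (c : Cx) (t : R) : ccont (fun _ => c) t.
Proof. split; apply continuous_const. Qed.

Lemma Cexpi_ccont (t : R) : ccont Cexpi t.
Proof. split; simpl; [apply continuous_cos|apply continuous_sin]. Qed.

Lemma circ_ccont (r t : R) : ccont (circ r) t.
Proof. apply cmul_ccont; [apply const_ccont|apply Cexpi_ccont]. Qed.

(** * The primitive of f g' *)

Lemma pw1_S (z : Cx) (n : nat) : pw1 z (S n) = (RtoC (INR (S n)) * Cpow z n)%X.
Proof.
  induction n as [|n IH]; [simpl; cx_ring|].
  change (pw1 z (S (S n))) with (Cpow z (S n) + z * pw1 z (S n))%X. rewrite IH.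
  rewrite (S_INR (S n)). simpl Cpow. cx_ring.
Qed.

Definition dcoef (b : nat -> Cx) (n : nat) : Cx := (RtoC (INR (S n)) * b (S n))%X.

Lemma absum_bounded (a : nat -> Cx) (r : R) : absum a -> 0 <= r < 1 ->
  exists B, 0 < B /\ forall n, Cnorm (a n) * r ^ n <= B.
Proof.
  intros Ha Hr. destruct (Ha r Hr) as [B [HB K]]. exists B. split; [assumption|]. intros n.
  eapply Rle_trans; [|apply (K (S n))].
  apply (Rsum_term (S n) n (fun k => Cnorm (a k) * r ^ k)); [|lia].
  intros k. apply Rmult_le_pos; [apply Cnorm_ge0|apply pow_le; lra].
Qed.

Lemma absum_dcoef (b : nat -> Cx) : absum b -> absum (dcoef b).
Proof.
  intros Hb. apply absum_of_bounded. intros r Hr. set (s := (1 + r) / 2).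
  assert (Hs : r < s < 1) by (unfold s; lra).
  destruct (absum_bounded b s Hb ltac:(lra)) as [B [HB K]].
  exists (/ (s - r) * B). intros n. unfold dcoef.
  assert (Hz : Cnorm (RtoC r) <= r) by (rewrite Cnorm_RtoC, Rabs_pos_eq; lra).
  destruct (pow_bounds r s (RtoC r) (RtoC r) (S n) ltac:(lra) Hz Hz) as [_ [H1 _]].
  rewrite pw1_S, Cnorm_mul, Cnorm_pow, !Cnorm_RtoC, (Rabs_pos_eq r), Rabs_pos_eq in H1; try lra; [|apply pos_INR].
  rewrite Cnorm_mul, Cnorm_RtoC, Rabs_pos_eq by apply pos_INR.
  specialize (K (S n)). pose proof (Cnorm_ge0 (b (S n))).
  replace (INR (S n) * Cnorm (b (S n)) * r ^ n) with (Cnorm (b (S n)) * (INR (S n) * r ^ n)) by ring.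
  eapply Rle_trans; [apply Rmult_le_compat_l; [assumption|exact H1]|].
  replace (Cnorm (b (S n)) * (/ (s - r) * s ^ S n)) with (/ (s - r) * (Cnorm (b (S n)) * s ^ S n)) by ring.
  apply Rmult_le_compat_l; [left; apply Rinv_0_lt_compat; lra|assumption].
Qed.

Lemma PS1_dcoef (b : nat -> Cx) (z : Cx) : absum b -> inD z -> PS1 b z = PS (dcoef b) z.
Proof.
  intros Hb Hz. apply lims_eq. pose proof (PS_cv _ z (absum_dcoef b Hb) Hz) as H.
  (* The term of index 0 vanishes, so the partial sums agree after a shift by one. *)
  assert (E : forall n, Csum (S n) (fun k => b k * pw1 z k)%X = psum (dcoef b) z n).
  { induction n; [simpl; cx_ring|]. change (Csum (S (S n)) (fun k => b k * pw1 z k)%X)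
      with (Csum (S n) (fun k => b k * pw1 z k) + b (S n) * pw1 z (S n))%X.
    rewrite IHn, pw1_S. unfold psum. cbn [Csum]. unfold dcoef at 3. ring. }
  intros eps He. destruct (H eps He) as [N HN]. exists (S N). intros [|n] Hn; [lia|].
  rewrite E. apply HN. lia.
Qed.

Definition conv (a b : nat -> Cx) (n : nat) : Cx := Csum (S n) (fun k => a k * b (n - k)%nat)%X.

Lemma Cre_Csum (n : nat) (u : nat -> Cx) : Cre (Csum n u) = Rsum n (fun k => Cre (u k)).
Proof. induction n; simpl; [reflexivity|]. now rewrite <- IHn. Qed.
Lemma Cim_Csum (n : nat) (u : nat -> Cx) : Cim (Csum n u) = Rsum n (fun k => Cim (u k)).
Proof. induction n; simpl; [reflexivity|]. now rewrite <- IHn. Qed.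

Lemma is_series_Rsum (u : nat -> R) (l : R) : is_series u l <-> is_lim_seq (fun n => Rsum n u) l.
Proof.
  rewrite (is_lim_seq_incr_1 (fun n => Rsum n u)). unfold is_series, is_lim_seq.
  split; apply filterlim_ext; intros n; rewrite sum_n_Reals, sum_f_R0_Rsum; reflexivity.
Qed.

Lemma ex_series_bounded (u : nat -> R) (B : R) :
  (forall k, 0 <= u k) -> (forall n, Rsum n u <= B) -> ex_series u.
Proof.
  intros H0 HB. destruct (ex_finite_lim_seq_incr (fun n => Rsum n u) B) as [l Hl].
  - intros n. simpl. specialize (H0 n). lra.
  - exact HB.
  - exists l. now apply is_series_Rsum.
Qed.

(** Real and imaginary parts reduce the claim to four products of absolutely convergent real
    series. *)
Lemma Cauchy_product (u v : nat -> Cx) (B1 B2 : R) (l m : Cx) :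
  (forall n, Rsum n (fun k => Cnorm (u k)) <= B1) -> (forall n, Rsum n (fun k => Cnorm (v k)) <= B2) ->
  ccv (fun n => Csum n u) l -> ccv (fun n => Csum n v) m ->
  ccv (fun n => Csum n (conv u v)) (l * m)%X.
Proof.
  intros H1 H2 Hl Hm.
  assert (X : forall (p : Cx -> R) (w : nat -> Cx) B, (forall z, Rabs (p z) <= Cnorm z) ->
     (forall n, Rsum n (fun k => Cnorm (w k)) <= B) -> ex_series (fun n => Rabs (p (w n)))).
  { intros p w B Hp HB. apply ex_series_bounded with B; [intros; apply Rabs_pos|].
    intros n. eapply Rle_trans; [|apply (HB n)]. apply Rsum_le. intros; apply Hp. }
  apply ccv_ReIm in Hl. apply ccv_ReIm in Hm. destruct Hl as [Hl1 Hl2], Hm as [Hm1 Hm2].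
  assert (Y : forall (u' v' : nat -> R) l' m', is_lim_seq (fun n => Rsum n u') (Finite l') ->
     is_lim_seq (fun n => Rsum n v') (Finite m') ->
     ex_series (fun n => Rabs (u' n)) -> ex_series (fun n => Rabs (v' n)) ->
     is_lim_seq (fun n => Rsum n (fun n => Rsum (S n) (fun k => u' k * v' (n - k)%nat))) (Finite (l' * m'))).
  { intros u' v' l' m' A1 A2 A3 A4. apply is_series_Rsum in A1. apply is_series_Rsum in A2.
    pose proof (is_series_mult _ _ _ _ A1 A2 A3 A4) as A5. apply is_series_Rsum in A5.
    eapply is_lim_seq_ext; [|exact A5]. intros n. apply Rsum_ext. intros k _. now rewrite sum_f_R0_Rsum. }
  assert (Hl1' : is_lim_seq (fun n => Rsum n (fun k => Cre (u k))) (Cre l)) by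
    (eapply is_lim_seq_ext; [|exact Hl1]; intros; apply Cre_Csum).
  assert (Hl2' : is_lim_seq (fun n => Rsum n (fun k => Cim (u k))) (Cim l)) by
    (eapply is_lim_seq_ext; [|exact Hl2]; intros; apply Cim_Csum).
  assert (Hm1' : is_lim_seq (fun n => Rsum n (fun k => Cre (v k))) (Cre m)) by
    (eapply is_lim_seq_ext; [|exact Hm1]; intros; apply Cre_Csum).
  assert (Hm2' : is_lim_seq (fun n => Rsum n (fun k => Cim (v k))) (Cim m)) by
    (eapply is_lim_seq_ext; [|exact Hm2]; intros; apply Cim_Csum).
  pose proof (X Cre u B1 Cre_le H1). pose proof (X Cim u B1 Cim_le H1).
  pose proof (X Cre v B2 Cre_le H2). pose proof (X Cim v B2 Cim_le H2).
  apply ccv_ReIm; split.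
  - eapply is_lim_seq_ext; [|apply is_lim_seq_minus'; [apply (Y _ _ _ _ Hl1' Hm1')|apply (Y _ _ _ _ Hl2' Hm2')]]; try assumption.
    intros n. cbv beta. rewrite Cre_Csum. rewrite <- (Rmult_1_l (Rsum n (fun n => Rsum (S n) (fun k => Cim (u k) * _)))).
    unfold Rminus. rewrite Ropp_mult_distr_l, <- Rsum_scal, <- Rsum_add. apply Rsum_ext. intros k _.
    unfold conv. rewrite Cre_Csum, <- Rsum_scal, <- Rsum_add. apply Rsum_ext. intros j _.
    unfold Cmul, Cre, Cim; simpl. ring.
  - eapply is_lim_seq_ext; [|apply is_lim_seq_plus'; [apply (Y _ _ _ _ Hl1' Hm2')|apply (Y _ _ _ _ Hl2' Hm1')]]; try assumption.
    intros n. cbv beta. rewrite Cim_Csum, <- Rsum_add. apply Rsum_ext. intros k _.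
    unfold conv. rewrite Cim_Csum, <- Rsum_add. apply Rsum_ext. intros j _.
    unfold Cmul, Cre, Cim; simpl. ring.
Qed.

Lemma conv_series (a b : nat -> Cx) (z : Cx) : absum a -> absum b -> inD z ->
  ccv (psum (conv a b) z) (PS a z * PS b z)%X.
Proof.
  intros Ha Hb Hz. pose proof (PS_cv a z Ha Hz) as H1. pose proof (PS_cv b z Hb Hz) as H2.
  destruct (Ha (Cnorm z) (conj (Cnorm_ge0 z) Hz)) as [B1 [_ K1]].
  destruct (Hb (Cnorm z) (conj (Cnorm_ge0 z) Hz)) as [B2 [_ K2]].
  eapply ccv_ext; [|apply (Cauchy_product (fun k => a k * Cpow z k)%X (fun k => b k * Cpow z k)%X B1 B2 _ _ ); try assumption].
  - intros n. apply Csum_ext. intros k _. unfold conv. replace (Csum (S k) (fun i => a i * b (k - i)%nat) * Cpow z k)%X with (Cpow z k * Csum (S k) (fun i => a i * b (k - i)%nat))%X by ring.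
    rewrite <- Csum_mul. apply Csum_ext. intros j Hj.
    replace k with (j + (k - j))%nat at 3 by lia. rewrite Cpow_add. ring.
  - intros n. eapply Rle_trans; [|apply (K1 n)]. apply Rsum_le. intros k _. rewrite Cnorm_mul, Cnorm_pow. lra.
  - intros n. eapply Rle_trans; [|apply (K2 n)]. apply Rsum_le. intros k _. rewrite Cnorm_mul, Cnorm_pow. lra.
Qed.

(** The constant factor k is there for [Tg_series], where it is 1/z and C(sz)/z is the primitive
    along the segment from 0 to z. *)
Lemma tay_der (F D1 D2 : Cx -> Cx) (k z : Cx) (t : R) : tay F D1 D2 -> inD (RtoC t * z)%X ->
  is_derive (fun s => Cre (k * F (RtoC s * z))%X) t (Cre (k * (D1 (RtoC t * z) * z))%X) /\
  is_derive (fun s => Cim (k * F (RtoC s * z))%X) t (Cim (k * (D1 (RtoC t * z) * z))%X).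
Proof.
  intros H Hz. set (w := (RtoC t * z)%X) in *.
  destruct (inD_room _ Hz) as [R0 [d [HR [Hd [Hz0 Hw]]]]].
  destruct (H R0 HR) as [C [HC K]].
  pose proof (Cnorm_ge0 z) as Nz. pose proof (Cnorm_ge0 k) as Nk.
  assert (P : forall eps, 0 < eps -> exists e, 0 < e /\ forall s, Rabs (s - t) < e ->
     Cnorm (k * F (RtoC s * z) - k * F w - RtoC (s - t) * (k * (D1 w * z)))%X <= eps * Rabs (s - t)).
  { intros eps He. set (M := Cnorm k * (2 * C) * (Cnorm z * Cnorm z) + Cnorm z + 1).
    assert (HM0 : 0 <= Cnorm k * (2 * C) * (Cnorm z * Cnorm z)) by (repeat apply Rmult_le_pos; lra).
    assert (HM : 0 < M) by (unfold M; lra).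
    exists (Rmin d eps / M). split; [apply Rdiv_lt_0_compat; [apply Rmin_pos; lra|assumption]|].
    intros s Hs. pose proof (Rmin_l d eps). pose proof (Rmin_r d eps).
    assert (Hs' : M * Rabs (s - t) < Rmin d eps).
    { apply (Rmult_lt_compat_l M) in Hs; [|assumption]. replace (M * (Rmin d eps / M)) with (Rmin d eps) in Hs by (field; lra). exact Hs. }
    pose proof (Rabs_pos (s - t)) as Na.
    set (h := (RtoC s * z - w)%X).
    assert (Eh : h = (RtoC (s - t) * z)%X) by (unfold h, w; cx_ring).
    assert (Nh : Cnorm h = Rabs (s - t) * Cnorm z) by (rewrite Eh, Cnorm_mul, Cnorm_RtoC; reflexivity).
    assert (Hh1 : Cnorm h <= d) by (rewrite Nh; unfold M in Hs'; nra).
    destruct (K w (RtoC s * z)%X Hz0 (Hw _ Hh1)) as [_ [_ [K2 K3]]]. fold h in K3.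
    replace (k * F (RtoC s * z) - k * F w - RtoC (s - t) * (k * (D1 w * z)))%X with
      (k * ((F (RtoC s * z) - F w - D1 w * h - D2 w * (h * h)) + D2 w * (h * h)))%X by (rewrite Eh; ring).
    rewrite Cnorm_mul.
    assert (B : Cnorm ((F (RtoC s * z) - F w - D1 w * h - D2 w * (h * h)) + D2 w * (h * h))%X <= 2 * C * (Cnorm h * Cnorm h)).
    { eapply Rle_trans; [apply Cnorm_add|]. rewrite !Cnorm_mul. simpl in K3. pose proof (Cnorm_ge0 h).
      assert (Cnorm h * Cnorm h * Cnorm h <= 1 * (Cnorm h * Cnorm h)).
      { rewrite (Rmult_comm 1), Rmult_1_r. nra. }
      assert (Cnorm (D2 w) * (Cnorm h * Cnorm h) <= C * (Cnorm h * Cnorm h)) by (apply Rmult_le_compat_r; nra). nra. }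
    apply (Rmult_le_compat_l (Cnorm k)) in B; [|assumption]. eapply Rle_trans; [exact B|].
    rewrite Nh. replace (Cnorm k * (2 * C * (Rabs (s - t) * Cnorm z * (Rabs (s - t) * Cnorm z))))
      with (Cnorm k * (2 * C) * (Cnorm z * Cnorm z) * Rabs (s - t) * Rabs (s - t)) by ring.
    apply Rmult_le_compat_r; [assumption|]. unfold M in Hs'. nra. }
  assert (Q : forall p : Cx -> R, (forall u v, p (u - v)%X = p u - p v) -> (forall x u, p (RtoC x * u)%X = x * p u) ->
     (forall u, Rabs (p u) <= Cnorm u) ->
     is_derive (fun s => p (k * F (RtoC s * z))%X) t (p (k * (D1 w * z))%X)).
  { intros p P1 P2 P3. split; [apply is_linear_scal_l|]. intros x Hx.
    pose proof (is_filter_lim_locally_unique (V := AbsRing_NormedModule R_AbsRing) t x Hx) as Ex. simpl in Ex. subst x. intros eps.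
    destruct (P eps (cond_pos eps)) as [e [He Ke]]. exists (mkposreal e He). intros s Hs.
    specialize (Ke s Hs). unfold norm, minus, plus, opp, scal; simpl. unfold abs; simpl. unfold mult; simpl.
    fold w. eapply Rle_trans; [|exact Ke].
    eapply Rle_trans; [|apply P3]. rewrite !P1, P2. right. reflexivity. }
  split; apply Q; try (intros; unfold Csub, Cadd, Cmul, Copp, RtoC, Cre, Cim; simpl; ring).
  - apply Cre_le.
  - apply Cim_le.
Qed.

(** The Taylor coefficients of the primitive of f g' that vanishes at 0, when a and b are those of f
    and g. *)
Definition volt (a b : nat -> Cx) (n : nat) : Cx :=
  match n with O => C0 | S k => (RtoC (/ INR (S k)) * conv a (dcoef b) k)%X end.

Lemma volt_series (a b : nat -> Cx) : absum a -> absum b ->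
  absum (volt a b) /\ PS (volt a b) C0 = C0 /\ forall z, inD z -> PS1 (volt a b) z = (PS a z * PS1 b z)%X.
Proof.
  intros Ha Hb. set (e := conv a (dcoef b)).
  assert (Hcv : forall z, inD z -> ccv (psum e z) (PS a z * PS1 b z)%X).
  { intros z Hz. rewrite PS1_dcoef by assumption. apply conv_series; try assumption. now apply absum_dcoef. }
  assert (He : absum e) by exact (series_absum e _ Hcv).
  set (c := volt a b).
  assert (Hc : absum c).
  { apply absum_of_bounded. intros r Hr. destruct (absum_bounded e r He ltac:(lra)) as [B [HB K]].
    exists B. intros [|n]; [change (c 0%nat) with C0; rewrite Cnorm_0, Rmult_0_l; lra|].
    change (c (S n)) with (RtoC (/ INR (S n)) * e n)%X.
    rewrite Cnorm_mul, Cnorm_RtoC. specialize (K n). pose proof (Cnorm_ge0 (e n)).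
    assert (0 < INR (S n)) by (apply lt_0_INR; lia).
    rewrite Rabs_pos_eq by (left; now apply Rinv_0_lt_compat).
    assert (I1 : / INR (S n) <= 1).
    { rewrite <- Rinv_1. apply Rinv_le_contravar; [lra|]. rewrite S_INR. pose proof (pos_INR n). lra. }
    assert (0 <= r ^ n) by (apply pow_le; lra).
    assert (0 <= Cnorm (e n) * r ^ n) by now apply Rmult_le_pos.
    replace (/ INR (S n) * Cnorm (e n) * r ^ S n) with ((/ INR (S n) * r) * (Cnorm (e n) * r ^ n)) by (simpl; ring).
    assert (0 < / INR (S n)) by now apply Rinv_0_lt_compat.
    assert (/ INR (S n) * r <= 1) by nra.
    apply Rle_trans with (1 * (Cnorm (e n) * r ^ n)); [apply Rmult_le_compat_r; assumption|rewrite Rmult_1_l; exact K]. }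
  split; [assumption|]. split.
  - apply lims_eq. eapply ccv_ext; [|apply ccv_const]. intros n. symmetry. apply Csum_zero.
    intros [|k] _; simpl; cx_ring.
  - intros z Hz. rewrite PS1_dcoef by assumption. apply lims_eq. eapply ccv_ext; [|apply Hcv; assumption].
    intros n. apply Csum_ext. intros k _. f_equal. unfold dcoef, c, volt. fold e.
    assert (INR (S k) <> 0) by (apply not_0_INR; lia).
    replace (RtoC (INR (S k)) * (RtoC (/ INR (S k)) * e k))%X with (RtoC (INR (S k) * / INR (S k)) * e k)%X by cx_ring.
    rewrite Rinv_r by assumption. ring.
Qed.

Lemma Tg_series (f g : Cx -> Cx) (a b : nat -> Cx) : absum a -> absum b ->
  (forall z, inD z -> PS a z = f z) -> (forall z, inD z -> PS b z = g z) ->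
  forall z, inD z -> PS (volt a b) z = Tg g f z.
Proof.
  intros Ha Hb Ef Eg z Hz. destruct (volt_series a b Ha Hb) as [Hc [E0 E1]]. set (c := volt a b) in *.
  pose proof (PS_tay c Hc) as Tc. pose proof (PS_tay _ (absum_dcoef c Hc)) as Te.
  (* The origin is separated because the argument below divides by z. *)
  unfold Tg. destruct (excluded_middle_informative (z = C0)) as [->|Hz0].
  { rewrite E0. cx_ring. }
  assert (Ht : forall t, 0 <= t <= 1 -> inD (RtoC t * z)%X).
  { intros t Ht. unfold inD in *. rewrite Cnorm_mul, Cnorm_RtoC, Rabs_pos_eq by lra.
    pose proof (Cnorm_ge0 z). nra. }
  (* The integrand of the operator is the derivative in t of C(tz)/z, with C the primitive of f
     g'. *)
  assert (I : forall t, 0 <= t <= 1 -> (f (RtoC t * z) * Cderiv g (RtoC t * z))%X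
     = (Cinv z * (PS1 c (RtoC t * z) * z))%X).
  { intros t H. rewrite E1, Ef by auto. rewrite (Cderiv_eq g _ (PS1 b (RtoC t * z)%X)).
    - field. assumption.
    - apply tay_Cderiv with (PS2 b); [|auto]. apply tay_ext with (PS b); [assumption|now apply PS_tay]. }
  assert (Kc : forall t, 0 <= t <= 1 -> ccont (fun t => (Cinv z * (PS1 c (RtoC t * z) * z))%X) t).
  { intros t H. apply cmul_ccont; [apply const_ccont|]. apply cmul_ccont; [|apply const_ccont].
    apply (tay_ccont (PS1 c) (PS1 (dcoef c)) (PS2 (dcoef c)) (fun t => (RtoC t * z)%X)); [|auto|].
    - apply tay_ext with (PS (dcoef c)); [|assumption]. intros w Hw. symmetry. now apply PS1_dcoef.
    - apply cmul_ccont; [apply RtoC_ccont|apply const_ccont]. }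
  assert (J : forall p : Cx -> R,
    (forall t, 0 <= t <= 1 -> is_derive (fun s => p (Cinv z * PS c (RtoC s * z))%X) t (p (Cinv z * (PS1 c (RtoC t * z) * z))%X)) ->
    (forall t, 0 <= t <= 1 -> continuous (fun t => p (Cinv z * (PS1 c (RtoC t * z) * z))%X) t) ->
    Rint (fun t => p (Cmul (f (Cmul (RtoC t) z)) (Cderiv g (Cmul (RtoC t) z)))) 0 1
      = p (Cinv z * PS c (RtoC 1 * z))%X - p (Cinv z * PS c (RtoC 0 * z))%X).
  { intros p P1 P2. apply Rint_is.
    apply is_RInt_ext with (fun t => p (Cinv z * (PS1 c (RtoC t * z) * z))%X).
    - rewrite Rmin_left, Rmax_right by lra. intros t H. rewrite I by lra. reflexivity.
    - apply (is_RInt_derive (fun s => p (Cinv z * PS c (RtoC s * z))%X)); rewrite Rmin_left, Rmax_right by lra; assumption. }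
  unfold Cint. rewrite (J Cre), (J Cim).
  - replace (RtoC 1 * z)%X with z by ring. replace (RtoC 0 * z)%X with C0 by cx_ring. rewrite E0.
    transitivity (z * (Cinv z * PS c z))%X; [field; assumption|]. f_equal.
    apply Cx_eq; unfold Csub, Cadd, Cmul, Copp, RtoC, C0, Cre, Cim; simpl; ring.
  - intros t H. now apply (tay_der _ _ _ _ _ _ Tc), Ht.
  - intros t H. now apply (Kc t H).
  - intros t H. now apply (tay_der _ _ _ _ _ _ Tc), Ht.
  - intros t H. now apply (Kc t H).
Qed.

(** * Second order jets along the flows z e^s and z e^(is) *)

Lemma der_pow_bound (f g : R -> R) (eta M : R) (k : nat) :
  (forall t, Rabs t <= eta -> is_derive f t (g t)) -> f 0 = 0 ->
  (forall t, Rabs t <= eta -> Rabs (g t) <= M * Rabs t ^ k) ->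
  forall t, Rabs t <= eta -> Rabs (f t) <= M * Rabs t ^ S k.
Proof.
  intros Hd H0 Hg t Ht.
  assert (In : forall c, Rmin 0 t <= c <= Rmax 0 t -> Rabs c <= Rabs t).
  { intros c. unfold Rmin, Rmax. destruct (Rle_dec 0 t); intros Hc; unfold Rabs; destruct (Rcase_abs c), (Rcase_abs t); lra. }
  destruct (MVT_gen f 0 t g) as [c [Hc E]].
  - intros x Hx. apply Hd. specialize (In x ltac:(lra)). lra.
  - intros x Hx. apply continuity_pt_filterlim. apply (ex_derive_continuous f x).
    exists (g x). apply Hd. specialize (In x Hx). lra.
  - rewrite H0 in E. replace (f t) with (g c * t) by lra. rewrite Rabs_mult. specialize (In c Hc).
    assert (Rabs (g c) <= M * Rabs c ^ k) by (apply Hg; lra).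
    destruct (Req_dec t 0) as [->|Ht0]; [rewrite Rabs_R0; simpl; rewrite Rmult_0_r, !Rmult_0_l, Rmult_0_r; lra|].
    assert (Rabs c ^ k <= Rabs t ^ k) by (apply pow_incr; split; [apply Rabs_pos|assumption]).
    assert (0 <= M \/ M < 0) as [HM|HM] by lra.
    + simpl. pose proof (Rabs_pos t). assert (M * Rabs c ^ k <= M * Rabs t ^ k) by (apply Rmult_le_compat_l; lra).
      replace (M * (Rabs t * Rabs t ^ k)) with (M * Rabs t ^ k * Rabs t) by ring. apply Rmult_le_compat_r; lra.
    + assert (Rabs (g t) <= M * Rabs t ^ k) by (apply Hg; lra). pose proof (Rabs_pos (g t)).
      assert (0 < Rabs t ^ k) by (apply pow_lt, Rabs_pos_lt; assumption). nra.
Qed.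

(** Each application of the mean value theorem raises the order by one. The factor 1/6 is given
    away, since only the order of the remainder matters. *)
Lemma taylor3 (f f1 f2 f3 : R -> R) (eta M : R) :
  (forall t, Rabs t <= eta -> is_derive f t (f1 t)) -> (forall t, Rabs t <= eta -> is_derive f1 t (f2 t)) ->
  (forall t, Rabs t <= eta -> is_derive f2 t (f3 t)) -> f 0 = 0 -> f1 0 = 0 -> f2 0 = 0 ->
  (forall t, Rabs t <= eta -> Rabs (f3 t) <= M) ->
  forall t, Rabs t <= eta -> Rabs (f t) <= M * Rabs t ^ 3.
Proof.
  intros D1 D2 D3 Z Z1 Z2 HM.
  apply (der_pow_bound f f1 eta M 2 D1 Z). apply (der_pow_bound f1 f2 eta M 1 D2 Z1).
  apply (der_pow_bound f2 f3 eta M 0 D3 Z2). intros t Ht. simpl. rewrite Rmult_1_r. now apply HM.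
Qed.

(** A bound of order s^3 becomes an equation with a bounded factor, so that expansions can be
    multiplied and composed by [ring]. *)
Lemma cube_factor (e C s : R) : 0 <= C -> Rabs e <= C * Rabs s ^ 3 -> exists rho, Rabs rho <= C /\ e = s * s * s * rho.
Proof.
  intros HC H. destruct (Req_dec s 0) as [->|Hs].
  - rewrite Rabs_R0 in H. simpl in H. rewrite !Rmult_0_l, Rmult_0_r in H.
    assert (e = 0) by (pose proof (Rabs_pos e); destruct (Req_dec e 0) as [|N]; [assumption|pose proof (Rabs_pos_lt e N); lra]).
    exists 0. rewrite Rabs_R0. split; lra.
  - assert (Hs3 : 0 < Rabs s ^ 3) by (apply pow_lt, Rabs_pos_lt; assumption).
    exists (e / (s * s * s)). split; [|field; assumption].
    unfold Rdiv. rewrite Rabs_mult, Rabs_inv. apply Rmult_le_reg_r with (Rabs s ^ 3); [assumption|].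
    rewrite !Rabs_mult. replace (Rabs e * / (Rabs s * Rabs s * Rabs s) * Rabs s ^ 3) with (Rabs e); [assumption|].
    field. now apply Rabs_no_R0.
Qed.

Lemma exp_taylor (y : R) : Rabs y <= 1 -> exists k, Rabs k <= 3 /\ exp y = 1 + y + y * y / 2 + y * y * y * k.
Proof.
  intros Hy. destruct (cube_factor (exp y - 1 - y - y * y / 2) 3 y) as [k [Hk E]]; [lra| |exists k; split; [assumption|lra]].
  apply (taylor3 (fun t => exp t - 1 - t - t * t / 2) (fun t => exp t - 1 - t) (fun t => exp t - 1) exp 1 3); try assumption;
    try (intros t _; auto_derive; [trivial|field]); try (rewrite exp_0; field).
  intros t Ht. rewrite Rabs_pos_eq by (left; apply exp_pos).
  eapply Rle_trans; [|apply exp_le_3]. destruct (Req_dec t 1) as [->|N]; [lra|left; apply exp_increasing].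
  pose proof (Rle_abs t). lra.
Qed.

Lemma cos_taylor (y : R) : Rabs y <= 1 -> exists k, Rabs k <= 1 /\ cos y = 1 - y * y / 2 + y * y * y * k.
Proof.
  intros Hy. destruct (cube_factor (cos y - 1 + y * y / 2) 1 y) as [k [Hk E]]; [lra| |exists k; split; [assumption|lra]].
  apply (taylor3 (fun t => cos t - 1 + t * t / 2) (fun t => - sin t + t) (fun t => - cos t + 1) sin 1 1); try assumption;
    try (intros t _; auto_derive; [trivial|field]); try (rewrite ?cos_0, ?sin_0; field).
  intros t Ht. apply Rabs_le. pose proof (SIN_bound t). lra.
Qed.

Lemma sin_taylor (y : R) : Rabs y <= 1 -> exists k, Rabs k <= 1 /\ sin y = y + y * y * y * k.
Proof.
  intros Hy. destruct (cube_factor (sin y - y) 1 y) as [k [Hk E]]; [lra| |exists k; split; [assumption|lra]].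
  apply (taylor3 (fun t => sin t - t) (fun t => cos t - 1) (fun t => - sin t) (fun t => - cos t) 1 1); try assumption;
    try (intros t _; auto_derive; [trivial|ring]); try (rewrite ?cos_0, ?sin_0; ring).
  intros t Ht. rewrite Rabs_Ropp. apply Rabs_le. pose proof (COS_bound t). lra.
Qed.

Lemma ln_taylor (x : R) : Rabs x <= 1 / 2 -> exists k, Rabs k <= 16 /\ ln (1 + x) = x - x * x / 2 + x * x * x * k.
Proof.
  intros Hx. destruct (cube_factor (ln (1 + x) - x + x * x / 2) 16 x) as [k [Hk E]]; [lra| |exists k; split; [assumption|lra]].
  assert (P : forall t, Rabs t <= 1 / 2 -> 1 / 2 <= 1 + t) by (intros t Ht; apply Rabs_le_between in Ht; lra).
  apply (taylor3 (fun t => ln (1 + t) - t + t * t / 2) (fun t => / (1 + t) - 1 + t) (fun t => 1 - / (1 + t) / (1 + t))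
    (fun t => 2 * (/ (1 + t) * / (1 + t) * / (1 + t))) (1 / 2) 16); try assumption;
    try (intros t Ht; specialize (P t Ht)).
  - auto_derive; [lra|field; lra].
  - auto_derive; [lra|field; lra].
  - auto_derive; [lra|field; lra].
  - rewrite Rplus_0_r, ln_1. field.
  - rewrite Rplus_0_r. field.
  - rewrite Rplus_0_r. field.
  - assert (0 < / (1 + t) <= 2).
    { split; [apply Rinv_0_lt_compat; lra|]. replace 2 with (/ (1 / 2)) by field. apply Rinv_le_contravar; lra. }
    set (v := / (1 + t)) in *. rewrite Rabs_pos_eq; [|repeat apply Rmult_le_pos; lra].
    assert (v * v <= 4) by nra. nra.
Qed.

(** Multiplication by these factors moves along rays and along circles: the two coordinate
    translations in the variable log z. *)
Definition flow (e : bool) (s : R) : Cx := if e then RtoC (exp s) else Cexpi s.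

(** An expansion along one flow, uniform on every smaller disc; u2 is the coefficient of s^2, so
    half of the second derivative. Calculus in this form needs neither partial derivatives nor their
    continuity. *)
Definition jet (e : bool) (u u1 u2 : Cx -> R) : Prop :=
  forall R0, 0 < R0 < 1 -> exists C d, 0 < C /\ 0 < d <= 1 /\ forall z, Cnorm z <= R0 ->
    Rabs (u z) <= C /\ Rabs (u1 z) <= C /\ Rabs (u2 z) <= C /\
    forall s, Rabs s <= d -> exists rho, Rabs rho <= C /\
      u (flow e s * z)%X = u z + s * u1 z + s * s * u2 z + s * s * s * rho.

Lemma abs_mul_le (x y a b : R) : Rabs x <= a -> Rabs y <= b -> Rabs (x * y) <= a * b.
Proof. intros. rewrite Rabs_mult. apply Rmult_le_compat; auto using Rabs_pos. Qed.

Lemma abs_add_le (x y a b : R) : Rabs x <= a -> Rabs y <= b -> Rabs (x + y) <= a + b.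
Proof. intros. eapply Rle_trans; [apply Rabs_triang|]. lra. Qed.

Lemma jet_ext (e : bool) (u u1 u2 v v1 v2 : Cx -> R) : (forall z, u z = v z) ->
  (forall z, inD z -> u1 z = v1 z) -> (forall z, inD z -> u2 z = v2 z) -> jet e u u1 u2 -> jet e v v1 v2.
Proof.
  intros E E1 E2 H R0 HR. destruct (H R0 HR) as [C [d [HC [Hd K]]]]. exists C, d. do 2 (split; [assumption|]).
  intros z Hz. rewrite <- E, <- E1, <- E2 by (unfold inD; lra). destruct (K z Hz) as [K1 [K2 [K3 K4]]]. repeat split; try assumption.
  intros s Hs. rewrite <- E. auto.
Qed.

Lemma jet_const (e : bool) (c : R) : jet e (fun _ => c) (fun _ => 0) (fun _ => 0).
Proof.
  intros R0 HR. exists (Rabs c + 1), 1. pose proof (Rabs_pos c). split; [lra|]. split; [lra|].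
  intros z Hz. rewrite !Rabs_R0. repeat split; try lra. intros s Hs. exists 0. rewrite Rabs_R0. split; [lra|ring].
Qed.

Lemma jet_add (e : bool) (u u1 u2 v v1 v2 : Cx -> R) : jet e u u1 u2 -> jet e v v1 v2 ->
  jet e (fun z => u z + v z) (fun z => u1 z + v1 z) (fun z => u2 z + v2 z).
Proof.
  intros Hu Hv R0 HR. destruct (Hu R0 HR) as [C [d [HC [Hd K]]]]. destruct (Hv R0 HR) as [C' [d' [HC' [Hd' K']]]].
  exists (C + C'), (Rmin d d'). split; [lra|]. split; [split; [apply Rmin_pos; lra|eapply Rle_trans; [apply Rmin_l|lra]]|].
  intros z Hz. destruct (K z Hz) as [K1 [K2 [K3 K4]]], (K' z Hz) as [L1 [L2 [L3 L4]]].
  repeat split; try (apply abs_add_le; assumption). intros s Hs.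
  pose proof (Rmin_l d d'). pose proof (Rmin_r d d').
  destruct (K4 s ltac:(lra)) as [r1 [B1 E1]], (L4 s ltac:(lra)) as [r2 [B2 E2]].
  exists (r1 + r2). split; [now apply abs_add_le|]. rewrite E1, E2. ring.
Qed.

Lemma jet_mul (e : bool) (u u1 u2 v v1 v2 : Cx -> R) : jet e u u1 u2 -> jet e v v1 v2 ->
  jet e (fun z => u z * v z) (fun z => u1 z * v z + u z * v1 z)
        (fun z => u2 z * v z + u z * v2 z + u1 z * v1 z).
Proof.
  intros Hu Hv R0 HR. destruct (Hu R0 HR) as [C [d [HC [Hd K]]]]. destruct (Hv R0 HR) as [C' [d' [HC' [Hd' K']]]].
  assert (P : 0 < C * C') by (now apply Rmult_lt_0_compat).
  (* In the product of two expansions, 4 + 3 + 2 + 1 products of coefficients have order 3 to 6 in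
     s. *)
  exists (10 * (C * C')), (Rmin d d'). split; [lra|]. split; [split; [apply Rmin_pos; lra|eapply Rle_trans; [apply Rmin_l|lra]]|].
  intros z Hz. destruct (K z Hz) as [K1 [K2 [K3 K4]]], (K' z Hz) as [L1 [L2 [L3 L4]]].
  assert (W : forall n x, Rabs x <= INR n * (C * C') -> INR n <= 10 -> Rabs x <= 10 * (C * C')).
  { intros n x Hx Hn. eapply Rle_trans; [exact Hx|]. apply Rmult_le_compat_r; lra. }
  split; [|split; [|split]].
  - apply (W 1%nat); simpl; [|lra]. rewrite Rmult_1_l. now apply abs_mul_le.
  - apply (W 2%nat); simpl; [|lra]. replace ((1 + 1) * (C * C')) with (C * C' + C * C') by ring.
    apply abs_add_le; now apply abs_mul_le.
  - apply (W 3%nat); simpl; [|lra]. replace ((1 + 1 + 1) * (C * C')) with (C * C' + C * C' + C * C') by ring.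
    repeat apply abs_add_le; now apply abs_mul_le.
  - intros s Hs. pose proof (Rmin_l d d'). pose proof (Rmin_r d d').
    destruct (K4 s ltac:(lra)) as [r1 [B1 E1]], (L4 s ltac:(lra)) as [r2 [B2 E2]].
    assert (S1 : Rabs s <= 1) by lra.
    exists ((u z * r2 + u1 z * v2 z + u2 z * v1 z + r1 * v z) + s * (u1 z * r2 + u2 z * v2 z + r1 * v1 z)
      + s * (s * (u2 z * r2 + r1 * v2 z)) + s * (s * (s * (r1 * r2)))).
    split; [|rewrite E1, E2; ring].
    replace (10 * (C * C')) with ((C * C' + C * C' + C * C' + C * C') + 1 * (C * C' + C * C' + C * C')
      + 1 * (1 * (C * C' + C * C')) + 1 * (1 * (1 * (C * C')))) by ring.
    repeat first [apply abs_add_le | (apply abs_mul_le; assumption) | (apply abs_mul_le; [assumption|])].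
Qed.

(** The outer function is expanded only at the values taken by u on the disc of radius R0, which
    admits [ln] and the inverse on ranges bounded away from 0. *)
Lemma jet_comp (e : bool) (phi phi1 phi2 : R -> R) (u u1 u2 : Cx -> R) : jet e u u1 u2 ->
  (forall R0, 0 < R0 < 1 -> exists K eta, 0 < K /\ 0 < eta /\ forall z, Cnorm z <= R0 ->
     Rabs (phi (u z)) <= K /\ Rabs (phi1 (u z)) <= K /\ Rabs (phi2 (u z)) <= K /\
     forall y, Rabs y <= eta -> exists k, Rabs k <= K /\
       phi (u z + y) = phi (u z) + y * phi1 (u z) + y * y * phi2 (u z) + y * y * y * k) ->
  jet e (fun z => phi (u z)) (fun z => phi1 (u z) * u1 z)
        (fun z => phi1 (u z) * u2 z + phi2 (u z) * (u1 z * u1 z)).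
Proof.
  intros Hu Hphi R0 HR. destruct (Hu R0 HR) as [C [d [HC [Hd K]]]].
  destruct (Hphi R0 HR) as [M [eta [HM [He L]]]].
  set (Q := M + M * C + M * (C * C) + M * (2 * C * (C + 1 * C) + 1 * ((C + 1 * C) * (C + 1 * C))) +
     (C + 1 * C + 1 * (1 * C)) * (C + 1 * C + 1 * (1 * C)) * (C + 1 * C + 1 * (1 * C)) * M).
  assert (0 < M * C) by nra. assert (0 < M * (C * C)) by (apply Rmult_lt_0_compat; nra).
  assert (P1 : 0 <= M * (2 * C * (C + 1 * C) + 1 * ((C + 1 * C) * (C + 1 * C)))) by (apply Rmult_le_pos; nra).
  assert (P2 : 0 <= (C + 1 * C + 1 * (1 * C)) * (C + 1 * C + 1 * (1 * C)) * (C + 1 * C + 1 * (1 * C)) * M)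
    by (repeat apply Rmult_le_pos; lra).
  (* The increment of u is s q with |q| <= 3C, so this radius keeps it within eta. *)
  exists Q, (Rmin d (eta / (3 * C))).
  split; [unfold Q; lra|]. split; [split; [apply Rmin_pos; [lra|apply Rdiv_lt_0_compat; lra]|eapply Rle_trans; [apply Rmin_l|lra]]|].
  intros z Hz. destruct (K z Hz) as [K1 [K2 [K3 K4]]], (L z Hz) as [L1 [L2 [L3 L4]]].
  split; [unfold Q; lra|]. split; [|split].
  - apply Rle_trans with (M * C); [now apply abs_mul_le|unfold Q; lra].
  - apply Rle_trans with (M * C + M * (C * C)); [|unfold Q; lra].
    apply abs_add_le; apply abs_mul_le; try assumption. now apply abs_mul_le.
  - intros s Hs. pose proof (Rmin_l d (eta / (3 * C))). pose proof (Rmin_r d (eta / (3 * C))).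
    destruct (K4 s ltac:(lra)) as [r [B E]]. assert (S1 : Rabs s <= 1) by lra.
    set (q := u1 z + s * u2 z + s * (s * r)).
    assert (Hq : Rabs q <= C + 1 * C + 1 * (1 * C)).
    { unfold q. repeat first [assumption | apply abs_add_le | (apply abs_mul_le; [assumption|])]. }
    destruct (L4 (s * q)) as [k [Bk Ek]].
    { rewrite Rabs_mult. apply Rle_trans with (eta / (3 * C) * (3 * C)); [|right; field; lra].
      apply Rmult_le_compat; try apply Rabs_pos; lra. }
    set (q' := u2 z + s * r).
    assert (Hq' : Rabs q' <= C + 1 * C) by (unfold q'; repeat first [assumption | apply abs_add_le | (apply abs_mul_le; [assumption|])]).
    exists (phi1 (u z) * r + phi2 (u z) * (2 * u1 z * q' + s * (q' * q')) + q * q * q * k). split.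
    + apply Rle_trans with (M * C + M * (2 * C * (C + 1 * C) + 1 * ((C + 1 * C) * (C + 1 * C))) +
        (C + 1 * C + 1 * (1 * C)) * (C + 1 * C + 1 * (1 * C)) * (C + 1 * C + 1 * (1 * C)) * M); [|unfold Q; lra].
      assert (Rabs 2 <= 2) by (rewrite Rabs_pos_eq; lra).
      repeat first [assumption | apply abs_add_le | apply abs_mul_le].
    + rewrite E. replace (u z + s * u1 z + s * s * u2 z + s * s * s * r) with (u z + s * q) by (unfold q; ring).
      rewrite Ek. unfold q, q'. ring.
Qed.

Lemma jet_exp (e : bool) (u u1 u2 : Cx -> R) : jet e u u1 u2 ->
  jet e (fun z => exp (u z)) (fun z => exp (u z) * u1 z) (fun z => exp (u z) * u2 z + (exp (u z) / 2) * (u1 z * u1 z)).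
Proof.
  intros H. apply (jet_comp e exp exp (fun x => exp x / 2)); [assumption|].
  intros R0 HR. destruct (H R0 HR) as [C [d [HC [Hd K]]]].
  exists (3 * exp C), 1. pose proof (exp_pos C). split; [lra|]. split; [lra|]. intros z Hz.
  destruct (K z Hz) as [K1 _]. assert (B : exp (u z) <= exp C).
  { pose proof (Rle_abs (u z)). destruct (Req_dec (u z) C) as [->|]; [lra|left; apply exp_increasing; lra]. }
  pose proof (exp_pos (u z)). rewrite !Rabs_pos_eq by lra.
  repeat split; try lra. intros y Hy. destruct (exp_taylor y Hy) as [k [Bk Ek]].
  exists (exp (u z) * k). split; [|rewrite exp_plus, Ek; field].
  rewrite Rabs_mult, Rabs_pos_eq by lra. pose proof (Rabs_pos k). nra.
Qed.

Lemma jet_ln (e : bool) (m : R) (u u1 u2 : Cx -> R) : 0 < m -> (forall z, inD z -> m <= u z) -> jet e u u1 u2 ->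
  jet e (fun z => ln (u z)) (fun z => / u z * u1 z)
        (fun z => / u z * u2 z + (- (/ u z * / u z) / 2) * (u1 z * u1 z)).
Proof.
  intros Hm Hlow H. apply (jet_comp e ln Rinv (fun x => - (/ x * / x) / 2)); [assumption|].
  intros R0 HR. destruct (H R0 HR) as [C [d [HC [Hd K]]]].
  set (v := / m). assert (Hv : 0 < v) by now apply Rinv_0_lt_compat.
  assert (Hv2 : 0 < v * v) by nra. assert (Hv3 : 0 < v * v * v) by nra.
  exists (Rabs (ln m) + Rabs (ln (C + m)) + v + v * v + 16 * (v * v * v)), (m / 2).
  pose proof (Rabs_pos (ln m)). pose proof (Rabs_pos (ln (C + m))).
  split; [lra|]. split; [lra|]. intros z Hz. assert (HzD : inD z) by (unfold inD; lra). specialize (Hlow z HzD).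
  destruct (K z Hz) as [K1 _]. pose proof (Rle_abs (u z)).
  assert (I : 0 < / u z <= v) by (split; [apply Rinv_0_lt_compat; lra|apply Rinv_le_contravar; lra]).
  assert (I2 : 0 < / u z * / u z <= v * v) by nra.
  split; [|split; [|split]].
  - assert (ln m <= ln (u z)) by (apply ln_le; lra). assert (ln (u z) <= ln (C + m)) by (apply ln_le; lra).
    pose proof (Rle_abs (ln (C + m))). pose proof (Rle_abs (- ln m)) as Hn. rewrite Rabs_Ropp in Hn.
    apply Rabs_le. lra.
  - rewrite Rabs_pos_eq; lra.
  - unfold Rdiv. rewrite <- Ropp_mult_distr_l, Rabs_Ropp, Rabs_pos_eq; lra.
  - intros y Hy. assert (Hy' : Rabs (y * / u z) <= 1 / 2).
    { rewrite Rabs_mult, (Rabs_pos_eq (/ u z)) by lra.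
      apply Rle_trans with (m / 2 * v); [apply Rmult_le_compat; try apply Rabs_pos; lra|]. right. unfold v. field. lra. }
    destruct (ln_taylor _ Hy') as [k [Bk Ek]]. exists (/ u z * / u z * / u z * k). split.
    + assert (0 < / u z * / u z * / u z <= v * v * v).
      { split; [nra|]. apply Rmult_le_compat; nra. }
      rewrite Rabs_mult, (Rabs_pos_eq (/ u z * / u z * / u z)) by lra. pose proof (Rabs_pos k). nra.
    + replace (u z + y) with (u z * (1 + y * / u z)) by (field; lra).
      apply Rabs_le_between in Hy'. rewrite ln_mult by lra. rewrite Ek. field. lra.
Qed.

Lemma jet_inv (e : bool) (m : R) (u u1 u2 : Cx -> R) : 0 < m -> (forall z, inD z -> m <= u z) -> jet e u u1 u2 ->
  jet e (fun z => / u z) (fun z => - (/ u z * / u z) * u1 z)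
        (fun z => - (/ u z * / u z) * u2 z + (/ u z * / u z * / u z) * (u1 z * u1 z)).
Proof.
  intros Hm Hlow H. apply (jet_comp e Rinv (fun x => - (/ x * / x)) (fun x => / x * / x * / x)); [assumption|].
  intros R0 HR. set (v := / m). assert (Hv : 0 < v) by now apply Rinv_0_lt_compat.
  assert (Hv2 : 0 < v * v) by nra. assert (Hv3 : 0 < v * v * v) by nra. assert (Hv4 : 0 < v * v * v * v) by nra.
  exists (v + v * v + v * v * v + v * v * v * (2 * v)), (m / 2).
  split; [nra|]. split; [lra|]. intros z Hz. assert (HzD : inD z) by (unfold inD; lra). specialize (Hlow z HzD).
  assert (I : 0 < / u z <= v) by (split; [apply Rinv_0_lt_compat; lra|apply Rinv_le_contravar; lra]).
  assert (I2 : 0 < / u z * / u z <= v * v) by nra.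
  assert (I3 : 0 < / u z * / u z * / u z <= v * v * v) by (split; [nra|apply Rmult_le_compat; nra]).
  rewrite Rabs_Ropp, !Rabs_pos_eq by lra. repeat split; try nra.
  intros y Hy. apply Rabs_le_between in Hy.
  assert (J : 0 < / (u z + y) <= 2 * v).
  { split; [apply Rinv_0_lt_compat; lra|]. replace (2 * v) with (/ (m / 2)) by (unfold v; field; lra).
    apply Rinv_le_contravar; lra. }
  exists (- (/ u z * / u z * / u z * / (u z + y))). split; [|field; lra].
  rewrite Rabs_Ropp, Rabs_pos_eq by (apply Rmult_le_pos; lra).
  assert (/ u z * / u z * / u z * / (u z + y) <= v * v * v * (2 * v)) by (apply Rmult_le_compat; lra). lra.
Qed.

Lemma jet_scal (e : bool) (c : R) (u u1 u2 : Cx -> R) : jet e u u1 u2 ->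
  jet e (fun z => c * u z) (fun z => c * u1 z) (fun z => c * u2 z).
Proof.
  intros H. eapply jet_ext; [| | |apply jet_mul; [apply (jet_const e c)|exact H]]; intros; simpl; ring.
Qed.

Lemma jet_sub (e : bool) (u u1 u2 v v1 v2 : Cx -> R) : jet e u u1 u2 -> jet e v v1 v2 ->
  jet e (fun z => u z - v z) (fun z => u1 z - v1 z) (fun z => u2 z - v2 z).
Proof.
  intros Hu Hv. eapply jet_ext; [| | |apply jet_add; [exact Hu|apply (jet_scal e (-1)); exact Hv]]; intros; simpl; ring.
Qed.

(** Both flows fix the origin, so jets say nothing about u near 0 compared with u at 0. Continuity
    there is a separate requirement, used to start the monotonicity of means at radius 0. *)
Definition cont0 (u : Cx -> R) : Prop :=
  @continuous (prod_UniformSpace R_UniformSpace R_UniformSpace) R_UniformSpace u C0.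

Lemma cont0_eps (u : Cx -> R) :
  (forall eps, 0 < eps -> exists d, 0 < d /\ forall z, Cnorm z < d -> Rabs (u z - u C0) < eps) <-> cont0 u.
Proof.
  split.
  - intros H. apply filterlim_locally. intros eps. destruct (H eps (cond_pos eps)) as [d [Hd K]].
    assert (Hd2 : 0 < d / 2) by lra. exists (mkposreal _ Hd2). intros z [B1 B2]. apply K.
    unfold ball in B1, B2; simpl in B1, B2; unfold AbsRing_ball in B1, B2; simpl in B1, B2.
    unfold abs, minus, plus, opp in B1, B2; simpl in B1, B2.
    eapply Rle_lt_trans; [apply Cnorm_le_ReIm|]. unfold Cre, Cim.
    rewrite Ropp_0, Rplus_0_r in B1, B2. lra.
  - intros H eps He. destruct (proj1 (filterlim_locally _ _) H (mkposreal _ He)) as [d K].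
    exists d. split; [apply cond_pos|]. intros z Hz. apply K. split; unfold ball; simpl; unfold AbsRing_ball; simpl;
      unfold abs, minus, plus, opp; simpl; rewrite Ropp_0, Rplus_0_r.
    + eapply Rle_lt_trans; [apply (Cre_le z)|exact Hz].
    + eapply Rle_lt_trans; [apply (Cim_le z)|exact Hz].
Qed.

(* [ux], [uy] are the derivatives of [u] along the two flows, that is, along log|z| and arg z;
   [L] is half of the Laplacian of [u] in the variable log z. *)
Definition smooth (u ux uy L : Cx -> R) : Prop :=
  exists u2 v2, jet true u ux u2 /\ jet false u uy v2 /\ (forall z, inD z -> u2 z + v2 z = L z) /\ cont0 u.

Lemma smooth_ext (u ux uy L v vx vy L' : Cx -> R) : (forall z, u z = v z) -> (forall z, inD z -> ux z = vx z) ->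
  (forall z, inD z -> uy z = vy z) -> (forall z, inD z -> L z = L' z) -> smooth u ux uy L -> smooth v vx vy L'.
Proof.
  intros E E1 E2 E3 [u2 [v2 [J1 [J2 [EL H0]]]]]. exists u2, v2. split; [|split; [|split]].
  - now apply (jet_ext true u ux u2).
  - now apply (jet_ext false u uy v2).
  - intros z Hz. rewrite <- E3 by assumption. auto.
  - apply (continuous_ext u); assumption.
Qed.

Lemma smooth_const (c : R) : smooth (fun _ => c) (fun _ => 0) (fun _ => 0) (fun _ => 0).
Proof.
  exists (fun _ => 0), (fun _ => 0). repeat split; try apply jet_const; [intros; ring|apply continuous_const].
Qed.

Lemma smooth_add (u ux uy L v vx vy L' : Cx -> R) : smooth u ux uy L -> smooth v vx vy L' ->
  smooth (fun z => u z + v z) (fun z => ux z + vx z) (fun z => uy z + vy z) (fun z => L z + L' z).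
Proof.
  intros [u2 [v2 [J1 [J2 [EL H0]]]]] [u2' [v2' [J1' [J2' [EL' H0']]]]].
  exists (fun z => u2 z + u2' z), (fun z => v2 z + v2' z). split; [|split; [|split]].
  - now apply jet_add.
  - now apply jet_add.
  - intros z Hz. rewrite <- EL, <- EL' by assumption. ring.
  - now apply @continuous_plus.
Qed.

Lemma smooth_mul (u ux uy L v vx vy L' : Cx -> R) : smooth u ux uy L -> smooth v vx vy L' ->
  smooth (fun z => u z * v z) (fun z => ux z * v z + u z * vx z) (fun z => uy z * v z + u z * vy z)
    (fun z => L z * v z + u z * L' z + ux z * vx z + uy z * vy z).
Proof.
  intros [u2 [v2 [J1 [J2 [EL H0]]]]] [u2' [v2' [J1' [J2' [EL' H0']]]]].
  eexists; eexists; split; [|split; [|split]].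
  - now apply jet_mul; [apply J1|apply J1'].
  - now apply jet_mul; [apply J2|apply J2'].
  - intros z Hz. rewrite <- EL, <- EL' by assumption. ring.
  - now apply @continuous_mult.
Qed.

Lemma smooth_scal (c : R) (u ux uy L : Cx -> R) : smooth u ux uy L ->
  smooth (fun z => c * u z) (fun z => c * ux z) (fun z => c * uy z) (fun z => c * L z).
Proof.
  intros H. eapply smooth_ext; [| | | |apply smooth_mul; [apply (smooth_const c)|exact H]]; intros; simpl; ring.
Qed.

Lemma smooth_exp (u ux uy L : Cx -> R) : smooth u ux uy L ->
  smooth (fun z => exp (u z)) (fun z => exp (u z) * ux z) (fun z => exp (u z) * uy z)
    (fun z => exp (u z) * (L z + (ux z * ux z + uy z * uy z) / 2)).
Proof.
  intros [u2 [v2 [J1 [J2 [EL H0]]]]].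
  eexists; eexists; split; [|split; [|split]].
  - apply jet_exp; exact J1.
  - apply jet_exp; exact J2.
  - intros z Hz. rewrite <- EL by assumption. simpl. field.
  - apply continuous_comp; [exact H0|]. apply continuous_exp.
Qed.

Lemma smooth_ln (m : R) (u ux uy L : Cx -> R) : 0 < m -> (forall z, inD z -> m <= u z) -> smooth u ux uy L ->
  smooth (fun z => ln (u z)) (fun z => / u z * ux z) (fun z => / u z * uy z)
    (fun z => / u z * L z - / u z * / u z * (ux z * ux z + uy z * uy z) / 2).
Proof.
  intros Hm Hl [u2 [v2 [J1 [J2 [EL H0]]]]].
  eexists; eexists; split; [|split; [|split]].
  - apply (jet_ln _ m); [assumption|assumption|exact J1].
  - apply (jet_ln _ m); [assumption|assumption|exact J2].
  - intros z Hz. rewrite <- EL by assumption. simpl. field. specialize (Hl z Hz). lra.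
  - apply continuous_comp; [exact H0|]. apply continuous_ln.
    assert (D0 : inD C0) by (unfold inD; rewrite Cnorm_0; lra). specialize (Hl _ D0). lra.
Qed.

Lemma smooth_pow (q m : R) (u ux uy L : Cx -> R) : 0 < m -> (forall z, inD z -> m <= u z) -> smooth u ux uy L ->
  smooth (fun z => Rpower (u z) q) (fun z => Rpower (u z) q * (q * / u z * ux z))
    (fun z => Rpower (u z) q * (q * / u z * uy z))
    (fun z => Rpower (u z) q * (q * / u z * L z + q * (q - 1) / 2 * (/ u z * / u z) * (ux z * ux z + uy z * uy z))).
Proof.
  intros Hm Hl H. pose proof (smooth_exp _ _ _ _ (smooth_scal q _ _ _ _ (smooth_ln m _ _ _ _ Hm Hl H))) as K.
  eapply smooth_ext; [| | | |exact K]; intros; unfold Rpower; simpl; field; specialize (Hl z H0); lra.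
Qed.

(* [A] and [2 B] are the first two derivatives of [F] along z e^s, so A = z F'(z); along
   z e^(is) they are i A and - 2 B. *)
Definition hol (F A : Cx -> Cx) : Prop := exists B,
  jet true (fun z => Cre (F z)) (fun z => Cre (A z)) (fun z => Cre (B z)) /\
  jet true (fun z => Cim (F z)) (fun z => Cim (A z)) (fun z => Cim (B z)) /\
  jet false (fun z => Cre (F z)) (fun z => - Cim (A z)) (fun z => - Cre (B z)) /\
  jet false (fun z => Cim (F z)) (fun z => Cre (A z)) (fun z => - Cim (B z)) /\
  cont0 (fun z => Cre (F z)) /\ cont0 (fun z => Cim (F z)).

Definition n2 (z : Cx) : R := Cre z * Cre z + Cim z * Cim z.

Lemma smooth_Re (F A : Cx -> Cx) : hol F A ->
  smooth (fun z => Cre (F z)) (fun z => Cre (A z)) (fun z => - Cim (A z)) (fun _ => 0).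
Proof.
  intros [B [J1 [J2 [J3 [J4 [H1 H2]]]]]]. eexists; eexists; split; [exact J1|split; [exact J3|split; [|exact H1]]].
  intros; simpl; ring.
Qed.

Lemma smooth_Im (F A : Cx -> Cx) : hol F A ->
  smooth (fun z => Cim (F z)) (fun z => Cim (A z)) (fun z => Cre (A z)) (fun _ => 0).
Proof.
  intros [B [J1 [J2 [J3 [J4 [H1 H2]]]]]]. eexists; eexists; split; [exact J2|split; [exact J4|split; [|exact H2]]].
  intros; simpl; ring.
Qed.

Lemma smooth_n2 (F A : Cx -> Cx) : hol F A ->
  smooth (fun z => n2 (F z)) (fun z => 2 * (Cre (F z) * Cre (A z) + Cim (F z) * Cim (A z)))
    (fun z => 2 * (Cim (F z) * Cre (A z) - Cre (F z) * Cim (A z))) (fun z => 2 * n2 (A z)).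
Proof.
  intros H. pose proof (smooth_Re F A H) as S1. pose proof (smooth_Im F A H) as S2.
  eapply smooth_ext; [| | | |apply smooth_add; [apply smooth_mul; exact S1|apply smooth_mul; exact S2]];
    intros; unfold n2; simpl; ring.
Qed.

Lemma hol_const (c : Cx) : hol (fun _ => c) (fun _ => C0).
Proof.
  exists (fun _ => C0). repeat split; try apply continuous_const;
    (eapply jet_ext; [| | |apply jet_const]; [reflexivity| |]; intros; unfold C0, Cre, Cim; simpl; ring).
Qed.

Lemma hol_add (F A G A' : Cx -> Cx) : hol F A -> hol G A' -> hol (fun z => F z + G z)%X (fun z => A z + A' z)%X.
Proof.
  intros [B [J1 [J2 [J3 [J4 [H1 H2]]]]]] [B' [J1' [J2' [J3' [J4' [H1' H2']]]]]].
  exists (fun z => B z + B' z)%X. split; [|split; [|split; [|split; [|split]]]].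
  - eapply jet_ext; [| | |apply jet_add; [exact J1|exact J1']]; reflexivity.
  - eapply jet_ext; [| | |apply jet_add; [exact J2|exact J2']]; reflexivity.
  - eapply jet_ext; [| | |apply jet_add; [exact J3|exact J3']]; intros; unfold Cadd, Cre, Cim; simpl; ring.
  - eapply jet_ext; [| | |apply jet_add; [exact J4|exact J4']]; intros; unfold Cadd, Cre, Cim; simpl; ring.
  - apply (continuous_ext (fun z => Cre (F z) + Cre (G z))); [reflexivity|]. now apply @continuous_plus.
  - apply (continuous_ext (fun z => Cim (F z) + Cim (G z))); [reflexivity|]. now apply @continuous_plus.
Qed.

Lemma hol_mul (F A G A' : Cx -> Cx) : hol F A -> hol G A' ->
  hol (fun z => F z * G z)%X (fun z => A z * G z + F z * A' z)%X.
Proof.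
  intros [B [J1 [J2 [J3 [J4 [H1 H2]]]]]] [B' [J1' [J2' [J3' [J4' [H1' H2']]]]]].
  exists (fun z => B z * G z + F z * B' z + A z * A' z)%X. split; [|split; [|split; [|split; [|split]]]].
  - eapply jet_ext; [| | |apply jet_sub; [apply jet_mul; [exact J1|exact J1']|apply jet_mul; [exact J2|exact J2']]];
      intros; unfold Cadd, Cmul, Cre, Cim; simpl; ring.
  - eapply jet_ext; [| | |apply jet_add; [apply jet_mul; [exact J1|exact J2']|apply jet_mul; [exact J2|exact J1']]];
      intros; unfold Cadd, Cmul, Cre, Cim; simpl; ring.
  - eapply jet_ext; [| | |apply jet_sub; [apply jet_mul; [exact J3|exact J3']|apply jet_mul; [exact J4|exact J4']]];
      intros; unfold Cadd, Cmul, Cre, Cim; simpl; ring.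
  - eapply jet_ext; [| | |apply jet_add; [apply jet_mul; [exact J3|exact J4']|apply jet_mul; [exact J4|exact J3']]];
      intros; unfold Cadd, Cmul, Cre, Cim; simpl; ring.
  - apply (continuous_ext (fun z => Cre (F z) * Cre (G z) - Cim (F z) * Cim (G z))); [reflexivity|].
    apply @continuous_minus; now apply @continuous_mult.
  - apply (continuous_ext (fun z => Cre (F z) * Cim (G z) + Cim (F z) * Cre (G z))); [reflexivity|].
    apply @continuous_plus; now apply @continuous_mult.
Qed.

(** Since 1/F is the conjugate of F divided by |F|^2, the real calculus applied to 1/|F|^2 is
    enough. *)
Lemma hol_inv (m : R) (F A : Cx -> Cx) : 0 < m -> (forall z, inD z -> m <= n2 (F z)) -> hol F A ->
  hol (fun z => Cinv (F z)) (fun z => - (A z * Cinv (F z) * Cinv (F z)))%X.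
Proof.
  intros Hm Hl [B [J1 [J2 [J3 [J4 [H1 H2]]]]]].
  assert (Q1 := jet_inv true m _ _ _ Hm Hl (jet_add _ _ _ _ _ _ _ (jet_mul _ _ _ _ _ _ _ J1 J1) (jet_mul _ _ _ _ _ _ _ J2 J2))).
  assert (Q2 := jet_inv false m _ _ _ Hm Hl (jet_add _ _ _ _ _ _ _ (jet_mul _ _ _ _ _ _ _ J3 J3) (jet_mul _ _ _ _ _ _ _ J4 J4))).
  assert (C0D : inD C0) by (unfold inD; rewrite Cnorm_0; lra).
  assert (Q0 : cont0 (fun z => / (Cre (F z) * Cre (F z) + Cim (F z) * Cim (F z)))).
  { apply (continuous_comp (fun z => Cre (F z) * Cre (F z) + Cim (F z) * Cim (F z)) Rinv).
    - apply @continuous_plus; now apply @continuous_mult.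
    - apply continuous_Rinv. specialize (Hl _ C0D). unfold n2 in Hl. lra. }
  exists (fun z => - (B z * Cinv (F z) * Cinv (F z)) + A z * A z * Cinv (F z) * Cinv (F z) * Cinv (F z))%X.
  split; [|split; [|split; [|split; [|split]]]].
  - eapply jet_ext; [| | |apply jet_mul; [exact J1|exact Q1]]; intros; [unfold n2; reflexivity| |]; specialize (Hl _ H); unfold n2 in Hl;
      unfold n2, Cinv, Cadd, Copp, Cmul, Cre, Cim in *; simpl; field; lra.
  - eapply jet_ext; [| | |apply jet_mul; [apply (jet_scal _ (-1)); exact J2|exact Q1]]; intros; [unfold n2, Cinv, Cre, Cim; simpl; unfold Rdiv; ring| |]; specialize (Hl _ H); unfold n2 in Hl;
      unfold n2, Cinv, Cadd, Copp, Cmul, Cre, Cim in *; simpl; field; lra.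
  - eapply jet_ext; [| | |apply jet_mul; [exact J3|exact Q2]]; intros; [unfold n2; reflexivity| |]; specialize (Hl _ H); unfold n2 in Hl;
      unfold n2, Cinv, Cadd, Copp, Cmul, Cre, Cim in *; simpl; field; lra.
  - eapply jet_ext; [| | |apply jet_mul; [apply (jet_scal _ (-1)); exact J4|exact Q2]]; intros; [unfold n2, Cinv, Cre, Cim; simpl; unfold Rdiv; ring| |]; specialize (Hl _ H); unfold n2 in Hl;
      unfold n2, Cinv, Cadd, Copp, Cmul, Cre, Cim in *; simpl; field; lra.
  - apply (continuous_ext (fun z => Cre (F z) * / (Cre (F z) * Cre (F z) + Cim (F z) * Cim (F z)))); [reflexivity|].
    now apply @continuous_mult.
  - apply (continuous_ext (fun z => - Cim (F z) * / (Cre (F z) * Cre (F z) + Cim (F z) * Cim (F z)))); [reflexivity|].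
    apply @continuous_mult; [now apply @continuous_opp|assumption].
Qed.

(** Both flows are exp(i s), with i equal to 1 or to the imaginary unit, so one computation in
    [tay_hol] serves both. *)
Lemma flow_taylor (e : bool) (s : R) : Rabs s <= 1 -> exists k : Cx, Cnorm k <= 3 /\
  let i := if e then C1 else (0, 1) in
  flow e s = (C1 + RtoC s * i + RtoC (s * s / 2) * (i * i) + RtoC (s * s * s) * k)%X.
Proof.
  intros Hs. destruct e; simpl.
  - destruct (exp_taylor s Hs) as [k [Hk E]]. exists (RtoC k). rewrite Cnorm_RtoC. split; [assumption|].
    rewrite E. apply Cx_eq; unfold Cadd, Cmul, RtoC, Cre, Cim; simpl; field.
  - destruct (cos_taylor s Hs) as [k [Hk E]]. destruct (sin_taylor s Hs) as [l [Hl El]].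
    exists (k, l). split; [eapply Rle_trans; [apply Cnorm_le_ReIm|]; unfold Cre, Cim; simpl; lra|].
    unfold Cexpi. rewrite E, El. apply Cx_eq; unfold Cadd, Cmul, RtoC, Cre, Cim; simpl; field.
Qed.

Lemma Cnorm_i : Cnorm (0, 1) = 1.
Proof. unfold Cnorm, Cre, Cim; simpl. replace (0 * 0 + 1 * 1) with 1 by ring. apply sqrt_1. Qed.

Lemma flow_near (e : bool) (s : R) : Rabs s <= 1 -> Cnorm (flow e s - C1)%X <= 5 * Rabs s.
Proof.
  intros Hs. destruct (flow_taylor e s Hs) as [k [Hk E]]. cbv zeta in E.
  set (i := if e then C1 else (0, 1)) in E.
  assert (Hi : Cnorm i = 1).
  { unfold i. destruct e; [apply Cnorm_1|apply Cnorm_i]. }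
  rewrite E. clear E. match goal with |- Cnorm ?x <= _ => replace x with (RtoC s * i + RtoC (s * s / 2) * (i * i) + RtoC (s * s * s) * k)%X by ring end.
  pose proof (Rabs_pos s). pose proof (Cnorm_ge0 k).
  eapply Rle_trans; [apply Cnorm_add|]. eapply Rle_trans; [apply Rplus_le_compat_r, Cnorm_add|].
  rewrite !Cnorm_mul, !Cnorm_RtoC, Hi. unfold Rdiv. rewrite !Rabs_mult, (Rabs_pos_eq (/ 2)) by lra.
  assert (Rabs s * Rabs s <= Rabs s) by nra. assert (Rabs s * Rabs s * Rabs s <= Rabs s) by nra. nra.
Qed.

Lemma tay_hol (F D1 D2 : Cx -> Cx) : tay F D1 D2 -> hol F (fun z => z * D1 z)%X.
Proof.
  intros H.
  assert (P : forall (e : bool) R0, 0 < R0 < 1 -> exists C d, 0 < C /\ 0 < d <= 1 /\ forall z, Cnorm z <= R0 ->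
    Cnorm (F z) <= C /\ Cnorm (z * D1 z)%X <= C /\ Cnorm (RtoC (1 / 2) * (z * D1 z) + z * z * D2 z)%X <= C /\
    forall s, Rabs s <= d -> let i : Cx := if e then C1 else (0, 1) in exists r : Cx, Cnorm r <= C /\
      F (flow e s * z)%X = (F z + RtoC s * (i * (z * D1 z)) + RtoC (s * s) * (i * i * (RtoC (1 / 2) * (z * D1 z) + z * z * D2 z))
         + RtoC (s * s * s) * r)%X).
  { intros e R0 HR. set (R1 := (1 + R0) / 2). assert (HR1 : R0 < R1 < 1) by (unfold R1; lra).
    (* The three parts of the remainder cost at most 3C, 24C and 125C; the bound on s keeps the
       moved point, at distance at most 5|s|, inside the disc of radius R1. *)
    destruct (H R1 ltac:(lra)) as [C [HC K]]. exists (200 * C), (Rmin 1 ((R1 - R0) / 5)). split; [lra|].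
    split; [split; [apply Rmin_pos; lra|apply Rmin_l]|]. intros z Hz.
    destruct (K z z ltac:(lra) ltac:(lra)) as [K0 [K1 [K2 _]]].
    pose proof (Cnorm_ge0 (D1 z)). pose proof (Cnorm_ge0 (D2 z)). pose proof (Cnorm_ge0 z).
    assert (B1 : Cnorm (z * D1 z)%X <= C) by (rewrite Cnorm_mul; nra).
    assert (B2 : Cnorm (z * z * D2 z)%X <= C) by (rewrite !Cnorm_mul; assert (Cnorm z * Cnorm z <= 1) by nra; nra).
    split; [lra|]. split; [lra|]. split.
    { eapply Rle_trans; [apply Cnorm_add|]. rewrite Cnorm_mul, Cnorm_RtoC, Rabs_pos_eq by lra. lra. }
    intros s Hs i. pose proof (Rmin_l 1 ((R1 - R0) / 5)). pose proof (Rmin_r 1 ((R1 - R0) / 5)).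
    assert (S1 : Rabs s <= 1) by lra. pose proof (Rabs_pos s).
    destruct (flow_taylor e s S1) as [k [Hk E]]. cbv zeta in E. fold i in E.
    pose proof (flow_near e s S1) as N.
    assert (Hi : Cnorm i = 1).
    { unfold i. destruct e; [apply Cnorm_1|apply Cnorm_i]. }
    set (h := (flow e s * z - z)%X).
    assert (Eh : h = (z * (flow e s - C1))%X) by (unfold h; ring).
    assert (Nh : Cnorm h <= 5 * Rabs s).
    { rewrite Eh, Cnorm_mul. pose proof (Cnorm_ge0 (flow e s - C1)%X). nra. }
    assert (Hw : Cnorm (flow e s * z)%X <= R1).
    { replace (flow e s * z)%X with (z + h)%X by (unfold h; ring). eapply Rle_trans; [apply Cnorm_add|]. lra. }
    destruct (K z _ ltac:(lra) Hw) as [_ [_ [_ K3]]]. fold h in K3.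
    (* With this t the flow is 1 + s i + s^2 t, so h = z (s i + s^2 t). *)
    set (t := (RtoC (1 / 2) * (i * i) + RtoC s * k)%X).
    assert (Nt : Cnorm t <= 4).
    { unfold t. eapply Rle_trans; [apply Cnorm_add|]. rewrite !Cnorm_mul, !Cnorm_RtoC, Hi, Rabs_pos_eq by lra.
      pose proof (Cnorm_ge0 k). nra. }
    set (err := (F (flow e s * z) - F z - D1 z * h - D2 z * (h * h))%X) in *.
    assert (Er : exists r0, Cnorm r0 <= 125 * C /\ err = (RtoC (s * s * s) * r0)%X).
    { assert (Herr : Cnorm err <= 125 * C * Rabs s ^ 3).
      { eapply Rle_trans; [exact K3|]. pose proof (Cnorm_ge0 h).
        assert (Hcub : Cnorm h ^ 3 <= (5 * Rabs s) ^ 3) by (apply pow_incr; lra).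
        replace ((5 * Rabs s) ^ 3) with (125 * Rabs s ^ 3) in Hcub by ring. nra. }
      destruct (Req_dec s 0) as [S0|S0].
      - exists C0. rewrite Cnorm_0. split; [lra|].
        rewrite S0, Rabs_R0 in Herr. simpl in Herr. rewrite !Rmult_0_l, Rmult_0_r in Herr.
        replace (RtoC (s * s * s) * C0)%X with C0 by ring. apply Cnorm_eq0. pose proof (Cnorm_ge0 err). lra.
      - assert (S3 : RtoC (s * s * s) <> C0).
        { intros X. apply (f_equal fst) in X. simpl in X.
          apply Rmult_integral in X. destruct X as [X|X]; [|lra]. apply Rmult_integral in X. lra. }
        exists (err / RtoC (s * s * s))%X. split; [|field; assumption].
        rewrite Cnorm_div, Cnorm_RtoC, !Rabs_mult by assumption.
        assert (0 < Rabs s) by now apply Rabs_pos_lt.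
        assert (0 < Rabs s * Rabs s * Rabs s) by (apply Rmult_lt_0_compat; nra).
        apply Rmult_le_reg_r with (Rabs s * Rabs s * Rabs s); [assumption|].
        unfold Rdiv. rewrite Rmult_assoc, Rinv_l by lra. simpl in Herr. lra. }
    destruct Er as [r0 [Hr0 Er]].
    exists (z * D1 z * k + z * z * D2 z * (RtoC 2 * i * t + RtoC s * (t * t)) + r0)%X. split.
    - eapply Rle_trans; [apply Cnorm_add|]. eapply Rle_trans; [apply Rplus_le_compat_r, Cnorm_add|].
      rewrite (Cnorm_mul (z * D1 z)%X), (Cnorm_mul (z * z * D2 z)%X).
      assert (Cnorm (RtoC 2 * i * t + RtoC s * (t * t))%X <= 24).
      { eapply Rle_trans; [apply Cnorm_add|]. rewrite !Cnorm_mul, !Cnorm_RtoC, Hi, (Rabs_pos_eq 2) by lra.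
        pose proof (Cnorm_ge0 t). assert (Cnorm t * Cnorm t <= 16) by nra. nra. }
      assert (Cnorm (z * D1 z)%X * Cnorm k <= C * 3) by (apply Rmult_le_compat; try apply Cnorm_ge0; assumption).
      assert (Cnorm (z * z * D2 z)%X * Cnorm (RtoC 2 * i * t + RtoC s * (t * t))%X <= C * 24) by (apply Rmult_le_compat; try apply Cnorm_ge0; assumption).
      lra.
    - transitivity (F z + D1 z * h + D2 z * (h * h) + err)%X; [unfold err; ring|].
      rewrite Er, Eh, E. unfold t.
      destruct (F z), (D1 z), (D2 z), z, k, r0, i. apply Cx_eq; unfold Csub, Cadd, Cmul, Copp, RtoC, Cre, Cim; simpl; field. }
  assert (Q0 : forall p : Cx -> R, (forall u v, p (u - v)%X = p u - p v) -> (forall u, Rabs (p u) <= Cnorm u) -> cont0 (fun z => p (F z))).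
  { intros p P1 P2. apply cont0_eps. intros eps He. destruct (tay_Lip F D1 D2 (1 / 2) H ltac:(lra)) as [C [HC K]].
    exists (Rmin (1 / 2) (eps / C)). split; [apply Rmin_pos; [lra|now apply Rdiv_lt_0_compat]|].
    intros z Hz. pose proof (Rmin_l (1 / 2) (eps / C)). pose proof (Rmin_r (1 / 2) (eps / C)).
    rewrite <- P1. eapply Rle_lt_trans; [apply P2|]. eapply Rle_lt_trans; [apply K; [rewrite Cnorm_0; lra|lra]|].
    replace (z - C0)%X with z by ring. replace eps with (C * (eps / C)) by (field; lra). apply Rmult_lt_compat_l; lra. }
  exists (fun z => RtoC (1 / 2) * (z * D1 z) + z * z * D2 z)%X. split; [|split; [|split; [|split; [|split]]]].
  - intros R0 HR. destruct (P true R0 HR) as [C [d [HC [Hd K]]]]. exists C, d. do 2 (split; [assumption|]).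
    intros z Hz. destruct (K z Hz) as [K0 [K1 [K2 K3]]].
    do 3 (split; [eapply Rle_trans; [apply Cre_le|assumption]|]). intros s Hs. destruct (K3 s Hs) as [r [Hr E]].
    exists (Cre r). split; [eapply Rle_trans; [apply Cre_le|assumption]|]. rewrite E.
    unfold Cadd, Cmul, RtoC, Cre, Cim; simpl; ring.
  - intros R0 HR. destruct (P true R0 HR) as [C [d [HC [Hd K]]]]. exists C, d. do 2 (split; [assumption|]).
    intros z Hz. destruct (K z Hz) as [K0 [K1 [K2 K3]]].
    do 3 (split; [eapply Rle_trans; [apply Cim_le|assumption]|]). intros s Hs. destruct (K3 s Hs) as [r [Hr E]].
    exists (Cim r). split; [eapply Rle_trans; [apply Cim_le|assumption]|]. rewrite E.
    unfold Cadd, Cmul, RtoC, Cre, Cim; simpl; ring.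
  - intros R0 HR. destruct (P false R0 HR) as [C [d [HC [Hd K]]]]. exists C, d. do 2 (split; [assumption|]).
    intros z Hz. destruct (K z Hz) as [K0 [K1 [K2 K3]]]. rewrite !Rabs_Ropp.
    split; [eapply Rle_trans; [apply Cre_le|assumption]|]. split; [eapply Rle_trans; [apply Cim_le|assumption]|].
    split; [eapply Rle_trans; [apply Cre_le|assumption]|]. intros s Hs. destruct (K3 s Hs) as [r [Hr E]].
    exists (Cre r). split; [eapply Rle_trans; [apply Cre_le|assumption]|]. rewrite E.
    unfold Cadd, Cmul, RtoC, Cre, Cim; simpl; ring.
  - intros R0 HR. destruct (P false R0 HR) as [C [d [HC [Hd K]]]]. exists C, d. do 2 (split; [assumption|]).
    intros z Hz. destruct (K z Hz) as [K0 [K1 [K2 K3]]]. rewrite !Rabs_Ropp.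
    split; [eapply Rle_trans; [apply Cim_le|assumption]|]. split; [eapply Rle_trans; [apply Cre_le|assumption]|].
    split; [eapply Rle_trans; [apply Cim_le|assumption]|]. intros s Hs. destruct (K3 s Hs) as [r [Hr E]].
    exists (Cim r). split; [eapply Rle_trans; [apply Cim_le|assumption]|]. rewrite E.
    unfold Cadd, Cmul, RtoC, Cre, Cim; simpl; ring.
  - apply Q0; [reflexivity|apply Cre_le].
  - apply Q0; [reflexivity|apply Cim_le].
Qed.

(** * Circle means and subharmonicity *)

Definition mean (f : R -> R) : R := RInt f 0 (2 * PI) / (2 * PI).
Definition cm (r : R) (u : Cx -> R) : R := mean (fun t => u (circ r t)).
Definition circont (r : R) (u : Cx -> R) : Prop := forall t, continuous (fun t => u (circ r t)) t.

Lemma PI2_pos : 0 < 2 * PI.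
Proof. pose proof PI_RGT_0. lra. Qed.

Lemma ex_RInt_cont (f : R -> R) (a b : R) : (forall t, continuous f t) -> ex_RInt f a b.
Proof. intros H. apply (ex_RInt_continuous (V := R_CompleteNormedModule)). intros t _. apply H. Qed.

Lemma mean_ext (f g : R -> R) : (forall t, f t = g t) -> mean f = mean g.
Proof. intros H. unfold mean. f_equal. apply RInt_ext. intros t _. apply H. Qed.

Lemma mean_le (f g : R -> R) : (forall t, continuous f t) -> (forall t, continuous g t) ->
  (forall t, f t <= g t) -> mean f <= mean g.
Proof.
  intros Hf Hg H. unfold mean. pose proof PI2_pos.
  apply Rmult_le_compat_r; [left; now apply Rinv_0_lt_compat|].
  apply RInt_le; [lra| | |intros; apply H]; now apply ex_RInt_cont.
Qed.

Lemma mean_const (c : R) : mean (fun _ => c) = c.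
Proof.
  unfold mean. pose proof PI2_pos.
  assert (E : RInt (fun _ : R => c) 0 (2 * PI) = (2 * PI - 0) * c) by exact (RInt_const 0 (2 * PI) c).
  rewrite E. field. lra.
Qed.

Lemma mean_add (f g : R -> R) : (forall t, continuous f t) -> (forall t, continuous g t) ->
  mean (fun t => f t + g t) = mean f + mean g.
Proof.
  intros Hf Hg. unfold mean.
  assert (E : RInt (fun t => f t + g t) 0 (2 * PI) = RInt f 0 (2 * PI) + RInt g 0 (2 * PI)).
  { exact (RInt_plus (V := R_CompleteNormedModule) _ _ 0 (2 * PI) (ex_RInt_cont f _ _ Hf) (ex_RInt_cont g _ _ Hg)). }
  rewrite E. unfold Rdiv. ring.
Qed.

Lemma mean_scal (c : R) (f : R -> R) : (forall t, continuous f t) -> mean (fun t => c * f t) = c * mean f.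
Proof.
  intros Hf. unfold mean.
  assert (E : RInt (fun t => c * f t) 0 (2 * PI) = c * RInt f 0 (2 * PI)).
  { exact (RInt_scal (V := R_CompleteNormedModule) _ 0 (2 * PI) c (ex_RInt_cont f _ _ Hf)). }
  rewrite E. unfold Rdiv. ring.
Qed.

Lemma cm_ext (r : R) (u v : Cx -> R) : (forall t, u (circ r t) = v (circ r t)) -> cm r u = cm r v.
Proof. intros H. now apply mean_ext. Qed.

Lemma cm_le (r : R) (u v : Cx -> R) : circont r u -> circont r v ->
  (forall t, u (circ r t) <= v (circ r t)) -> cm r u <= cm r v.
Proof. intros. now apply mean_le. Qed.

Lemma cm_const (r c : R) : cm r (fun _ => c) = c.
Proof. exact (mean_const c). Qed.

Lemma cm_add (r : R) (u v : Cx -> R) : circont r u -> circont r v ->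
  cm r (fun z => u z + v z) = cm r u + cm r v.
Proof. intros. now apply (mean_add (fun t => u (circ r t)) (fun t => v (circ r t))). Qed.

Lemma cm_scal (r c : R) (u : Cx -> R) : circont r u -> cm r (fun z => c * u z) = c * cm r u.
Proof. intros. now apply (mean_scal c (fun t => u (circ r t))). Qed.

Lemma circont_const (r c : R) : circont r (fun _ => c).
Proof. intros t. apply continuous_const. Qed.

Lemma circont_add (r : R) (u v : Cx -> R) : circont r u -> circont r v -> circont r (fun z => u z + v z).
Proof. intros Hu Hv t. apply (continuous_plus (fun t => u (circ r t)) (fun t => v (circ r t))); [apply Hu|apply Hv]. Qed.

Lemma circont_sub (r : R) (u v : Cx -> R) : circont r u -> circont r v -> circont r (fun z => u z - v z).
Proof. intros Hu Hv t. apply (continuous_minus (fun t => u (circ r t)) (fun t => v (circ r t))); [apply Hu|apply Hv]. Qed.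

Lemma circont_mul (r : R) (u v : Cx -> R) : circont r u -> circont r v -> circont r (fun z => u z * v z).
Proof. intros Hu Hv t. apply (continuous_mult (fun t => u (circ r t)) (fun t => v (circ r t))); [apply Hu|apply Hv]. Qed.

Lemma circont_scal (r c : R) (u : Cx -> R) : circont r u -> circont r (fun z => c * u z).
Proof. intros Hu. apply circont_mul; [apply circont_const|assumption]. Qed.

Lemma circont_comp (r : R) (phi : R -> R) (u : Cx -> R) : (forall x, continuous phi x) -> circont r u -> circont r (fun z => phi (u z)).
Proof. intros Hp Hu t. apply (continuous_comp (fun t => u (circ r t)) phi); [apply Hu|apply Hp]. Qed.

Lemma circont_ext (r : R) (u v : Cx -> R) : (forall t, u (circ r t) = v (circ r t)) -> circont r u -> circont r v.
Proof. intros E H t. apply (continuous_ext (fun t => u (circ r t))); [intros; apply E|apply H]. Qed.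

Lemma cm_sub (r : R) (u v : Cx -> R) : circont r u -> circont r v ->
  cm r (fun z => u z - v z) = cm r u - cm r v.
Proof.
  intros Hu Hv. rewrite (cm_ext r _ (fun z => u z + (-1) * v z)) by (intros; ring).
  rewrite cm_add, cm_scal; [ring|assumption|assumption|now apply circont_scal].
Qed.

Lemma flow_true_circ (s r t : R) : (flow true s * circ r t)%X = circ (r * exp s) t.
Proof. unfold flow, circ. apply Cx_eq; unfold Cmul, RtoC, Cre, Cim; simpl; ring. Qed.

Lemma flow_false_circ (s r t : R) : (flow false s * circ r t)%X = circ r (t + s).
Proof. unfold flow, circ. rewrite Cexpi_add. ring. Qed.

Lemma circ_0 (t : R) : circ 0 t = C0.
Proof. unfold circ. cx_ring. Qed.

Lemma Rabs_jet (s u1 u2 rho C : R) : 0 < C -> Rabs s <= 1 -> Rabs u1 <= C -> Rabs u2 <= C -> Rabs rho <= C ->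
  Rabs (s * u1 + s * s * u2 + s * s * s * rho) <= 3 * C * Rabs s.
Proof.
  intros HC Hs H1 H2 H3. replace (s * u1 + s * s * u2 + s * s * s * rho) with (s * (u1 + s * u2 + s * (s * rho))) by ring.
  rewrite (Rmult_comm (3 * C)). apply abs_mul_le; [lra|].
  replace (3 * C) with (C + 1 * C + 1 * (1 * C)) by ring.
  repeat first [assumption | apply abs_add_le | apply abs_mul_le].
Qed.

Lemma jet_circont (u u1 u2 : Cx -> R) (r : R) : jet false u u1 u2 -> 0 <= r < 1 -> circont r u.
Proof.
  intros H Hr t. destruct (H ((1 + r) / 2) ltac:(lra)) as [C [d [HC [Hd K]]]].
  destruct (K (circ r t)) as [_ [K1 [K2 K3]]]; [rewrite Cnorm_circ; lra|].
  apply filterlim_locally. intros eps. pose proof (cond_pos eps) as He.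
  assert (Hm : 0 < Rmin d (eps / (3 * C))) by (apply Rmin_pos; [lra|apply Rdiv_lt_0_compat; lra]).
  exists (mkposreal _ Hm). intros s Hs. simpl in s. change (Rabs (s - t) < Rmin d (eps / (3 * C))) in Hs.
  pose proof (Rmin_l d (eps / (3 * C))). pose proof (Rmin_r d (eps / (3 * C))).
  destruct (K3 (s - t) ltac:(lra)) as [rho [Hrho E]]. rewrite flow_false_circ in E.
  replace (t + (s - t)) with s in E by ring.
  change (Rabs (u (circ r s) - u (circ r t)) < eps). rewrite E.
  replace (u (circ r t) + (s - t) * u1 (circ r t) + (s - t) * (s - t) * u2 (circ r t) + (s - t) * (s - t) * (s - t) * rho - u (circ r t))
    with ((s - t) * u1 (circ r t) + (s - t) * (s - t) * u2 (circ r t) + (s - t) * (s - t) * (s - t) * rho) by ring.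
  eapply Rle_lt_trans; [apply (Rabs_jet _ _ _ _ C); try assumption; lra|].
  replace (pos eps) with (3 * C * (eps / (3 * C))) by (field; lra). apply Rmult_lt_compat_l; lra.
Qed.

Lemma smooth_circont (u ux uy L : Cx -> R) (r : R) : smooth u ux uy L -> 0 <= r < 1 -> circont r u.
Proof. intros [u2 [v2 [_ [J _]]]]. now apply jet_circont with (1 := J). Qed.

Lemma RInt_rot (r s : R) (u : Cx -> R) : circont r u ->
  RInt (fun t => u (circ r (t + s))) 0 (2 * PI) = RInt (fun t => u (circ r t)) 0 (2 * PI).
Proof.
  intros H. pose proof PI2_pos. set (f := fun t => u (circ r t)).
  assert (Ex : forall a b, ex_RInt f a b).
  { intros a b. apply (ex_RInt_continuous (V := R_CompleteNormedModule)). intros t _. apply H. }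
  assert (Per : forall t, f (t + 2 * PI) = f t) by (intros t; unfold f, circ; now rewrite Cexpi_2PI).
  assert (Sh : forall v a b, RInt (fun t => f (t + v)) a b = RInt f (a + v) (b + v)).
  { intros v a b. pose proof (RInt_comp_lin f 1 v a b) as E. rewrite !Rmult_1_l in E.
    rewrite <- E by apply Ex. apply RInt_ext. intros x _. unfold scal; simpl; unfold mult; simpl.
    now rewrite !Rmult_1_l. }
  assert (Ch : forall a b c, RInt f a b + RInt f b c = RInt f a c) by (intros a b c; apply (RInt_Chasles f a b c); apply Ex).
  change (RInt (fun t => f (t + s)) 0 (2 * PI) = RInt f 0 (2 * PI)). rewrite Sh.
  pose proof (Ch (0 + s) 0 (2 * PI)) as E1. pose proof (Ch (0 + s) (2 * PI) (2 * PI + s)) as E2.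
  pose proof (Ch (0 + s) 0 (2 * PI)) as E3.
  assert (E4 : RInt f (2 * PI) (2 * PI + s) = RInt f 0 (0 + s)).
  { pose proof (Sh (2 * PI) 0 (0 + s)) as E. rewrite (RInt_ext _ f) in E by (intros; apply Per).
    rewrite E. f_equal; ring. }
  pose proof (Ch 0 (0 + s) 0) as E5. rewrite (RInt_point 0 f) in E5. unfold zero in E5; simpl in E5. lra.
Qed.

(** If J exceeded its chord, then J minus the chord plus a small parabola would still have an
    interior maximum. There the second difference is at most 0, while the parabola contributes 2 eta
    s^2, which beats the error C s^3 for small s. *)
Lemma almost_convex_convex (J : R -> R) (a b : R) : a < b ->
  (forall x, a <= x <= b -> continuity_pt J x) ->
  (exists C d, 0 < C /\ 0 < d /\ forall x s, a <= x <= b -> 0 < s <= d -> - C * (s * s * s) <= J (x + s) + J (x - s) - 2 * J x) ->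
  forall m, a < m < b -> J m <= J a + (J b - J a) / (b - a) * (m - a).
Proof.
  intros Hab Hc [C [d [HC [Hd H]]]] m Hm.
  destruct (Rle_lt_dec (J m) (J a + (J b - J a) / (b - a) * (m - a))) as [|Hlt]; [assumption|exfalso].
  set (sl := (J b - J a) / (b - a)) in *.
  set (kap := J m - (J a + sl * (m - a))). assert (Hk : 0 < kap) by (unfold kap; lra).
  (* The parabola then takes away at most half of the excess kap at m. *)
  set (eta := kap / (2 * (b - a) * (b - a))).
  assert (Hba : 0 < (b - a) * (b - a)) by nra.
  assert (He : 0 < eta) by (unfold eta; apply Rdiv_lt_0_compat; nra).
  set (K := fun x => J x - (J a + sl * (x - a)) + eta * ((x - a) * (x - b))).
  destruct (continuity_ab_maj K a b) as [c [Hmax Hcab]]; [lra| |].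
  - intros x Hx. unfold K. apply continuity_pt_plus; [apply continuity_pt_minus|].
    + now apply Hc.
    + apply derivable_continuous_pt. reg.
    + apply derivable_continuous_pt. reg.
  - assert (Km : kap / 2 <= K m).
    { unfold K. fold kap. assert (eta * ((b - a) * (b - a)) = kap / 2) by (unfold eta; field; lra).
      assert ((m - a) * (b - m) <= (b - a) * (b - a)) by nra. nra. }
    assert (Ka : K a = 0) by (unfold K; ring).
    assert (Kb : K b = 0) by (unfold K, sl; field; lra).
    assert (Kc : kap / 2 <= K c) by (specialize (Hmax m ltac:(lra)); lra).
    assert (a < c) by (destruct (Req_dec a c) as [<-|]; lra).
    assert (c < b) by (destruct (Req_dec c b) as [->|]; lra).
    set (s := Rmin (Rmin d (eta / C)) (Rmin (c - a) (b - c))).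
    assert (Hs : 0 < s) by (unfold s; repeat apply Rmin_pos; try lra; apply Rdiv_lt_0_compat; lra).
    assert (s <= d /\ s <= eta / C /\ s <= c - a /\ s <= b - c) as [S1 [S2 [S3 S4]]].
    { unfold s. pose proof (Rmin_l (Rmin d (eta / C)) (Rmin (c - a) (b - c))).
      pose proof (Rmin_r (Rmin d (eta / C)) (Rmin (c - a) (b - c))).
      pose proof (Rmin_l d (eta / C)). pose proof (Rmin_r d (eta / C)).
      pose proof (Rmin_l (c - a) (b - c)). pose proof (Rmin_r (c - a) (b - c)). lra. }
    pose proof (Hmax (c + s) ltac:(lra)) as M1. pose proof (Hmax (c - s) ltac:(lra)) as M2.
    specialize (H c s ltac:(lra) ltac:(lra)). unfold K in M1, M2.
    assert (C * s <= eta).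
    { apply (Rmult_le_compat_l C) in S2; [|lra]. replace (C * (eta / C)) with eta in S2 by (field; lra). lra. }
    assert (0 < s * s) by nra. nra.
Qed.

(** A convex function that decreases somewhere grows at least linearly towards minus infinity,
    against the bound there. *)
Lemma convex_bounded_nondecr (J : R -> R) (B : R) :
  (forall a m b, a < m < b -> b < 0 -> J m <= J a + (J b - J a) / (b - a) * (m - a)) ->
  (exists x0, forall x, x <= x0 -> J x <= B) ->
  forall x y, x < y -> y < 0 -> J x <= J y.
Proof.
  intros Hc [x0 HB] x y Hxy Hy. destruct (Rle_lt_dec (J x) (J y)) as [|Hlt]; [assumption|exfalso].
  set (k := (J x - J y) / (y - x)). assert (Hk : 0 < k) by (unfold k; apply Rdiv_lt_0_compat; lra).
  (* So far to the left that the slope -k forces J a above B. *)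
  set (a := Rmin (Rmin x0 (x - 1)) (x - (Rabs (B - J x) + 1) / k)).
  assert (Hq : 0 <= Rabs (B - J x)) by apply Rabs_pos.
  assert (Ha : a <= x0 /\ a <= x - 1 /\ a <= x - (Rabs (B - J x) + 1) / k).
  { unfold a. pose proof (Rmin_l (Rmin x0 (x - 1)) (x - (Rabs (B - J x) + 1) / k)).
    pose proof (Rmin_r (Rmin x0 (x - 1)) (x - (Rabs (B - J x) + 1) / k)).
    pose proof (Rmin_l x0 (x - 1)). pose proof (Rmin_r x0 (x - 1)). lra. }
  destruct Ha as [A1 [A2 A3]]. specialize (HB a A1).
  specialize (Hc a x y ltac:(lra) Hy).
  assert (E1 : (J x - J a) * (y - a) <= (J y - J a) * (x - a)).
  { apply (Rmult_le_compat_r (y - a)) in Hc; [|lra].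
    replace ((J a + (J y - J a) / (y - a) * (x - a)) * (y - a)) with (J a * (y - a) + (J y - J a) * (x - a)) in Hc by (field; lra). lra. }
  assert (E2 : (J x - J y) * (x - a) <= (J a - J x) * (y - x)) by nra.
  assert (E3 : k * (x - a) <= J a - J x).
  { unfold k. apply Rmult_le_reg_r with (y - x); [lra|].
    replace ((J x - J y) / (y - x) * (x - a) * (y - x)) with ((J x - J y) * (x - a)) by (field; lra). assumption. }
  assert (E4 : Rabs (B - J x) + 1 <= k * (x - a)).
  { replace (Rabs (B - J x) + 1) with (k * ((Rabs (B - J x) + 1) / k)) by (field; lra). apply Rmult_le_compat_l; lra. }
  pose proof (Rle_abs (B - J x)). lra.
Qed.

(* The five-point Laplacian in (log r, t): averaging over t kills the two rotated
   terms, so I(r) = cm r u is convex in log r as soon as L >= 0; bounded at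
   log r -> -oo, it is then nondecreasing. *)
Theorem cm_nondecr (u ux uy L : Cx -> R) : smooth u ux uy L -> (forall z, inD z -> 0 <= L z) ->
  forall r s, 0 <= r <= s -> s < 1 -> cm r u <= cm s u.
Proof.
  intros S HL. pose proof S as [u2 [v2 [J1 [J2 [EL H0]]]]].
  pose proof (fun r Hr => smooth_circont u ux uy L r S Hr) as Cc.
  pose proof PI2_pos as HPI.
  set (J := fun x => cm (exp x) u).
  assert (Hexp : forall x, x < 0 -> 0 < exp x < 1).
  { intros x Hx. split; [apply exp_pos|]. rewrite <- exp_0. now apply exp_increasing. }
  (* A Lipschitz bound, for the continuity of J, and a lower bound on second differences. The
     constants depend on b only, because jets are uniform on the disc of radius e^b. *)
  assert (KJ : forall b, b < 0 -> exists C d, 0 < C /\ 0 < d /\ forall x, x <= b ->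
     (forall s, Rabs s <= d -> x + s < 0 /\ Rabs (J (x + s) - J x) <= C * Rabs s) /\
     (forall s, 0 < s <= d -> - C * (s * s * s) <= J (x + s) + J (x - s) - 2 * J x)).
  { intros b Hb. destruct (Hexp b Hb) as [Hb0 Hb1].
    destruct (J1 (exp b) ltac:(lra)) as [C1' [d1 [HC1 [Hd1 K1]]]].
    destruct (J2 (exp b) ltac:(lra)) as [C2' [d2 [HC2 [Hd2 K2]]]].
    exists (3 * C1' + 2 * C1' + 2 * C2'), (Rmin (Rmin d1 d2) (- b / 2)).
    split; [lra|]. split; [repeat apply Rmin_pos; lra|]. intros x Hx.
    pose proof (Rmin_l (Rmin d1 d2) (- b / 2)). pose proof (Rmin_r (Rmin d1 d2) (- b / 2)).
    pose proof (Rmin_l d1 d2). pose proof (Rmin_r d1 d2).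
    assert (Hxb : exp x <= exp b) by (destruct (Req_dec x b) as [->|]; [lra|left; apply exp_increasing; lra]).
    assert (Hx1 : 0 < exp x < 1) by (apply Hexp; lra).
    assert (Hn : forall t, Cnorm (circ (exp x) t) <= exp b) by (intros t; rewrite Cnorm_circ; lra).
    assert (Fl : forall s t, (flow true s * circ (exp x) t)%X = circ (exp (x + s)) t) by (intros; now rewrite flow_true_circ, exp_plus).
    split.
    - intros s Hs. assert (Hxs : x + s < 0) by (apply Rabs_le_between in Hs; lra). split; [assumption|].
      destruct (Hexp _ Hxs) as [E1 E2].
      assert (P : forall t, Rabs (u (circ (exp (x + s)) t) - u (circ (exp x) t)) <= 3 * C1' * Rabs s).
      { intros t. destruct (K1 _ (Hn t)) as [_ [B1 [B2 B3]]]. destruct (B3 s ltac:(lra)) as [rho [Hrho E]].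
        rewrite Fl in E. rewrite E.
        match goal with |- Rabs ?y <= _ => replace y with (s * ux (circ (exp x) t) + s * s * u2 (circ (exp x) t) + s * s * s * rho) by ring end.
        apply Rabs_jet; try assumption; lra. }
      assert (M : forall r1 r2 c, 0 <= r1 < 1 -> 0 <= r2 < 1 -> (forall t, u (circ r1 t) <= u (circ r2 t) + c) -> cm r1 u <= cm r2 u + c).
      { intros r1 r2 c R1 R2 Hc. rewrite <- (mean_const c). unfold cm.
        rewrite <- (mean_add (fun t => u (circ r2 t)) (fun _ => c)); [|intros t; now apply Cc|intros; apply continuous_const].
        apply mean_le; [intros t; now apply Cc| |assumption].
        intros t. apply (continuous_plus (fun t => u (circ r2 t)) (fun _ => c)); [now apply Cc|apply continuous_const]. }
      pose proof (Rabs_pos s).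
      apply Rle_trans with (3 * C1' * Rabs s); [|apply Rmult_le_compat_r; lra].
      assert (P1 : J (x + s) <= J x + 3 * C1' * Rabs s).
      { apply (M (exp (x + s)) (exp x)); [lra|lra|]. intros t. specialize (P t). apply Rabs_le_between in P. lra. }
      assert (P2 : J x <= J (x + s) + 3 * C1' * Rabs s).
      { apply (M (exp x) (exp (x + s))); [lra|lra|]. intros t. specialize (P t). apply Rabs_le_between in P. lra. }
      apply Rabs_le. lra.
    - intros s Hs.
      (* In the five-point sum the first-order terms cancel, the second-order terms give 2 s^2 L >=
         0, and the four remainders are cubic. *)
      assert (Q : forall t, 4 * u (circ (exp x) t) + - (2 * C1' + 2 * C2') * (s * s * s) <=
        (u (circ (exp (x + s)) t) + u (circ (exp (x - s)) t)) + (u (circ (exp x) (t + s)) + u (circ (exp x) (t + - s)))).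
      { intros t. set (z := circ (exp x) t).
        destruct (K1 z (Hn t)) as [_ [_ [_ B3]]]. destruct (K2 z (Hn t)) as [_ [_ [_ D3]]].
        destruct (B3 s) as [r1 [Hr1 F1]]; [rewrite Rabs_pos_eq; lra|].
        destruct (B3 (- s)) as [r2 [Hr2 F2]]; [rewrite Rabs_Ropp, Rabs_pos_eq; lra|].
        destruct (D3 s) as [r3 [Hr3 F3]]; [rewrite Rabs_pos_eq; lra|].
        destruct (D3 (- s)) as [r4 [Hr4 F4]]; [rewrite Rabs_Ropp, Rabs_pos_eq; lra|].
        unfold z in F1, F2, F3, F4. rewrite Fl in F1, F2. rewrite flow_false_circ in F3, F4. fold z in F1, F2, F3, F4.
        unfold Rminus. rewrite F1, F2, F3, F4.
        assert (HzD : inD z) by (unfold inD, z; rewrite Cnorm_circ; lra).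
        pose proof (EL z HzD) as HE. pose proof (HL z HzD) as HL'.
        apply Rabs_le_between in Hr1. apply Rabs_le_between in Hr2. apply Rabs_le_between in Hr3. apply Rabs_le_between in Hr4.
        assert (Hs3 : 0 < s * s * s) by (assert (0 < s * s) by nra; nra).
        assert (0 <= s * s * (u2 z + v2 z)) by (apply Rmult_le_pos; nra).
        assert (0 <= s * s * s * (r1 - r2 + r3 - r4 + 2 * C1' + 2 * C2')) by (apply Rmult_le_pos; lra).
        nra. }
      assert (X1 : forall t, continuous (fun t => u (circ (exp x) t)) t) by (intros t; apply Cc; lra).
      assert (Xs : forall y, Rabs y <= s -> forall t, continuous (fun t => u (circ (exp (x + y)) t)) t).
      { intros y Hy t. apply Cc. assert (x + y < 0) by (apply Rabs_le_between in Hy; lra). specialize (Hexp (x + y) ltac:(lra)). lra. }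
      assert (X2 : forall t, continuous (fun t => u (circ (exp (x + s)) t)) t) by (apply Xs; rewrite Rabs_pos_eq; lra).
      assert (X3 : forall t, continuous (fun t => u (circ (exp (x - s)) t)) t) by (apply Xs; rewrite Rabs_Ropp, Rabs_pos_eq; lra).
      assert (X4 : forall y t, continuous (fun t => u (circ (exp x) (t + y))) t).
      { intros y t. apply (continuous_comp (fun t => t + y) (fun t => u (circ (exp x) t))); [|apply X1].
        apply (continuous_plus (fun t => t) (fun _ => y)); [apply continuous_id|apply continuous_const]. }
      assert (RR : forall y, mean (fun t => u (circ (exp x) (t + y))) = J x).
      { intros y. unfold mean. rewrite (RInt_rot (exp x) y u X1). reflexivity. }
      apply mean_le in Q.
      + rewrite (mean_add (fun t => 4 * u (circ (exp x) t)) (fun _ => - (2 * C1' + 2 * C2') * (s * s * s))) in Q.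
        2: intros t; apply (continuous_mult (fun _ => 4) (fun t => u (circ (exp x) t))); [apply continuous_const|apply X1].
        2: intros t; apply continuous_const.
        rewrite (mean_scal 4 (fun t => u (circ (exp x) t))), mean_const in Q by assumption.
        rewrite (mean_add (fun t => u (circ (exp (x + s)) t) + u (circ (exp (x - s)) t)) (fun t => u (circ (exp x) (t + s)) + u (circ (exp x) (t + - s)))) in Q.
        2: intros t; apply (continuous_plus (fun t => u (circ (exp (x + s)) t)) (fun t => u (circ (exp (x - s)) t))); [apply X2|apply X3].
        2: intros t; apply (continuous_plus (fun t => u (circ (exp x) (t + s))) (fun t => u (circ (exp x) (t + - s)))); apply X4.
        rewrite (mean_add _ _ X2 X3), (mean_add _ _ (X4 s) (X4 (- s))), !RR in Q.
        change (4 * J x + - (2 * C1' + 2 * C2') * (s * s * s) <= J (x + s) + J (x - s) + (J x + J x)) in Q.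
        assert (Hs3 : 0 < s * s * s) by (repeat apply Rmult_lt_0_compat; lra).
        assert (0 <= 3 * C1' * (s * s * s)) by (apply Rmult_le_pos; lra). lra.
      + intros t. apply (continuous_plus (fun t => 4 * u (circ (exp x) t)) (fun _ => - (2 * C1' + 2 * C2') * (s * s * s))); [|apply continuous_const].
        apply (continuous_mult (fun _ => 4) (fun t => u (circ (exp x) t))); [apply continuous_const|apply X1].
      + intros t. apply (continuous_plus (fun t => u (circ (exp (x + s)) t) + u (circ (exp (x - s)) t)) (fun t => u (circ (exp x) (t + s)) + u (circ (exp x) (t + - s)))).
        * apply (continuous_plus (fun t => u (circ (exp (x + s)) t)) (fun t => u (circ (exp (x - s)) t))); [apply X2|apply X3].
        * apply (continuous_plus (fun t => u (circ (exp x) (t + s))) (fun t => u (circ (exp x) (t + - s)))); apply X4. }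
  assert (JC : forall x, x < 0 -> continuity_pt J x).
  { intros x Hx. destruct (KJ x Hx) as [C [d [HC [Hd K]]]]. destruct (K x ltac:(lra)) as [K1 _].
    intros eps He. exists (Rmin d (eps / (2 * C))). split; [apply Rmin_pos; [lra|apply Rdiv_lt_0_compat; lra]|].
    intros y [_ Hy]. simpl in y, Hy. unfold Rdist in Hy. pose proof (Rmin_l d (eps / (2 * C))). pose proof (Rmin_r d (eps / (2 * C))).
    destruct (K1 (y - x) ltac:(lra)) as [_ K2]. replace (x + (y - x)) with y in K2 by ring.
    simpl. unfold Rdist. eapply Rle_lt_trans; [exact K2|].
    apply Rle_lt_trans with (C * (eps / (2 * C))); [apply Rmult_le_compat_l; lra|].
    replace (C * (eps / (2 * C))) with (eps / 2) by (field; lra). lra. }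
  assert (Conv : forall a m b, a < m < b -> b < 0 -> J m <= J a + (J b - J a) / (b - a) * (m - a)).
  { intros a m b Hm Hb. apply almost_convex_convex; [lra|intros; apply JC; lra| |assumption].
    destruct (KJ b Hb) as [C [d [HC [Hd K]]]]. exists C, d. do 2 (split; [assumption|]).
    intros x s Hx Hs. destruct (K x ltac:(lra)) as [_ K2]. now apply K2. }
  assert (Bd : exists B, 0 < B /\ forall r, 0 <= r <= 1 / 2 -> cm r u <= B).
  { destruct (J1 (1 / 2) ltac:(lra)) as [C [d [HC [Hd K]]]]. exists C. split; [assumption|]. intros r Hr.
    rewrite <- (cm_const r C). apply cm_le; [apply Cc; lra|apply circont_const|].
    intros t. destruct (K (circ r t)) as [B _]; [rewrite Cnorm_circ; lra|]. apply Rabs_le_between in B. lra. }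
  destruct Bd as [B [HB Bd]].
  assert (Mono : forall r s, 0 < r <= s -> s < 1 -> cm r u <= cm s u).
  { intros r s Hr Hs. destruct (Req_dec r s) as [->|N]; [lra|].
    replace (cm r u) with (J (ln r)) by (unfold J; rewrite exp_ln; [reflexivity|lra]).
    replace (cm s u) with (J (ln s)) by (unfold J; rewrite exp_ln; [reflexivity|lra]).
    apply (convex_bounded_nondecr J B Conv).
    - exists (ln (1 / 2)). intros x Hx. apply (Bd (exp x)). split; [left; apply exp_pos|].
      rewrite <- (exp_ln (1 / 2)) by lra. destruct (Req_dec x (ln (1 / 2))) as [->|]; [lra|left; apply exp_increasing; lra].
    - apply ln_increasing; lra.
    - rewrite <- ln_1. apply ln_increasing; lra. }
  (* Radius 0 corresponds to log r = -oo and is reached through a small circle of radius q, on which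
     u is within eps of its value at 0. *)
  intros r s Hr Hs. destruct (Req_dec r 0) as [->|Hr0]; [|apply Mono; lra].
  destruct (Req_dec s 0) as [->|Hs0]; [lra|].
  assert (E0 : cm 0 u = u C0) by (rewrite (cm_ext 0 u (fun _ => u C0)); [apply cm_const|intros; now rewrite circ_0]).
  rewrite E0. apply le_epsilon. intros eps He. destruct (proj2 (cont0_eps u) H0 eps He) as [d [Hd K]].
  set (q := Rmin s (d / 2)). assert (Hq : 0 < q) by (apply Rmin_pos; lra).
  pose proof (Rmin_l s (d / 2)) as Q1. pose proof (Rmin_r s (d / 2)) as Q2. fold q in Q1, Q2.
  apply Rle_trans with (cm q u + eps); [|pose proof (Mono q s ltac:(lra) Hs); lra].
  apply Rle_trans with (cm q (fun z => u z + eps)).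
  - rewrite <- (cm_const q (u C0)). apply cm_le; [apply circont_const|apply circont_add; [apply Cc; lra|apply circont_const]|].
    intros t. specialize (K (circ q t)). rewrite Cnorm_circ in K by lra. specialize (K ltac:(lra)). apply Rabs_lt_between in K. lra.
  - rewrite cm_add, cm_const; [lra|apply Cc; lra|apply circont_const].
Qed.

Lemma cm_0 (u : Cx -> R) : cm 0 u = u C0.
Proof. rewrite (cm_ext 0 u (fun _ => u C0)); [apply cm_const|intros; now rewrite circ_0]. Qed.

(** The mean-value property comes from monotonicity of the means of u and of -u. *)
Lemma cm_harmonic (u ux uy : Cx -> R) (r : R) : smooth u ux uy (fun _ => 0) -> 0 <= r < 1 -> cm r u = u C0.
Proof.
  intros S Hr. rewrite <- (cm_0 u). apply Rle_antisym.
  - assert (S' := smooth_scal (-1) _ _ _ _ S).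
    pose proof (cm_nondecr _ _ _ _ S' (fun z _ => ltac:(simpl; lra)) 0 r ltac:(lra) ltac:(lra)) as H.
    rewrite !cm_scal in H; [lra| |]; apply (smooth_circont u ux uy (fun _ => 0)); try assumption; lra.
  - apply (cm_nondecr _ _ _ _ S); [intros; simpl; lra|lra|lra].
Qed.

(** * Hardy space norms *)

Lemma rpow_pos_eq (x p : R) : 0 < x -> rpow x p = Rpower x p.
Proof. intros H. unfold rpow. destruct (Rle_dec x 0); [lra|reflexivity]. Qed.

Lemma rpow_npos (x p : R) : x <= 0 -> rpow x p = 0.
Proof. intros H. unfold rpow. destruct (Rle_dec x 0); [reflexivity|lra]. Qed.

Lemma Rpower_pos (x p : R) : 0 < Rpower x p.
Proof. apply exp_pos. Qed.

Lemma rpow_ge0 (x p : R) : 0 <= rpow x p.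
Proof. unfold rpow. destruct (Rle_dec x 0); [lra|left; apply Rpower_pos]. Qed.

Lemma rpow_gt0 (x p : R) : 0 < x -> 0 < rpow x p.
Proof. intros H. rewrite rpow_pos_eq by assumption. apply Rpower_pos. Qed.

Lemma Rpower_le_l (x y p : R) : 0 <= p -> 0 < x <= y -> Rpower x p <= Rpower y p.
Proof. intros Hp H. now apply Rle_Rpower_l. Qed.

Lemma rpow_le (x y p : R) : 0 <= p -> x <= y -> rpow x p <= rpow y p.
Proof.
  intros Hp H. destruct (Rle_lt_dec x 0).
  - rewrite rpow_npos by assumption. apply rpow_ge0.
  - rewrite !rpow_pos_eq by lra. apply Rpower_le_l; lra.
Qed.

Lemma rpow_lt (x y p : R) : 0 < p -> 0 <= x < y -> rpow x p < rpow y p.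
Proof.
  intros Hp H. rewrite (rpow_pos_eq y) by lra. destruct (Req_dec x 0) as [->|].
  - rewrite rpow_npos by lra. apply Rpower_pos.
  - rewrite rpow_pos_eq by lra. unfold Rpower. apply exp_increasing.
    apply Rmult_lt_compat_l; [assumption|]. apply ln_increasing; lra.
Qed.

Lemma rpow_mult (x y p : R) : 0 <= x -> 0 <= y -> rpow (x * y) p = rpow x p * rpow y p.
Proof.
  intros Hx Hy. destruct (Req_dec x 0) as [->|Nx]; [rewrite Rmult_0_l, (rpow_npos 0), Rmult_0_l by lra; reflexivity|].
  destruct (Req_dec y 0) as [->|Ny]; [rewrite Rmult_0_r, (rpow_npos 0), Rmult_0_r by lra; reflexivity|].
  rewrite !rpow_pos_eq by nra. symmetry. apply Rpower_mult_distr; lra.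
Qed.

Lemma rpow_rpow (x p q : R) : rpow (rpow x p) q = rpow x (p * q).
Proof.
  destruct (Rle_lt_dec x 0).
  - rewrite (rpow_npos x), (rpow_npos x), rpow_npos by lra. reflexivity.
  - rewrite (rpow_pos_eq x p), (rpow_pos_eq x (p * q)), rpow_pos_eq by first [assumption | apply Rpower_pos]. apply Rpower_mult.
Qed.

Lemma rpow_1 (x : R) : 0 <= x -> rpow x 1 = x.
Proof.
  intros H. destruct (Req_dec x 0) as [->|]; [apply rpow_npos; lra|].
  rewrite rpow_pos_eq by lra. apply Rpower_1. lra.
Qed.

Lemma rpow_2 (x : R) : 0 <= x -> rpow x 2 = x * x.
Proof.
  intros H. destruct (Req_dec x 0) as [->|]; [rewrite rpow_npos; lra|].
  rewrite rpow_pos_eq by lra. replace 2 with (INR 2) by (simpl; ring). rewrite Rpower_pow by lra. ring.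
Qed.

Lemma rpow_base1 (p : R) : rpow 1 p = 1.
Proof. rewrite rpow_pos_eq by lra. unfold Rpower. rewrite ln_1, Rmult_0_r. apply exp_0. Qed.

Lemma rpow_inv (x p : R) : 0 < p -> 0 <= x -> rpow (rpow x p) (1 / p) = x.
Proof. intros Hp Hx. rewrite rpow_rpow. replace (p * (1 / p)) with 1 by (field; lra). now apply rpow_1. Qed.

Lemma rpow_inv' (x p : R) : 0 < p -> 0 <= x -> rpow (rpow x (1 / p)) p = x.
Proof. intros Hp Hx. rewrite rpow_rpow. replace (1 / p * p) with 1 by (field; lra). now apply rpow_1. Qed.

Lemma rpow_half_sqr (x q : R) : 0 <= x -> rpow (x * x) q = rpow x (2 * q).
Proof. intros H. rewrite <- rpow_rpow, rpow_2 by assumption. reflexivity. Qed.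

Lemma continuous_rpow (p x : R) : 0 < p -> continuous (fun x => rpow x p) x.
Proof.
  intros Hp. destruct (Rtotal_order x 0) as [H|[->|H]].
  - apply (continuous_ext_loc _ (fun _ => 0) x); [|apply continuous_const].
    assert (Hx : 0 < - x) by lra. exists (mkposreal _ Hx). intros y Hy. change (Rabs (y - x) < - x) in Hy.
    apply Rabs_lt_between in Hy. symmetry. apply rpow_npos. lra.
  - apply filterlim_locally. intros eps. pose proof (cond_pos eps) as He.
    exists (mkposreal _ (Rpower_pos eps (1 / p))). intros y Hy. change (Rabs (y - 0) < Rpower eps (1 / p)) in Hy.
    change (Rabs (rpow y p - rpow 0 p) < eps). rewrite (rpow_npos 0) by lra. rewrite Rminus_0_r in *.
    rewrite Rabs_pos_eq by apply rpow_ge0. destruct (Rle_lt_dec y 0); [rewrite rpow_npos; assumption|].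
    rewrite <- (rpow_inv' eps p) by lra. apply rpow_lt; [assumption|]. rewrite (rpow_pos_eq eps) by lra.
    pose proof (Rle_abs y). lra.
  - apply (continuous_ext_loc _ (fun x => Rpower x p) x).
    + exists (mkposreal _ H). intros y Hy. change (Rabs (y - x) < x) in Hy. apply Rabs_lt_between in Hy.
      symmetry. apply rpow_pos_eq. lra.
    + apply (continuous_comp (fun x => p * ln x) exp); [|apply continuous_exp].
      apply (continuous_mult (fun _ => p) ln); [apply continuous_const|now apply continuous_ln].
Qed.

Definition cc (r : R) (F : Cx -> Cx) : Prop := forall t, ccont (fun t => F (circ r t)) t.

Lemma cc_norm (r : R) (F : Cx -> Cx) : cc r F -> circont r (fun z => Cnorm (F z)).
Proof.
  intros H t. destruct (H t) as [H1 H2].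
  apply (continuous_comp (fun t => Cre (F (circ r t)) * Cre (F (circ r t)) + Cim (F (circ r t)) * Cim (F (circ r t))) sqrt).
  - apply (continuous_plus (fun t => Cre (F (circ r t)) * Cre (F (circ r t))) (fun t => Cim (F (circ r t)) * Cim (F (circ r t))));
      [apply (continuous_mult (fun t => Cre (F (circ r t))) (fun t => Cre (F (circ r t))))|apply (continuous_mult (fun t => Cim (F (circ r t))) (fun t => Cim (F (circ r t))))]; assumption.
  - apply continuous_sqrt.
Qed.

Definition pw (p : R) (F : Cx -> Cx) (z : Cx) : R := rpow (Cnorm (F z)) p.

Lemma pw_ge0 (p : R) (F : Cx -> Cx) (z : Cx) : 0 <= pw p F z.
Proof. apply rpow_ge0. Qed.

Lemma cc_pw (p r : R) (F : Cx -> Cx) : 0 < p -> cc r F -> circont r (pw p F).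
Proof.
  intros Hp H. apply (circont_comp r (fun x => rpow x p) (fun z => Cnorm (F z))); [|now apply cc_norm].
  intros x. now apply continuous_rpow.
Qed.

Lemma cm_ge0 (r : R) (u : Cx -> R) : circont r u -> (forall t, 0 <= u (circ r t)) -> 0 <= cm r u.
Proof. intros Hc H. rewrite <- (cm_const r 0). apply cm_le; [apply circont_const|assumption|assumption]. Qed.

Lemma Mp_cm (p r : R) (F : Cx -> Cx) : 0 < p -> cc r F -> Mp p r F = rpow (cm r (pw p F)) (1 / p).
Proof.
  intros Hp H. unfold Mp, cm, mean. do 2 f_equal. apply Rint_is.
  apply (RInt_correct (fun t => rpow (Cnorm (F (circ r t))) p)). apply ex_RInt_cont. intros t. apply (cc_pw p r F Hp H).
Qed.

Lemma analytic_PS (f : Cx -> Cx) : analytic f -> exists a, absum a /\ forall z, inD z -> PS a z = f z.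
Proof.
  intros [a Ha]. exists a. assert (H : absum a) by (apply (series_absum a f); exact Ha).
  split; [assumption|]. intros z Hz. apply ccv_unique with (psum a z); [now apply PS_cv|]. exact (Ha z Hz).
Qed.

Lemma PS_analytic (a : nat -> Cx) (f : Cx -> Cx) : absum a -> (forall z, inD z -> PS a z = f z) -> analytic f.
Proof. intros Ha E. exists a. intros z Hz. rewrite <- E by assumption. exact (PS_cv a z Ha Hz). Qed.

Lemma analytic_tay (f : Cx -> Cx) : analytic f -> exists D1 D2, tay f D1 D2.
Proof.
  intros H. destruct (analytic_PS f H) as [a [Ha E]]. exists (PS1 a), (PS2 a).
  apply tay_ext with (PS a); [assumption|now apply PS_tay].
Qed.

Lemma analytic_cc (f : Cx -> Cx) (r : R) : analytic f -> 0 <= r < 1 -> cc r f.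
Proof.
  intros H Hr t. destruct (analytic_tay f H) as [D1 [D2 T]].
  apply (tay_ccont f D1 D2 (circ r)); [assumption| |apply circ_ccont].
  unfold inD. rewrite Cnorm_circ; lra.
Qed.

(** Bounds are kept on p-th powers, since these are what add up over almost disjoint functions;
    roots are taken only when norms must be reported. *)
Definition hp (p : R) (F : Cx -> Cx) (B : R) : Prop := forall r, 0 <= r < 1 -> cm r (pw p F) <= B.

Lemma cm_pw_ge0 (p r : R) (F : Cx -> Cx) : 0 < p -> analytic F -> 0 <= r < 1 -> 0 <= cm r (pw p F).
Proof. intros. apply cm_ge0; [apply cc_pw; [assumption|now apply analytic_cc]|intros; apply pw_ge0]. Qed.

Lemma is_Hp_hp (p : R) (F : Cx -> Cx) : 0 < p -> is_Hp p F -> exists B, 0 <= B /\ hp p F B.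
Proof.
  intros Hp [Ha [K HK]]. exists (rpow K p). split; [apply rpow_ge0|]. intros r Hr.
  specialize (HK r Hr). rewrite Mp_cm in HK by (try assumption; now apply analytic_cc).
  pose proof (cm_pw_ge0 p r F Hp Ha Hr). rewrite <- (rpow_inv' (cm r (pw p F)) p) by assumption.
  apply rpow_le; lra.
Qed.

Lemma hp_is_Hp (p B : R) (F : Cx -> Cx) : 0 < p -> analytic F -> hp p F B -> is_Hp p F.
Proof.
  intros Hp Ha HB. split; [assumption|]. exists (rpow B (1 / p)). intros r Hr.
  rewrite Mp_cm by (try assumption; now apply analytic_cc). apply rpow_le; [|now apply HB].
  left. apply Rdiv_lt_0_compat; lra.
Qed.

(** Boundedness of the means makes the chosen supremum a genuine one. It is used only through these
    three properties. *)
Lemma Hp_norm_spec (p : R) (F : Cx -> Cx) : 0 < p -> is_Hp p F ->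
  0 <= Hp_norm p F /\ hp p F (rpow (Hp_norm p F) p) /\
  forall B, 0 <= B -> hp p F B -> rpow (Hp_norm p F) p <= B.
Proof.
  intros Hp H. pose proof H as [Ha [K HK]].
  assert (L : is_lub (fun y => exists r, 0 <= r < 1 /\ y = Mp p r F) (Hp_norm p F)).
  { unfold Hp_norm. apply epsilon_spec.
    destruct (completeness (fun y => exists r, 0 <= r < 1 /\ y = Mp p r F)) as [l Hl].
    - exists K. intros y [r [Hr ->]]. now apply HK.
    - exists (Mp p 0 F), 0. split; [lra|reflexivity].
    - now exists l. }
  destruct L as [L1 L2].
  assert (N0 : 0 <= Hp_norm p F).
  { apply Rle_trans with (Mp p 0 F); [apply rpow_ge0|]. apply L1. exists 0. split; [lra|reflexivity]. }
  assert (E : forall r, 0 <= r < 1 -> Mp p r F = rpow (cm r (pw p F)) (1 / p)).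
  { intros r Hr. apply Mp_cm; [assumption|now apply analytic_cc]. }
  split; [assumption|]. split.
  - intros r Hr. assert (M : Mp p r F <= Hp_norm p F) by (apply L1; now exists r).
    rewrite E in M by assumption. pose proof (cm_pw_ge0 p r F Hp Ha Hr).
    rewrite <- (rpow_inv' (cm r (pw p F)) p) by assumption. apply rpow_le; lra.
  - intros B HB HhB. rewrite <- (rpow_inv' B p) by assumption. apply rpow_le; [lra|].
    apply L2. intros y [r [Hr ->]]. rewrite E by assumption. apply rpow_le; [left; apply Rdiv_lt_0_compat; lra|now apply HhB].
Qed.

(** * A bounded potential for BMOA symbols *)

(** Polynomials in Horner form: the recursion P = a + z w is the one along which the harmonic
    extension of |P|^2 can be written explicitly. *)
Fixpoint pd (l : list Cx) (z : Cx) : Cx :=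
  match l with nil => C0 | cons a l' => (a + z * pd l' z)%X end.

(* [pH l] is analytic and its real part is the harmonic extension of [|pd l|^2]
   from the unit circle, as [pH_pd] shows. *)
Fixpoint pH (l : list Cx) (z : Cx) : Cx :=
  match l with nil => C0 | cons a l' => (Cconj a * (RtoC 2 * pd l z - a) + pH l' z)%X end.

(** The quotient by 1 - |z|^2 of the harmonic extension of |P|^2 minus |P|^2; as a sum of squares it
    is nonnegative. *)
Fixpoint pE (l : list Cx) (z : Cx) : R :=
  match l with nil => 0 | cons a l' => n2 (pd l' z) + pE l' z end.

(** For P = a + z w, the new summand of [pH] has real part 2 Re(conj(a) P) - |a|^2 = |P|^2 - |P -
    a|^2 = |P|^2 - |z|^2 |w|^2, and the induction hypothesis adds |w|^2 plus a multiple of 1 -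
    |z|^2. *)
Lemma pH_pd (l : list Cx) (z : Cx) : Cre (pH l z) - n2 (pd l z) = (1 - n2 z) * pE l z.
Proof.
  induction l as [|a l IH]; cbn [pd pH pE].
  - unfold n2, C0, Cre, Cim; simpl. ring.
  - assert (E : Cre (pH l z) = n2 (pd l z) + (1 - n2 z) * pE l z) by lra.
    rewrite (Rmult_plus_distr_l (1 - n2 z)). revert E. generalize (pd l z) (pH l z) ((1 - n2 z) * pE l z). intros w h e E.
    change (Cre (Cconj a * (RtoC 2 * (a + z * w) - a))%X + Cre h - n2 (a + z * w)%X = (1 - n2 z) * n2 w + e).
    rewrite E. unfold n2, Csub, Cadd, Copp, Cmul, Cconj, RtoC, Cre, Cim. simpl. ring.
Qed.

Lemma n2_ge0 (z : Cx) : 0 <= n2 z.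
Proof. unfold n2. nra. Qed.

Lemma n2_norm (z : Cx) : n2 z = Cnorm z * Cnorm z.
Proof. unfold n2. now rewrite Cnorm_sqr. Qed.

Lemma pE_ge0 (l : list Cx) (z : Cx) : 0 <= pE l z.
Proof. induction l; simpl; [lra|]. pose proof (n2_ge0 (pd l z)). lra. Qed.

Lemma n2_le (z : Cx) (c : R) : Cnorm z <= c -> n2 z <= c * c.
Proof. intros H. rewrite n2_norm. pose proof (Cnorm_ge0 z). nra. Qed.

Lemma pd_bound (l : list Cx) : exists B, 0 < B /\ forall z, Cnorm z <= 1 -> Cnorm (pd l z) <= B.
Proof.
  induction l as [|a l [B [HB IH]]]; simpl.
  - exists 1. split; [lra|]. intros. rewrite Cnorm_0. lra.
  - exists (Cnorm a + B). pose proof (Cnorm_ge0 a). split; [lra|]. intros z Hz.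
    eapply Rle_trans; [apply Cnorm_add|]. rewrite Cnorm_mul. specialize (IH z Hz).
    pose proof (Cnorm_ge0 z). pose proof (Cnorm_ge0 (pd l z)). nra.
Qed.

Lemma pE_bound (l : list Cx) : exists B, 0 < B /\ forall z, Cnorm z <= 1 -> pE l z <= B.
Proof.
  induction l as [|a l [B [HB IH]]]; simpl.
  - exists 1. split; [lra|]. intros. lra.
  - destruct (pd_bound l) as [B' [HB' K]]. exists (B' * B' + B). split; [nra|]. intros z Hz.
    specialize (IH z Hz). specialize (K z Hz). pose proof (n2_le _ _ K). lra.
Qed.

Lemma hol_pd (phi A : Cx -> Cx) (l : list Cx) : hol phi A -> exists A', hol (fun z => pd l (phi z)) A'.
Proof.
  intros H. induction l as [|a l [A' IH]]; simpl.
  - eexists. exact (hol_const C0).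
  - eexists. apply hol_add; [apply hol_const|]. apply hol_mul; [exact H|exact IH].
Qed.

Lemma hol_pH (phi A : Cx -> Cx) (l : list Cx) : hol phi A -> exists A', hol (fun z => pH l (phi z)) A'.
Proof.
  intros H. induction l as [|a l [A' IH]].
  - eexists. exact (hol_const C0).
  - destruct (hol_pd phi A (a :: l) H) as [A1 H1]. eexists. cbn [pH].
    apply hol_add; [|exact IH]. apply hol_mul; [apply hol_const|].
    unfold Csub. apply hol_add; [|apply hol_const]. apply hol_mul; [apply hol_const|exact H1].
Qed.

Lemma hol_id : hol (fun z => z) (fun z => (z * C1)%X).
Proof.
  apply (tay_hol (fun z => z) (fun _ => C1) (fun _ => C0)). intros R0 HR. exists 1. split; [lra|].
  intros z w Hz Hw. rewrite Cnorm_1, Cnorm_0.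
  replace (w - z - C1 * (w - z) - C0 * ((w - z) * (w - z)))%X with C0 by (unfold C1; cx_ring).
  rewrite Cnorm_0. assert (0 <= Cnorm (w - z)%X ^ 3) by (apply pow_le, Cnorm_ge0). lra.
Qed.

Lemma hol_opp (F A : Cx -> Cx) : hol F A -> hol (fun z => - F z)%X (fun z => - A z)%X.
Proof.
  intros [B [J1 [J2 [J3 [J4 [H1 H2]]]]]]. exists (fun z => - B z)%X. split; [|split; [|split; [|split; [|split]]]].
  - eapply jet_ext; [| | |apply (jet_scal _ (-1)); exact J1]; intros; unfold Copp, Cre, Cim; simpl; ring.
  - eapply jet_ext; [| | |apply (jet_scal _ (-1)); exact J2]; intros; unfold Copp, Cre, Cim; simpl; ring.
  - eapply jet_ext; [| | |apply (jet_scal _ (-1)); exact J3]; intros; unfold Copp, Cre, Cim; simpl; ring.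
  - eapply jet_ext; [| | |apply (jet_scal _ (-1)); exact J4]; intros; unfold Copp, Cre, Cim; simpl; ring.
  - apply (continuous_ext (fun z => - Cre (F z))); [reflexivity|]. now apply @continuous_opp.
  - apply (continuous_ext (fun z => - Cim (F z))); [reflexivity|]. now apply @continuous_opp.
Qed.

Fixpoint lst (u : nat -> Cx) (n : nat) : list Cx :=
  match n with O => nil | S k => u O :: lst (fun j => u (S j)) k end.

Lemma pd_lst (n : nat) (u : nat -> Cx) (z : Cx) : pd (lst u n) z = psum u z n.
Proof.
  revert u. induction n as [|n IH]; intros u; [reflexivity|]. simpl. rewrite IH.
  unfold psum. change (S n) with (1 + n)%nat. rewrite Csum_split. rewrite <- Csum_mul. simpl Csum at 2.
  f_equal; [cx_ring|]. apply Csum_ext. intros k _. simpl. ring.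
Qed.

(** Harmonic extensions are explicit for polynomials only, so a dilate, which is continuous up to
    the unit circle, is replaced by a partial sum of its series. *)
Lemma poly_approx (a : nat -> Cx) (r delta : R) : absum a -> 0 <= r < 1 -> 0 < delta ->
  exists l, forall w, Cnorm w <= 1 -> Cnorm (pd l w - PS a (RtoC r * w))%X <= delta.
Proof.
  intros Ha Hr Hd. destruct (Ha r Hr) as [B [HB K]].
  assert (T0 : forall k, 0 <= Cnorm (a k) * r ^ k) by (intros; apply Rmult_le_pos; [apply Cnorm_ge0|apply pow_le; lra]).
  destruct (Rsum_bounded_Cauchy _ B T0 K delta Hd) as [N HN].
  exists (lst (fun k => a k * Cpow (RtoC r) k)%X N). intros w Hw. rewrite pd_lst.
  assert (HwD : inD (RtoC r * w)%X).
  { unfold inD. rewrite Cnorm_mul, Cnorm_RtoC, Rabs_pos_eq by lra. pose proof (Cnorm_ge0 w). nra. }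
  replace (psum (fun k => a k * Cpow (RtoC r) k)%X w N) with (psum a (RtoC r * w)%X N)
    by (apply Csum_ext; intros k _; rewrite Cpow_mul; ring).
  rewrite Cnorm_sub_sym. pose proof (PS_cv a _ Ha HwD) as H.
  apply (ccv_norm_le (fun n => psum a (RtoC r * w)%X n - psum a (RtoC r * w)%X N)%X).
  - exists N. intros n Hn. unfold psum. replace n with (N + (n - N))%nat at 1 by lia. rewrite Csum_split.
    match goal with |- Cnorm (?x + ?y - ?x)%X <= _ => replace (x + y - x)%X with y by ring end.
    eapply Rle_trans; [apply Cnorm_Csum|]. specialize (HN N n ltac:(lia) Hn).
    replace n with (N + (n - N))%nat in HN by lia. rewrite Rsum_split in HN.
    replace (N + (n - N) - N)%nat with (n - N)%nat in HN by lia.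
    eapply Rle_trans; [|left; unfold Rminus in HN; rewrite Rplus_comm, <- Rplus_assoc, Rplus_opp_l, Rplus_0_l in HN; exact HN].
    apply Rsum_le. intros k _. rewrite Cnorm_mul, Cnorm_pow, Cnorm_mul, Cnorm_RtoC, Rabs_pos_eq by lra.
    apply Rmult_le_compat_l; [apply Cnorm_ge0|]. apply pow_incr. pose proof (Cnorm_ge0 w).
    split; [apply Rmult_le_pos; lra|nra].
  - apply (ccv_add _ _ _ (- psum a (RtoC r * w)%X N)%X H (ccv_const _)).
Qed.

Lemma n2_add (z w : Cx) : n2 (z + w)%X <= 2 * n2 z + 2 * n2 w.
Proof.
  unfold n2, Cadd, Cre, Cim; simpl. pose proof (Rle_0_sqr (fst z - fst w)). pose proof (Rle_0_sqr (snd z - snd w)).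
  unfold Rsqr in *. nra.
Qed.

Lemma n2_approx (z w : Cx) (d : R) : Cnorm (z - w)%X <= d -> n2 z <= 2 * n2 w + 2 * (d * d).
Proof.
  intros H. replace z with (w + (z - w))%X by ring. pose proof (n2_add w (z - w)%X).
  pose proof (n2_le _ _ H). lra.
Qed.

Lemma n2_eq0 (z : Cx) : 0 < n2 z -> z <> C0.
Proof. intros H ->. unfold n2, C0, Cre, Cim in H; simpl in H. lra. Qed.

(** * Automorphisms of the disc *)

Lemma sigma_den (a z : Cx) : Cnorm a < 1 -> Cnorm z <= 1 ->
  (1 - Cnorm a) * (1 - Cnorm a) <= n2 (RtoC 1 - Cconj a * z)%X <= 4.
Proof.
  intros Ha Hz. rewrite n2_norm. pose proof (Cnorm_ge0 a). pose proof (Cnorm_ge0 z).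
  assert (Cnorm (Cconj a * z)%X <= Cnorm a) by (rewrite Cnorm_mul, Cnorm_conj; nra).
  pose proof (Cnorm_rev C1 (Cconj a * z)%X) as H2. pose proof (Cnorm_sub C1 (Cconj a * z)%X) as H3.
  rewrite Cnorm_1 in H2, H3. split; [|nra]. apply Rmult_le_compat; lra.
Qed.

Lemma sigma_n2 (a z : Cx) : 0 < n2 (RtoC 1 - Cconj a * z)%X ->
  1 - n2 (sigma a z) = (1 - n2 a) * (1 - n2 z) / n2 (RtoC 1 - Cconj a * z)%X.
Proof.
  intros H. unfold sigma, Cdiv, Cinv. unfold n2, Csub, Cadd, Copp, Cmul, Cconj, RtoC, Cre, Cim in *. simpl in *. field. lra.
Qed.

Lemma Cconj_mul_self (a : Cx) : (Cconj a * a)%X = RtoC (n2 a).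
Proof. unfold n2. cx_ring. Qed.

Lemma sigma_invol (a z : Cx) : Cnorm a < 1 -> Cnorm z <= 1 -> sigma a (sigma a z) = z.
Proof.
  intros Ha Hz. pose proof (sigma_den a z Ha Hz) as [D1 _].
  assert (D : (RtoC 1 - Cconj a * z)%X <> C0) by (apply n2_eq0; assert (0 < (1 - Cnorm a) * (1 - Cnorm a)) by nra; lra).
  assert (D2 : (RtoC 1 - Cconj a * a)%X <> C0).
  { rewrite Cconj_mul_self. intros X. apply (f_equal fst) in X. simpl in X. rewrite n2_norm in X.
    pose proof (Cnorm_ge0 a). nra. }
  unfold sigma. field. change (R1, R0) with (RtoC 1). split; [exact D|].
  replace (RtoC 1 - Cconj a * z - Cconj a * (a - z))%X with (RtoC 1 - Cconj a * a)%X by ring. exact D2.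
Qed.

Lemma sigma_norm (a z : Cx) : Cnorm a < 1 -> Cnorm z < 1 -> Cnorm (sigma a z) < 1.
Proof.
  intros Ha Hz. pose proof (sigma_den a z Ha ltac:(lra)) as [D1 D2]. pose proof (Cnorm_ge0 a). pose proof (Cnorm_ge0 z).
  assert (0 < (1 - Cnorm a) * (1 - Cnorm a)) by nra.
  pose proof (sigma_n2 a z ltac:(lra)) as E. rewrite !n2_norm in E.
  assert (0 < (1 - Cnorm a * Cnorm a) * (1 - Cnorm z * Cnorm z) / n2 (RtoC 1 - Cconj a * z)%X).
  { apply Rdiv_lt_0_compat; [|lra]. apply Rmult_lt_0_compat; nra. }
  rewrite !n2_norm in H2. pose proof (Cnorm_ge0 (sigma a z)). nra.
Qed.

Lemma hol_sigma (a : Cx) (phi A : Cx -> Cx) : Cnorm a < 1 -> (forall z, inD z -> Cnorm (phi z) <= 1) -> hol phi A ->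
  exists A', hol (fun z => sigma a (phi z)) A'.
Proof.
  intros Ha Hphi H. eexists. unfold sigma, Cdiv, Csub. apply hol_mul.
  - apply hol_add; [apply hol_const|]. apply hol_opp; exact H.
  - apply hol_inv with ((1 - Cnorm a) * (1 - Cnorm a)).
    + nra.
    + intros z Hz. apply (sigma_den a (phi z) Ha). now apply Hphi.
    + apply hol_add; [apply hol_const|]. apply hol_opp. apply hol_mul; [apply hol_const|exact H].
Qed.

Lemma radius_near_1 (eps : R) : 0 < eps -> exists r, 0 < r < 1 /\ 1 - r * r <= eps.
Proof.
  intros He. exists (1 - Rmin eps 1 / 2). pose proof (Rmin_l eps 1). pose proof (Rmin_r eps 1).
  assert (0 < Rmin eps 1) by (apply Rmin_pos; lra). split; [lra|nra].
Qed.

Lemma n2_circ (r t : R) : 0 <= r -> n2 (circ r t) = r * r.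
Proof. intros H. now rewrite n2_norm, Cnorm_circ. Qed.

Lemma hol_cc (F A : Cx -> Cx) (r : R) : hol F A -> 0 <= r < 1 -> cc r F.
Proof.
  intros H Hr t. split.
  - apply (smooth_circont _ _ _ _ r (smooth_Re F A H) Hr).
  - apply (smooth_circont _ _ _ _ r (smooth_Im F A H) Hr).
Qed.

Lemma cm_dilate (r rho : R) (u : Cx -> R) : cm r (fun z => u (RtoC rho * z)%X) = cm (rho * r) u.
Proof.
  apply mean_ext. intros t. f_equal. unfold circ. cx_ring.
Qed.

Lemma hol_harmonic_ge0 (W A : Cx -> Cx) (c r : R) : hol W A -> 0 <= r < 1 ->
  (forall t, 0 <= Cre (W (circ r t)) + c) -> 0 <= Cre (W C0) + c.
Proof.
  intros H Hr Hc. pose proof (smooth_Re W A H) as S.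
  rewrite <- (cm_harmonic _ _ _ r S Hr). rewrite <- (cm_const r c). rewrite <- cm_add.
  - apply cm_ge0; [|assumption]. apply circont_add; [now apply (smooth_circont _ _ _ _ r S)|apply circont_const].
  - now apply (smooth_circont _ _ _ _ r S).
  - apply circont_const.
Qed.

(** The left side is the mean over the unit circle of |P|^2, P being the polynomial l. Replacing
    that circle by a nearby one costs 1, and |P|^2 <= 2|e|^2 + 2 accounts for the rest. *)
Lemma pH0_le (e : nat -> Cx) (l : list Cx) (R0 K : R) : absum e -> 0 < R0 < 1 ->
  (forall w, Cnorm w <= 1 -> Cnorm (pd l w - PS e (RtoC R0 * w))%X <= 1) ->
  (forall r, 0 <= r < 1 -> cm r (fun z => n2 (PS e z)) <= K) ->
  Cre (pH l C0) <= 2 * K + 3.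
Proof.
  intros He HR Hl HK. destruct (pE_bound l) as [B [HB KB]].
  (* On this circle (1 - r^2) [pE] <= 1, so [pH] exceeds |P|^2 by at most 1. *)
  destruct (radius_near_1 (/ B)) as [r [Hr Hr1]]; [now apply Rinv_0_lt_compat|].
  destruct (hol_pH _ _ l hol_id) as [A' HA]. pose proof (smooth_Re _ _ HA) as S.
  pose proof (cm_harmonic _ _ _ r S ltac:(lra)) as E. simpl in E. rewrite <- E.
  assert (Hh : hol (PS e) (fun z => z * PS1 e z)%X) by (apply (tay_hol _ _ (PS2 e)), PS_tay; assumption).
  assert (C0' : circont r (fun z => n2 (PS e (RtoC R0 * z)%X))).
  { apply (circont_ext r (fun z => n2 (PS e (RtoC R0 * z)%X))); [reflexivity|]. intros t.
    apply (continuous_ext (fun t => n2 (PS e (circ (R0 * r) t)))).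
    - intros s. do 2 f_equal. unfold circ. cx_ring.
    - apply (smooth_circont _ _ _ _ (R0 * r) (smooth_n2 _ _ Hh)). nra. }
  apply Rle_trans with (cm r (fun z => 2 * n2 (PS e (RtoC R0 * z)%X) + 3)).
  - apply cm_le; [apply (smooth_circont _ _ _ _ r S); lra|apply circont_add; [now apply circont_scal|apply circont_const]|].
    intros t. assert (Hn : Cnorm (circ r t) <= 1) by (rewrite Cnorm_circ; lra).
    pose proof (pH_pd l (circ r t)) as H1. rewrite n2_circ in H1 by lra.
    pose proof (KB _ Hn). pose proof (pE_ge0 l (circ r t)).
    pose proof (n2_approx _ _ _ (Hl _ Hn)).
    assert ((1 - r * r) * pE l (circ r t) <= 1); [|lra].
    apply Rle_trans with (/ B * B); [apply Rmult_le_compat; try lra; nra|rewrite Rinv_l; lra].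
  - rewrite cm_add, cm_scal, cm_const; try assumption; [|now apply circont_scal|apply circont_const].
    rewrite (cm_dilate r R0 (fun z => n2 (PS e z))). specialize (HK (R0 * r) ltac:(nra)). lra.
Qed.

Lemma n2_sub (x y : Cx) : n2 x = n2 (x - y)%X + 2 * Cre (Cconj y * x)%X - n2 y.
Proof. unfold n2, Csub, Cadd, Copp, Cmul, Cconj, Cre, Cim; simpl. ring. Qed.

Lemma sqrt_lt1_bounds (x : R) : 0 < x < 1 -> 0 < sqrt x < 1.
Proof. intros H. split; [apply sqrt_lt_R0; lra|]. rewrite <- sqrt_1. apply sqrt_lt_1; lra. Qed.

(* g(rho s_a(z)) - g(rho a) = (g o s_c - g(c))(w(z)) with s = sigma, c = rho a and
   w = s_c o (rho s_a), a self-map of D with w(0) = 0 and relatively compact image: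
   subordination reduces the dilate of g to g itself. *)
Lemma potential_bound (g : Cx -> Cx) (K rho : R) (l : list Cx) (a : Cx) :
  (forall c, inD c -> exists e, absum e /\ (forall z, inD z -> PS e z = (g (sigma c z) - g c)%X) /\
     forall r, 0 <= r < 1 -> cm r (fun z => n2 (PS e z)) <= K) ->
  0 < rho < 1 -> (forall w, Cnorm w <= 1 -> Cnorm (pd l w - g (RtoC rho * w))%X <= 1) -> inD a ->
  Cre (pH l a) - n2 (pd l a) <= 8 * K + 25.
Proof.
  intros HG Hrho Hl Ha. unfold inD in Ha. pose proof (Cnorm_ge0 a) as Ha0. set (c := (RtoC rho * a)%X).
  assert (Hc : Cnorm c <= rho) by (unfold c; rewrite Cnorm_mul, Cnorm_RtoC, Rabs_pos_eq by lra; nra).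
  assert (HcD : inD c) by (unfold inD; lra).
  destruct (HG c HcD) as [e [He [Ee HK]]].
  (* A lower bound for 1 - |w(z)|^2: both factors of the numerator in [sigma_n2] are at least 1 -
     rho^2 and the denominator is at most 4. Hence |w| <= R0 below. *)
  set (q := (1 - rho * rho) * (1 - rho * rho) / 4).
  assert (Hq : 0 < q < 1) by (unfold q; assert (0 < 1 - rho * rho < 1) by nra; nra).
  set (R0 := sqrt (1 - q)). assert (HR : 0 < R0 < 1) by (apply sqrt_lt1_bounds; lra).
  assert (HRR : R0 * R0 = 1 - q) by (apply sqrt_sqrt; lra).
  destruct (poly_approx e R0 1 He ltac:(lra) ltac:(lra)) as [Q HQ].
  pose proof (pH0_le e Q R0 K He HR HQ HK) as HQ0.
  set (sg := fun z => sigma a z). set (v := fun z => (RtoC rho * sg z)%X). set (om := fun z => sigma c (v z)).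
  assert (Hsg : forall z, inD z -> Cnorm (sg z) < 1) by (intros z Hz; now apply sigma_norm).
  assert (Hv : forall z, inD z -> Cnorm (v z) <= rho).
  { intros z Hz. unfold v. rewrite Cnorm_mul, Cnorm_RtoC, Rabs_pos_eq by lra.
    specialize (Hsg z Hz). pose proof (Cnorm_ge0 (sg z)). nra. }
  assert (Hom : forall z, inD z -> Cnorm (om z) <= R0).
  { intros z Hz. specialize (Hv z Hz). pose proof (Cnorm_ge0 (v z)). pose proof (Cnorm_ge0 c).
    destruct (sigma_den c (v z) ltac:(lra) ltac:(lra)) as [D1 D2].
    assert (D3 : 0 < n2 (RtoC 1 - Cconj c * v z)%X) by nra.
    pose proof (sigma_n2 c (v z) D3) as E. fold (om z) in E.
    set (N := (1 - n2 c) * (1 - n2 (v z))) in E. set (D := n2 (RtoC 1 - Cconj c * v z)%X) in *.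
    assert (Nq : 4 * q <= N).
    { unfold N, q. pose proof (n2_le _ _ Hc). pose proof (n2_le _ _ Hv).
      replace (4 * ((1 - rho * rho) * (1 - rho * rho) / 4)) with ((1 - rho * rho) * (1 - rho * rho)) by field.
      apply Rmult_le_compat; nra. }
    assert (q <= N / D).
    { apply Rmult_le_reg_r with D; [assumption|]. replace (N / D * D) with N by (field; lra). nra. }
    assert (n2 (om z) <= R0 * R0) by lra. rewrite n2_norm in H2. pose proof (Cnorm_ge0 (om z)). nra. }
  assert (Gom : forall z, inD z -> (g (v z) - g c)%X = PS e (om z)).
  { intros z Hz. rewrite Ee by (unfold inD; specialize (Hom z Hz); lra).
    unfold om. rewrite sigma_invol; [reflexivity|lra|specialize (Hv z Hz); lra]. }
  destruct (hol_sigma a _ _ Ha (fun z Hz => Rlt_le _ _ Hz) hol_id) as [As Hs]. fold sg in Hs.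
  assert (Hvh := hol_mul _ _ _ _ (hol_const (RtoC rho)) Hs).
  destruct (hol_sigma c _ _ ltac:(lra) (fun z Hz => Rle_trans _ _ _ (Hv z Hz) (Rlt_le _ _ (proj2 Hrho))) Hvh) as [Ao Ho].
  assert (Hoh := hol_mul _ _ _ _ (hol_const (RtoC (/ R0))) Ho). cbv beta in Hoh.
  destruct (hol_pH _ _ Q Hoh) as [A1 H1]. destruct (hol_pd _ _ l Hs) as [A2 H2]. destruct (hol_pH _ _ l Hs) as [A3 H3].
  set (Pa := pd l a).
  (* W has Re W + 13 - |P(a)|^2 >= 0 near the unit circle: |P|^2 is expanded around P(a), where |P -
     P(a)|^2 <= 4 Re pH Q + 12, and the passage from [pH l] to |P|^2 costs 1 more. At z = 0 this
     bounds Re pH(a) - |P(a)|^2 by 4 (2K + 3) + 13. *)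
  assert (HW := hol_add _ _ _ _ (hol_mul _ _ _ _ (hol_const (RtoC 4)) H1)
     (hol_add _ _ _ _ (hol_mul _ _ _ _ (hol_const (RtoC 2 * Cconj Pa)%X) H2) (hol_opp _ _ H3))).
  cbv beta in HW. fold v in HW.
  destruct (pE_bound l) as [B [HB KB]].
  set (m := (1 - Cnorm a) * (1 - Cnorm a)). assert (Hm : 0 < m) by (unfold m; nra).
  (* The denominator in [sigma_n2] is at least m, so 1 - |sg z|^2 <= 1/B on this circle. *)
  destruct (radius_near_1 (m * / B)) as [r [Hr Hr1]].
  { apply Rmult_lt_0_compat; [assumption|now apply Rinv_0_lt_compat]. }
  pose proof (hol_harmonic_ge0 _ _ (13 - n2 Pa) r HW ltac:(lra)) as Hfin. cbv beta in Hfin.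
  assert (S0 : sg C0 = a).
  { unfold sg, sigma. replace (a - C0)%X with a by ring. replace (RtoC 1 - Cconj a * C0)%X with (RtoC 1) by ring.
    unfold Cdiv. replace (Cinv (RtoC 1)) with (RtoC 1); [ring|].
    unfold Cinv, RtoC, Cre, Cim; simpl. f_equal; field. }
  assert (O0 : sigma c (v C0) = C0).
  { unfold v. rewrite S0. fold c. unfold sigma. replace (c - c)%X with C0 by ring. unfold Cdiv. ring. }
  rewrite O0, S0 in Hfin. fold Pa in Hfin. replace (RtoC (/ R0) * C0)%X with C0 in Hfin by ring.
  assert (Hc1 : Cre (RtoC 2 * Cconj Pa * Pa)%X = 2 * n2 Pa) by (unfold n2, Cmul, Cconj, RtoC, Cre, Cim; simpl; ring).
  assert (F1 : 0 <= 4 * Cre (pH Q C0) + (2 * n2 Pa + - Cre (pH l a)) + (13 - n2 Pa)).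
  { rewrite <- Hc1. eapply Rle_trans; [apply Hfin|].
    2: right; unfold Cadd, Cmul, Copp, RtoC, Cre, Cim; simpl; ring.
    intros t. set (z := circ r t). assert (Hz : inD z) by (unfold inD, z; rewrite Cnorm_circ; lra).
    assert (Hw : Cnorm (RtoC (/ R0) * om z)%X <= 1).
    { rewrite Cnorm_mul, Cnorm_RtoC, Rabs_pos_eq by (left; apply Rinv_0_lt_compat; lra).
      specialize (Hom z Hz). apply Rle_trans with (/ R0 * R0); [apply Rmult_le_compat_l; [left; apply Rinv_0_lt_compat; lra|assumption]|rewrite Rinv_l; lra]. }
    change (0 <= Cre (RtoC 4 * pH Q (RtoC (/ R0) * om z) + (RtoC 2 * Cconj Pa * pd l (sg z) + - pH l (sg z)))%X + (13 - n2 Pa)).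
    set (w := (RtoC (/ R0) * om z)%X) in *.
    assert (Ew : (RtoC R0 * w)%X = om z).
    { unfold w. transitivity (RtoC (R0 * / R0) * om z)%X; [cx_ring|]. rewrite Rinv_r by lra. cx_ring. }
    pose proof (HQ w Hw) as X1. rewrite Ew, <- Gom in X1 by assumption.
    pose proof (pH_pd Q w) as X2. pose proof (pE_ge0 Q w) as X3. pose proof (n2_le _ _ Hw) as X4.
    assert (X5 : n2 (pd Q w) <= Cre (pH Q w)) by (assert (0 <= (1 - n2 w) * pE Q w) by (apply Rmult_le_pos; lra); lra).
    rewrite Cnorm_sub_sym in X1. pose proof (n2_approx _ _ _ X1) as X6.
    set (P := pd l (sg z)).
    assert (X7 : Cnorm (P - Pa - (g (v z) - g c))%X <= 2).
    { replace (P - Pa - (g (v z) - g c))%X with ((P - g (v z)) - (Pa - g c))%X by ring.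
      eapply Rle_trans; [apply Cnorm_sub|]. unfold P, Pa, v, c.
      pose proof (Hl (sg z) ltac:(specialize (Hsg z Hz); lra)). pose proof (Hl a ltac:(lra)). lra. }
    pose proof (n2_approx _ _ _ X7) as X8.
    pose proof (n2_sub P Pa) as X9.
    pose proof (pH_pd l (sg z)) as Y1. fold P in Y1.
    destruct (sigma_den a z Ha ltac:(unfold inD in Hz; lra)) as [D1 D2]. fold m in D1.
    pose proof (sigma_n2 a z ltac:(lra)) as Y2. fold (sg z) in Y2. unfold z in Y2 at 2. rewrite n2_circ in Y2 by lra.
    assert (Y3 : (1 - n2 (sg z)) * pE l (sg z) <= 1).
    { rewrite Y2. set (D := n2 (RtoC 1 - Cconj a * z)%X) in *.
      assert (Z1 : (1 - n2 a) * (1 - r * r) / D <= / B).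
      { apply Rmult_le_reg_r with D; [lra|].
        replace ((1 - n2 a) * (1 - r * r) / D * D) with ((1 - n2 a) * (1 - r * r)) by (field; lra).
        pose proof (n2_ge0 a). assert (0 < / B) by now apply Rinv_0_lt_compat.
        assert (0 <= 1 - r * r) by nra.
        assert ((1 - n2 a) * (1 - r * r) <= 1 * (1 - r * r)) by (apply Rmult_le_compat_r; lra).
        assert (m * / B <= / B * D) by (rewrite Rmult_comm; apply Rmult_le_compat_l; lra). lra. }
      apply Rle_trans with (/ B * B); [|rewrite Rinv_l; lra].
      apply Rmult_le_compat; [|apply pE_ge0|assumption|apply KB; specialize (Hsg z Hz); lra].
      apply Rmult_le_pos; [|left; apply Rinv_0_lt_compat; lra]. pose proof (n2_le a 1 ltac:(lra)). apply Rmult_le_pos; nra. }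
    assert (Y4 : Cre (RtoC 4 * pH Q w + (RtoC 2 * Cconj Pa * P + - pH l (sg z)))%X =
       4 * Cre (pH Q w) + 2 * Cre (Cconj Pa * P)%X - Cre (pH l (sg z))).
    { unfold Cadd, Cmul, Copp, Cconj, RtoC, Cre, Cim; simpl; ring. }
    rewrite Y4. lra. }
  lra.
Qed.

Lemma tay_dilate (F D1 D2 : Cx -> Cx) (rho : R) : 0 <= rho <= 1 -> tay F D1 D2 ->
  tay (fun z => F (RtoC rho * z)%X) (fun z => RtoC rho * D1 (RtoC rho * z))%X
      (fun z => RtoC rho * RtoC rho * D2 (RtoC rho * z))%X.
Proof.
  intros Hr H R0 HR. destruct (H R0 HR) as [C [HC K]]. exists C. split; [assumption|].
  assert (Hn : forall z, Cnorm z <= R0 -> Cnorm (RtoC rho * z)%X <= R0).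
  { intros z Hz. rewrite Cnorm_mul, Cnorm_RtoC, Rabs_pos_eq by lra. pose proof (Cnorm_ge0 z). nra. }
  intros z w Hz Hw. destruct (K _ _ (Hn z Hz) (Hn w Hw)) as [K0 [K1 [K2 K3]]].
  pose proof (Cnorm_ge0 (D1 (RtoC rho * z)%X)). pose proof (Cnorm_ge0 (D2 (RtoC rho * z)%X)).
  split; [assumption|]. split; [|split].
  - rewrite Cnorm_mul, Cnorm_RtoC, Rabs_pos_eq by lra. nra.
  - rewrite !Cnorm_mul, Cnorm_RtoC, Rabs_pos_eq by lra. assert (rho * rho <= 1) by nra. nra.
  - replace (RtoC rho * w - RtoC rho * z)%X with (RtoC rho * (w - z))%X in K3 by ring.
    match type of K3 with Cnorm ?x <= _ => match goal with |- Cnorm ?y <= _ => replace y with x by ring end end.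
    eapply Rle_trans; [exact K3|]. apply Rmult_le_compat_l; [lra|].
    rewrite Cnorm_mul, Cnorm_RtoC, Rabs_pos_eq by lra. apply pow_incr. pose proof (Cnorm_ge0 (w - z)%X).
    split; nra.
Qed.

(** The derivative of the function in the variable log z, which is the right gradient for the
    Laplacian in use. *)
Definition grad (b : nat -> Cx) (z : Cx) : Cx := (z * PS1 b z)%X.

Lemma hol_PS (b : nat -> Cx) : absum b -> hol (PS b) (grad b).
Proof. intros H. apply (tay_hol _ _ (PS2 b)). now apply PS_tay. Qed.

Lemma hol_dilate (b : nat -> Cx) (rho : R) : absum b -> 0 <= rho <= 1 ->
  hol (fun z => PS b (RtoC rho * z)%X) (fun z => grad b (RtoC rho * z)%X).
Proof.
  intros Hb Hr. pose proof (tay_hol _ _ _ (tay_dilate _ _ _ rho Hr (PS_tay b Hb))) as H.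
  replace (fun z => grad b (RtoC rho * z)%X) with (fun z => z * (RtoC rho * PS1 b (RtoC rho * z)))%X; [exact H|].
  apply functional_extensionality. intros z. unfold grad. ring.
Qed.

(** The approximating polynomial enters only through the harmonic part of v. The identity for the
    Laplacian is therefore exact, and the approximation affects merely the bounds on v; the added
    constant 1 restores v >= 0. *)
Theorem BMOA_potential (g : Cx -> Cx) (b : nat -> Cx) : is_BMOA g -> absum b -> (forall z, inD z -> PS b z = g z) ->
  exists K, 0 < K /\ forall rho, 0 < rho < 1 -> exists v vx vy,
    smooth v vx vy (fun z => - (2 * n2 (grad b (RtoC rho * z)%X))) /\ forall z, inD z -> 0 <= v z <= K.
Proof.
  intros [_ [K HK]] Hb Eb.
  assert (HG : forall c, inD c -> exists e, absum e /\ (forall z, inD z -> PS e z = (g (sigma c z) - g c)%X) /\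
     forall r, 0 <= r < 1 -> cm r (fun z => n2 (PS e z)) <= rpow K 2).
  { intros c Hc. destruct (HK c Hc) as [H1 H2].
    destruct (analytic_PS _ (proj1 H1)) as [e [He Ee]]. exists e. split; [assumption|]. split; [assumption|].
    intros r Hr. destruct (Hp_norm_spec 2 _ ltac:(lra) H1) as [N0 [N1 _]].
    apply Rle_trans with (rpow (Hp_norm 2 (fun z => (g (sigma c z) - g c)%X)) 2); [|apply rpow_le; [lra|exact H2]].
    eapply Rle_trans; [|apply (N1 r Hr)]. right. apply cm_ext. intros t.
    assert (Hz : inD (circ r t)) by (unfold inD; rewrite Cnorm_circ; lra).
    rewrite Ee by assumption. unfold pw. rewrite rpow_2 by apply Cnorm_ge0. apply n2_norm. }
  pose proof (rpow_ge0 K 2) as HK0.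
  exists (8 * rpow K 2 + 27). split; [lra|]. intros rho Hrho.
  pose proof (PS_tay b Hb) as Tb. destruct (Tb rho ltac:(lra)) as [M [HM KM]].
  (* With |g(rho w)| <= M, an error d in the values changes the squared modulus by at most d (2M +
     1) <= 1. *)
  set (d := / (2 * M + 3)). assert (Hd : 0 < d) by (apply Rinv_0_lt_compat; lra).
  assert (Hd1 : d * (2 * M + 3) = 1) by (unfold d; field; lra). assert (Hd2 : d <= 1) by nra.
  destruct (poly_approx b rho d Hb ltac:(lra) Hd) as [l Hl].
  assert (Bd : forall w, Cnorm w <= 1 -> Cnorm (PS b (RtoC rho * w)%X) <= M).
  { intros w Hw. assert (Cnorm (RtoC rho * w)%X <= rho) by (rewrite Cnorm_mul, Cnorm_RtoC, Rabs_pos_eq by lra; nra).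
    now apply (KM _ (RtoC rho * w)%X). }
  assert (Cl : forall w, Cnorm w <= 1 -> Rabs (n2 (pd l w) - n2 (PS b (RtoC rho * w)%X)) <= 1).
  { intros w Hw. specialize (Hl w Hw). specialize (Bd w Hw). rewrite !n2_norm.
    pose proof (Cnorm_rev (pd l w) (PS b (RtoC rho * w)%X)) as R1.
    pose proof (Cnorm_rev (PS b (RtoC rho * w)%X) (pd l w)) as R2.
    rewrite Cnorm_sub_sym in R2. set (x := Cnorm (pd l w)) in *. set (y := Cnorm (PS b (RtoC rho * w)%X)) in *.
    assert (0 <= x) by apply Cnorm_ge0. assert (0 <= y) by apply Cnorm_ge0.
    apply Rabs_le. assert (- d <= x - y <= d) by lra. assert (x + y <= 2 * M + 1) by lra.
    replace (x * x - y * y) with ((x - y) * (x + y)) by ring. nra. }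
  destruct (hol_pH _ _ l hol_id) as [A' HA].
  pose proof (smooth_add _ _ _ _ _ _ _ _ (smooth_add _ _ _ _ _ _ _ _ (smooth_Re _ _ HA) (smooth_const 1))
    (smooth_scal (-1) _ _ _ _ (smooth_n2 _ _ (hol_dilate b rho Hb ltac:(lra))))) as S. cbv beta in S.
  eexists; eexists; eexists. split.
  - eapply smooth_ext; [| | | |exact S]; try reflexivity. intros z _. simpl. ring.
  - intros z Hz. pose proof (Cl z ltac:(unfold inD in Hz; lra)) as C1'. apply Rabs_le_between in C1'.
    pose proof (pH_pd l z) as P1. pose proof (pE_ge0 l z) as P2.
    assert (0 <= (1 - n2 z) * pE l z).
    { apply Rmult_le_pos; [|assumption]. unfold inD in Hz. pose proof (n2_le z 1 ltac:(lra)). lra. }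
    assert (Cre (pH l z) - n2 (pd l z) <= 8 * rpow K 2 + 25).
    { apply (potential_bound g (rpow K 2) rho l z HG Hrho); [|assumption]. intros w Hw.
      rewrite <- Eb; [eapply Rle_trans; [now apply Hl|assumption]|].
      unfold inD. rewrite Cnorm_mul, Cnorm_RtoC, Rabs_pos_eq by lra. pose proof (Cnorm_ge0 w). nra. }
    lra.
Qed.

(** * Estimates for the Volterra operator on circles *)

Lemma hol_ext_der (F A A' : Cx -> Cx) : (forall z, inD z -> A z = A' z) -> hol F A -> hol F A'.
Proof.
  intros E [B [J1 [J2 [J3 [J4 [H1 H2]]]]]]. exists B. split; [|split; [|split; [|split; [|split]]]]; try assumption.
  - eapply jet_ext; [| | |exact J1]; [reflexivity|intros z Hz; cbv beta; rewrite (E z Hz); reflexivity|reflexivity].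
  - eapply jet_ext; [| | |exact J2]; [reflexivity|intros z Hz; cbv beta; rewrite (E z Hz); reflexivity|reflexivity].
  - eapply jet_ext; [| | |exact J3]; [reflexivity|intros z Hz; cbv beta; rewrite (E z Hz); reflexivity|reflexivity].
  - eapply jet_ext; [| | |exact J4]; [reflexivity|intros z Hz; cbv beta; rewrite (E z Hz); reflexivity|reflexivity].
Qed.

Lemma Rpower_div (x q : R) : 0 < x -> Rpower x q * / x = Rpower x (q - 1).
Proof.
  intros H. unfold Rminus. rewrite Rpower_plus, Rpower_Ropp, Rpower_1 by assumption. reflexivity.
Qed.

Lemma Rpower_anti (x y s : R) : s <= 0 -> 0 < x <= y -> Rpower y s <= Rpower x s.
Proof.
  intros Hs H. replace s with (- - s) by ring. rewrite !(Rpower_Ropp _ (- s)).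
  apply Rinv_le_contravar; [apply Rpower_pos|]. apply Rpower_le_l; lra.
Qed.

Lemma Rpower_ge1 (x s : R) : 0 < x <= 1 -> s <= 0 -> 1 <= Rpower x s.
Proof.
  intros Hx Hs. replace 1 with (Rpower 1 s); [apply Rpower_anti; lra|].
  unfold Rpower. rewrite ln_1, Rmult_0_r. apply exp_0.
Qed.

(** Either y <= eta x, and the first term suffices, or x < y / eta, and the second does. *)
Lemma young_prod (x y q eta : R) : 0 < x -> 0 < y -> 1 <= q -> 0 < eta ->
  Rpower x (q - 1) * y <= eta * Rpower x q + Rpower eta (1 - q) * Rpower y q.
Proof.
  intros Hx Hy Hq He. pose proof (Rpower_pos x (q - 1)). pose proof (Rpower_pos x q). pose proof (Rpower_pos y q).
  pose proof (Rpower_pos eta (1 - q)).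
  assert (Ex : Rpower x q = Rpower x (q - 1) * x).
  { rewrite <- (Rpower_1 x) at 3 by assumption. rewrite <- Rpower_plus. f_equal. ring. }
  assert (Ey : Rpower y q = Rpower y (q - 1) * y).
  { rewrite <- (Rpower_1 y) at 3 by assumption. rewrite <- Rpower_plus. f_equal. ring. }
  destruct (Rle_lt_dec y (eta * x)) as [L|L].
  - assert (Rpower x (q - 1) * y <= eta * Rpower x q) by (rewrite Ex; nra).
    assert (0 <= Rpower eta (1 - q) * Rpower y q) by (apply Rmult_le_pos; lra). lra.
  - assert (Hxy : x <= y * / eta).
    { apply Rmult_le_reg_r with eta; [assumption|]. rewrite Rmult_assoc, Rinv_l by lra. lra. }
    assert (I : Rpower x (q - 1) <= Rpower y (q - 1) * Rpower eta (1 - q)).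
    { eapply Rle_trans; [apply (Rpower_le_l x (y * / eta)); lra|].
      rewrite <- Rpower_mult_distr; [|assumption|now apply Rinv_0_lt_compat].
      replace (1 - q) with (- (q - 1)) by ring. rewrite Rpower_Ropp.
      right. f_equal. unfold Rpower. rewrite ln_Rinv by assumption. rewrite <- exp_Ropp. f_equal. ring. }
    apply (Rmult_le_compat_r y) in I; [|lra]. rewrite Ey.
    assert (0 <= eta * Rpower x q) by nra. lra.
Qed.

(** Beyond the threshold y0, where kap y0^(P - q) = 1, the higher power dominates; below it y^q is
    at most the constant y0^q. *)
Lemma young_split (q P kap : R) : 0 < q < P -> 0 < kap -> exists C, 0 < C /\ forall y, 0 < y -> Rpower y q <= kap * Rpower y P + C.
Proof.
  intros Hq Hk. set (y0 := Rpower (/ kap) (/ (P - q))). exists (Rpower y0 q).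
  assert (Hy0 : 0 < y0) by apply Rpower_pos. pose proof (Rpower_pos y0 q). split; [assumption|]. intros y Hy.
  pose proof (Rpower_pos y P). pose proof (Rpower_pos y q). destruct (Rle_lt_dec y y0) as [L|L].
  - assert (Rpower y q <= Rpower y0 q) by (apply Rpower_le_l; lra). assert (0 <= kap * Rpower y P) by nra. lra.
  - assert (E : Rpower y P = Rpower y q * Rpower y (P - q)) by (rewrite <- Rpower_plus; f_equal; ring).
    assert (I : / kap <= Rpower y (P - q)).
    { apply Rle_trans with (Rpower y0 (P - q)); [|apply Rpower_le_l; lra].
      unfold y0. rewrite Rpower_mult, Rinv_l, Rpower_1 by (try apply Rinv_0_lt_compat; lra). lra. }
    apply (Rmult_le_compat_l kap) in I; [|lra]. rewrite Rinv_r in I by lra. rewrite E. nra.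
Qed.

Lemma grad_n2 (x a : Cx) : (2 * (Cre x * Cre a + Cim x * Cim a)) * (2 * (Cre x * Cre a + Cim x * Cim a)) +
  (2 * (Cim x * Cre a - Cre x * Cim a)) * (2 * (Cim x * Cre a - Cre x * Cim a)) = 4 * (n2 x * n2 a).
Proof. unfold n2. ring. Qed.

Lemma smooth_n2_eps (f Af : Cx -> Cx) (eps : R) : hol f Af ->
  smooth (fun z => n2 (f z) + eps) (fun z => 2 * (Cre (f z) * Cre (Af z) + Cim (f z) * Cim (Af z)))
    (fun z => 2 * (Cim (f z) * Cre (Af z) - Cre (f z) * Cim (Af z))) (fun z => 2 * n2 (Af z)).
Proof.
  intros H. eapply smooth_ext; [| | | |apply smooth_add; [apply smooth_n2; exact H|apply (smooth_const eps)]];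
    intros; simpl; ring.
Qed.

(** The last bracket lies between q and 1, because the quotient in it lies in [0, 1]. The three
    lemmas after [frac_bounds] read this off for q <= 1, for q >= 1 and for sign only. *)
Lemma pow_laplacian (f Af : Cx -> Cx) (q eps : R) : hol f Af -> 0 < eps -> exists ux uy L,
  smooth (fun z => Rpower (n2 (f z) + eps) q) ux uy L /\
  forall z, inD z -> L z = 2 * q * Rpower (n2 (f z) + eps) (q - 1) * n2 (Af z) * (1 + (q - 1) * (n2 (f z) * / (n2 (f z) + eps))).
Proof.
  intros H He. eexists; eexists; eexists; split.
  - apply (smooth_pow q eps); [assumption| |apply smooth_n2_eps; exact H].
    intros z _. pose proof (n2_ge0 (f z)). lra.
  - intros z _. cbv beta. rewrite grad_n2. pose proof (n2_ge0 (f z)).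
    rewrite <- Rpower_div by lra. field. lra.
Qed.

Lemma frac_bounds (x e : R) : 0 <= x -> 0 < e -> 0 <= x * / (x + e) <= 1.
Proof.
  intros Hx He. assert (0 < / (x + e)) by (apply Rinv_0_lt_compat; lra). split; [nra|].
  apply Rmult_le_reg_r with (x + e); [lra|]. rewrite Rmult_assoc, Rinv_l by lra. lra.
Qed.

Lemma pow_laplacian_lower (f Af : Cx -> Cx) (q eps : R) : hol f Af -> 0 < eps -> 0 < q <= 1 -> exists ux uy L,
  smooth (fun z => Rpower (n2 (f z) + eps) q) ux uy L /\
  forall z, inD z -> 2 * q * q * Rpower (n2 (f z) + eps) (q - 1) * n2 (Af z) <= L z.
Proof.
  intros H He Hq. destruct (pow_laplacian f Af q eps H He) as [ux [uy [L [S E]]]]. exists ux, uy, L.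
  split; [assumption|]. intros z Hz. rewrite E by assumption.
  pose proof (frac_bounds _ _ (n2_ge0 (f z)) He). pose proof (Rpower_pos (n2 (f z) + eps) (q - 1)). pose proof (n2_ge0 (Af z)).
  assert (0 <= 2 * q * Rpower (n2 (f z) + eps) (q - 1) * n2 (Af z)) by (repeat apply Rmult_le_pos; lra).
  replace (2 * q * q * Rpower (n2 (f z) + eps) (q - 1) * n2 (Af z)) with (2 * q * Rpower (n2 (f z) + eps) (q - 1) * n2 (Af z) * q) by ring.
  apply Rmult_le_compat_l; [assumption|]. nra.
Qed.

Lemma pow_laplacian_upper (f Af : Cx -> Cx) (q eps : R) : hol f Af -> 0 < eps -> 1 <= q -> exists ux uy L,
  smooth (fun z => Rpower (n2 (f z) + eps) q) ux uy L /\
  forall z, inD z -> L z <= 2 * q * q * Rpower (n2 (f z) + eps) (q - 1) * n2 (Af z).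
Proof.
  intros H He Hq. destruct (pow_laplacian f Af q eps H He) as [ux [uy [L [S E]]]]. exists ux, uy, L.
  split; [assumption|]. intros z Hz. rewrite E by assumption.
  pose proof (frac_bounds _ _ (n2_ge0 (f z)) He). pose proof (Rpower_pos (n2 (f z) + eps) (q - 1)). pose proof (n2_ge0 (Af z)).
  assert (0 <= 2 * q * Rpower (n2 (f z) + eps) (q - 1) * n2 (Af z)) by (repeat apply Rmult_le_pos; lra).
  replace (2 * q * q * Rpower (n2 (f z) + eps) (q - 1) * n2 (Af z)) with (2 * q * Rpower (n2 (f z) + eps) (q - 1) * n2 (Af z) * q) by ring.
  apply Rmult_le_compat_l; [assumption|]. nra.
Qed.

Lemma pow_subharmonic (f Af : Cx -> Cx) (q eps : R) : hol f Af -> 0 < eps -> 0 < q -> exists ux uy L,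
  smooth (fun z => Rpower (n2 (f z) + eps) q) ux uy L /\ forall z, inD z -> 0 <= L z.
Proof.
  intros H He Hq. destruct (pow_laplacian f Af q eps H He) as [ux [uy [L [S E]]]]. exists ux, uy, L.
  split; [assumption|]. intros z Hz. rewrite E by assumption.
  pose proof (frac_bounds _ _ (n2_ge0 (f z)) He). pose proof (Rpower_pos (n2 (f z) + eps) (q - 1)). pose proof (n2_ge0 (Af z)).
  apply Rmult_le_pos; [repeat apply Rmult_le_pos; lra|]. nra.
Qed.

(** The Carleson embedding in differential form. The function is exp(h) with h = -v + q ln(|f|^2 +
    eps); since the logarithm is subharmonic, h has Laplacian at least that of -v, and the squared
    gradient of h only helps. *)
Lemma pot_pow (f Af Ag : Cx -> Cx) (v vx vy : Cx -> R) (q eps K : R) : hol f Af ->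
  smooth v vx vy (fun z => - (2 * n2 (Ag z))) -> (forall z, inD z -> 0 <= v z <= K) -> 0 < eps -> 0 < q ->
  exists ux uy L, smooth (fun z => exp (- v z) * Rpower (n2 (f z) + eps) q) ux uy L /\
  forall z, inD z -> exp (- K) * Rpower (n2 (f z) + eps) q * (2 * n2 (Ag z)) <= L z.
Proof.
  intros H Hv HK He Hq.
  assert (Hl : forall z, inD z -> eps <= n2 (f z) + eps) by (intros z _; pose proof (n2_ge0 (f z)); lra).
  pose proof (smooth_exp _ _ _ _ (smooth_add _ _ _ _ _ _ _ _ (smooth_scal (-1) _ _ _ _ Hv)
    (smooth_scal q _ _ _ _ (smooth_ln eps _ _ _ _ He Hl (smooth_n2_eps f Af eps H))))) as S. cbv beta in S.
  eexists; eexists; eexists; split.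
  - eapply smooth_ext; [|reflexivity|reflexivity|reflexivity|exact S].
    intros z. simpl. rewrite exp_plus. unfold Rpower. f_equal. f_equal. ring.
  - intros z Hz. cbv beta. rewrite exp_plus. change (exp (q * ln (n2 (f z) + eps))) with (Rpower (n2 (f z) + eps) q).
    rewrite grad_n2. pose proof (Rpower_pos (n2 (f z) + eps) q). pose proof (n2_ge0 (Ag z)). pose proof (n2_ge0 (Af z)). pose proof (n2_ge0 (f z)).
    pose proof (frac_bounds _ _ (n2_ge0 (f z)) He) as Fr.
    assert (I : 0 < / (n2 (f z) + eps)) by (apply Rinv_0_lt_compat; lra).
    assert (Ev : exp (- K) <= exp (-1 * v z)).
    { specialize (HK z Hz). destruct (Req_dec (- K) (-1 * v z)) as [->|]; [lra|left; apply exp_increasing; lra]. }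
    apply Rle_trans with (exp (-1 * v z) * Rpower (n2 (f z) + eps) q * (2 * n2 (Ag z))).
    { apply Rmult_le_compat_r; [lra|]. apply Rmult_le_compat_r; lra. }
    apply Rmult_le_compat_l; [apply Rmult_le_pos; [left; apply exp_pos|lra]|].
    match goal with |- _ <= _ + (?s * ?s + ?t * ?t) / 2 => pose proof (Rle_0_sqr s); pose proof (Rle_0_sqr t); unfold Rsqr in * end.
    assert (0 <= / (n2 (f z) + eps) * (2 * n2 (Af z)) - / (n2 (f z) + eps) * / (n2 (f z) + eps) * (4 * (n2 (f z) * n2 (Af z))) / 2).
    { replace (/ (n2 (f z) + eps) * (2 * n2 (Af z)) - / (n2 (f z) + eps) * / (n2 (f z) + eps) * (4 * (n2 (f z) * n2 (Af z))) / 2)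
        with (/ (n2 (f z) + eps) * (2 * n2 (Af z)) * (1 - n2 (f z) * / (n2 (f z) + eps))) by (field; lra).
      apply Rmult_le_pos; [apply Rmult_le_pos; lra|lra]. }
    nra.
Qed.

(** For q <= 1 the gradient term of the power is negative and is dropped. The added multiple of
    |f|^2 + eps bounds the negative power q - 1 of the base, even at zeros of F. *)
Lemma pow_concave (F AF f Af : Cx -> Cx) (q al eps : R) : hol F AF -> hol f Af -> 0 < eps -> 0 < al -> 0 < q <= 1 ->
  exists ux uy L, smooth (fun z => Rpower (n2 (F z) + al * (n2 (f z) + eps)) q) ux uy L /\
  forall z, inD z -> L z <= 2 * q * Rpower (al * (n2 (f z) + eps)) (q - 1) * (n2 (AF z) + al * n2 (Af z)).
Proof.
  intros HF Hf He Ha Hq.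
  assert (Hae : 0 < al * eps) by now apply Rmult_lt_0_compat.
  assert (Hl : forall z, inD z -> al * eps <= n2 (F z) + al * (n2 (f z) + eps)).
  { intros z _. pose proof (n2_ge0 (f z)). pose proof (n2_ge0 (F z)). nra. }
  pose proof (smooth_pow q (al * eps) _ _ _ _ Hae Hl
    (smooth_add _ _ _ _ _ _ _ _ (smooth_n2 F AF HF) (smooth_scal al _ _ _ _ (smooth_n2_eps f Af eps Hf)))) as S. cbv beta in S.
  eexists; eexists; eexists; split; [exact S|].
  intros z Hz. cbv beta. specialize (Hl z Hz). set (X := n2 (F z) + al * (n2 (f z) + eps)) in *.
  match goal with |- Rpower X q * (_ + _ * (?s * ?s + ?t * ?t)) <= _ => assert (G : 0 <= s * s + t * t) by (apply Rplus_le_le_0_compat; apply Rle_0_sqr);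
     set (GG := s * s + t * t) in * end.
  assert (I : 0 < / X) by (apply Rinv_0_lt_compat; lra).
  pose proof (Rpower_pos X q). pose proof (n2_ge0 (f z)). pose proof (n2_ge0 (F z)). pose proof (n2_ge0 (AF z)). pose proof (n2_ge0 (Af z)).
  assert (T : q * (q - 1) / 2 * (/ X * / X) * GG <= 0).
  { assert (0 <= (/ X * / X) * GG) by (apply Rmult_le_pos; nra). assert (q * (q - 1) / 2 <= 0) by nra. nra. }
  apply Rle_trans with (Rpower X q * (q * / X * (2 * n2 (AF z) + al * (2 * n2 (Af z))))).
  { apply Rmult_le_compat_l; lra. }
  replace (Rpower X q * (q * / X * (2 * n2 (AF z) + al * (2 * n2 (Af z))))) with
    (2 * q * (Rpower X q * / X) * (n2 (AF z) + al * n2 (Af z))) by ring.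
  rewrite Rpower_div by lra. apply Rmult_le_compat_r; [nra|]. apply Rmult_le_compat_l; [lra|].
  apply Rpower_anti; [lra|]. split; [nra|]. unfold X. lra.
Qed.

Lemma n2_mul (x y : Cx) : n2 (x * y)%X = n2 x * n2 y.
Proof. unfold n2, Cmul, Cre, Cim; simpl. ring. Qed.

Lemma exp_neg_le1 (x : R) : 0 <= x -> exp (- x) <= 1.
Proof. intros H. rewrite <- exp_0. destruct (Req_dec x 0) as [->|]; [rewrite Ropp_0; lra|left; apply exp_increasing; lra]. Qed.

Lemma exp_pot (v K : R) : 0 <= v <= K -> 1 <= exp K * exp (- v).
Proof.
  intros H. rewrite <- exp_plus. rewrite <- exp_0. destruct (Req_dec 0 (K + - v)) as [<-|]; [lra|left; apply exp_increasing; lra].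
Qed.

Lemma exp_KK (K : R) : exp K * exp (- K) = 1.
Proof. rewrite <- exp_plus, Rplus_opp_r. apply exp_0. Qed.

(* With Y = |f|^2 + eps and X = |F|^2 + Y the function Y^q/q + q e^K e^(-v) Y^q - X^q has
   nonnegative Laplacian. *)
Lemma volterra_small (q K : R) : 0 < q <= 1 -> exists C, 0 < C /\
  forall (F f Af Ag : Cx -> Cx) (v vx vy : Cx -> R), hol F (fun z => f z * Ag z)%X -> hol f Af -> F C0 = C0 ->
  smooth v vx vy (fun z => - (2 * n2 (Ag z))) -> (forall z, inD z -> 0 <= v z <= K) ->
  forall eps r, 0 < eps -> 0 <= r < 1 ->
  cm r (fun z => Rpower (n2 (F z) + eps) q) <= C * cm r (fun z => Rpower (n2 (f z) + eps) q).
Proof.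
  intros Hq. pose proof (exp_pos K) as HeK. exists (/ q + q * exp K).
  assert (Hiq : 1 <= / q) by (rewrite <- Rinv_1; apply Rinv_le_contravar; lra).
  split; [nra|]. intros F f Af Ag v vx vy HF Hf F0 Hv HK eps r He Hr.
  destruct (pow_laplacian_lower f Af q eps Hf He Hq) as [u1 [u2 [L1 [S1 B1]]]].
  destruct (pot_pow f Af Ag v vx vy q eps K Hf Hv HK He ltac:(lra)) as [w1 [w2 [L2 [S2 B2]]]].
  destruct (pow_concave F _ f Af q 1 eps HF Hf He ltac:(lra) Hq) as [x1 [x2 [L3 [S3 B3]]]].
  pose proof (smooth_add _ _ _ _ _ _ _ _ (smooth_add _ _ _ _ _ _ _ _ (smooth_scal (/ q) _ _ _ _ S1)
     (smooth_scal (q * exp K) _ _ _ _ S2)) (smooth_scal (-1) _ _ _ _ S3)) as S.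
  pose proof (smooth_circont _ _ _ _ r S1 Hr) as K1. pose proof (smooth_circont _ _ _ _ r S2 Hr) as K2.
  pose proof (smooth_circont _ _ _ _ r S3 Hr) as K3.
  pose proof (cm_nondecr _ _ _ _ S) as M. cbv beta in M.
  assert (HL : forall z, inD z -> 0 <= / q * L1 z + q * exp K * L2 z + -1 * L3 z).
  { intros z Hz. specialize (B1 z Hz). specialize (B2 z Hz). specialize (B3 z Hz).
    rewrite n2_mul, !Rmult_1_l in B3. set (Y := n2 (f z) + eps) in *.
    pose proof (n2_ge0 (f z)). pose proof (n2_ge0 (Ag z)). pose proof (n2_ge0 (Af z)).
    pose proof (Rpower_pos Y (q - 1)). pose proof (Rpower_pos Y q).
    assert (EY : Rpower Y q = Rpower Y (q - 1) * Y).
    { rewrite <- (Rpower_1 Y) at 3 by (unfold Y; lra). rewrite <- Rpower_plus. f_equal. ring. }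
    apply (Rmult_le_compat_l (/ q)) in B1; [|lra].
    replace (/ q * (2 * q * q * Rpower Y (q - 1) * n2 (Af z))) with (2 * q * Rpower Y (q - 1) * n2 (Af z)) in B1 by (field; lra).
    apply (Rmult_le_compat_l (q * exp K)) in B2; [|apply Rmult_le_pos; lra].
    replace (q * exp K * (exp (- K) * Rpower Y q * (2 * n2 (Ag z)))) with (exp K * exp (- K) * (2 * q * Rpower Y q * n2 (Ag z))) in B2 by ring.
    rewrite exp_KK, Rmult_1_l, EY in B2.
    assert (2 * q * Rpower Y (q - 1) * (n2 (f z) * n2 (Ag z)) <= 2 * q * (Rpower Y (q - 1) * Y) * n2 (Ag z)).
    { replace (2 * q * (Rpower Y (q - 1) * Y) * n2 (Ag z)) with (2 * q * Rpower Y (q - 1) * (Y * n2 (Ag z))) by ring.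
      apply Rmult_le_compat_l; [repeat apply Rmult_le_pos; lra|]. apply Rmult_le_compat_r; [lra|]. unfold Y; lra. }
    lra. }
  (* The comparison starts at radius 0, where F(0) = 0 gives X = Y; as 1 <= 1/q, the value there is
     nonnegative. *)
  specialize (M HL 0 r ltac:(lra) ltac:(lra)). rewrite cm_0 in M. rewrite F0 in M.
  rewrite !cm_add, !cm_scal in M by (repeat first [assumption | apply circont_add | apply circont_scal]).
  assert (D0 : inD C0) by (unfold inD; rewrite Cnorm_0; lra).
  replace (n2 C0 + 1 * (n2 (f C0) + eps)) with (n2 (f C0) + eps) in M by (unfold n2, C0, Cre, Cim; simpl; ring).
  pose proof (Rpower_pos (n2 (f C0) + eps) q) as P0.
  assert (0 <= q * exp K * (exp (- v C0) * Rpower (n2 (f C0) + eps) q)).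
  { pose proof (exp_pos (- v C0)). apply Rmult_le_pos; [nra|]. nra. }
  assert (P1 : 1 * Rpower (n2 (f C0) + eps) q <= / q * Rpower (n2 (f C0) + eps) q) by (apply Rmult_le_compat_r; lra).
  assert (Q1 : cm r (fun z => exp (- v z) * Rpower (n2 (f z) + eps) q) <= cm r (fun z => Rpower (n2 (f z) + eps) q)).
  { apply cm_le; [assumption|assumption|]. intros t. assert (Hz : inD (circ r t)) by (unfold inD; rewrite Cnorm_circ; lra).
    pose proof (exp_neg_le1 _ (proj1 (HK _ Hz))). pose proof (Rpower_pos (n2 (f (circ r t)) + eps) q). nra. }
  apply (Rmult_le_compat_l (q * exp K)) in Q1; [|nra].
  assert (Q2 : cm r (fun z => Rpower (n2 (F z) + eps) q) <= cm r (fun z => Rpower (n2 (F z) + 1 * (n2 (f z) + eps)) q)).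
  { destruct (pow_subharmonic F _ q eps HF He ltac:(lra)) as [y1 [y2 [L4 [S4 _]]]].
    apply cm_le; [now apply (smooth_circont _ _ _ _ r S4)|assumption|]. intros t.
    pose proof (n2_ge0 (F (circ r t))). pose proof (n2_ge0 (f (circ r t))). apply Rpower_le_l; lra. }
  lra.
Qed.

(* Here the function is q^2 e^K e^(-v) (eta X^q + eta^(1-q) Y^q) - X^q with X = |F|^2 + eps;
   the first term is absorbed for small eta. *)
Lemma volterra_large (q K : R) : 1 <= q -> exists C, 0 < C /\
  forall (F f Af Ag : Cx -> Cx) (v vx vy : Cx -> R), hol F (fun z => f z * Ag z)%X -> hol f Af -> F C0 = C0 ->
  smooth v vx vy (fun z => - (2 * n2 (Ag z))) -> (forall z, inD z -> 0 <= v z <= K) ->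
  forall eps r, 0 < eps -> 0 <= r < 1 ->
  cm r (fun z => Rpower (n2 (F z) + eps) q) <= C * cm r (fun z => Rpower (n2 (f z) + eps) q).
Proof.
  (* This eta makes q^2 e^K' eta = 1/2, so half of the left side absorbs the first term. K' = max K
     0 ensures eta <= 1, so that the factor eta^(1-q) is at least 1. *)
  intros Hq. pose proof (exp_pos K) as HeK. set (eta := / (2 * q * q * exp (Rmax K 0))).
  set (K' := Rmax K 0) in *. assert (HK' : 0 <= K') by apply Rmax_r. assert (HKK : K <= K') by apply Rmax_l.
  pose proof (exp_pos K') as HeK'.
  assert (HeK1 : 1 <= exp K') by (rewrite <- exp_0; destruct (Req_dec 0 K') as [<-|]; [lra|left; apply exp_increasing; lra]).
  assert (Hqq : 1 <= q * q) by nra.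
  assert (Hden : 1 <= 2 * q * q * exp K') by nra.
  assert (Heta : 0 < eta) by (apply Rinv_0_lt_compat; lra).
  assert (Heta1 : eta <= 1) by (unfold eta; rewrite <- Rinv_1; apply Rinv_le_contravar; lra).
  assert (Eeta : q * q * exp K' * eta = 1 / 2) by (unfold eta; field; lra).
  set (D := q * q * exp K' * Rpower eta (1 - q)).
  assert (HD : 1 <= Rpower eta (1 - q)) by (apply Rpower_ge1; lra).
  assert (HD1 : q * q * exp K' <= D) by (unfold D; nra).
  exists (2 * D). split; [nra|]. intros F f Af Ag v vx vy HF Hf F0 Hv HKv0 eps r He Hr.
  assert (HKv : forall z, inD z -> 0 <= v z <= K') by (intros z Hz; specialize (HKv0 z Hz); lra).
  destruct (pow_laplacian_upper F _ q eps HF He Hq) as [u1 [u2 [L1 [S1 B1]]]].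
  destruct (pot_pow f Af Ag v vx vy q eps K' Hf Hv HKv He ltac:(lra)) as [w1 [w2 [L2 [S2 B2]]]].
  destruct (pot_pow F _ Ag v vx vy q eps K' HF Hv HKv He ltac:(lra)) as [x1 [x2 [L3 [S3 B3]]]].
  destruct (pow_subharmonic f _ q eps Hf He ltac:(lra)) as [y1 [y2 [L4 [S4 _]]]].
  pose proof (smooth_add _ _ _ _ _ _ _ _ (smooth_add _ _ _ _ _ _ _ _ (smooth_scal (q * q * exp K' * eta) _ _ _ _ S3)
     (smooth_scal D _ _ _ _ S2)) (smooth_scal (-1) _ _ _ _ S1)) as S.
  pose proof (smooth_circont _ _ _ _ r S1 Hr) as K1. pose proof (smooth_circont _ _ _ _ r S2 Hr) as K2.
  pose proof (smooth_circont _ _ _ _ r S3 Hr) as K3. pose proof (smooth_circont _ _ _ _ r S4 Hr) as K4.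
  pose proof (cm_nondecr _ _ _ _ S) as M. cbv beta in M.
  assert (HL : forall z, inD z -> 0 <= q * q * exp K' * eta * L3 z + D * L2 z + -1 * L1 z).
  { intros z Hz. specialize (B1 z Hz). specialize (B2 z Hz). specialize (B3 z Hz). cbv beta in B1. rewrite n2_mul in B1.
    set (Y := n2 (f z) + eps) in *. set (X := n2 (F z) + eps) in *.
    pose proof (n2_ge0 (f z)). pose proof (n2_ge0 (F z)). pose proof (n2_ge0 (Ag z)).
    pose proof (young_prod X Y q eta ltac:(unfold X; lra) ltac:(unfold Y; lra) Hq Heta) as Yg.
    apply (Rmult_le_compat_l (q * q * exp K' * eta)) in B3; [|lra].
    apply (Rmult_le_compat_l D) in B2; [|nra].
    replace (q * q * exp K' * eta * (exp (- K') * Rpower X q * (2 * n2 (Ag z)))) with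
      (exp K' * exp (- K') * (2 * q * q * n2 (Ag z) * (eta * Rpower X q))) in B3 by ring.
    replace (D * (exp (- K') * Rpower Y q * (2 * n2 (Ag z)))) with
      (exp K' * exp (- K') * (2 * q * q * n2 (Ag z) * (Rpower eta (1 - q) * Rpower Y q))) in B2 by (unfold D; ring).
    rewrite exp_KK, Rmult_1_l in B2, B3.
    assert (Hg : 0 <= 2 * q * q * n2 (Ag z)) by (repeat apply Rmult_le_pos; lra).
    apply (Rmult_le_compat_l _ _ _ Hg) in Yg.
    assert (2 * q * q * Rpower X (q - 1) * (n2 (f z) * n2 (Ag z)) <= 2 * q * q * n2 (Ag z) * (Rpower X (q - 1) * Y)).
    { replace (2 * q * q * Rpower X (q - 1) * (n2 (f z) * n2 (Ag z))) with (2 * q * q * n2 (Ag z) * (Rpower X (q - 1) * n2 (f z))) by ring.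
      apply Rmult_le_compat_l; [assumption|]. apply Rmult_le_compat_l; [left; apply Rpower_pos|unfold Y; lra]. }
    lra. }
  specialize (M HL 0 r ltac:(lra) ltac:(lra)). rewrite cm_0 in M. rewrite F0 in M.
  rewrite !cm_add, !cm_scal in M by (repeat first [assumption | apply circont_add | apply circont_scal]).
  rewrite Eeta in M.
  assert (D0 : inD C0) by (unfold inD; rewrite Cnorm_0; lra).
  replace (n2 C0 + eps) with eps in M by (unfold n2, C0, Cre, Cim; simpl; ring).
  pose proof (Rpower_pos eps q) as P0. pose proof (exp_pos (- v C0)).
  assert (P1 : Rpower eps q <= D * (exp (- v C0) * Rpower (n2 (f C0) + eps) q)).
  { pose proof (exp_pot _ _ (HKv _ D0)) as Ep. pose proof (n2_ge0 (f C0)).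
    assert (Rpower eps q <= Rpower (n2 (f C0) + eps) q) by (apply Rpower_le_l; lra).
    assert (1 <= D * exp (- v C0)) by nra. nra. }
  assert (Q0 : 0 <= 1 / 2 * (exp (- v C0) * Rpower eps q)) by (apply Rmult_le_pos; nra).
  assert (Ex : forall (G : Cx -> Cx), circont r (fun z => exp (- v z) * Rpower (n2 (G z) + eps) q) -> circont r (fun z => Rpower (n2 (G z) + eps) q) ->
     cm r (fun z => exp (- v z) * Rpower (n2 (G z) + eps) q) <= cm r (fun z => Rpower (n2 (G z) + eps) q)).
  { intros G G1 G2. apply cm_le; [assumption|assumption|]. intros t. assert (Hz : inD (circ r t)) by (unfold inD; rewrite Cnorm_circ; lra).
    pose proof (exp_neg_le1 _ (proj1 (HKv _ Hz))). pose proof (Rpower_pos (n2 (G (circ r t)) + eps) q). nra. }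
  pose proof (Ex F K3 K1) as Q1. pose proof (Ex f K2 K4) as Q2.
  apply (Rmult_le_compat_l D) in Q2; [|nra]. lra.
Qed.

(** * From regularised powers of dilates to circle means *)

Lemma pw_n2 (q : R) (F : Cx -> Cx) (z : Cx) : pw (2 * q) F z = rpow (n2 (F z)) q.
Proof. unfold pw. rewrite n2_norm. symmetry. apply rpow_half_sqr, Cnorm_ge0. Qed.

Lemma rpow_le_Rpower (x y q : R) : 0 <= q -> x <= y -> 0 < y -> rpow x q <= Rpower y q.
Proof. intros Hq H Hy. rewrite <- rpow_pos_eq by assumption. now apply rpow_le. Qed.

Lemma rpow_add_le (x y q : R) : 0 <= q -> 0 <= x -> 0 <= y -> rpow (x + y) q <= Rpower 2 q * (rpow x q + rpow y q).
Proof.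
  intros Hq Hx Hy. rewrite <- (rpow_pos_eq 2) by lra. pose proof (rpow_ge0 x q). pose proof (rpow_ge0 y q). pose proof (rpow_ge0 2 q).
  destruct (Rle_lt_dec x y).
  - apply Rle_trans with (rpow (2 * y) q); [apply rpow_le; lra|]. rewrite rpow_mult by lra. nra.
  - apply Rle_trans with (rpow (2 * x) q); [apply rpow_le; lra|]. rewrite rpow_mult by lra. nra.
Qed.

Definition primitive (a b c : nat -> Cx) : Prop :=
  absum a /\ absum c /\ PS c C0 = C0 /\ forall z, inD z -> PS1 c z = (PS a z * PS1 b z)%X.

Lemma inD_dilate (rho : R) (z : Cx) : 0 <= rho <= 1 -> inD z -> inD (RtoC rho * z)%X.
Proof.
  intros Hr Hz. unfold inD in *. rewrite Cnorm_mul, Cnorm_RtoC, Rabs_pos_eq by lra. pose proof (Cnorm_ge0 z). nra.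
Qed.

Lemma primitive_hol (a b c : nat -> Cx) (rho : R) : primitive a b c -> 0 <= rho <= 1 ->
  hol (fun z => PS c (RtoC rho * z)%X) (fun z => PS a (RtoC rho * z) * grad b (RtoC rho * z))%X.
Proof.
  intros [Ha [Hc [_ E]]] Hr. apply (hol_ext_der _ (fun z => grad c (RtoC rho * z)%X)); [|now apply hol_dilate].
  intros z Hz. unfold grad. rewrite E by now apply inD_dilate. ring.
Qed.

Lemma C0_dilate (rho : R) : (RtoC rho * C0)%X = C0.
Proof. ring. Qed.

Lemma PS_cc (a : nat -> Cx) (r : R) : absum a -> 0 <= r < 1 -> cc r (PS a).
Proof. intros Ha Hr. now apply (hol_cc _ _ r (hol_PS a Ha)). Qed.

(** The bound holds circle by circle with one constant, because the bound K on the potential does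
    not depend on the dilation. *)
Lemma Tg_bounded (g : Cx -> Cx) (b : nat -> Cx) (p : R) : is_BMOA g -> absum b -> (forall z, inD z -> PS b z = g z) -> 0 < p ->
  exists C, 0 < C /\ forall a c, primitive a b c -> forall r, 0 <= r < 1 ->
  cm r (pw p (PS c)) <= C * cm r (pw p (PS a)).
Proof.
  intros Hg Hb Eb Hp. destruct (BMOA_potential g b Hg Hb Eb) as [K [HK HV]]. set (q := p / 2).
  assert (Hq : 0 < q) by (unfold q; lra). assert (Ep : p = 2 * q) by (unfold q; field).
  assert (V : exists C, 0 < C /\
  forall (F f Af Ag : Cx -> Cx) (v vx vy : Cx -> R), hol F (fun z => f z * Ag z)%X -> hol f Af -> F C0 = C0 ->
  smooth v vx vy (fun z => - (2 * n2 (Ag z))) -> (forall z, inD z -> 0 <= v z <= K) ->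
  forall eps r, 0 < eps -> 0 <= r < 1 ->
  cm r (fun z => Rpower (n2 (F z) + eps) q) <= C * cm r (fun z => Rpower (n2 (f z) + eps) q)).
  { destruct (Rle_lt_dec q 1); [apply volterra_small; lra|apply volterra_large; lra]. }
  destruct V as [C [HC V]]. pose proof (Rpower_pos 2 q) as H2.
  exists (C * Rpower 2 q). split; [now apply Rmult_lt_0_compat|]. intros a c Hac r Hr.
  pose proof Hac as [Ha [Hc [Hc0 _]]].
  (* The circle of radius s for the dilates by rho is the circle of radius r = rho s for the
     functions themselves. *)
  set (rho := (1 + r) / 2). assert (Hrho : 0 < rho < 1 /\ r < rho) by (unfold rho; lra).
  set (s := r / rho). assert (Hs : 0 <= s < 1).
  { unfold s. split; [apply Rmult_le_pos; [lra|left; apply Rinv_0_lt_compat; lra]|].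
    apply Rmult_lt_reg_r with rho; [lra|]. replace (r / rho * rho) with r by (field; lra). lra. }
  assert (Es : rho * s = r) by (unfold s; field; lra).
  destruct (HV rho ltac:(lra)) as [v [vx [vy [Sv Bv]]]].
  assert (H : forall eps, 0 < eps -> cm r (pw p (PS c)) <= C * Rpower 2 q * cm r (pw p (PS a)) + C * Rpower 2 q * rpow eps q).
  { intros eps He.
    pose proof (V _ _ _ _ v vx vy (primitive_hol a b c rho Hac ltac:(lra)) (hol_dilate a rho Ha ltac:(lra))) as W.
    cbv beta in W. rewrite C0_dilate in W. specialize (W Hc0 Sv Bv eps s He Hs).
    rewrite (cm_dilate s rho (fun z => Rpower (n2 (PS c z) + eps) q)), (cm_dilate s rho (fun z => Rpower (n2 (PS a z) + eps) q)), Es in W.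
    destruct (pow_subharmonic (PS c) _ q eps (hol_PS c Hc) He Hq) as [y1 [y2 [L4 [S4 _]]]].
    destruct (pow_subharmonic (PS a) _ q eps (hol_PS a Ha) He Hq) as [x1 [x2 [L5 [S5 _]]]].
    pose proof (smooth_circont _ _ _ _ r S4 Hr) as K4. pose proof (smooth_circont _ _ _ _ r S5 Hr) as K5.
    assert (Kc : circont r (pw p (PS c))) by (apply cc_pw; [assumption|now apply PS_cc]).
    assert (Ka : circont r (pw p (PS a))) by (apply cc_pw; [assumption|now apply PS_cc]).
    assert (W1 : cm r (pw p (PS c)) <= cm r (fun z => Rpower (n2 (PS c z) + eps) q)).
    { apply cm_le; [assumption|assumption|]. intros t. rewrite Ep, pw_n2. pose proof (n2_ge0 (PS c (circ r t))).
      apply rpow_le_Rpower; lra. }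
    assert (W2 : cm r (fun z => Rpower (n2 (PS a z) + eps) q) <= Rpower 2 q * cm r (pw p (PS a)) + Rpower 2 q * rpow eps q).
    { rewrite <- (cm_const r (Rpower 2 q * rpow eps q)). rewrite <- cm_scal by assumption.
      rewrite <- cm_add by first [now apply circont_scal | apply circont_const].
      apply cm_le; [assumption|apply circont_add; [now apply circont_scal|apply circont_const]|].
      intros t. rewrite Ep, pw_n2. pose proof (n2_ge0 (PS a (circ r t))).
      rewrite <- rpow_pos_eq by lra. rewrite <- Rmult_plus_distr_l. apply rpow_add_le; lra. }
    apply (Rmult_le_compat_l C) in W2; [|lra]. lra. }
  (* The regularisation is chosen with D eps^q = eta. *)
  apply le_epsilon. intros eta He. set (D := C * Rpower 2 q) in *. assert (HD : 0 < D) by (unfold D; nra).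
  specialize (H (Rpower (eta / D) (1 / q)) (Rpower_pos _ _)).
  assert (Hed : 0 < eta / D) by now apply Rdiv_lt_0_compat.
  rewrite <- (rpow_pos_eq (eta / D)), rpow_inv' in H by lra. replace (D * (eta / D)) with eta in H by (field; lra). lra.
Qed.

(** Each term on the right pays for one part of the Laplacian of X^q, X = |F|^2 + al Y, Y = |f|^2 +
    1: the power Y^q for |f'|^2, and for |f|^2 |g'|^2 Y^(q-1) <= (kap Y^P + Ck) |g'|^2 the function
    e^(-v) Y^P and |G|^2. The last enters through its increment only, which is small for r near 1;
    the others have coefficients that al and kap make small. *)
Lemma volterra_weak (q P K al kap Ck : R) (F f Af G Ag : Cx -> Cx) (v vx vy : Cx -> R) :
  0 < q <= 1 -> 0 < P -> 0 < al -> 0 < kap -> 0 < Ck ->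
  (forall y, 0 < y -> Rpower y q <= kap * Rpower y P + Ck) ->
  hol F (fun z => f z * Ag z)%X -> hol f Af -> hol G Ag ->
  smooth v vx vy (fun z => - (2 * n2 (Ag z))) -> (forall z, inD z -> 0 <= v z <= K) ->
  forall r s, 0 <= r <= s -> s < 1 ->
  let T := Rpower al (q - 1) in
  cm s (fun z => Rpower (n2 (F z) + al * (n2 (f z) + 1)) q) <=
    cm r (fun z => Rpower (n2 (F z) + al * (n2 (f z) + 1)) q)
    + T * al / q * cm s (fun z => Rpower (n2 (f z) + 1) q)
    + q * T * kap * exp K * cm s (fun z => Rpower (n2 (f z) + 1) P)
    + q * T * Ck * (cm s (fun z => n2 (G z)) - cm r (fun z => n2 (G z))).
Proof.
  intros Hq HP Hal Hkap HCk Yg HF Hf HG Hv HK r s Hrs Hs1 T.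
  assert (HT : 0 < T) by apply Rpower_pos. pose proof (exp_pos K) as HeK.
  destruct (pow_laplacian_lower f Af q 1 Hf ltac:(lra) Hq) as [u1 [u2 [L1 [S1 B1]]]].
  destruct (pot_pow f Af Ag v vx vy P 1 K Hf Hv HK ltac:(lra) HP) as [w1 [w2 [L2 [S2 B2]]]].
  destruct (pow_concave F _ f Af q al 1 HF Hf ltac:(lra) Hal Hq) as [x1 [x2 [L3 [S3 B3]]]].
  destruct (pow_subharmonic f _ P 1 Hf ltac:(lra) HP) as [y1 [y2 [L4 [S4 _]]]].
  pose proof (smooth_n2 G Ag HG) as S5.
  set (k1 := T * al / q). set (k2 := q * T * kap * exp K). set (k3 := q * T * Ck).
  assert (Hk1 : 0 < k1) by (unfold k1; apply Rdiv_lt_0_compat; [apply Rmult_lt_0_compat|]; lra).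
  assert (Hk2 : 0 < k2) by (unfold k2; repeat apply Rmult_lt_0_compat; lra).
  assert (Hk3 : 0 < k3) by (unfold k3; repeat apply Rmult_lt_0_compat; lra).
  pose proof (smooth_add _ _ _ _ _ _ _ _ (smooth_add _ _ _ _ _ _ _ _ (smooth_scal k1 _ _ _ _ S1)
     (smooth_add _ _ _ _ _ _ _ _ (smooth_scal k2 _ _ _ _ S2) (smooth_scal k3 _ _ _ _ S5))) (smooth_scal (-1) _ _ _ _ S3)) as S.
  pose proof (cm_nondecr _ _ _ _ S) as M. cbv beta in M.
  assert (HL : forall z, inD z -> 0 <= k1 * L1 z + (k2 * L2 z + k3 * (2 * n2 (Ag z))) + -1 * L3 z).
  { intros z Hz. specialize (B1 z Hz). specialize (B2 z Hz). specialize (B3 z Hz). cbv beta in B3.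
    rewrite n2_mul in B3. set (Y := n2 (f z) + 1) in *.
    pose proof (n2_ge0 (f z)). pose proof (n2_ge0 (Ag z)). pose proof (n2_ge0 (Af z)).
    assert (HY : 0 < Y) by (unfold Y; lra). specialize (Yg Y HY).
    pose proof (Rpower_pos Y (q - 1)). pose proof (Rpower_pos Y q).
    assert (EY : Rpower Y q = Rpower Y (q - 1) * Y).
    { rewrite <- (Rpower_1 Y) at 3 by assumption. rewrite <- Rpower_plus. f_equal. ring. }
    rewrite <- Rpower_mult_distr in B3 by assumption. fold T in B3.
    apply (Rmult_le_compat_l k1) in B1; [|lra].
    replace (k1 * (2 * q * q * Rpower Y (q - 1) * n2 (Af z))) with (2 * q * (T * Rpower Y (q - 1)) * (al * n2 (Af z))) in B1 by (unfold k1; field; lra).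
    apply (Rmult_le_compat_l k2) in B2; [|lra].
    replace (k2 * (exp (- K) * Rpower Y P * (2 * n2 (Ag z)))) with (exp K * exp (- K) * (2 * q * T * n2 (Ag z) * (kap * Rpower Y P))) in B2 by (unfold k2; ring).
    rewrite exp_KK, Rmult_1_l in B2.
    assert (Hg : 0 <= 2 * q * T * n2 (Ag z)) by (repeat apply Rmult_le_pos; lra).
    apply (Rmult_le_compat_l _ _ _ Hg) in Yg. rewrite EY in Yg.
    assert (2 * q * (T * Rpower Y (q - 1)) * (n2 (f z) * n2 (Ag z)) <= 2 * q * T * n2 (Ag z) * (Rpower Y (q - 1) * Y)).
    { replace (2 * q * (T * Rpower Y (q - 1)) * (n2 (f z) * n2 (Ag z))) with (2 * q * T * n2 (Ag z) * (Rpower Y (q - 1) * n2 (f z))) by ring.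
      apply Rmult_le_compat_l; [assumption|]. apply Rmult_le_compat_l; [lra|unfold Y; lra]. }
    replace (k3 * (2 * n2 (Ag z))) with (2 * q * T * n2 (Ag z) * Ck) by (unfold k3; ring). lra. }
  specialize (M HL r s Hrs Hs1).
  assert (Kc : forall t, t = r \/ t = s -> 0 <= t < 1) by (intros t [->| ->]; lra).
  assert (E : forall t, t = r \/ t = s -> cm t (fun z => k1 * Rpower (n2 (f z) + 1) q + (k2 * (exp (- v z) * Rpower (n2 (f z) + 1) P) + k3 * n2 (G z)) +
      -1 * Rpower (n2 (F z) + al * (n2 (f z) + 1)) q) =
      k1 * cm t (fun z => Rpower (n2 (f z) + 1) q) + (k2 * cm t (fun z => exp (- v z) * Rpower (n2 (f z) + 1) P) + k3 * cm t (fun z => n2 (G z)))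
      + -1 * cm t (fun z => Rpower (n2 (F z) + al * (n2 (f z) + 1)) q)).
  { intros t Ht. specialize (Kc t Ht).
    pose proof (smooth_circont _ _ _ _ t S1 Kc). pose proof (smooth_circont _ _ _ _ t S2 Kc).
    pose proof (smooth_circont _ _ _ _ t S3 Kc). pose proof (smooth_circont _ _ _ _ t S5 Kc).
    rewrite (cm_add t (fun z => k1 * Rpower (n2 (f z) + 1) q + (k2 * (exp (- v z) * Rpower (n2 (f z) + 1) P) + k3 * n2 (G z))))
      by (repeat first [assumption | apply circont_add | apply circont_scal]).
    rewrite (cm_add t (fun z => k1 * Rpower (n2 (f z) + 1) q)) by (repeat first [assumption | apply circont_add | apply circont_scal]).
    rewrite (cm_add t (fun z => k2 * (exp (- v z) * Rpower (n2 (f z) + 1) P))) by (repeat first [assumption | apply circont_scal]).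
    rewrite !(cm_scal t) by assumption. reflexivity. }
  rewrite (E r), (E s) in M by tauto.
  (* The terms at radius r that are nonnegative and have a favourable sign are dropped. *)
  assert (N1 : 0 <= cm r (fun z => Rpower (n2 (f z) + 1) q)).
  { apply cm_ge0; [apply (smooth_circont _ _ _ _ r S1); lra|intros; left; apply Rpower_pos]. }
  assert (N2 : 0 <= cm r (fun z => exp (- v z) * Rpower (n2 (f z) + 1) P)).
  { apply cm_ge0; [apply (smooth_circont _ _ _ _ r S2); lra|]. intros. apply Rmult_le_pos; left; [apply exp_pos|apply Rpower_pos]. }
  assert (N3 : cm s (fun z => exp (- v z) * Rpower (n2 (f z) + 1) P) <= cm s (fun z => Rpower (n2 (f z) + 1) P)).
  { apply cm_le; [apply (smooth_circont _ _ _ _ s S2); lra|apply (smooth_circont _ _ _ _ s S4); lra|].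
    intros t. assert (Hz : inD (circ s t)) by (unfold inD; rewrite Cnorm_circ; lra).
    pose proof (exp_neg_le1 _ (proj1 (HK _ Hz))). pose proof (Rpower_pos (n2 (f (circ s t)) + 1) P). nra. }
  apply (Rmult_le_compat_l k1) in N1; [|lra]. apply (Rmult_le_compat_l k2) in N2; [|lra]. apply (Rmult_le_compat_l k2) in N3; [|lra].
  rewrite Rmult_0_r in N1, N2. lra.
Qed.

(** Since |g|^2 + v is harmonic for each dilate, the H^2 means of g are at most |g(0)|^2 + K. Their
    supremum is finite, and R0 is taken where it is nearly attained. *)
Lemma BMOA_H2 (g : Cx -> Cx) (b : nat -> Cx) : is_BMOA g -> absum b -> (forall z, inD z -> PS b z = g z) ->
  forall delta, 0 < delta -> exists R0, 0 <= R0 < 1 /\ forall s, R0 <= s < 1 ->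
    cm s (fun z => n2 (PS b z)) - cm R0 (fun z => n2 (PS b z)) <= delta.
Proof.
  intros Hg Hb Eb delta Hd. destruct (BMOA_potential g b Hg Hb Eb) as [K [HK HV]].
  set (mu := fun s => cm s (fun z => n2 (PS b z))).
  assert (Bd : forall s, 0 <= s < 1 -> mu s <= n2 (PS b C0) + K).
  { intros s Hs. set (rho := (1 + s) / 2). assert (Hrho : 0 < rho < 1 /\ s < rho) by (unfold rho; lra).
    set (t := s / rho). assert (Ht : 0 <= t < 1).
    { unfold t. split; [apply Rmult_le_pos; [lra|left; apply Rinv_0_lt_compat; lra]|].
      apply Rmult_lt_reg_r with rho; [lra|]. replace (s / rho * rho) with s by (field; lra). lra. }
    assert (Es : rho * t = s) by (unfold t; field; lra).
    destruct (HV rho ltac:(lra)) as [v [vx [vy [Sv Bv]]]].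
    pose proof (smooth_n2 _ _ (hol_dilate b rho Hb ltac:(lra))) as Sn.
    pose proof (smooth_add _ _ _ _ _ _ _ _ Sn Sv) as S.
    assert (S' : exists ux uy, smooth (fun z => n2 (PS b (RtoC rho * z)%X) + v z) ux uy (fun _ => 0)).
    { eexists; eexists. eapply smooth_ext; [reflexivity|reflexivity|reflexivity| |exact S]. intros; simpl; ring. }
    destruct S' as [ux [uy S']].
    pose proof (cm_harmonic _ _ _ t S' Ht) as E. cbv beta in E.
    rewrite cm_add in E by (try (apply (smooth_circont _ _ _ _ t Sn Ht)); apply (smooth_circont _ _ _ _ t Sv Ht)).
    rewrite (cm_dilate t rho (fun z => n2 (PS b z))), Es, C0_dilate in E. fold (mu s) in E.
    assert (D0 : inD C0) by (unfold inD; rewrite Cnorm_0; lra). pose proof (Bv _ D0).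
    assert (0 <= cm t v).
    { apply cm_ge0; [apply (smooth_circont _ _ _ _ t Sv Ht)|]. intros x. apply Bv. unfold inD. rewrite Cnorm_circ; lra. }
    lra. }
  destruct (completeness (fun y => exists s, 0 <= s < 1 /\ y = mu s)) as [l [Hu Hl]].
  - exists (n2 (PS b C0) + K). intros y [s [Hs ->]]. now apply Bd.
  - exists (mu 0), 0. split; [lra|reflexivity].
  - destruct (classic (exists s, 0 <= s < 1 /\ l - delta < mu s)) as [[s [Hs Hms]]|N].
    + exists s. split; [assumption|]. intros t Ht. fold (mu t) (mu s).
      assert (mu t <= l) by (apply Hu; exists t; split; [lra|reflexivity]). lra.
    + assert (l <= l - delta); [|lra]. apply Hl. intros y [s [Hs ->]].
      destruct (Rle_lt_dec (mu s) (l - delta)); [assumption|]. destruct N. now exists s.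
Qed.

(** On |z| <= R0 smallness is the hypothesis; [volterra_weak] carries it from the circle of radius
    R0 to all larger ones. *)
Lemma Tg_weak (g : Cx -> Cx) (b : nat -> Cx) (p B : R) : is_BMOA g -> absum b -> (forall z, inD z -> PS b z = g z) ->
  1 <= p -> 0 <= B -> forall a c : nat -> nat -> Cx, (forall n, primitive (a n) b (c n)) ->
  (forall n, hp p (PS (a n)) B) ->
  (forall R0 eta, 0 <= R0 < 1 -> 0 < eta -> exists N, forall n, (n >= N)%nat -> forall z, Cnorm z <= R0 ->
     n2 (PS (a n) z) <= eta /\ n2 (PS (c n) z) <= eta) ->
  forall eta, 0 < eta -> exists N, forall n, (n >= N)%nat -> forall s, 0 <= s < 1 -> cm s (pw (1 / 2) (PS (c n))) <= eta.
Proof.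
  intros Hg Hb Eb Hp HB a c Hac Hhp Hsm eta Heta.
  destruct (BMOA_potential g b Hg Hb Eb) as [K [HK HV]]. pose proof (exp_pos K) as HeK.
  (* The exponent 1/4 of |F|^2 is the exponent 1/2 of |F|; it is below P because p >= 1, as
     [young_split] requires. *)
  set (q := 1 / 4). set (P := p / 2). assert (HP : 1 / 2 <= P) by (unfold P; lra).
  set (B' := Rpower 2 P * (B + 1)). assert (HB' : 0 < B') by (unfold B'; pose proof (Rpower_pos 2 P); nra).
  set (D := Rpower 3 q + B' / q). assert (HD : 0 < D) by (unfold D, q; pose proof (Rpower_pos 3 (1 / 4)); lra).
  (* The order of choices matters: al first, then kap, which fixes Ck, then delta, then R0 and
     finally N. The terms of [volterra_weak] then contribute three quarters of eta. The 3 in D comes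
     from |F|^2 <= al and |f|^2 <= 1 on |z| <= R0. *)
  set (al := Rpower (eta / (4 * D)) (1 / q)). assert (Hal : 0 < al) by apply Rpower_pos.
  assert (Eal : Rpower al q * D = eta / 4).
  { unfold al. rewrite Rpower_mult. replace (1 / q * q) with 1 by (unfold q; field).
    rewrite Rpower_1 by (apply Rdiv_lt_0_compat; lra). field. lra. }
  pose proof (Rpower_pos al q) as Haq. pose proof (Rpower_pos 3 q) as H3q.
  set (T := Rpower al (q - 1)). assert (HT : 0 < T) by apply Rpower_pos.
  assert (ET : T * al = Rpower al q).
  { unfold T. rewrite <- (Rpower_1 al) at 2 by assumption. rewrite <- Rpower_plus. f_equal. ring. }
  set (kap := eta / (4 * (q * T * exp K * B'))).
  assert (Hq0 : 0 < q) by (unfold q; lra). assert (HqT : 0 < q * T) by now apply Rmult_lt_0_compat.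
  assert (Hk0 : 0 < q * T * exp K * B') by (apply Rmult_lt_0_compat; [apply Rmult_lt_0_compat|]; assumption).
  assert (Hkap : 0 < kap) by (unfold kap; apply Rdiv_lt_0_compat; lra).
  destruct (young_split q P kap) as [Ck [HCk Yg]]; [unfold q; lra|assumption|].
  set (delta := eta / (4 * (q * T * Ck))).
  assert (Hd0 : 0 < q * T * Ck) by now apply Rmult_lt_0_compat.
  assert (Hdelta : 0 < delta) by (unfold delta; apply Rdiv_lt_0_compat; lra).
  destruct (BMOA_H2 g b Hg Hb Eb delta Hdelta) as [R0 [HR0 HH2]].
  destruct (Hsm R0 (Rmin al 1) HR0 ltac:(apply Rmin_pos; lra)) as [N HN].
  pose proof (Rmin_l al 1) as Ml. pose proof (Rmin_r al 1) as Mr.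
  exists N. intros n Hn s Hs. specialize (HN n Hn). pose proof (Hac n) as [Ha [Hc [Hc0 _]]].
  assert (Small : forall z, Cnorm z <= R0 -> Rpower (n2 (PS (c n) z) + al * (n2 (PS (a n) z) + 1)) q <= Rpower al q * Rpower 3 q).
  { intros z Hz. destruct (HN z Hz) as [S1 S2]. pose proof (n2_ge0 (PS (a n) z)). pose proof (n2_ge0 (PS (c n) z)).
    rewrite Rpower_mult_distr by lra. apply Rpower_le_l; [unfold q; lra|]. nra. }
  assert (Pt : forall z, pw (1 / 2) (PS (c n)) z <= Rpower (n2 (PS (c n) z) + al * (n2 (PS (a n) z) + 1)) q).
  { intros z. replace (1 / 2) with (2 * q) by (unfold q; field). rewrite pw_n2.
    pose proof (n2_ge0 (PS (a n) z)). pose proof (n2_ge0 (PS (c n) z)).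
    apply rpow_le_Rpower; [unfold q; lra|nra|nra]. }
  destruct (pow_concave (PS (c n)) _ (PS (a n)) _ q al 1 (hol_PS _ Hc) (hol_PS _ Ha) ltac:(lra) Hal ltac:(unfold q; lra)) as [x1 [x2 [L3 [S3 _]]]].
  assert (Kpw : circont s (pw (1 / 2) (PS (c n)))) by (apply cc_pw; [lra|now apply PS_cc]).
  apply Rle_trans with (cm s (fun z => Rpower (n2 (PS (c n) z) + al * (n2 (PS (a n) z) + 1)) q)).
  { apply cm_le; [assumption|now apply (smooth_circont _ _ _ _ s S3)|]. intros t. apply Pt. }
  assert (Bs : forall t, 0 <= t <= R0 -> cm t (fun z => Rpower (n2 (PS (c n) z) + al * (n2 (PS (a n) z) + 1)) q) <= Rpower al q * Rpower 3 q).
  { intros t Ht. rewrite <- (cm_const t (Rpower al q * Rpower 3 q)).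
    apply cm_le; [apply (smooth_circont _ _ _ _ t S3); lra|apply circont_const|]. intros x. apply Small. rewrite Cnorm_circ; lra. }
  assert (D1 : Rpower al q * Rpower 3 q + Rpower al q * (B' / q) = eta / 4) by (rewrite <- Eal; unfold D; ring).
  assert (D2 : 0 <= Rpower al q * (B' / q)) by (apply Rmult_le_pos; [lra|unfold q; lra]).
  destruct (Rle_lt_dec s R0) as [L|L]; [specialize (Bs s ltac:(lra)); lra|].
  set (rho := (1 + s) / 2). assert (Hrho : 0 < rho < 1 /\ s < rho) by (unfold rho; lra).
  destruct (HV rho ltac:(lra)) as [v [vx [vy [Sv Bv]]]].
  assert (Hdiv : forall x, 0 <= x <= s -> 0 <= x / rho < 1 /\ rho * (x / rho) = x).
  { intros x Hx. split; [|field; lra]. split; [apply Rmult_le_pos; [lra|left; apply Rinv_0_lt_compat; lra]|].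
    apply Rmult_lt_reg_r with rho; [lra|]. replace (x / rho * rho) with x by (field; lra). lra. }
  destruct (Hdiv s ltac:(lra)) as [Hs1 Es]. destruct (Hdiv R0 ltac:(lra)) as [Hr1 Er].
  assert (Hord : R0 / rho <= s / rho) by (apply Rmult_le_compat_r; [left; apply Rinv_0_lt_compat; lra|lra]).
  pose proof (volterra_weak q P K al kap Ck _ _ _ _ _ v vx vy ltac:(unfold q; lra) ltac:(lra) Hal Hkap HCk Yg
     (primitive_hol (a n) b (c n) rho (Hac n) ltac:(lra)) (hol_dilate (a n) rho Ha ltac:(lra)) (hol_dilate b rho Hb ltac:(lra)) Sv Bv
     (R0 / rho) (s / rho) ltac:(lra) ltac:(lra)) as W. cbv beta zeta in W. fold T in W.
  rewrite (cm_dilate _ rho (fun z => Rpower (n2 (PS (c n) z) + al * (n2 (PS (a n) z) + 1)) q)) in W.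
  rewrite (cm_dilate _ rho (fun z => Rpower (n2 (PS (c n) z) + al * (n2 (PS (a n) z) + 1)) q)) in W.
  rewrite (cm_dilate _ rho (fun z => Rpower (n2 (PS (a n) z) + 1) q)), (cm_dilate _ rho (fun z => Rpower (n2 (PS (a n) z) + 1) P)) in W.
  rewrite !(cm_dilate _ rho (fun z => n2 (PS b z))) in W. rewrite Es, Er in W.
  destruct (pow_subharmonic (PS (a n)) _ P 1 (hol_PS _ Ha) ltac:(lra) ltac:(lra)) as [y1 [y2 [L4 [S4 _]]]].
  destruct (pow_subharmonic (PS (a n)) _ q 1 (hol_PS _ Ha) ltac:(lra) ltac:(unfold q; lra)) as [z1 [z2 [L5 [S5 _]]]].
  assert (WP : cm s (fun z => Rpower (n2 (PS (a n) z) + 1) P) <= B').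
  { assert (Ka : circont s (pw p (PS (a n)))) by (apply cc_pw; [lra|now apply PS_cc]).
    apply Rle_trans with (cm s (fun z => Rpower 2 P * pw p (PS (a n)) z + Rpower 2 P)).
    - apply cm_le; [now apply (smooth_circont _ _ _ _ s S4)|apply circont_add; [now apply circont_scal|apply circont_const]|].
      intros t. replace p with (2 * P) at 1 by (unfold P; field). rewrite pw_n2. pose proof (n2_ge0 (PS (a n) (circ s t))).
      rewrite <- rpow_pos_eq by lra. eapply Rle_trans; [apply rpow_add_le; lra|]. rewrite rpow_base1. lra.
    - rewrite cm_add, cm_scal, cm_const; [|assumption|now apply circont_scal|apply circont_const].
      specialize (Hhp n s Hs). pose proof (Rpower_pos 2 P). unfold B'. nra. }
  assert (Wq : cm s (fun z => Rpower (n2 (PS (a n) z) + 1) q) <= B').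
  { eapply Rle_trans; [|exact WP]. apply cm_le; [now apply (smooth_circont _ _ _ _ s S5)|now apply (smooth_circont _ _ _ _ s S4)|].
    intros t. pose proof (n2_ge0 (PS (a n) (circ s t))). apply Rle_Rpower; [lra|unfold q; lra]. }
  specialize (HH2 s ltac:(lra)). specialize (Bs R0 ltac:(lra)).
  apply (Rmult_le_compat_l (T * al / q)) in Wq; [|left; apply Rdiv_lt_0_compat; [now apply Rmult_lt_0_compat|assumption]].
  apply (Rmult_le_compat_l (q * T * kap * exp K)) in WP; [|left; apply Rmult_lt_0_compat; [apply Rmult_lt_0_compat|]; assumption].
  apply (Rmult_le_compat_l (q * T * Ck)) in HH2; [|lra].
  replace (T * al / q * B') with (Rpower al q * (B' / q)) in Wq by (rewrite <- ET; unfold Rdiv; ring).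
  replace (q * T * kap * exp K * B') with (eta / 4) in WP by (unfold kap; field; repeat split; try lra; unfold q; lra).
  replace (q * T * Ck * delta) with (eta / 4) in HH2 by (unfold delta; field; repeat split; try lra; unfold q; lra).
  lra.
Qed.

(** * Uniform integrability *)

Lemma cm_sup_near (u : Cx -> R) (B : R) : (forall s, 0 <= s < 1 -> cm s u <= B) ->
  forall delta, 0 < delta -> exists R0, 0 <= R0 < 1 /\ forall s, 0 <= s < 1 -> cm s u - cm R0 u <= delta.
Proof.
  intros HB delta Hd.
  destruct (completeness (fun y => exists s, 0 <= s < 1 /\ y = cm s u)) as [l [Hu Hl]].
  - exists B. intros y [s [Hs ->]]. now apply HB.
  - exists (cm 0 u), 0. split; [lra|reflexivity].
  - destruct (classic (exists s, 0 <= s < 1 /\ l - delta < cm s u)) as [[s [Hs Hms]]|N].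
    + exists s. split; [assumption|]. intros t Ht.
      assert (cm t u <= l) by (apply Hu; exists t; split; [lra|reflexivity]). lra.
    + assert (l <= l - delta); [|lra]. apply Hl. intros y [s [Hs ->]].
      destruct (Rle_lt_dec (cm s u) (l - delta)); [assumption|]. destruct N. now exists s.
Qed.

(* Y^P (lam/(lam+Y))^(P/2) is subharmonic for Y = |f|^2 + 1, because phi(Y) is a
   nondecreasing convex function of log Y; this needs P >= 1/2, i.e. p >= 1. *)
Definition damp (P lam Y : R) : R := Rpower Y P * Rpower (lam / (lam + Y)) (P / 2).

Lemma damp_subharmonic (f Af : Cx -> Cx) (P lam : R) : hol f Af -> 1 / 2 <= P -> 0 < lam -> exists ux uy L,
  smooth (fun z => damp P lam (n2 (f z) + 1)) ux uy L /\ forall z, inD z -> 0 <= L z.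
Proof.
  intros H HP Hlam.
  assert (H1 : forall z, inD z -> 1 <= n2 (f z) + 1) by (intros z _; pose proof (n2_ge0 (f z)); lra).
  assert (H2 : forall z, inD z -> lam <= n2 (f z) + (lam + 1)) by (intros z _; pose proof (n2_ge0 (f z)); lra).
  pose proof (smooth_exp _ _ _ _ (smooth_add _ _ _ _ _ _ _ _ (smooth_const (P / 2 * ln lam))
    (smooth_add _ _ _ _ _ _ _ _ (smooth_scal P _ _ _ _ (smooth_ln 1 _ _ _ _ ltac:(lra) H1 (smooth_n2_eps f Af 1 H)))
      (smooth_scal (- (P / 2)) _ _ _ _ (smooth_ln lam _ _ _ _ Hlam H2 (smooth_n2_eps f Af (lam + 1) H)))))) as S. cbv beta in S.
  eexists; eexists; eexists; split.
  - eapply smooth_ext; [|reflexivity|reflexivity|reflexivity|exact S].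
    intros z. pose proof (n2_ge0 (f z)). unfold damp, Rpower. rewrite <- exp_plus. f_equal.
    unfold Rdiv at 4. rewrite ln_mult, ln_Rinv by (try apply Rinv_0_lt_compat; lra).
    replace (lam + (n2 (f z) + 1)) with (n2 (f z) + (lam + 1)) by ring. ring.
  - intros z Hz. cbv beta. apply Rmult_le_pos; [left; apply exp_pos|].
    pose proof (n2_ge0 (f z)) as Hx. pose proof (n2_ge0 (Af z)) as HA.
    pose proof (grad_n2 (f z) (Af z)) as G.
    set (gx := 2 * (Cre (f z) * Cre (Af z) + Cim (f z) * Cim (Af z))) in *.
    set (gy := 2 * (Cim (f z) * Cre (Af z) - Cre (f z) * Cim (Af z))) in *. clearbody gx gy.
    set (x := n2 (f z)) in *. set (A := n2 (Af z)) in *. clearbody x A.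
    set (iY := / (x + 1)). set (iZ := / (x + (lam + 1))).
    assert (HiY : 0 < iY) by (apply Rinv_0_lt_compat; lra). assert (HiZ : 0 < iZ) by (apply Rinv_0_lt_compat; lra).
    set (sg := (x + 1) * iZ). set (t := x * iY).
    assert (Hsg : 0 < sg < 1).
    { split; [unfold sg; nra|]. apply Rmult_lt_reg_r with (x + (lam + 1)); [lra|].
      unfold sg, iZ. rewrite Rmult_assoc, Rinv_l by lra. lra. }
    assert (Ht : 0 <= t <= 1) by (apply frac_bounds; lra).
    assert (EZ : iZ = sg * iY) by (unfold sg, iY; field; lra).
    assert (Ex : x * iY = t) by reflexivity.
    (* With sg = Y / (lam + Y) and t = |f|^2 / Y the bracket is nonnegative for P >= 1/2, since 1 -
       2 sg + 5/4 sg^2 has negative discriminant. *)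
    match goal with |- 0 <= ?e => replace e with (2 * A * iY * (P * ((1 - t) * (1 - sg / 2) + t * (P * ((1 - sg / 2) * (1 - sg / 2)) - sg * (1 - sg) / 2)))) end.
    + apply Rmult_le_pos; [apply Rmult_le_pos; lra|]. apply Rmult_le_pos; [lra|].
      assert (0 <= (1 - sg / 2) * (1 - sg / 2)) by apply Rle_0_sqr.
      assert (0 <= P * ((1 - sg / 2) * (1 - sg / 2)) - sg * (1 - sg) / 2) by nra.
      apply Rplus_le_le_0_compat; apply Rmult_le_pos; lra.
    + replace (0 + (P * (iY * gx) + - (P / 2) * (iZ * gx))) with (P * iY * (1 - sg / 2) * gx) by (rewrite EZ; field).
      replace (0 + (P * (iY * gy) + - (P / 2) * (iZ * gy))) with (P * iY * (1 - sg / 2) * gy) by (rewrite EZ; field).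
      replace (P * iY * (1 - sg / 2) * gx * (P * iY * (1 - sg / 2) * gx) + P * iY * (1 - sg / 2) * gy * (P * iY * (1 - sg / 2) * gy))
        with (P * iY * (1 - sg / 2) * (P * iY * (1 - sg / 2)) * (gx * gx + gy * gy)) by ring.
      rewrite G, EZ. rewrite <- Ex. field.
Qed.

Lemma damp_le (P lam Y : R) : 0 < P -> 0 < lam -> 0 < Y -> damp P lam Y <= Rpower Y P.
Proof.
  intros HP Hl HY. unfold damp. pose proof (Rpower_pos Y P).
  assert (Rpower (lam / (lam + Y)) (P / 2) <= 1); [|nra].
  replace 1 with (Rpower 1 (P / 2)) by (unfold Rpower; rewrite ln_1, Rmult_0_r; apply exp_0).
  apply Rpower_le_l; [lra|]. split; [apply Rdiv_lt_0_compat; lra|].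
  apply Rmult_le_reg_r with (lam + Y); [lra|]. replace (lam / (lam + Y) * (lam + Y)) with lam by (field; lra). lra.
Qed.

Lemma Rpower_lt1 (x s : R) : 0 < s -> 0 < x < 1 -> Rpower x s < 1.
Proof.
  intros Hs Hx. replace 1 with (Rpower 1 s) by (unfold Rpower; rewrite ln_1, Rmult_0_r; apply exp_0).
  rewrite <- !rpow_pos_eq by lra. apply rpow_lt; lra.
Qed.

(** For lam large compared with M the damping hardly changes values up to M. *)
Lemma damp_low (P M tau : R) : 0 < P -> 0 < M -> 0 < tau < 1 -> exists lam, 0 < lam /\
  forall Y, 0 < Y <= M -> (1 - tau) * Rpower Y P <= damp P lam Y.
Proof.
  intros HP HM Ht. set (th := Rpower (1 - tau) (2 / P)).
  assert (Hth : 0 < th < 1).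
  { split; [apply Rpower_pos|]. apply Rpower_lt1; [apply Rdiv_lt_0_compat|]; lra. }
  set (lam := M * th / (1 - th)). assert (Hlam : 0 < lam) by (unfold lam; apply Rdiv_lt_0_compat; nra).
  exists lam. split; [assumption|]. intros Y HY. unfold damp. rewrite Rmult_comm.
  apply Rmult_le_compat_l; [left; apply Rpower_pos|].
  replace (1 - tau) with (Rpower th (P / 2)).
  - apply Rpower_le_l; [lra|]. split; [lra|]. apply Rmult_le_reg_r with (lam + Y); [lra|].
    replace (lam / (lam + Y) * (lam + Y)) with lam by (field; lra).
    assert (E : lam * (1 - th) = M * th) by (unfold lam; field; lra). nra.
  - unfold th. rewrite Rpower_mult. replace (2 / P * (P / 2)) with 1 by (field; lra). apply Rpower_1. lra.
Qed.

(** For lam fixed the damping removes at least half of every large value, so the loss controls the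
    large part of Y^P. *)
Lemma damp_high (P lam : R) : 0 < P -> 0 < lam -> exists T, 0 < T /\
  forall Y, 0 < Y -> Rpower Y P <= 2 * (Rpower Y P - damp P lam Y) + T.
Proof.
  intros HP Hlam. set (k := Rpower (1 / 2) (2 / P)).
  assert (Hk : 0 < k < 1).
  { split; [apply Rpower_pos|]. apply Rpower_lt1; [apply Rdiv_lt_0_compat|]; lra. }
  set (Lm := lam * (1 - k) / k). assert (HLm : 0 < Lm) by (unfold Lm; apply Rdiv_lt_0_compat; nra).
  exists (Rpower Lm P). split; [apply Rpower_pos|]. intros Y HY.
  pose proof (damp_le P lam Y HP Hlam HY). pose proof (Rpower_pos Y P). pose proof (Rpower_pos Lm P).
  destruct (Rle_lt_dec Y Lm) as [L|L].
  - assert (Rpower Y P <= Rpower Lm P) by (apply Rpower_le_l; lra). lra.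
  - assert (Rpower (lam / (lam + Y)) (P / 2) <= 1 / 2).
    { replace (1 / 2) with (Rpower k (P / 2)).
      - apply Rpower_le_l; [lra|]. split; [apply Rdiv_lt_0_compat; lra|]. apply Rmult_le_reg_r with (lam + Y); [lra|].
        replace (lam / (lam + Y) * (lam + Y)) with lam by (field; lra).
        assert (E : k * Lm = lam * (1 - k)) by (unfold Lm; field; lra). nra.
      - unfold k. rewrite Rpower_mult. replace (2 / P * (P / 2)) with 1 by (field; lra). apply Rpower_1. lra. }
    unfold damp in *. nra.
Qed.

Lemma tay_bound_n2 (a : nat -> Cx) (r : R) : absum a -> 0 <= r < 1 ->
  exists M, 0 < M /\ forall z, Cnorm z <= r -> n2 (PS a z) <= M.
Proof.
  intros Ha Hr. destruct (PS_tay a Ha r Hr) as [C [HC K]]. exists (C * C). split; [nra|].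
  intros z Hz. apply n2_le. now apply (K z z).
Qed.

(** At a radius r where the mean of u = Y^P is nearly maximal, Y is bounded and the damped function
    ph has almost the same mean. The mean of ph does not decrease afterwards and that of u cannot
    grow much, so u - ph stays small in mean on all larger circles; by [damp_high] this bounds the
    mass carried by large values, uniformly in s. The weight w replaces the indicator of a set. *)
Lemma uniformly_integrable (a : nat -> Cx) (p B : R) : 1 <= p -> absum a -> 0 <= B -> hp p (PS a) B ->
  forall eta, 0 < eta -> exists delta, 0 < delta /\ forall s (w : Cx -> R), 0 <= s < 1 -> circont s w ->
  (forall t, 0 <= w (circ s t) <= 1) -> cm s w <= delta -> cm s (fun z => w z * pw p (PS a) z) <= eta.
Proof.
  intros Hp Ha HB Hh eta He. set (P := p / 2). assert (HP : 1 / 2 <= P) by (unfold P; lra).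
  set (Y := fun z => n2 (PS a z) + 1). assert (HY : forall z, 1 <= Y z) by (intros z; unfold Y; pose proof (n2_ge0 (PS a z)); lra).
  destruct (pow_subharmonic (PS a) _ P 1 (hol_PS a Ha) ltac:(lra) ltac:(lra)) as [u1 [u2 [L1 [S1 B1]]]].
  set (u := fun z => Rpower (Y z) P). change (smooth u u1 u2 L1) in S1.
  pose proof (fun s Hs => smooth_circont _ _ _ _ s S1 Hs) as Ku.
  set (N := Rpower 2 P * (B + 1)). pose proof (Rpower_pos 2 P) as H2P. assert (HN : 0 < N) by (unfold N; nra).
  assert (Kp : forall s, 0 <= s < 1 -> circont s (pw p (PS a))) by (intros s Hs; apply cc_pw; [lra|now apply PS_cc]).
  assert (UB : forall s, 0 <= s < 1 -> cm s u <= N).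
  { intros s Hs. apply Rle_trans with (cm s (fun z => Rpower 2 P * pw p (PS a) z + Rpower 2 P)).
    - apply cm_le; [now apply Ku|apply circont_add; [apply circont_scal; now apply Kp|apply circont_const]|].
      intros t. replace p with (2 * P) at 1 by (unfold P; field). rewrite pw_n2. unfold u, Y. pose proof (n2_ge0 (PS a (circ s t))).
      rewrite <- rpow_pos_eq by lra. eapply Rle_trans; [apply rpow_add_le; lra|]. rewrite rpow_base1. lra.
    - rewrite cm_add, cm_scal, cm_const; [|now apply Kp|apply circont_scal; now apply Kp|apply circont_const].
      specialize (Hh s Hs). unfold N. nra. }
  destruct (cm_sup_near u N UB (eta / 8) ltac:(lra)) as [r [Hr Hrs]].
  destruct (tay_bound_n2 a r Ha Hr) as [M [HM HMr]].
  set (tau := Rmin (1 / 2) (eta / (8 * N))). assert (Htau : 0 < tau) by (apply Rmin_pos; [lra|apply Rdiv_lt_0_compat; lra]).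
  assert (Htau1 : tau <= 1 / 2) by apply Rmin_l. assert (Htau2 : tau * N <= eta / 8).
  { apply Rle_trans with (eta / (8 * N) * N); [apply Rmult_le_compat_r; [lra|apply Rmin_r]|right; field; lra]. }
  destruct (damp_low P (M + 1) tau ltac:(lra) ltac:(lra) ltac:(lra)) as [lam [Hlam Hlow]].
  destruct (damp_high P lam ltac:(lra) Hlam) as [T [HT Hhigh]].
  destruct (damp_subharmonic (PS a) _ P lam (hol_PS a Ha) HP Hlam) as [v1 [v2 [L2 [S2 B2]]]].
  set (ph := fun z => damp P lam (Y z)). change (smooth ph v1 v2 L2) in S2.
  pose proof (fun s Hs => smooth_circont _ _ _ _ s S2 Hs) as Kph.
  set (Mp' := Rpower (M + 1) P). assert (HMp : 0 < Mp') by apply Rpower_pos.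
  exists (eta / (2 * (T + Mp'))). assert (HTM : 0 < T + Mp') by lra. split; [apply Rdiv_lt_0_compat; lra|].
  intros s w Hs Kw Hw Hcw.
  assert (Pu : forall z, pw p (PS a) z <= u z).
  { intros z. replace p with (2 * P) by (unfold P; field). rewrite pw_n2. unfold u, Y. pose proof (n2_ge0 (PS a z)).
    apply rpow_le_Rpower; lra. }
  assert (Hcw0 : 0 <= cm s w) by (apply cm_ge0; [assumption|intros; apply Hw]).
  assert (Hcw' : (T + Mp') * cm s w <= eta / 2).
  { apply Rle_trans with ((T + Mp') * (eta / (2 * (T + Mp')))); [apply Rmult_le_compat_l; lra|right; field; lra]. }
  assert (Kwp : circont s (fun z => w z * pw p (PS a) z)) by (apply circont_mul; [assumption|now apply Kp]).
  destruct (Rle_lt_dec s r) as [L|L].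
  - apply Rle_trans with (cm s (fun z => Mp' * w z)).
    + apply cm_le; [assumption|now apply circont_scal|]. intros t. rewrite Rmult_comm. apply Rmult_le_compat_r; [apply Hw|].
      eapply Rle_trans; [apply Pu|]. unfold u, Mp'. apply Rpower_le_l; [lra|]. pose proof (HY (circ s t)). split; [lra|].
      unfold Y. specialize (HMr (circ s t)). rewrite Cnorm_circ in HMr by lra. specialize (HMr L). lra.
    + rewrite cm_scal by assumption. assert (0 <= T * cm s w) by (apply Rmult_le_pos; lra). lra.
  - assert (Low : (1 - tau) * cm r u <= cm r ph).
    { rewrite <- cm_scal by now apply Ku. apply cm_le; [apply circont_scal; now apply Ku|now apply Kph|].
      intros t. unfold u, ph. apply Hlow. pose proof (HY (circ r t)). split; [lra|].
      unfold Y. specialize (HMr (circ r t)). rewrite Cnorm_circ in HMr by lra. specialize (HMr (Rle_refl r)). lra. }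
    pose proof (cm_nondecr _ _ _ _ S2 B2 r s ltac:(lra) ltac:(lra)) as Mono.
    pose proof (UB r Hr) as Ur. specialize (Hrs s Hs).
    (* The mean of u exceeds that at r by at most eta/8, and that of ph is at least 1 - tau times
       the mean of u at r. *)
    assert (D : cm s u - cm s ph <= eta / 4).
    { assert (tau * cm r u <= tau * N) by (apply Rmult_le_compat_l; lra). lra. }
    apply Rle_trans with (cm s (fun z => 2 * (u z - ph z) + T * w z)).
    + apply cm_le; [assumption|apply circont_add; apply circont_scal; [apply circont_sub; [now apply Ku|now apply Kph]|assumption]|].
      intros t. set (z := circ s t). pose proof (Hw t) as Hwt. fold z in Hwt.
      pose proof (HY z). pose proof (Hhigh (Y z) ltac:(lra)) as Hh'. pose proof (damp_le P lam (Y z) ltac:(lra) Hlam ltac:(lra)) as Hd'.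
      fold (u z) (ph z) in Hh', Hd'. pose proof (Pu z). pose proof (pw_ge0 p (PS a) z).
      apply Rle_trans with (w z * (2 * (u z - ph z) + T)); [apply Rmult_le_compat_l; lra|]. nra.
    + pose proof (Ku s Hs) as Ks1. pose proof (Kph s Hs) as Ks2.
      pose proof (circont_sub s u ph Ks1 Ks2) as Ks3.
      rewrite (cm_add s (fun z => 2 * (u z - ph z)) (fun z => T * w z)) by now apply circont_scal.
      rewrite (cm_scal s 2 (fun z => u z - ph z)), (cm_scal s T w), (cm_sub s u ph) by assumption.
      assert (0 <= Mp' * cm s w) by (apply Rmult_le_pos; lra). lra.
Qed.

(** * Coefficient estimates and completeness *)

Lemma absum_lin (x y : Cx) (a b : nat -> Cx) : absum a -> absum b -> absum (fun k => x * a k + y * b k)%X.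
Proof.
  intros Ha Hb. apply absum_of_bounded. intros r Hr.
  destruct (absum_bounded a r Ha ltac:(lra)) as [A [HA KA]]. destruct (absum_bounded b r Hb ltac:(lra)) as [B [HB KB]].
  exists (Cnorm x * A + Cnorm y * B). intros n. specialize (KA n). specialize (KB n).
  assert (0 <= r ^ n) by (apply pow_le; lra). pose proof (Cnorm_ge0 x). pose proof (Cnorm_ge0 y).
  pose proof (Cnorm_add (x * a n)%X (y * b n)%X) as H2. rewrite !Cnorm_mul in H2.
  apply (Rmult_le_compat_r (r ^ n)) in H2; [|assumption].
  apply (Rmult_le_compat_l (Cnorm x)) in KA; [|assumption]. apply (Rmult_le_compat_l (Cnorm y)) in KB; [|assumption]. lra.
Qed.

Lemma PS_lin (x y : Cx) (a b : nat -> Cx) (z : Cx) : absum a -> absum b -> inD z ->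
  PS (fun k => x * a k + y * b k)%X z = (x * PS a z + y * PS b z)%X.
Proof.
  intros Ha Hb Hz. apply lims_eq.
  eapply ccv_ext; [|apply ccv_add; apply ccv_scal; [apply (PS_cv a z Ha Hz)|apply (PS_cv b z Hb Hz)]].
  intros n. cbv beta. unfold psum. rewrite <- !Csum_mul, <- Csum_add. apply Csum_ext. intros k _. ring.
Qed.

Definition cdiff (a b : nat -> Cx) (k : nat) : Cx := (a k - b k)%X.

Lemma cdiff_lin (a b : nat -> Cx) : cdiff a b = (fun k => C1 * a k + (- C1) * b k)%X.
Proof. apply functional_extensionality. intros k. unfold cdiff. ring. Qed.

Lemma absum_diff (a b : nat -> Cx) : absum a -> absum b -> absum (cdiff a b).
Proof. intros. rewrite cdiff_lin. now apply absum_lin. Qed.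

Lemma PS_diff (a b : nat -> Cx) (z : Cx) : absum a -> absum b -> inD z -> PS (cdiff a b) z = (PS a z - PS b z)%X.
Proof. intros. rewrite cdiff_lin, PS_lin by assumption. ring. Qed.

Lemma absum_shift (k : nat) (a : nat -> Cx) : absum a -> absum (fun n => a (k + n)%nat).
Proof.
  intros Ha. apply absum_of_bounded. intros r Hr. destruct (absum_bounded a r Ha ltac:(lra)) as [B [HB K]].
  assert (Hk : 0 < r ^ k) by (apply pow_lt; lra).
  exists (B * / r ^ k). intros n. specialize (K (k + n)%nat). rewrite pow_add in K.
  apply Rmult_le_reg_r with (r ^ k); [assumption|]. rewrite Rmult_assoc, Rmult_assoc, Rinv_l by lra. lra.
Qed.

Lemma PS_shift (k : nat) (a : nat -> Cx) (z : Cx) : absum a -> inD z ->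
  PS a z = (psum a z k + Cpow z k * PS (fun n => a (k + n)%nat) z)%X.
Proof.
  intros Ha Hz. apply lims_eq.
  pose proof (ccv_add _ _ _ _ (ccv_const (psum a z k)) (ccv_scal (Cpow z k) _ _ (PS_cv _ z (absum_shift k a Ha) Hz))) as H.
  intros eps He. destruct (H eps He) as [N HN]. exists (k + N)%nat. intros n Hn.
  specialize (HN (n - k)%nat ltac:(lia)). replace n with (k + (n - k))%nat at 1 by lia. rewrite Csum_split.
  unfold psum in HN at 2. rewrite <- Csum_mul in HN.
  erewrite (Csum_ext (n - k)); [exact HN|]. intros j _. rewrite Cpow_add. ring.
Qed.

Lemma hol_Csum (k : nat) (G : nat -> Cx -> Cx) : (forall j, exists A, hol (G j) A) ->
  exists A, hol (fun z => Csum k (fun j => G j z)) A.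
Proof.
  intros H. induction k as [|k [A IH]]; simpl.
  - eexists. exact (hol_const C0).
  - destruct (H k) as [A' H']. eexists. apply hol_add; [exact IH|exact H'].
Qed.

Lemma hol_pow (n : nat) : exists A, hol (fun z => Cpow z n) A.
Proof.
  induction n as [|n [A IH]]; simpl.
  - eexists. exact (hol_const (1, 0)).
  - eexists. apply hol_mul; [exact hol_id|exact IH].
Qed.

Lemma Cconj_mul (x y : Cx) : Cconj (x * y)%X = (Cconj x * Cconj y)%X.
Proof. cx_ring. Qed.

Lemma Cconj_pow (x : Cx) (n : nat) : Cconj (Cpow x n) = Cpow (Cconj x) n.
Proof. induction n; simpl; [cx_ring|]. now rewrite Cconj_mul, IHn. Qed.

Lemma Cre_conj (x : Cx) : Cre (Cconj x) = Cre x.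
Proof. reflexivity. Qed.

Lemma Cpow_C0 (n : nat) : (0 < n)%nat -> Cpow C0 n = C0.
Proof. destruct n; [lia|]. intros _. simpl. ring. Qed.

Lemma RtoC_mul (x y : R) : RtoC (x * y) = (RtoC x * RtoC y)%X.
Proof. cx_ring. Qed.

(* The mean-value property for the harmonic function which on |z| = r equals
   Re (c conj(z)^k f(z)). *)
Lemma coef_bound (a : nat -> Cx) (k : nat) (r : R) : absum a -> 0 < r < 1 ->
  Cnorm (a k) * r ^ k <= cm r (fun z => Cnorm (PS a z)).
Proof.
  intros Ha Hr. set (rr := RtoC (r * r)).
  (* The unimodular factor turns the coefficient into its modulus. *)
  assert (Hc : exists c : Cx, Cnorm c = 1 /\ Cre (c * a k)%X = Cnorm (a k)).
  { destruct (Req_dec (Cnorm (a k)) 0) as [E|N].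
    - exists C1. rewrite (Cnorm_eq0 _ E), Cnorm_0, Cnorm_1. split; [reflexivity|]. unfold Cmul, C0, RtoC, Cre, Cim; simpl; ring.
    - exists (Cconj (a k) * RtoC (/ Cnorm (a k)))%X. pose proof (Cnorm_ge0 (a k)). assert (0 < Cnorm (a k)) by lra.
      rewrite Cnorm_mul, Cnorm_conj, Cnorm_RtoC, Rabs_pos_eq by (left; now apply Rinv_0_lt_compat).
      split; [field; lra|]. replace (Cconj (a k) * RtoC (/ Cnorm (a k)) * a k)%X with (RtoC (/ Cnorm (a k)) * (Cconj (a k) * a k))%X by ring.
      rewrite Cconj_mul_self, <- RtoC_mul. rewrite n2_norm. unfold RtoC, Cre; simpl. field. lra. }
  destruct Hc as [c [Hc1 Hc2]].
  set (d := PS (fun n => a (k + n)%nat)).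
  (* On |z| = r, conj(z)^k z^j = r^(2j) conj(z)^(k-j) for j < k. These terms are antianalytic;
     replacing them by their conjugates keeps the real part and makes the whole analytic. *)
  destruct (hol_Csum k (fun j z => Cconj (c * a j) * Cpow rr j * Cpow z (k - j))%X) as [A1 H1].
  { intros j. destruct (hol_pow (k - j)) as [A' HA']. eexists. apply hol_mul; [apply hol_const|exact HA']. }
  pose proof (hol_add _ _ _ _ (hol_mul _ _ _ _ (hol_const (c * Cpow rr k)%X) (hol_PS _ (absum_shift k a Ha))) H1) as HW.
  cbv beta in HW. fold d in HW. pose proof (smooth_Re _ _ HW) as Sm.
  pose proof (cm_harmonic _ _ _ r Sm ltac:(lra)) as E. cbv beta in E.
  assert (Z0 : (c * Cpow rr k * d C0 + Csum k (fun j => Cconj (c * a j) * Cpow rr j * Cpow C0 (k - j)))%X = (Cpow rr k * (c * a k))%X).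
  { rewrite (Csum_zero k) by (intros j Hj; rewrite Cpow_C0 by lia; ring).
    assert (d C0 = a k); [|rewrite H; ring].
    unfold d. apply lims_eq. intros eps He. exists 1%nat. intros [|n] Hn; [lia|].
    change (S n) with (1 + n)%nat. rewrite Csum_split, (Csum_zero n) by (intros j Hj; rewrite Cpow_C0 by lia; ring).
    simpl. rewrite Nat.add_0_r. change (1, 0) with C1. replace (C0 + a k * C1 + C0 - a k)%X with C0 by ring. rewrite Cnorm_0. lra. }
  rewrite Z0 in E.
  assert (Prr : forall n, Cpow rr n = RtoC (r ^ n * r ^ n)).
  { induction n; simpl; [cx_ring|]. rewrite IHn. unfold rr. rewrite <- RtoC_mul. f_equal. ring. }
  assert (E2 : Cre (Cpow rr k * (c * a k))%X = r ^ k * (Cnorm (a k) * r ^ k)).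
  { rewrite Prr, <- Hc2. unfold Cmul, RtoC, Cre, Cim; simpl. ring. }
  rewrite E2 in E.
  assert (Hrk : 0 < r ^ k) by (apply pow_lt; lra).
  apply Rmult_le_reg_l with (r ^ k); [assumption|]. rewrite <- E.
  assert (Kn : circont r (fun z => Cnorm (PS a z))) by (apply cc_norm, PS_cc; [assumption|lra]).
  rewrite <- cm_scal by assumption.
  apply cm_le; [apply (smooth_circont _ _ _ _ r Sm); lra|now apply circont_scal|].
  intros t. set (z := circ r t). assert (Hz : inD z) by (unfold inD, z; rewrite Cnorm_circ; lra).
  assert (Hzz : (Cconj z * z)%X = rr) by (rewrite Cconj_mul_self; unfold z, rr; now rewrite n2_circ by lra).
  assert (Pz : forall n, (Cpow (Cconj z) n * Cpow z n)%X = Cpow rr n) by (intros n; now rewrite <- Cpow_mul, Hzz).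
  assert (Id : Cre (c * Cpow rr k * d z + Csum k (fun j => Cconj (c * a j) * Cpow rr j * Cpow z (k - j)))%X
     = Cre (c * Cpow (Cconj z) k * PS a z)%X).
  { rewrite (PS_shift k a z Ha Hz). fold d.
    replace (c * Cpow (Cconj z) k * (psum a z k + Cpow z k * d z))%X with
      (c * (Cpow (Cconj z) k * Cpow z k) * d z + c * Cpow (Cconj z) k * psum a z k)%X by ring.
    rewrite Pz. change (Cre (c * Cpow rr k * d z)%X + Cre (Csum k (fun j => Cconj (c * a j) * Cpow rr j * Cpow z (k - j)))%X =
      Cre (c * Cpow rr k * d z)%X + Cre (c * Cpow (Cconj z) k * psum a z k)%X).
    f_equal. unfold psum. rewrite <- Csum_mul, !Cre_Csum. apply Rsum_ext. intros j Hj.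
    rewrite <- Cre_conj. f_equal. rewrite !Cconj_mul, !Cconj_pow.
    assert (Ec : Cconj rr = rr) by (unfold rr; cx_ring). rewrite Ec.
    assert (Ecc : forall x, Cconj (Cconj x) = x) by (intros; cx_ring). rewrite !Ecc.
    replace k with ((k - j) + j)%nat at 2 by lia. rewrite Cpow_add, <- (Pz j). ring. }
  rewrite Id. eapply Rle_trans; [apply Rle_abs|]. eapply Rle_trans; [apply Cre_le|].
  rewrite !Cnorm_mul, Cnorm_pow, Cnorm_conj, Hc1. unfold z at 1. rewrite Cnorm_circ by lra. lra.
Qed.

Lemma bernoulli (d : R) (k : nat) : 0 <= d <= 1 -> 1 - INR k * d <= (1 - d) ^ k.
Proof.
  intros Hd. induction k as [|k IH]; [simpl; lra|]. rewrite S_INR. simpl.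
  pose proof (pos_INR k). assert (0 <= INR k * d) by (apply Rmult_le_pos; lra). nra.
Qed.

Lemma pow_near_1 (x y : R) (k : nat) : 0 <= x -> x > y -> exists r, 0 < r < 1 /\ x * r ^ k > y.
Proof.
  intros Hx Hxy. pose proof (pos_INR k). set (d := Rmin (1 / 2) ((x - y) / (2 * (x + 1) * (INR k + 1)))).
  assert (Hd : 0 < d).
  { apply Rmin_pos; [lra|]. apply Rdiv_lt_0_compat; [lra|]. apply Rmult_lt_0_compat; lra. }
  assert (Hd1 : d <= 1 / 2) by apply Rmin_l.
  exists (1 - d). split; [lra|].
  assert (B : 1 - INR k * d <= (1 - d) ^ k).
  { apply bernoulli. lra. }
  assert (D2 : d * (2 * (x + 1) * (INR k + 1)) <= x - y).
  { apply Rle_trans with ((x - y) / (2 * (x + 1) * (INR k + 1)) * (2 * (x + 1) * (INR k + 1))).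
    - apply Rmult_le_compat_r; [nra|apply Rmin_r].
    - right. field. split; lra. }
  assert (x * (INR k * d) < x - y).
  { assert (0 < d * (x + 1) * (INR k + 1)) by (repeat apply Rmult_lt_0_compat; lra).
    assert (x * (INR k * d) <= d * (x + 1) * (INR k + 1)).
    { replace (x * (INR k * d)) with (d * (x * INR k)) by ring. rewrite Rmult_assoc. apply Rmult_le_compat_l; [lra|]. nra. }
    lra. }
  apply (Rmult_le_compat_l x) in B; [|assumption]. lra.
Qed.

(** In place of Hoelder's inequality, x <= tau + tau^(1-p) x^p for p >= 1, with tau = eps^(1/p);
    both summands have mean at most tau, which gives the factor 2. *)
Lemma hp_coef (a : nat -> Cx) (p eps : R) (k : nat) : 1 <= p -> 0 < eps -> absum a -> hp p (PS a) eps ->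
  Cnorm (a k) <= 2 * rpow eps (1 / p).
Proof.
  intros Hp He Ha H. set (tau := rpow eps (1 / p)). assert (Ht : 0 < tau) by now apply rpow_gt0.
  destruct (Rle_lt_dec (Cnorm (a k)) (2 * tau)) as [|L]; [assumption|exfalso].
  destruct (pow_near_1 _ _ k (Cnorm_ge0 (a k)) L) as [r [Hr K]].
  pose proof (coef_bound a k r Ha Hr) as B. specialize (H r ltac:(lra)).
  assert (Kn : circont r (fun z => Cnorm (PS a z))) by (apply cc_norm, PS_cc; [assumption|lra]).
  assert (Kp : circont r (pw p (PS a))) by (apply cc_pw; [lra|apply PS_cc; [assumption|lra]]).
  set (c := Rpower tau (1 - p)).
  assert (Ec : c * eps = tau).
  { unfold c, tau. rewrite !rpow_pos_eq by lra. rewrite Rpower_mult. rewrite <- (Rpower_1 eps) at 2 by assumption.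
    rewrite <- Rpower_plus. f_equal. field. lra. }
  assert (B2 : cm r (fun z => Cnorm (PS a z)) <= tau + c * eps).
  { apply Rle_trans with (cm r (fun z => tau + c * pw p (PS a) z)).
    - apply cm_le; [assumption|apply circont_add; [apply circont_const|now apply circont_scal]|].
      intros t. unfold pw. set (x := Cnorm (PS a (circ r t))). pose proof (rpow_ge0 x p).
      assert (0 < c) by apply Rpower_pos. destruct (Rle_lt_dec x tau); [nra|].
      assert (x <= c * rpow x p); [|lra]. rewrite rpow_pos_eq by lra.
      rewrite <- (Rpower_1 x) at 1 by lra. replace 1 with ((1 - p) + p) at 1 by ring. rewrite Rpower_plus.
      apply Rmult_le_compat_r; [left; apply Rpower_pos|]. apply Rpower_anti; lra.
    - rewrite (cm_add r (fun _ => tau) (fun z => c * pw p (PS a) z)), cm_const, cm_scal;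
        [|assumption|apply circont_const|now apply circont_scal].
      assert (0 < c) by apply Rpower_pos. nra. }
  lra.
Qed.

Lemma PS_coef_small (a : nat -> Cx) (eta : R) (n : nat) (z : Cx) : inD z -> 0 <= eta ->
  (forall k, Cnorm (a k) <= eta) -> (forall k, (k < n)%nat -> a k = C0) ->
  Cnorm (PS a z) <= eta * (Cnorm z ^ n * / (1 - Cnorm z)).
Proof.
  intros Hz He Hk Hz0. unfold inD in Hz. pose proof (Cnorm_ge0 z) as Nz.
  assert (Hq : 0 <= Cnorm z ^ n) by now apply pow_le.
  apply (lims_bound (fun k => a k * Cpow z k)%X (fun k => if Compare_dec.lt_dec k n then 0 else Cnorm z ^ k) _ eta He).
  - intros k. rewrite Cnorm_mul, Cnorm_pow. destruct (Compare_dec.lt_dec k n).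
    + rewrite Hz0 by assumption. rewrite Cnorm_0. lra.
    + apply Rmult_le_compat_r; [now apply pow_le|apply Hk].
  - assert (I : 0 < / (1 - Cnorm z)) by (apply Rinv_0_lt_compat; lra).
    assert (Z : forall m, (m <= n)%nat -> Rsum m (fun k => if Compare_dec.lt_dec k n then 0 else Cnorm z ^ k) = 0).
    { induction m; intros Hm; simpl; [reflexivity|]. rewrite IHm by lia. destruct (Compare_dec.lt_dec m n); [ring|lia]. }
    intros m. destruct (Nat.le_gt_cases m n) as [L|L].
    + rewrite Z by assumption. nra.
    + replace m with (n + (m - n))%nat by lia. rewrite Rsum_split, Z by lia.
      rewrite (Rsum_ext _ _ (fun k => Cnorm z ^ n * Cnorm z ^ k)).
      * rewrite Rsum_scal, Rplus_0_l. apply Rmult_le_compat_l; [assumption|]. apply Rsum_geom. lra.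
      * intros k _. destruct (Compare_dec.lt_dec (n + k) n); [lia|]. apply pow_add.
Qed.

Lemma pw_le_quasi (p : R) (F G H : Cx -> Cx) (z : Cx) : 0 <= p -> F z = (G z + H z)%X ->
  pw p F z <= Rpower 2 p * (pw p G z + pw p H z).
Proof.
  intros Hp E. unfold pw. rewrite E. eapply Rle_trans; [apply rpow_le; [assumption|apply Cnorm_add]|].
  apply rpow_add_le; [assumption|apply Cnorm_ge0|apply Cnorm_ge0].
Qed.

Lemma cm_quasi (p r : R) (F G H : Cx -> Cx) : 0 < p -> cc r F -> cc r G -> cc r H -> 0 <= r < 1 ->
  (forall z, inD z -> F z = (G z + H z)%X) ->
  cm r (pw p F) <= Rpower 2 p * (cm r (pw p G) + cm r (pw p H)).
Proof.
  intros Hp KF KG KH Hr E. pose proof (cc_pw p r F Hp KF). pose proof (cc_pw p r G Hp KG). pose proof (cc_pw p r H Hp KH).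
  rewrite <- cm_add by assumption. rewrite <- cm_scal by now apply circont_add.
  apply cm_le; [assumption|apply circont_scal; now apply circont_add|].
  intros t. apply pw_le_quasi; [lra|]. apply E. unfold inD. rewrite Cnorm_circ; lra.
Qed.

(** Norm-Cauchy implies that coefficients converge uniformly in their index, hence the functions
    converge locally uniformly. The limit in norm is then checked one circle at a time. *)
Lemma hp_complete (p : R) (al : nat -> nat -> Cx) : 1 <= p -> (forall n, absum (al n)) ->
  (forall eps, 0 < eps -> exists N, forall n m, (n >= N)%nat -> (m >= N)%nat -> hp p (PS (cdiff (al n) (al m))) eps) ->
  exists a, absum a /\ (forall z, inD z -> ccv (fun n => PS (al n) z) (PS a z)) /\
    forall eps, 0 < eps -> exists N, forall n, (n >= N)%nat -> hp p (PS (cdiff (al n) a)) eps.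
Proof.
  intros Hp Hab Hcau.
  assert (Cau : forall eta, 0 < eta -> exists N, forall n m, (n >= N)%nat -> (m >= N)%nat -> forall k, Cnorm (al n k - al m k)%X <= eta).
  { intros eta He. assert (Hr : 0 < rpow (eta / 2) p) by (apply rpow_gt0; lra).
    destruct (Hcau _ Hr) as [N HN]. exists N. intros n m Hn Hm k.
    pose proof (hp_coef (cdiff (al n) (al m)) p _ k Hp Hr (absum_diff _ _ (Hab n) (Hab m)) (HN n m Hn Hm)) as B.
    rewrite rpow_inv in B by lra. unfold cdiff in B. lra. }
  assert (Lim : forall k, exists l, ccv (fun n => al n k) l).
  { intros k. apply ccv_Cauchy. intros eps He. destruct (Cau (eps / 2) ltac:(lra)) as [N HN].
    exists N. intros n m Hn Hm. specialize (HN n m Hn Hm k). lra. }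
  set (a := fun k => epsilon (inhabits C0) (ccv (fun n => al n k))).
  assert (Ha : forall k, ccv (fun n => al n k) (a k)) by (intros k; unfold a; apply epsilon_spec; apply Lim).
  assert (Unif : forall eta, 0 < eta -> exists N, forall n, (n >= N)%nat -> forall k, Cnorm (al n k - a k)%X <= eta).
  { intros eta He. destruct (Cau eta He) as [N HN]. exists N. intros n Hn k.
    apply (ccv_norm_le (fun m => al n k + (- C1) * al m k)%X).
    - exists N. intros m Hm. replace (al n k + - C1 * al m k)%X with (al n k - al m k)%X by ring. now apply HN.
    - replace (al n k - a k)%X with (al n k + (- C1) * a k)%X by ring.
      apply ccv_add; [apply ccv_const|]. apply ccv_scal, Ha. }
  assert (Hsum : absum a).
  { destruct (Unif 1 ltac:(lra)) as [N HN]. specialize (HN N (le_n N)).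
    apply absum_of_bounded. intros r Hr. destruct (absum_bounded (al N) r (Hab N) ltac:(lra)) as [B [HB K]].
    exists (B + 1). intros k. specialize (K k). specialize (HN k).
    assert (0 <= r ^ k <= 1) by (split; [apply pow_le; lra|rewrite <- (pow1 k); apply pow_incr; lra]).
    assert (Cnorm (a k) <= Cnorm (al N k) + 1).
    { pose proof (Cnorm_rev (a k) (al N k)). rewrite Cnorm_sub_sym in H0. lra. }
    pose proof (Cnorm_ge0 (a k)). nra. }
  assert (Pt : forall R0 eta, 0 <= R0 < 1 -> 0 < eta -> exists N, forall n, (n >= N)%nat -> forall z, Cnorm z <= R0 ->
     Cnorm (PS (cdiff (al n) a) z) <= eta).
  { intros R0 eta HR He. destruct (Unif (eta * (1 - R0)) ltac:(nra)) as [N HN]. exists N. intros n Hn z Hz.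
    pose proof (Cnorm_ge0 z).
    eapply Rle_trans; [apply (PS_coef_small _ (eta * (1 - R0)) 0); [unfold inD; lra|nra|now apply HN|intros k Hk; lia]|].
    simpl. rewrite Rmult_1_l. apply Rle_trans with (eta * (1 - R0) * / (1 - R0)).
    - apply Rmult_le_compat_l; [nra|]. apply Rinv_le_contravar; lra.
    - right. field. lra. }
  exists a. split; [assumption|]. split.
  - intros z Hz eps He. destruct (Pt (Cnorm z) (eps / 2) (conj (Cnorm_ge0 z) Hz) ltac:(lra)) as [N HN].
    exists N. intros n Hn. rewrite <- PS_diff by auto. specialize (HN n Hn z (Rle_refl _)). lra.
  - intros eps He. pose proof (Rpower_pos 2 p) as H2p. set (e' := eps / (2 * Rpower 2 p)).
    (* On the circle of radius r the limit is compared with one [al m]; m depends on r, the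
       resulting bound does not. *)
    assert (He' : 0 < e') by (unfold e'; apply Rdiv_lt_0_compat; lra).
    destruct (Hcau e' He') as [N HN]. exists N. intros n Hn r Hr.
    destruct (Pt r (rpow e' (1 / p)) Hr) as [M HM]; [now apply rpow_gt0|].
    set (m := (N + M)%nat).
    assert (Kc : forall x y, absum x -> absum y -> cc r (PS (cdiff x y))) by (intros; apply PS_cc; [now apply absum_diff|assumption]).
    pose proof (cm_quasi p r (PS (cdiff (al n) a)) (PS (cdiff (al n) (al m))) (PS (cdiff (al m) a)) ltac:(lra)
      (Kc _ _ (Hab n) Hsum) (Kc _ _ (Hab n) (Hab m)) (Kc _ _ (Hab m) Hsum) Hr) as Q.
    assert (Q1 : cm r (pw p (PS (cdiff (al m) a))) <= e').
    { rewrite <- (cm_const r e'). apply cm_le; [apply cc_pw; [lra|now apply Kc]|apply circont_const|].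
      intros t. unfold pw. rewrite <- (rpow_inv' e' p) by lra. apply rpow_le; [lra|].
      apply HM; [unfold m; lia|]. rewrite Cnorm_circ; lra. }
    pose proof (HN n m Hn ltac:(unfold m; lia) r Hr) as Q2.
    eapply Rle_trans; [apply Q; intros z Hz; rewrite !PS_diff by auto; ring|].
    apply Rle_trans with (Rpower 2 p * (e' + e')); [apply Rmult_le_compat_l; lra|]. right. unfold e'. field. lra.
Qed.

(** * Almost disjoint subsequences *)

Lemma rpow_near (p eta : R) : 0 < p -> 0 < eta -> exists tau, 0 < tau < 1 /\ rpow tau p <= eta /\
  forall u, Rabs (u - 1) <= tau -> Rabs (rpow u p - 1) <= eta.
Proof.
  intros Hp He. destruct (proj1 (filterlim_locally _ _) (continuous_rpow p 1 Hp) (mkposreal _ He)) as [d K].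
  pose proof (cond_pos d). set (tau := Rmin (Rmin (d / 2) (1 / 2)) (rpow eta (1 / p))).
  assert (Ht : 0 < tau) by (repeat apply Rmin_pos; try lra; now apply rpow_gt0).
  pose proof (Rmin_l (Rmin (d / 2) (1 / 2)) (rpow eta (1 / p))) as M1. pose proof (Rmin_r (Rmin (d / 2) (1 / 2)) (rpow eta (1 / p))) as M2.
  pose proof (Rmin_l (d / 2) (1 / 2)). pose proof (Rmin_r (d / 2) (1 / 2)). fold tau in M1, M2.
  exists tau. split; [lra|]. split.
  - rewrite <- (rpow_inv' eta p) by lra. apply rpow_le; lra.
  - intros u Hu. specialize (K u). rewrite <- (rpow_base1 p). left. apply K.
    change (Rabs (u - 1) < d). lra.
Qed.

(** If |x| is a small multiple of |y|, continuity of the power at 1 gives the first error term;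
    otherwise every power is dominated by |x|^p. The lemma is used with the two roles exchanged as
    well. *)
Lemma power_split (p eta : R) : 0 < p -> 0 < eta -> exists C, 0 < C /\ forall x y : Cx,
  Rabs (rpow (Cnorm (x + y)%X) p - rpow (Cnorm x) p - rpow (Cnorm y) p) <= eta * rpow (Cnorm y) p + C * rpow (Cnorm x) p.
Proof.
  intros Hp He. destruct (rpow_near p (eta / 2) Hp ltac:(lra)) as [tau [Ht [T1 T2]]].
  assert (Hit : 0 < / tau) by (apply Rinv_0_lt_compat; lra).
  pose proof (rpow_ge0 (1 + / tau) p) as G1. pose proof (rpow_ge0 (/ tau) p) as G2.
  exists (rpow (1 + / tau) p + 1 + rpow (/ tau) p). split; [lra|]. intros x y.
  set (a := Cnorm x). set (b := Cnorm y). assert (Ha : 0 <= a) by apply Cnorm_ge0. assert (Hb : 0 <= b) by apply Cnorm_ge0.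
  pose proof (rpow_ge0 a p) as Pa. pose proof (rpow_ge0 b p) as Pb. pose proof (rpow_ge0 (Cnorm (x + y)%X) p) as Pxy.
  pose proof (Cnorm_add x y) as Hadd. fold a b in Hadd. pose proof (Cnorm_ge0 (x + y)%X) as H0.
  destruct (Rle_lt_dec a (tau * b)) as [L|L].
  - destruct (Req_dec b 0) as [Eb|Nb].
    + assert (Ea : a = 0) by nra. rewrite Ea, Eb in *. assert (Cnorm (x + y)%X = 0) by lra.
      rewrite H, !rpow_npos by lra. rewrite !Rminus_0_r, Rabs_R0. lra.
    + assert (Hb' : 0 < b) by lra. set (u := Cnorm (x + y)%X / b).
      assert (Eu : Cnorm (x + y)%X = b * u) by (unfold u; field; lra).
      assert (Hu : Rabs (u - 1) <= tau).
      { pose proof (Cnorm_rev y (- x)%X) as R1. rewrite Cnorm_opp in R1. fold a b in R1.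
        replace (y - - x)%X with (x + y)%X in R1 by ring.
        apply Rabs_le. rewrite Eu in R1, Hadd. split; apply Rmult_le_reg_l with b; try assumption; nra. }
      specialize (T2 u Hu). assert (Hu0 : 0 <= u) by (unfold u; apply Rmult_le_pos; [assumption|left; now apply Rinv_0_lt_compat]).
      rewrite Eu, rpow_mult by assumption.
      replace (rpow b p * rpow u p - rpow a p - rpow b p) with (rpow b p * (rpow u p - 1) + - rpow a p) by ring.
      assert (Ia : rpow a p <= rpow tau p * rpow b p) by (rewrite <- rpow_mult by lra; apply rpow_le; lra).
      eapply Rle_trans; [apply Rabs_triang|]. rewrite Rabs_mult, Rabs_Ropp, (Rabs_pos_eq (rpow b p)), (Rabs_pos_eq (rpow a p)) by assumption.
      assert (rpow b p * Rabs (rpow u p - 1) <= rpow b p * (eta / 2)) by (apply Rmult_le_compat_l; assumption).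
      assert (rpow tau p * rpow b p <= eta / 2 * rpow b p) by (apply Rmult_le_compat_r; assumption).
      assert (0 <= (rpow (1 + / tau) p + 1 + rpow (/ tau) p) * rpow a p) by (apply Rmult_le_pos; lra). lra.
  - assert (Hba : b <= / tau * a).
    { apply Rmult_le_reg_l with tau; [lra|]. rewrite <- Rmult_assoc, Rinv_r by lra. lra. }
    assert (I1 : rpow b p <= rpow (/ tau) p * rpow a p) by (rewrite <- rpow_mult by lra; apply rpow_le; lra).
    assert (I2 : rpow (Cnorm (x + y)%X) p <= rpow (1 + / tau) p * rpow a p).
    { rewrite <- rpow_mult by lra. apply rpow_le; lra. }
    assert (0 <= eta * rpow b p) by (apply Rmult_le_pos; lra). apply Rabs_le. lra.
Qed.

Lemma circont_Rsum (r : R) (k : nat) (u : nat -> Cx -> R) : (forall j, circont r (u j)) -> circont r (fun z => Rsum k (fun j => u j z)).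
Proof.
  intros H. induction k; simpl; [apply circont_const|]. now apply circont_add.
Qed.

Lemma cm_Rsum (r : R) (k : nat) (u : nat -> Cx -> R) : (forall j, circont r (u j)) ->
  cm r (fun z => Rsum k (fun j => u j z)) = Rsum k (fun j => cm r (u j)).
Proof.
  intros H. induction k; simpl; [apply cm_const|].
  rewrite (cm_add r (fun z => Rsum k (fun j => u j z)) (u k)), IHk; [reflexivity|now apply circont_Rsum|apply H].
Qed.

Lemma cm_abs_le (r : R) (u V : Cx -> R) : circont r u -> circont r V -> (forall t, Rabs (u (circ r t)) <= V (circ r t)) ->
  Rabs (cm r u) <= cm r V.
Proof.
  intros Ku KV H. apply Rabs_le. split.
  - replace (- cm r V) with (cm r (fun z => -1 * V z)) by (rewrite cm_scal by assumption; ring).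
    apply cm_le; [now apply circont_scal|assumption|]. intros t. specialize (H t). apply Rabs_le_between in H. lra.
  - apply cm_le; [assumption|assumption|]. intros t. specialize (H t). apply Rabs_le_between in H. lra.
Qed.

Lemma cc_add (r : R) (F G : Cx -> Cx) : cc r F -> cc r G -> cc r (fun z => F z + G z)%X.
Proof.
  intros HF HG t. destruct (HF t) as [F1 F2], (HG t) as [G1 G2]. split.
  - apply (continuous_plus (fun t => Cre (F (circ r t))) (fun t => Cre (G (circ r t)))); assumption.
  - apply (continuous_plus (fun t => Cim (F (circ r t))) (fun t => Cim (G (circ r t)))); assumption.
Qed.

Lemma cc_scal (r : R) (c : Cx) (F : Cx -> Cx) : cc r F -> cc r (fun z => c * F z)%X.
Proof. intros HF t. apply (cmul_ccont (fun _ => c) (fun t => F (circ r t))); [apply const_ccont|apply HF]. Qed.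

Lemma cc_Csum (r : R) (k : nat) (F : nat -> Cx -> Cx) : (forall j, cc r (F j)) -> cc r (fun z => Csum k (fun j => F j z)).
Proof.
  intros H. induction k; simpl; [intros t; apply const_ccont|]. apply cc_add; [assumption|apply H].
Qed.

Lemma pw_scal (p : R) (c : Cx) (F : Cx -> Cx) (z : Cx) : pw p (fun z => c * F z)%X z = rpow (Cnorm c) p * pw p F z.
Proof. unfold pw. rewrite Cnorm_mul. apply rpow_mult; apply Cnorm_ge0. Qed.

(** The constant grows with k, which is harmless: k is fixed before the next index is chosen. *)
Lemma pw_Csum (p A : R) (k : nat) (x : nat -> Cx) (F : nat -> Cx -> Cx) (z : Cx) : 0 < p -> 0 <= A ->
  (forall j, (j < k)%nat -> Cnorm (x j) <= A) ->
  pw p (fun z => Csum k (fun j => x j * F j z)%X) z <= rpow A p * (Rpower 2 p ^ k * Rsum k (fun j => pw p (F j) z)).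
Proof.
  intros Hp HA. pose proof (Rpower_pos 2 p) as H2.
  assert (H21 : 1 <= Rpower 2 p).
  { rewrite <- (rpow_base1 p), <- rpow_pos_eq by lra. apply rpow_le; lra. }
  pose proof (rpow_ge0 A p) as HAp. induction k as [|k IH]; intros Hx.
  - unfold pw at 1. simpl. rewrite Cnorm_0, rpow_npos by lra. lra.
  - specialize (IH (fun j Hj => Hx j ltac:(lia))). simpl Csum. simpl Rsum.
    eapply Rle_trans; [apply (pw_le_quasi p _ (fun z => Csum k (fun j => x j * F j z)%X) (fun z => x k * F k z)%X); [lra|reflexivity]|].
    rewrite pw_scal. pose proof (pw_ge0 p (F k) z) as Pk.
    assert (X1 : rpow (Cnorm (x k)) p <= rpow A p) by (apply rpow_le; [lra|apply Hx; lia]).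
    assert (Hk : 1 <= Rpower 2 p ^ k) by now apply pow_R1_Rle.
    assert (X2 : rpow (Cnorm (x k)) p * pw p (F k) z <= rpow A p * (Rpower 2 p ^ k * pw p (F k) z)).
    { apply Rmult_le_compat; try assumption; [apply rpow_ge0|]. nra. }
    apply Rle_trans with (Rpower 2 p * (rpow A p * (Rpower 2 p ^ k * Rsum k (fun j => pw p (F j) z)) + rpow A p * (Rpower 2 p ^ k * pw p (F k) z))).
    + apply Rmult_le_compat_l; lra.
    + right. simpl. ring.
Qed.

Lemma common_delta (P : nat -> R -> Prop) (k : nat) : (forall j d d', P j d -> 0 < d' <= d -> P j d') ->
  (forall j, exists d, 0 < d /\ P j d) -> exists d, 0 < d /\ forall j, (j < k)%nat -> P j d.
Proof.
  intros Mono H. induction k as [|k [d [Hd IH]]].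
  - exists 1. split; [lra|]. intros; lia.
  - destruct (H k) as [d' [Hd' Pk]]. exists (Rmin d d'). pose proof (Rmin_l d d'). pose proof (Rmin_r d d').
    assert (0 < Rmin d d') by now apply Rmin_pos. split; [assumption|]. intros j Hj.
    destruct (Nat.eq_dec j k) as [->|N]; [apply (Mono k d'); [assumption|lra]|apply (Mono j d); [apply IH; lia|lra]].
Qed.

Lemma continuous_min1 (lam x : R) : 0 < lam -> continuous (fun x => Rmin 1 (x / lam)) x.
Proof.
  intros Hl. apply (continuous_ext (fun x => / 2 * (1 + x / lam - Rabs (1 - x / lam)))).
  - intros y. unfold Rmin, Rabs. destruct (Rle_dec 1 (y / lam)), (Rcase_abs (1 - y / lam)); lra.
  - assert (Kd : continuous (fun x => x / lam) x) by (apply (continuous_mult (fun x => x) (fun _ => / lam)); [apply continuous_id|apply continuous_const]).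
    apply (continuous_mult (fun _ => / 2) (fun x => 1 + x / lam - Rabs (1 - x / lam))); [apply continuous_const|].
    apply (continuous_minus (fun x => 1 + x / lam) (fun x => Rabs (1 - x / lam))).
    + apply (continuous_plus (fun _ => 1) (fun x => x / lam)); [apply continuous_const|assumption].
    + apply (continuous_comp (fun x => 1 - x / lam) Rabs).
      * apply (continuous_minus (fun _ => 1) (fun x => x / lam)); [apply continuous_const|assumption].
      * apply continuity_pt_filterlim. apply Rcontinuity_abs.
Qed.

Definition comb (c : nat -> nat -> Cx) (k : nat) (pre : nat -> nat) (x : nat -> Cx) (z : Cx) : Cx :=
  Csum k (fun j => x j * PS (c (pre j)) z)%X.

(** The circle and the coefficients are quantified inside, so one n serves them all, and the error
    is homogeneous in the bound A on the coefficients. *)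
Definition nearly_disjoint (p : R) (c : nat -> nat -> Cx) (k : nat) (pre : nat -> nat) (eps : R) (n : nat) : Prop :=
  forall s A x y, 0 <= s < 1 -> 0 <= A -> (forall j, (j < k)%nat -> Cnorm (x j) <= A) -> Cnorm y <= A ->
  Rabs (cm s (pw p (fun z => comb c k pre x z + y * PS (c n) z)%X) - cm s (pw p (comb c k pre x))
        - rpow (Cnorm y) p * cm s (pw p (PS (c n)))) <= eps * rpow A p.

(** With G the earlier combination, the weight w = min(1, |F_n| / lam) separates two regimes. Where
    F_n is large, an error C |G|^p is allowed: w is small in mean, so uniform integrability of the
    earlier functions makes w |G|^p small. Where F_n is small, an error C |y F_n|^p is allowed, and
    it is of size lam^p. A continuous weight keeps all means within integrals of continuous
    functions. *)
Lemma nearly_disjoint_exists (p B : R) (c : nat -> nat -> Cx) (k : nat) (pre : nat -> nat) (eps : R) : 1 <= p -> 0 <= B ->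
  (forall n, absum (c n)) -> (forall n, hp p (PS (c n)) B) ->
  (forall eta, 0 < eta -> exists N, forall n, (n >= N)%nat -> forall s, 0 <= s < 1 -> cm s (pw (1 / 2) (PS (c n))) <= eta) ->
  0 < eps ->
  exists N, forall n, (n >= N)%nat -> nearly_disjoint p c k pre eps n.
Proof.
  intros p_ge1 B_ge0 c_absum c_hp c_weak He. pose proof (Rpower_pos 2 p) as H2. set (E := Rpower 2 p ^ k). assert (HE : 0 < E) by now apply pow_lt.
  pose proof (pos_INR k) as Hk. set (EK := E * INR k). assert (HEK : 0 <= EK) by (apply Rmult_le_pos; lra).
  (* The constants eta, lam and mu are fixed so that the eta terms together, the lam term and the mu
     term each cost at most eps/4. *)
  set (den := 4 * (B + 1) * (1 + EK)). assert (Hden : 0 < den) by (unfold den; apply Rmult_lt_0_compat; lra).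
  set (eta := eps / den). assert (Heta : 0 < eta) by now apply Rdiv_lt_0_compat.
  assert (Eeta : eta * den = eps) by (unfold eta; field; lra).
  destruct (power_split p eta ltac:(lra) Heta) as [Ct [HCt PS1']].
  set (lam := rpow (eps / (4 * Ct)) (1 / p)).
  assert (Hq : 0 < eps / (4 * Ct)) by (apply Rdiv_lt_0_compat; lra).
  assert (Hlam : 0 < lam) by now apply rpow_gt0.
  assert (Elam : Ct * rpow lam p = eps / 4) by (unfold lam; rewrite rpow_inv' by lra; field; lra).
  set (mu := eps / (4 * (Ct * (EK + 1)))). assert (Hmu0 : 0 < Ct * (EK + 1)) by (apply Rmult_lt_0_compat; lra).
  assert (Hmu : 0 < mu) by (unfold mu; apply Rdiv_lt_0_compat; lra).
  assert (Emu : Ct * (EK + 1) * mu = eps / 4) by (unfold mu; field; split; lra).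
  destruct (common_delta (fun j d => forall s (w : Cx -> R), 0 <= s < 1 -> circont s w ->
     (forall t, 0 <= w (circ s t) <= 1) -> cm s w <= d -> cm s (fun z => w z * pw p (PS (c (pre j))) z) <= mu) k) as [d [Hd UI]].
  { intros j d d' H Hd s w Hs Kw Hw Hc. apply H; try assumption. lra. }
  { intros j. apply (uniformly_integrable (c (pre j)) p B p_ge1 (c_absum _) B_ge0 (c_hp _) mu Hmu). }
  pose proof (rpow_gt0 lam (1 / 2) Hlam) as Hsl.
  destruct (c_weak (d * rpow lam (1 / 2)) ltac:(now apply Rmult_lt_0_compat)) as [N HN].
  exists N. intros n Hn s A x y Hs HA Hx Hy. specialize (HN n Hn s Hs).
  set (Fn := PS (c n)). set (G := comb c k pre x). set (w := fun z => Rmin 1 (Cnorm (Fn z) / lam)).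
  pose proof (rpow_ge0 A p) as HAp.
  assert (KF : forall m, cc s (PS (c m))) by (intros m; now apply PS_cc).
  assert (KFp : forall m, circont s (pw p (PS (c m)))) by (intros m; apply cc_pw; [lra|apply KF]).
  assert (KG : cc s G).
  { apply cc_Csum. intros j. apply (cc_scal s (x j) (PS (c (pre j)))), KF. }
  assert (KGp : circont s (pw p G)) by (apply cc_pw; [lra|assumption]).
  assert (KGF : circont s (pw p (fun z => G z + y * Fn z)%X)).
  { apply cc_pw; [lra|]. apply cc_add; [assumption|]. apply (cc_scal s y (PS (c n))), KF. }
  assert (Kw : circont s w).
  { apply (circont_comp s (fun x => Rmin 1 (x / lam)) (fun z => Cnorm (Fn z))); [intros; now apply continuous_min1|apply cc_norm, KF]. }
  assert (Hw : forall z, 0 <= w z <= 1).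
  { intros z. unfold w. split; [|apply Rmin_l]. apply Rmin_glb; [lra|]. apply Rmult_le_pos; [apply Cnorm_ge0|left; now apply Rinv_0_lt_compat]. }
  assert (Cw : cm s w <= d).
  { apply Rmult_le_reg_l with (rpow lam (1 / 2)); [assumption|]. rewrite <- cm_scal by assumption.
    apply Rle_trans with (cm s (pw (1 / 2) Fn)); [|rewrite (Rmult_comm _ d); exact HN].
    apply cm_le; [now apply circont_scal|apply cc_pw; [lra|apply KF]|].
    intros t. set (z := circ s t). unfold pw. pose proof (Cnorm_ge0 (Fn z)) as NF. set (v := Cnorm (Fn z) / lam).
    assert (Hv : 0 <= v) by (unfold v; apply Rmult_le_pos; [assumption|left; now apply Rinv_0_lt_compat]).
    replace (Cnorm (Fn z)) with (lam * v) by (unfold v; field; lra). rewrite rpow_mult by lra.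
    apply Rmult_le_compat_l; [lra|]. unfold w. fold v. destruct (Rle_lt_dec 1 v).
    - rewrite Rmin_left by assumption. apply Rle_trans with (rpow 1 (1 / 2)); [rewrite rpow_base1; lra|apply rpow_le; lra].
    - rewrite Rmin_right by lra. set (q := rpow v (1 / 2)).
      assert (Eq : q * q = v) by (unfold q; rewrite <- (rpow_2 (rpow v (1 / 2))) by apply rpow_ge0; apply rpow_inv'; lra).
      assert (0 <= q) by apply rpow_ge0. assert (q <= 1) by nra. nra. }
  set (V := fun z => eta * pw p Fn z + (eta * E * Rsum k (fun j => pw p (PS (c (pre j))) z)
     + (Ct * E * Rsum k (fun j => w z * pw p (PS (c (pre j))) z) + Ct * rpow lam p))).
  assert (KS1 : circont s (fun z => Rsum k (fun j => pw p (PS (c (pre j))) z))) by (apply (circont_Rsum s k (fun j => pw p (PS (c (pre j))))); intros; apply KFp).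
  assert (KS2 : circont s (fun z => Rsum k (fun j => w z * pw p (PS (c (pre j))) z))).
  { apply (circont_Rsum s k (fun j z => w z * pw p (PS (c (pre j))) z)). intros; apply circont_mul; [assumption|apply KFp]. }
  assert (KV : circont s V).
  { unfold V. apply circont_add; [apply circont_scal, KFp|]. apply circont_add; [now apply circont_scal|].
    apply circont_add; [now apply circont_scal|apply circont_const]. }
  assert (Pt : forall z, Rabs (pw p (fun z => G z + y * Fn z)%X z - pw p G z - rpow (Cnorm y) p * pw p Fn z) <= rpow A p * V z).
  { intros z.
    set (T := pw p (fun z => G z + y * Fn z)%X z). set (g := pw p G z). set (f := pw p Fn z). set (ay := rpow (Cnorm y) p).
    assert (Ey : rpow (Cnorm (y * Fn z)%X) p = ay * f) by exact (pw_scal p y Fn z).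
    assert (I1 : Rabs (T - g - ay * f) <= eta * (ay * f) + Ct * g) by (rewrite <- Ey; exact (PS1' (G z) (y * Fn z)%X)).
    assert (I2 : Rabs (T - g - ay * f) <= eta * g + Ct * (ay * f)).
    { pose proof (PS1' (y * Fn z)%X (G z)) as I2. replace (y * Fn z + G z)%X with (G z + y * Fn z)%X in I2 by ring.
      rewrite Ey in I2. change (Rabs (T - ay * f - g) <= eta * g + Ct * (ay * f)) in I2.
      replace (T - g - ay * f) with (T - ay * f - g) by ring. exact I2. }
    assert (Hay : ay <= rpow A p) by (apply rpow_le; lra). assert (Hay0 : 0 <= ay) by apply rpow_ge0.
    assert (Hf : 0 <= f) by apply pw_ge0. assert (Hg : 0 <= g) by apply pw_ge0.
    assert (Hyf : ay * f <= rpow A p * f) by (apply Rmult_le_compat_r; assumption).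
    pose proof (pw_Csum p A k x (fun j => PS (c (pre j))) z ltac:(lra) HA Hx) as HG. fold (comb c k pre x) in HG.
    change (g <= rpow A p * (E * Rsum k (fun j => pw p (PS (c (pre j))) z))) in HG.
    pose proof (Hw z) as Hwz.
    assert (Hwf : (1 - w z) * f <= rpow lam p).
    { unfold w. destruct (Rle_lt_dec lam (Cnorm (Fn z))) as [L|L].
      - rewrite Rmin_left; [rewrite Rminus_diag, Rmult_0_l; apply rpow_ge0|].
        apply Rmult_le_reg_r with lam; [assumption|]. replace (Cnorm (Fn z) / lam * lam) with (Cnorm (Fn z)) by (field; lra). lra.
      - assert (f <= rpow lam p) by (apply rpow_le; lra). fold (w z). nra. }
    set (S := Rsum k (fun j => pw p (PS (c (pre j))) z)) in *.
    assert (ES : Rsum k (fun j => w z * pw p (PS (c (pre j))) z) = w z * S) by apply Rsum_scal.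
    unfold V. rewrite ES. fold f S.
    (* The two splittings are averaged with weights w and 1 - w. *)
    apply Rle_trans with (w z * (eta * (ay * f) + Ct * g) + (1 - w z) * (eta * g + Ct * (ay * f))).
    { set (D := Rabs (T - g - ay * f)) in *.
      replace D with (w z * D + (1 - w z) * D) by ring.
      apply Rplus_le_compat; (apply Rmult_le_compat_l; [lra|assumption]). }
    apply Rle_trans with (eta * (ay * f) + eta * g + Ct * (w z * g) + Ct * (ay * ((1 - w z) * f))).
    { assert (0 <= eta * (ay * f)) by (apply Rmult_le_pos; [lra|now apply Rmult_le_pos]). assert (0 <= eta * g) by (apply Rmult_le_pos; lra). nra. }
    assert (J1 : eta * (ay * f) <= rpow A p * (eta * f)) by (replace (rpow A p * (eta * f)) with (eta * (rpow A p * f)) by ring; apply Rmult_le_compat_l; lra).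
    assert (J2 : eta * g <= rpow A p * (eta * E * S)) by (replace (rpow A p * (eta * E * S)) with (eta * (rpow A p * (E * S))) by ring; apply Rmult_le_compat_l; lra).
    assert (J3 : Ct * (w z * g) <= rpow A p * (Ct * E * (w z * S))).
    { replace (rpow A p * (Ct * E * (w z * S))) with (Ct * (w z * (rpow A p * (E * S)))) by ring.
      apply Rmult_le_compat_l; [lra|]. apply Rmult_le_compat_l; lra. }
    assert (J4 : Ct * (ay * ((1 - w z) * f)) <= rpow A p * (Ct * rpow lam p)).
    { replace (rpow A p * (Ct * rpow lam p)) with (Ct * (rpow A p * rpow lam p)) by ring.
      apply Rmult_le_compat_l; [lra|]. apply Rmult_le_compat; try assumption. apply Rmult_le_pos; lra. }
    lra. }
  assert (Cv : cm s V <= eps).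
  { assert (Q0 := circont_scal s eta _ (KFp n)). cbv beta in Q0. fold Fn in Q0.
    assert (Q1 := circont_scal s (eta * E) _ KS1). assert (Q2 := circont_scal s (Ct * E) _ KS2).
    assert (Q3 := circont_const s (Ct * rpow lam p)). assert (Q4 := circont_add s _ _ Q2 Q3). assert (Q5 := circont_add s _ _ Q1 Q4).
    unfold V. rewrite (cm_add s _ _ Q0 Q5), (cm_add s _ _ Q1 Q4), (cm_add s _ _ Q2 Q3).
    rewrite cm_const, (cm_scal s eta (pw p Fn)) by apply KFp.
    rewrite (cm_scal s (eta * E) (fun z => Rsum k (fun j => pw p (PS (c (pre j))) z))) by assumption.
    rewrite (cm_scal s (Ct * E) (fun z => Rsum k (fun j => w z * pw p (PS (c (pre j))) z))) by assumption.
    rewrite (cm_Rsum s k (fun j => pw p (PS (c (pre j))))) by (intros; apply KFp).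
    rewrite (cm_Rsum s k (fun j z => w z * pw p (PS (c (pre j))) z)) by (intros; apply circont_mul; [assumption|apply KFp]).
    pose proof (c_hp n s Hs) as B1.
    assert (B2 : Rsum k (fun j => cm s (pw p (PS (c (pre j))))) <= INR k * B).
    { rewrite <- Rsum_const. apply Rsum_le. intros j _. now apply c_hp. }
    assert (B3 : Rsum k (fun j => cm s (fun z => w z * pw p (PS (c (pre j))) z)) <= INR k * mu).
    { rewrite <- Rsum_const. apply Rsum_le. intros j Hj. apply UI; try assumption. intros t. apply Hw. }
    apply (Rmult_le_compat_l eta) in B1; [|lra].
    apply (Rmult_le_compat_l (eta * E)) in B2; [|apply Rmult_le_pos; lra].
    apply (Rmult_le_compat_l (Ct * E)) in B3; [|apply Rmult_le_pos; lra].
    replace (eta * E * (INR k * B)) with (eta * (EK * B)) in B2 by (unfold EK; ring).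
    replace (Ct * E * (INR k * mu)) with (Ct * EK * mu) in B3 by (unfold EK; ring).
    assert (P1 : 0 <= Ct * mu) by (apply Rmult_le_pos; lra).
    assert (P2 : eta * B + eta * (EK * B) <= eps / 4).
    { rewrite <- Eeta. unfold den. replace (eta * (4 * (B + 1) * (1 + EK)) / 4) with (eta * ((B + 1) * (1 + EK))) by field.
      rewrite <- Rmult_plus_distr_l. apply Rmult_le_compat_l; [lra|]. nra. }
    fold Fn in B1. lra. }
  fold Fn G.
  assert (Eq : cm s (pw p (fun z => G z + y * Fn z)%X) - cm s (pw p G) - rpow (Cnorm y) p * cm s (pw p Fn)
    = cm s (fun z => pw p (fun z => G z + y * Fn z)%X z - pw p G z - rpow (Cnorm y) p * pw p Fn z)).
  { rewrite (cm_sub s (fun z => pw p (fun z => G z + y * Fn z)%X z - pw p G z) (fun z => rpow (Cnorm y) p * pw p Fn z));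
      [|now apply circont_sub|apply circont_scal, KFp].
    rewrite (cm_sub s (pw p (fun z => G z + y * Fn z)%X) (pw p G)) by assumption.
    rewrite (cm_scal s (rpow (Cnorm y) p) (pw p Fn)) by apply KFp. reflexivity. }
  rewrite Eq. apply Rle_trans with (cm s (fun z => rpow A p * V z)).
  - apply cm_abs_le; [apply circont_sub; [now apply circont_sub|apply circont_scal, KFp]|now apply circont_scal|].
    intros t. apply Pt.
  - rewrite cm_scal by assumption. rewrite Rmult_comm. apply Rmult_le_compat_r; assumption.
Qed.

(** Errors eps 2^(-k-1) at the successive steps sum to less than eps. The resulting estimate is
    uniform in the length K, the coefficients and the circle. *)
Lemma gliding_hump (p B : R) (c : nat -> nat -> Cx) (eps : R) : 1 <= p -> 0 <= B ->
  (forall n, absum (c n)) -> (forall n, hp p (PS (c n)) B) ->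
  (forall eta, 0 < eta -> exists N, forall n, (n >= N)%nat -> forall s, 0 <= s < 1 -> cm s (pw (1 / 2) (PS (c n))) <= eta) ->
  0 < eps -> exists idx : nat -> nat,
  forall K x A s, 0 <= s < 1 -> 0 <= A -> (forall j, (j < K)%nat -> Cnorm (x j) <= A) ->
  Rabs (cm s (pw p (comb c K idx x)) - Rsum K (fun j => rpow (Cnorm (x j)) p * cm s (pw p (PS (c (idx j)))))) <= eps * rpow A p.
Proof.
  intros p_ge1 B_ge0 c_absum c_hp c_weak He.
  set (nxt := fun k pre => epsilon (inhabits 0%nat) (nearly_disjoint p c k pre (eps * (/ 2) ^ S k))).
  assert (Hh : forall k, 0 < (/ 2) ^ k) by (intros; apply pow_lt; lra).
  assert (Hn : forall k pre, nearly_disjoint p c k pre (eps * (/ 2) ^ S k) (nxt k pre)).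
  { intros k pre. unfold nxt. apply epsilon_spec.
    destruct (nearly_disjoint_exists p B c k pre (eps * (/ 2) ^ S k)) as [N HN]; try assumption; [apply Rmult_lt_0_compat; [assumption|apply Hh]|].
    exists N. exact (HN N (le_n N)). }
  (* [pres k] records the first k choices; its default 0 beyond them is harmless, since a
     combination of length k looks only at smaller indices. *)
  set (pres := fix pres (k : nat) : nat -> nat := match k with O => fun _ => 0%nat
     | S k' => fun j => if Nat.eq_dec j k' then nxt k' (pres k') else pres k' j end).
  set (idx := fun j => pres (S j) j).
  assert (Hpre : forall k j, (j < k)%nat -> pres k j = idx j).
  { induction k as [|k IH]; intros j Hj; [lia|]. destruct (Nat.eq_dec j k) as [->|N]; [reflexivity|].
    change (pres (S k) j) with (if Nat.eq_dec j k then nxt k (pres k) else pres k j).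
    destruct (Nat.eq_dec j k); [contradiction|]. apply IH. lia. }
  assert (Hidx : forall k, idx k = nxt k (pres k)).
  { intros k. unfold idx. change (pres (S k) k) with (if Nat.eq_dec k k then nxt k (pres k) else pres k k).
    destruct (Nat.eq_dec k k); [reflexivity|contradiction]. }
  exists idx. intros K x A s Hs HA. pose proof (rpow_ge0 A p) as HAp.
  (* The partial geometric sum 1 - 2^(-K) is kept so that the induction closes. *)
  assert (Main : (forall j, (j < K)%nat -> Cnorm (x j) <= A) ->
    Rabs (cm s (pw p (comb c K idx x)) - Rsum K (fun j => rpow (Cnorm (x j)) p * cm s (pw p (PS (c (idx j)))))) <= eps * (1 - (/ 2) ^ K) * rpow A p).
  { induction K as [|K IH]; intros Hx.
    - simpl. rewrite (cm_ext s _ (fun _ => 0)); [|intros t; unfold pw, comb; simpl; rewrite Cnorm_0; apply rpow_npos; lra].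
      rewrite cm_const, Rminus_0_r, Rabs_R0. replace (eps * (1 - 1) * rpow A p) with 0 by ring. lra.
    - specialize (IH (fun j Hj => Hx j ltac:(lia))).
      pose proof (Hn K (pres K) s A x (x K) Hs HA (fun j Hj => Hx j ltac:(lia)) (Hx K ltac:(lia))) as N. rewrite <- Hidx in N.
      assert (Ec : comb c K (pres K) x = comb c K idx x).
      { apply functional_extensionality. intros z. apply Csum_ext. intros j Hj. now rewrite Hpre. }
      rewrite Ec in N. change (pw p (comb c (S K) idx x)) with (pw p (fun z => comb c K idx x z + x K * PS (c (idx K)) z)%X).
      simpl Rsum. simpl in N. simpl pow.
      match type of N with Rabs ?a <= _ => match type of IH with Rabs ?b <= _ => match goal with |- Rabs ?g <= _ => replace g with (a + b) by ring end end end.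
      eapply Rle_trans; [apply Rabs_triang|].
      replace (eps * (1 - / 2 * (/ 2) ^ K) * rpow A p) with (eps * (/ 2 * (/ 2) ^ K) * rpow A p + eps * (1 - (/ 2) ^ K) * rpow A p) by field.
      now apply Rplus_le_compat. }
  intros Hx. eapply Rle_trans; [now apply Main|]. apply Rmult_le_compat_r; [assumption|]. specialize (Hh K). nra.
Qed.

(** * Building a copy of l^p *)

Lemma infinite_sum_spec (u : nat -> R) (s : R) : (forall k, 0 <= u k) -> infinite_sum u s ->
  (forall n, Rsum n u <= s) /\ forall B, (forall n, Rsum n u <= B) -> s <= B.
Proof.
  intros H0 H. apply is_series_Reals in H. apply is_series_Rsum in H. split.
  - intros n. apply (is_lim_seq_incr_compare (fun n => Rsum n u) s H). intros m. simpl. specialize (H0 m). lra.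
  - intros B HB. apply (is_lim_seq_le (fun n => Rsum n u) (fun _ => B) s B); [exact HB|exact H|apply is_lim_seq_const].
Qed.

Definition Xsum (p : R) (x : nat -> Cx) (n : nat) : R := Rsum n (fun j => rpow (Cnorm (x j)) p).

Lemma in_lp_iff (p : R) (x : nat -> Cx) : in_lp p x <-> exists B, forall n, Xsum p x n <= B.
Proof.
  split.
  - intros [s Hs]. exists s. apply (infinite_sum_spec _ s); [intros; apply rpow_ge0|exact Hs].
  - intros [B HB]. destruct (ex_series_bounded (fun n => rpow (Cnorm (x n)) p) B) as [s Hs]; [intros; apply rpow_ge0|exact HB|].
    exists s. now apply is_series_Reals.
Qed.

Definition lp_sum (p : R) (x : nat -> Cx) : R := epsilon (inhabits 0) (infinite_sum (fun n => rpow (Cnorm (x n)) p)).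

Lemma lp_sum_spec (p : R) (x : nat -> Cx) : in_lp p x ->
  (forall n, Xsum p x n <= lp_sum p x) /\ forall B, (forall n, Xsum p x n <= B) -> lp_sum p x <= B.
Proof.
  intros H. apply infinite_sum_spec; [intros; apply rpow_ge0|]. unfold lp_sum. apply epsilon_spec. exact H.
Qed.

Lemma lp_sum_ge0 (p : R) (x : nat -> Cx) : in_lp p x -> 0 <= lp_sum p x.
Proof. intros H. apply (proj1 (lp_sum_spec p x H) 0%nat). Qed.

Lemma Xsum_quasi (p : R) (x y w : nat -> Cx) (n : nat) : 0 <= p -> (forall j, w j = (x j + y j)%X) ->
  Xsum p w n <= Rpower 2 p * (Xsum p x n + Xsum p y n).
Proof.
  intros Hp E. unfold Xsum. rewrite <- Rsum_add, <- Rsum_scal. apply Rsum_le. intros j _. rewrite E.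
  eapply Rle_trans; [apply rpow_le; [assumption|apply Cnorm_add]|]. apply rpow_add_le; [assumption|apply Cnorm_ge0|apply Cnorm_ge0].
Qed.

Lemma Xsum_scal (p : R) (c : Cx) (x : nat -> Cx) (n : nat) :
  Xsum p (fun j => c * x j)%X n = rpow (Cnorm c) p * Xsum p x n.
Proof.
  unfold Xsum. rewrite <- Rsum_scal. apply Rsum_ext. intros j _. rewrite Cnorm_mul. apply rpow_mult; apply Cnorm_ge0.
Qed.

Lemma in_lp_lin (p : R) (a b : Cx) (x y : nat -> Cx) : 0 <= p -> in_lp p x -> in_lp p y ->
  in_lp p (fun n => a * x n + b * y n)%X.
Proof.
  intros Hp Hx Hy. apply in_lp_iff in Hx. apply in_lp_iff in Hy. destruct Hx as [A HA], Hy as [B HB].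
  apply in_lp_iff. exists (Rpower 2 p * (rpow (Cnorm a) p * A + rpow (Cnorm b) p * B)). intros n.
  eapply Rle_trans; [apply (Xsum_quasi p (fun j => a * x j)%X (fun j => b * y j)%X); [assumption|reflexivity]|].
  apply Rmult_le_compat_l; [left; apply Rpower_pos|]. rewrite !Xsum_scal.
  apply Rplus_le_compat; apply Rmult_le_compat_l; try apply rpow_ge0; auto.
Qed.

Definition fsum (a : nat -> nat -> Cx) (n : nat) (x : nat -> Cx) (k : nat) : Cx := Csum n (fun j => x j * a j k)%X.

Lemma absum_fsum (a : nat -> nat -> Cx) (n : nat) (x : nat -> Cx) : (forall j, absum (a j)) -> absum (fsum a n x).
Proof.
  intros Ha. induction n as [|n IH].
  - intros r Hr. exists 1. split; [lra|]. intros n. rewrite (Rsum_ext n _ (fun _ => 0)).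
    + rewrite Rsum_const. lra.
    + intros k _. unfold fsum. simpl. rewrite Cnorm_0. ring.
  - replace (fsum a (S n) x) with (fun k => C1 * fsum a n x k + x n * a n k)%X; [now apply absum_lin|].
    apply functional_extensionality. intros k. unfold fsum. simpl. ring.
Qed.

Lemma PS_fsum (a : nat -> nat -> Cx) (n : nat) (x : nat -> Cx) (z : Cx) : (forall j, absum (a j)) -> inD z ->
  PS (fsum a n x) z = Csum n (fun j => x j * PS (a j) z)%X.
Proof.
  intros Ha Hz. induction n as [|n IH].
  - apply lims_eq. eapply ccv_ext; [|apply ccv_const]. intros m. symmetry. apply Csum_zero. intros k _. unfold fsum. simpl. ring.
  - replace (fsum a (S n) x) with (fun k => C1 * fsum a n x k + x n * a n k)%X.
    + rewrite PS_lin by (try apply absum_fsum; auto). rewrite IH. simpl. ring.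
    + apply functional_extensionality. intros k. unfold fsum. simpl. ring.
Qed.

Lemma hp_ext (p B : R) (F G : Cx -> Cx) : (forall z, inD z -> F z = G z) -> hp p F B -> hp p G B.
Proof.
  intros E H r Hr. rewrite <- (cm_ext r (pw p F)); [now apply H|].
  intros t. unfold pw. rewrite E; [reflexivity|]. unfold inD. rewrite Cnorm_circ; lra.
Qed.

Lemma hp_opp (p B : R) (F G : Cx -> Cx) : (forall z, inD z -> F z = (- G z)%X) -> hp p F B -> hp p G B.
Proof.
  intros E H r Hr. rewrite <- (cm_ext r (pw p F)); [now apply H|].
  intros t. unfold pw. rewrite E; [now rewrite Cnorm_opp|]. unfold inD. rewrite Cnorm_circ; lra.
Qed.

Lemma hp_le (p B B' : R) (F : Cx -> Cx) : B <= B' -> hp p F B -> hp p F B'.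
Proof. intros HB H r Hr. specialize (H r Hr). lra. Qed.

Lemma hp_eps (p B : R) (F : Cx -> Cx) : (forall eps, 0 < eps -> hp p F (B + eps)) -> hp p F B.
Proof. intros H r Hr. apply le_epsilon. intros eps He. now apply H. Qed.

Lemma hp_quasi (p A B : R) (F : Cx -> Cx) (a b : nat -> Cx) : 1 <= p -> absum a -> absum b ->
  analytic F -> (forall z, inD z -> F z = (PS a z + PS b z)%X) -> hp p (PS a) A -> hp p (PS b) B -> hp p F (Rpower 2 p * (A + B)).
Proof.
  intros Hp Ha Hb HF E HA HB r Hr.
  eapply Rle_trans; [apply (cm_quasi p r F (PS a) (PS b)); [lra|now apply analytic_cc|now apply PS_cc|now apply PS_cc|assumption|assumption]|].
  apply Rmult_le_compat_l; [left; apply Rpower_pos|]. specialize (HA r Hr). specialize (HB r Hr). lra.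
Qed.

Lemma PS_is_analytic (a : nat -> Cx) : absum a -> analytic (PS a).
Proof. intros H. now apply (PS_analytic a). Qed.

Lemma hp_zero (p : R) (a : nat -> Cx) (z : Cx) : 1 <= p -> absum a -> (forall eps, 0 < eps -> hp p (PS a) eps) -> inD z -> PS a z = C0.
Proof.
  intros Hp Ha H Hz.
  assert (E : forall k, a k = C0).
  { intros k. apply Cnorm_eq0. apply Rle_antisym; [|apply Cnorm_ge0]. apply le_epsilon. intros eps He.
    assert (Hr : 0 < rpow (eps / 2) p) by (apply rpow_gt0; lra).
    pose proof (hp_coef a p _ k Hp Hr Ha (H _ Hr)) as B. rewrite rpow_inv in B by lra. lra. }
  apply lims_eq. eapply ccv_ext; [|apply ccv_const]. intros n. symmetry. apply Csum_zero. intros k _. rewrite E. ring.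
Qed.

Lemma closed_Csum (p : R) (M : (Cx -> Cx) -> Prop) (f : nat -> Cx -> Cx) (x : nat -> Cx) (n : nat) : closed_subspace p M ->
  (forall j, (j < n)%nat -> M (f j)) -> M (fun z => Csum n (fun j => x j * f j z)%X).
Proof.
  intros [_ [M0 [Madd [Mmul _]]]] Hf. induction n as [|n IH]; simpl; [exact M0|].
  apply (Madd (fun z => Csum n (fun j => x j * f j z)%X) (fun z => x n * f n z)%X).
  - apply IH. intros; apply Hf; lia.
  - apply Mmul, Hf. lia.
Qed.

Lemma Np_le (p B : R) (F : Cx -> Cx) : 0 < p -> analytic F -> 0 <= B -> hp p F B -> Hp_norm p F <= rpow B (1 / p).
Proof.
  intros Hp HF HB H. destruct (Hp_norm_spec p F Hp (hp_is_Hp p B F Hp HF H)) as [N0 [_ N2]].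
  rewrite <- (rpow_inv (Hp_norm p F) p) by assumption. apply rpow_le; [left; apply Rdiv_lt_0_compat; lra|now apply N2].
Qed.

Definition lp_limit (p : R) (a : nat -> nat -> Cx) (x : nat -> Cx) (al : nat -> Cx) : Prop :=
  absum al /\ (forall z, inD z -> ccv (fun n => PS (fsum a n x) z) (PS al z)) /\
  forall eps, 0 < eps -> exists N, forall n, (n >= N)%nat -> hp p (PS (cdiff (fsum a n x) al)) eps.

(** The isomorphism must be a function of arbitrary sequences, so the limit is selected by choice;
    off l^p its value is irrelevant. *)
Definition lp_coef (p : R) (a : nat -> nat -> Cx) (x : nat -> Cx) : nat -> Cx :=
  epsilon (inhabits (fun _ => C0)) (lp_limit p a x).

Definition lp_map (p : R) (a : nat -> nat -> Cx) (x : nat -> Cx) : Cx -> Cx := PS (lp_coef p a x).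

Lemma lp_map_spec (p C2 : R) (a : nat -> nat -> Cx) (x : nat -> Cx) : 1 <= p -> 0 < C2 -> (forall j, absum (a j)) ->
  (forall n x, hp p (PS (fsum a n x)) (C2 * Xsum p x n)) -> in_lp p x -> lp_limit p a x (lp_coef p a x).
Proof.
  intros Hp HC2 Ha HU Hx. unfold lp_coef. apply epsilon_spec.
  apply in_lp_iff in Hx. destruct Hx as [B HB].
  destruct (hp_complete p (fun n => fsum a n x) Hp) as [al [H1 [H2 H3]]].
  - intros n. now apply absum_fsum.
  - intros eps He.
    destruct (Rsum_bounded_Cauchy (fun j => rpow (Cnorm (x j)) p) B (fun _ => rpow_ge0 _ _) HB (eps / C2)) as [N HN]; [now apply Rdiv_lt_0_compat|].
    assert (K : forall m n, (N <= m)%nat -> (m <= n)%nat -> hp p (PS (cdiff (fsum a n x) (fsum a m x))) eps).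
    (* A difference of partial sums is the finite combination with the first m coefficients set to
       0, so the upper estimate applies to it. *)
    { intros m n Hm Hn. set (y := fun j => if Compare_dec.lt_dec j m then C0 else x j).
      assert (Ez : forall j, (j < m)%nat -> y j = C0) by (intros j Hj; unfold y; destruct (Compare_dec.lt_dec j m); [reflexivity|lia]).
      assert (Ex : forall j, y (m + j)%nat = x (m + j)%nat) by (intros j; unfold y; destruct (Compare_dec.lt_dec (m + j) m); [lia|reflexivity]).
      assert (Ef : fsum a n y = cdiff (fsum a n x) (fsum a m x)).
      { apply functional_extensionality. intros k. unfold cdiff, fsum. replace n with (m + (n - m))%nat by lia. rewrite !Csum_split.
        rewrite (Csum_zero m (fun j => y j * a j k)%X) by (intros j Hj; rewrite Ez by assumption; ring).
        rewrite (Csum_ext (n - m) (fun j => y (m + j)%nat * a (m + j)%nat k)%X (fun j => x (m + j)%nat * a (m + j)%nat k)%X) by (intros j _; now rewrite Ex).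
        ring. }
      rewrite <- Ef. apply (hp_le p (C2 * Xsum p y n)); [|apply HU].
      assert (EX : Xsum p y n = Xsum p x n - Xsum p x m).
      { unfold Xsum. replace n with (m + (n - m))%nat by lia. rewrite !Rsum_split.
        rewrite (Rsum_ext m (fun j => rpow (Cnorm (y j)) p) (fun _ => 0)) by (intros j Hj; rewrite Ez by assumption; rewrite Cnorm_0; apply rpow_npos; lra).
        rewrite Rsum_const, (Rsum_ext (n - m) (fun j => rpow (Cnorm (y (m + j)%nat)) p) (fun j => rpow (Cnorm (x (m + j)%nat)) p)) by (intros j _; now rewrite Ex).
        ring. }
      rewrite EX. specialize (HN m n Hm Hn). fold (Xsum p x n) (Xsum p x m) in HN.
      replace eps with (C2 * (eps / C2)) by (field; lra). apply Rmult_le_compat_l; lra. }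
    exists N. intros n m Hn Hm. destruct (Nat.le_ge_cases m n).
    + apply K; lia.
    + apply (hp_opp p eps (PS (cdiff (fsum a m x) (fsum a n x)))); [|apply K; lia].
      intros z Hz. rewrite !PS_diff by (try apply absum_fsum; auto). ring.
  - exists al. now split.
Qed.

(** Two-sided estimates on finite combinations pass to the limit. N is the range of the limit map,
    and it is closed because the map is bounded below. *)
Theorem lp_copy (p C2 C3 : R) (a : nat -> nat -> Cx) (M : (Cx -> Cx) -> Prop) (f : nat -> Cx -> Cx) :
  1 <= p -> 0 < C2 -> 0 < C3 -> (forall j, absum (a j)) -> (forall j z, inD z -> PS (a j) z = f j z) ->
  closed_subspace p M -> (forall j, M (f j)) ->
  (forall n x, hp p (PS (fsum a n x)) (C2 * Xsum p x n)) ->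
  (forall n x B, 0 <= B -> hp p (PS (fsum a n x)) B -> Xsum p x n <= C3 * B) ->
  exists N : (Cx -> Cx) -> Prop, closed_subspace p N /\ (forall f, N f -> M f) /\ isomorphic_to_lp p N.
Proof.
  intros Hp HC2 HC3 Ha Ef HM HMf HU HL.
  pose proof (Rpower_pos 2 p) as H2p. set (T := lp_map p a).
  assert (Sp : forall x, in_lp p x -> lp_limit p a x (lp_coef p a x)) by (intros x Hx; now apply (lp_map_spec p C2)).
  assert (Tab : forall x, in_lp p x -> absum (lp_coef p a x)) by (intros x Hx; apply (Sp x Hx)).
  assert (Tan : forall x, in_lp p x -> analytic (T x)) by (intros x Hx; apply PS_is_analytic; auto).
  set (K1 := Rpower 2 p * C2). assert (HK1 : 0 < K1) by now apply Rmult_lt_0_compat.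
  set (K2 := C3 * Rpower 2 p). assert (HK2 : 0 < K2) by now apply Rmult_lt_0_compat.
  assert (T1 : forall x, in_lp p x -> forall B, (forall n, Xsum p x n <= B) -> hp p (T x) (K1 * B)).
  { intros x Hx B HB. destruct (Sp x Hx) as [S1 [S2 S3]]. apply hp_eps. intros eps He.
    destruct (S3 (eps / Rpower 2 p)) as [N HN]; [now apply Rdiv_lt_0_compat|]. specialize (HN N (le_n N)).
    apply (hp_le p (Rpower 2 p * (C2 * B + eps / Rpower 2 p))); [right; unfold K1; field; lra|].
    apply (hp_quasi p _ _ (T x) (fsum a N x) (cdiff (lp_coef p a x) (fsum a N x))); try assumption.
    - now apply absum_fsum.
    - apply absum_diff; [assumption|now apply absum_fsum].
    - now apply Tan.
    - intros z Hz. rewrite PS_diff by (try apply absum_fsum; auto). unfold T, lp_map. ring.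
    - apply (hp_le p (C2 * Xsum p x N)); [apply Rmult_le_compat_l; [lra|apply HB]|apply HU].
    - apply (hp_opp p _ (PS (cdiff (fsum a N x) (lp_coef p a x)))); [|assumption].
      intros z Hz. rewrite !PS_diff by (try apply absum_fsum; auto). ring. }
  assert (T2 : forall x, in_lp p x -> forall B, 0 <= B -> hp p (T x) B -> forall n, Xsum p x n <= K2 * B).
  { intros x Hx B HB HhB k. destruct (Sp x Hx) as [S1 [S2 S3]]. apply le_epsilon. intros eps He.
    destruct (S3 (eps / K2)) as [N HN]; [now apply Rdiv_lt_0_compat|].
    (* A partial sum long enough to be close to the limit and to contain the first k
       coefficients. *)
    specialize (HN (N + k)%nat ltac:(lia)).
    assert (HQ : 0 < eps / K2) by now apply Rdiv_lt_0_compat.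
    apply Rle_trans with (Xsum p x (N + k)).
    - apply Rsum_incr; [intros; apply rpow_ge0|lia].
    - apply Rle_trans with (C3 * (Rpower 2 p * (B + eps / K2))); [|right; unfold K2; field; split; lra].
      apply HL; [apply Rmult_le_pos; lra|].
      apply (hp_quasi p _ _ _ (lp_coef p a x) (cdiff (fsum a (N + k) x) (lp_coef p a x))); try assumption.
      + apply absum_diff; [now apply absum_fsum|assumption].
      + apply PS_is_analytic. now apply absum_fsum.
      + intros z Hz. rewrite PS_diff by (try apply absum_fsum; auto). ring. }
  assert (Tlin : forall x y (u v : Cx), in_lp p x -> in_lp p y -> forall z, inD z ->
     T (fun n => u * x n + v * y n)%X z = (u * T x z + v * T y z)%X).
  { intros x y u v Hx Hy z Hz. pose proof (in_lp_lin p u v x y ltac:(lra) Hx Hy) as Hxy.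
    destruct (Sp x Hx) as [_ [Sx _]], (Sp y Hy) as [_ [Sy _]], (Sp _ Hxy) as [_ [Sxy _]].
    apply (ccv_unique _ _ _ (Sxy z Hz)).
    eapply ccv_ext; [|apply ccv_add; apply ccv_scal; [apply (Sx z Hz)|apply (Sy z Hz)]].
    intros n. cbv beta. rewrite !PS_fsum by assumption. rewrite <- !Csum_mul, <- Csum_add. apply Csum_ext. intros j _. ring. }
  assert (TinHp : forall x h, in_lp p x -> (forall z, inD z -> T x z = h z) -> is_Hp p h).
  { intros x h Hx E. destruct (proj1 (in_lp_iff p x) Hx) as [B HB].
    apply (hp_is_Hp p (K1 * B)); [lra| |].
    - apply (PS_analytic (lp_coef p a x)); [auto|exact E].
    - apply (hp_ext p _ (T x)); [assumption|]. now apply T1. }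
  exists (fun h => exists x, in_lp p x /\ forall z, inD z -> T x z = h z). split; [|split].
  - split; [|split; [|split; [|split]]].
    + intros h [x [Hx E]]. now apply (TinHp x).
    + assert (H0 : in_lp p (fun _ => C0)).
      { apply in_lp_iff. exists 0. intros n. unfold Xsum. rewrite (Rsum_ext n _ (fun _ => 0)) by (intros; rewrite Cnorm_0; apply rpow_npos; lra). rewrite Rsum_const. lra. }
      exists (fun _ => C0). split; [assumption|]. intros z Hz.
      pose proof (Tlin _ _ C0 C0 H0 H0 z Hz) as E.
      assert (EE : (fun n : nat => (C0 * (fun _ : nat => C0) n + C0 * (fun _ : nat => C0) n)%X) = (fun _ => C0))
        by (apply functional_extensionality; intros n; cbv beta; ring).
      cbv beta in E, EE. rewrite EE in E. rewrite E. ring.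
    + intros h1 h2 [x [Hx E1]] [y [Hy E2]]. exists (fun n => C1 * x n + C1 * y n)%X.
      split; [apply in_lp_lin; [lra|assumption|assumption]|]. intros z Hz. rewrite Tlin, E1, E2 by assumption. ring.
    + intros c h [x [Hx E]]. exists (fun n => c * x n + C0 * x n)%X.
      split; [apply in_lp_lin; [lra|assumption|assumption]|]. intros z Hz. rewrite Tlin, E by assumption. ring.
    (* Preimages of a convergent sequence in N are Cauchy in l^p by the lower estimate; their
       coordinatewise limit x is then shown to be a limit in l^p, with T x = F. *)
    + intros fn F HN HF Hcv.
      assert (Ch : exists xs : nat -> nat -> Cx, forall n, in_lp p (xs n) /\ forall z, inD z -> T (xs n) z = fn n z).
      { exists (fun n => epsilon (inhabits (fun _ : nat => C0)) (fun x => in_lp p x /\ forall z, inD z -> T x z = fn n z)).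
        intros n. apply epsilon_spec. apply HN. }
      destruct Ch as [xs Hxs].
      destruct (analytic_PS F (proj1 HF)) as [ph [Hph EF]].
      destruct (is_Hp_hp p F ltac:(lra) HF) as [BF [HBF HhF]].
      assert (Dsm : forall eps, 0 < eps -> exists N, forall n, (n >= N)%nat -> hp p (PS (cdiff (lp_coef p a (xs n)) ph)) eps).
      { intros eps He. destruct (Hcv (rpow eps (1 / p)) ltac:(now apply rpow_gt0)) as [N HNn]. exists N. intros n Hn.
        specialize (HNn n Hn). destruct (Hxs n) as [Hx E].
        assert (Ed : forall z, inD z -> PS (cdiff (lp_coef p a (xs n)) ph) z = (fn n z - F z)%X).
        { intros z Hz. rewrite PS_diff by auto. rewrite EF by assumption. rewrite <- (E z Hz). reflexivity. }
        assert (Hd : is_Hp p (fun z => fn n z - F z)%X).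
        { destruct (proj1 (in_lp_iff p _) Hx) as [B HB].
          apply (hp_is_Hp p (Rpower 2 p * (K1 * B + BF))); [lra|apply (PS_analytic (cdiff (lp_coef p a (xs n)) ph)); [apply absum_diff; auto|exact Ed]|].
          apply (hp_ext p _ (PS (cdiff (lp_coef p a (xs n)) ph))); [exact Ed|].
          apply (hp_quasi p _ _ _ (lp_coef p a (xs n)) (fun k => (- C1) * ph k + C0 * ph k)%X); try assumption; auto.
          - now apply absum_lin.
          - apply PS_is_analytic, absum_diff; auto.
          - intros z Hz. rewrite PS_diff, PS_lin by auto. ring.
          - apply (T1 _ Hx B HB).
          - apply (hp_opp p _ F); [|assumption]. intros z Hz. rewrite PS_lin, EF by auto. ring. }
        destruct (Hp_norm_spec p _ ltac:(lra) Hd) as [N0 [N1 _]].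
        apply (hp_ext p _ (fun z => fn n z - F z)%X); [intros z Hz; now rewrite Ed|].
        apply (hp_le p (rpow (Hp_norm p (fun z => fn n z - F z)%X) p)); [|assumption].
        unfold Rdist in HNn. rewrite Rminus_0_r, Rabs_pos_eq in HNn by assumption.
        rewrite <- (rpow_inv' eps p) by lra. apply rpow_le; lra. }
      assert (Dif : forall n m, in_lp p (fun k => C1 * xs n k + (- C1) * xs m k)%X) by (intros n m; apply in_lp_lin; [lra|apply Hxs|apply Hxs]).
      assert (Cau : forall eps, 0 < eps -> exists N, forall n m, (n >= N)%nat -> (m >= N)%nat -> forall k,
         Xsum p (fun k => C1 * xs n k + (- C1) * xs m k)%X k <= eps).
      { intros eps He. set (e := eps / (2 * K2 * Rpower 2 p)).
        assert (He' : 0 < e) by (unfold e; apply Rdiv_lt_0_compat; [assumption|apply Rmult_lt_0_compat; lra]).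
        destruct (Dsm e He') as [N HNn]. exists N. intros n m Hn Hm k.
        apply Rle_trans with (K2 * (Rpower 2 p * (e + e))); [|right; unfold e; field; split; lra].
        apply (T2 _ (Dif n m)); [apply Rmult_le_pos; lra|].
        apply (hp_quasi p _ _ _ (cdiff (lp_coef p a (xs n)) ph) (cdiff ph (lp_coef p a (xs m)))); try assumption.
        - apply absum_diff; [apply Tab, Hxs|assumption].
        - apply absum_diff; [assumption|apply Tab, Hxs].
        - apply Tan, Dif.
        - intros z Hz. rewrite Tlin by (try assumption; apply Hxs). rewrite !PS_diff by (try assumption; apply Tab, Hxs). unfold T, lp_map. ring.
        - apply HNn. lia.
        - apply (hp_opp p _ (PS (cdiff (lp_coef p a (xs m)) ph))); [|apply HNn; lia].
          intros z Hz. rewrite !PS_diff by (try assumption; apply Tab, Hxs). ring. }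
      assert (Lim : forall k, exists l, ccv (fun n => xs n k) l).
      { intros k. apply ccv_Cauchy. intros eps He. destruct (Cau (rpow (eps / 2) p) ltac:(apply rpow_gt0; lra)) as [N HNn].
        exists N. intros n m Hn Hm. specialize (HNn n m Hn Hm (S k)).
        pose proof (Rsum_term (S k) k (fun k => rpow (Cnorm (C1 * xs n k + (- C1) * xs m k)%X) p) (fun _ => rpow_ge0 _ _) ltac:(lia)) as Ht. cbv beta in Ht.
        replace (C1 * xs n k + - C1 * xs m k)%X with (xs n k - xs m k)%X in Ht by ring.
        assert (Hle : rpow (Cnorm (xs n k - xs m k)%X) p <= rpow (eps / 2) p) by (eapply Rle_trans; [exact Ht|exact HNn]).
        apply (rpow_le _ _ (1 / p)) in Hle; [|left; apply Rdiv_lt_0_compat; lra].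
        rewrite !rpow_inv in Hle by (try apply Cnorm_ge0; lra). lra. }
      set (x := fun k => epsilon (inhabits C0) (ccv (fun n => xs n k))).
      assert (Hxk : forall k, ccv (fun n => xs n k) (x k)) by (intros k; unfold x; apply epsilon_spec; apply Lim).
      assert (Xsm : forall eps, 0 < eps -> exists N, forall n, (n >= N)%nat -> forall k, Xsum p (fun k => x k - xs n k)%X k <= eps).
      { intros eps He. set (e := eps / (2 * Rpower 2 p)). assert (He' : 0 < e) by (unfold e; apply Rdiv_lt_0_compat; lra).
        destruct (Cau e He') as [N HNn]. exists N. intros n Hn k.
        (* Only k coordinates are involved, so coordinatewise convergence yields some m; it depends
           on k, but the bound e does not. *)
        assert (Fin : exists m, (m >= N)%nat /\ Xsum p (fun k => x k - xs m k)%X k <= e).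
        { set (d := rpow (e / (INR k + 1)) (1 / p)). pose proof (pos_INR k).
          assert (Hd0 : 0 < e / (INR k + 1)) by (apply Rdiv_lt_0_compat; lra).
          assert (Hd : 0 < d) by now apply rpow_gt0.
          assert (Cm : exists m, (m >= N)%nat /\ forall j, (j < k)%nat -> forall m', (m' >= m)%nat -> Cnorm (xs m' j - x j)%X < d).
          { clearbody d. clear - Hxk Hd. induction k as [|k [m [Hm IH]]]; [exists N; split; [lia|intros; lia]|].
            destruct (Hxk k d Hd) as [m2 Hm2]. exists (m + m2)%nat. split; [lia|]. intros j Hj m' Hm'.
            destruct (Nat.eq_dec j k) as [->|Nj]; [apply Hm2; lia|apply IH; lia]. }
          destruct Cm as [m [Hm Cm]]. exists m. split; [assumption|].
          apply Rle_trans with (INR k * (e / (INR k + 1))).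
          - rewrite <- Rsum_const. apply Rsum_le. intros j Hj. rewrite <- (rpow_inv' (e / (INR k + 1)) p) by lra.
            apply rpow_le; [lra|]. rewrite Cnorm_sub_sym. left. apply Cm; [assumption|lia].
          - apply Rle_trans with ((INR k + 1) * (e / (INR k + 1))); [apply Rmult_le_compat_r; lra|right; field; lra]. }
        destruct Fin as [m [Hm Fin]].
        eapply Rle_trans; [apply (Xsum_quasi p (fun k => x k - xs m k)%X (fun k => C1 * xs m k + (- C1) * xs n k)%X); [lra|intros j; ring]|].
        pose proof (HNn m n Hm Hn k) as H1. apply Rle_trans with (Rpower 2 p * (e + e)); [apply Rmult_le_compat_l; lra|].
        right. unfold e. field. lra. }
      assert (Hdx : forall eps, 0 < eps -> exists N, forall n, (n >= N)%nat -> in_lp p (fun k => x k - xs n k)%X /\ hp p (T (fun k => x k - xs n k)%X) eps).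
      { intros eps He. destruct (Xsm (eps / K1)) as [N HNn]; [now apply Rdiv_lt_0_compat|]. exists N. intros n Hn. specialize (HNn n Hn).
        assert (Hl : in_lp p (fun k => x k - xs n k)%X) by (apply in_lp_iff; now exists (eps / K1)).
        split; [assumption|]. apply (hp_le p (K1 * (eps / K1))); [right; field; lra|]. now apply T1. }
      assert (Hx : in_lp p x).
      { destruct (Hdx 1 ltac:(lra)) as [N HNn]. destruct (HNn N (le_n N)) as [Hl _].
        pose proof (in_lp_lin p C1 C1 _ _ ltac:(lra) Hl (proj1 (Hxs N))) as H.
        replace x with (fun n => (C1 * (x n - xs N n) + C1 * xs N n)%X); [exact H|].
        apply functional_extensionality. intros k. ring. }
      exists x. split; [assumption|]. intros z Hz.
      (* T x - F = T(x - x_n) + (T x_n - F), and both terms become arbitrarily small. *)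
      assert (Z : PS (cdiff (lp_coef p a x) ph) z = C0).
      { apply (hp_zero p); try assumption; [apply absum_diff; auto|]. intros eps He.
        set (e := eps / (2 * Rpower 2 p)). assert (He' : 0 < e) by (unfold e; apply Rdiv_lt_0_compat; lra).
        destruct (Hdx e He') as [N1 H1]. destruct (Dsm e He') as [N2 H2]. set (n := (N1 + N2)%nat).
        destruct (H1 n ltac:(unfold n; lia)) as [Hl Hh]. specialize (H2 n ltac:(unfold n; lia)).
        apply (hp_le p (Rpower 2 p * (e + e))); [right; unfold e; field; lra|].
        apply (hp_quasi p _ _ _ (lp_coef p a (fun k => x k - xs n k)%X) (cdiff (lp_coef p a (xs n)) ph)); try assumption.
        - now apply Tab.
        - apply absum_diff; [apply Tab, Hxs|assumption].
        - apply PS_is_analytic, absum_diff; auto.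
        - intros w Hw. rewrite !PS_diff by (try assumption; try apply Tab; try apply Hxs; assumption).
          change (PS (lp_coef p a (fun k => (x k - xs n k)%X)) w) with (T (fun k => x k - xs n k)%X w).
          pose proof (Tlin x (xs n) C1 (- C1)%X Hx (proj1 (Hxs n)) w Hw) as E.
          replace (fun k => (C1 * x k + - C1 * xs n k)%X) with (fun k => (x k - xs n k)%X) in E
            by (apply functional_extensionality; intros k; ring).
          rewrite E. unfold T, lp_map. ring. }
      rewrite PS_diff, EF in Z by auto. change (T x z - F z = C0)%X in Z.
      replace (T x z) with ((T x z - F z) + F z)%X by ring. rewrite Z. ring.
  (* N lies in M because the finite combinations do and M is closed. *)
  - intros h [x [Hx E]]. destruct (Sp x Hx) as [S1 [S2 S3]]. pose proof HM as [_ [_ [_ [_ Mcl]]]].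
    apply (Mcl (fun n z => Csum n (fun j => x j * f j z)%X) h).
    + intros n. apply (closed_Csum p); [assumption|]. intros; apply HMf.
    + now apply (TinHp x).
    + intros d Hd. destruct (S3 (rpow (d / 2) p)) as [N HN]; [apply rpow_gt0; lra|]. exists N. intros n Hn. specialize (HN n Hn).
      assert (Ed : forall z, inD z -> PS (cdiff (fsum a n x) (lp_coef p a x)) z = (Csum n (fun j => x j * f j z) - h z)%X).
      { intros z Hz. rewrite PS_diff, PS_fsum by (try apply absum_fsum; auto). rewrite <- (E z Hz).
        f_equal. apply Csum_ext. intros j _. now rewrite Ef. }
      assert (An : analytic (fun z => Csum n (fun j => x j * f j z) - h z)%X).
      { apply (PS_analytic (cdiff (fsum a n x) (lp_coef p a x))); [apply absum_diff; [now apply absum_fsum|assumption]|exact Ed]. }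
      pose proof (hp_ext p _ _ _ Ed HN) as HN'.
      pose proof (Np_le p _ _ ltac:(lra) An (rpow_ge0 _ _) HN') as B. rewrite rpow_inv in B by lra.
      destruct (Hp_norm_spec p _ ltac:(lra) (hp_is_Hp p _ _ ltac:(lra) An HN')) as [N0 _].
      unfold Rdist. rewrite Rminus_0_r, Rabs_pos_eq by assumption. lra.
  - exists T. split; [|split; [|split]].
    + intros x Hx. exists x. split; [assumption|reflexivity].
    + intros x y u v Hx Hy z Hz. now apply Tlin.
    + intros h Hh. exact Hh.
    + exists (/ rpow K2 (1 / p)), (rpow K1 (1 / p)).
      pose proof (rpow_gt0 K1 (1 / p) HK1) as R1. pose proof (rpow_gt0 K2 (1 / p) HK2) as R2.
      split; [now apply Rinv_0_lt_compat|]. split; [assumption|]. intros x Hx.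
      destruct (lp_sum_spec p x Hx) as [L1 L2]. pose proof (lp_sum_ge0 p x Hx) as L0.
      change (lp_norm p x) with (rpow (lp_sum p x) (1 / p)).
      assert (Hh : hp p (T x) (K1 * lp_sum p x)) by now apply T1.
      split.
      * destruct (Hp_norm_spec p (T x) ltac:(lra) (hp_is_Hp p _ _ ltac:(lra) (Tan x Hx) Hh)) as [N0 [N1 _]].
        assert (B : lp_sum p x <= K2 * rpow (Hp_norm p (T x)) p) by (apply L2; apply T2; [assumption|apply rpow_ge0|assumption]).
        apply (rpow_le _ _ (1 / p)) in B; [|left; apply Rdiv_lt_0_compat; lra].
        rewrite rpow_mult, rpow_inv in B by (try apply rpow_ge0; lra).
        apply Rmult_le_reg_l with (rpow K2 (1 / p)); [assumption|]. rewrite <- Rmult_assoc, Rinv_r, Rmult_1_l by lra. exact B.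
      * rewrite <- rpow_mult by lra. apply Np_le; [lra|now apply Tan|apply Rmult_le_pos; lra|assumption].
Qed.

(** * Unit vectors in M with many vanishing coefficients *)

Definition skip (i0 i : nat) : nat := if Compare_dec.lt_dec i i0 then i else S i.

Lemma Csum_skip (m i0 : nat) (F : nat -> Cx) : (i0 <= m)%nat ->
  Csum (S m) F = (F i0 + Csum m (fun i => F (skip i0 i)))%X.
Proof.
  induction m as [|m IH]; intros H.
  - replace i0 with 0%nat by lia. simpl. ring.
  - destruct (Nat.eq_dec i0 (S m)) as [->|N].
    + rewrite (Csum_ext (S m) (fun i => F (skip (S m) i)) F).
      * change (Csum (S (S m)) F) with (Csum (S m) F + F (S m))%X. ring.
      * intros i Hi. unfold skip. destruct (Compare_dec.lt_dec i (S m)); [reflexivity|lia].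
    + change (Csum (S (S m)) F) with (Csum (S m) F + F (S m))%X.
      change (Csum (S m) (fun i => F (skip i0 i))) with (Csum m (fun i => F (skip i0 i)) + F (skip i0 m))%X.
      rewrite IH by lia. replace (skip i0 m) with (S m); [ring|].
      unfold skip. destruct (Compare_dec.lt_dec m i0); [lia|reflexivity].
Qed.

(** Elimination: a vector with nonzero last coordinate clears that coordinate from the others, which
    leaves n + 1 vectors with n coordinates. *)
Lemma lin_dep (n : nat) (v : nat -> nat -> Cx) : exists c : nat -> Cx,
  (exists i, (i < S n)%nat /\ c i <> C0) /\
  forall j, (j < n)%nat -> Csum (S n) (fun i => c i * v i j)%X = C0.
Proof.
  revert v. induction n as [|n IH]; intros v.
  - exists (fun _ => C1). split; [|intros; lia]. exists 0%nat. split; [lia|].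
    intros E. apply (f_equal Cre) in E. simpl in E. lra.
  - destruct (excluded_middle_informative (exists i0, (i0 < S (S n))%nat /\ v i0 n <> C0)) as [[i0 [Hi0 Hv]]|Nv].
    + set (lam := fun i => (v (skip i0 i) n / v i0 n)%X).
      destruct (IH (fun i j => v (skip i0 i) j - lam i * v i0 j)%X) as [c [[i [Hi Hc]] Hs]].
      (* The pivot receives the coefficient that compensates all the multiples subtracted from the
         other vectors. *)
      set (d := fun i => if Nat.eq_dec i i0 then (- Csum (S n) (fun i => c i * lam i))%X
                         else if Compare_dec.lt_dec i i0 then c i else c (pred i)).
      assert (E1 : d i0 = (- Csum (S n) (fun i => c i * lam i))%X) by (unfold d; destruct (Nat.eq_dec i0 i0); [reflexivity|lia]).
      assert (E2 : forall i, d (skip i0 i) = c i).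
      { intros k. unfold skip, d. destruct (Compare_dec.lt_dec k i0).
        - destruct (Nat.eq_dec k i0); [lia|]. destruct (Compare_dec.lt_dec k i0); [reflexivity|lia].
        - destruct (Nat.eq_dec (S k) i0); [lia|]. destruct (Compare_dec.lt_dec (S k) i0); [lia|reflexivity]. }
      assert (Hd : forall j, Csum (S (S n)) (fun i => d i * v i j)%X
                = Csum (S n) (fun i => c i * (v (skip i0 i) j - lam i * v i0 j))%X).
      { intros j. rewrite (Csum_skip (S n) i0) by lia. rewrite E1.
        rewrite (Csum_ext (S n) (fun i => d (skip i0 i) * v (skip i0 i) j)%X
           (fun i => c i * (v (skip i0 i) j - lam i * v i0 j) + v i0 j * (c i * lam i))%X) by (intros k _; rewrite E2; ring).
        rewrite Csum_add, Csum_mul. ring. }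
      exists d. split.
      * exists (skip i0 i). rewrite E2. split; [unfold skip; destruct (Compare_dec.lt_dec i i0); lia|assumption].
      * intros j Hj. rewrite Hd. destruct (Nat.eq_dec j n) as [->|Nj]; [|apply Hs; lia].
        apply Csum_zero. intros k _. unfold lam. field. assumption.
    (* Without a pivot the last coordinate imposes no condition, and one vector is given coefficient
       0. *)
    + assert (Z : forall i, (i < S (S n))%nat -> v i n = C0) by (intros i Hi; apply NNPP; intros Hne; apply Nv; now exists i).
      destruct (IH v) as [c [[i [Hi Hc]] Hs]].
      exists (fun i => if Compare_dec.lt_dec i (S n) then c i else C0). split.
      * exists i. split; [lia|]. destruct (Compare_dec.lt_dec i (S n)); [assumption|lia].
      * intros j Hj. destruct (Nat.eq_dec j n) as [->|Nj].
        -- apply Csum_zero. intros k Hk. rewrite Z by assumption. ring.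
        -- change (Csum (S n) (fun i => (if Compare_dec.lt_dec i (S n) then c i else C0) * v i j)
              + (if Compare_dec.lt_dec (S n) (S n) then c (S n) else C0) * v (S n) j = C0)%X.
           destruct (Compare_dec.lt_dec (S n) (S n)); [lia|].
           rewrite (Csum_ext (S n) _ (fun i => c i * v i j)%X) by
             (intros k Hk; destruct (Compare_dec.lt_dec k (S n)); [reflexivity|lia]).
           rewrite Hs by lia. ring.
Qed.

Lemma hp_scal (p B : R) (c : Cx) (F : Cx -> Cx) : 0 < p -> analytic F -> hp p F B ->
  hp p (fun z => c * F z)%X (rpow (Cnorm c) p * B).
Proof.
  intros Hp HF H r Hr. rewrite (cm_ext r _ (fun z => rpow (Cnorm c) p * pw p F z)) by (intros; apply pw_scal).
  rewrite cm_scal by (apply cc_pw; [assumption|now apply analytic_cc]).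
  apply Rmult_le_compat_l; [apply rpow_ge0|now apply H].
Qed.

(** Members of M are functions on the whole plane, but the norm sees only the disc. The constant
    sequence f therefore converges to h, and closedness gives independence of the values outside. *)
Lemma closed_ext (p : R) (M : (Cx -> Cx) -> Prop) (f h : Cx -> Cx) : 1 <= p -> closed_subspace p M -> M f ->
  (forall z, inD z -> h z = f z) -> M h.
Proof.
  intros Hp [M1 [_ [_ [_ Mcl]]]] Hf E.
  destruct (analytic_PS f (proj1 (M1 f Hf))) as [a [Ha Ef]].
  assert (Hh : is_Hp p h).
  { destruct (is_Hp_hp p f ltac:(lra) (M1 f Hf)) as [B [_ HB]]. apply (hp_is_Hp p B); [lra| |].
    - apply (PS_analytic a); [assumption|]. intros z Hz. rewrite E by assumption. now apply Ef.
    - apply (hp_ext p B f); [|assumption]. intros z Hz. symmetry. now apply E. }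
  apply (Mcl (fun _ => f) h (fun _ => Hf) Hh). intros eps He. exists 0%nat. intros n _.
  assert (Ed : forall z, inD z -> PS (cdiff a a) z = (f z - h z)%X) by (intros z Hz; rewrite PS_diff, E, Ef by assumption; reflexivity).
  assert (An : analytic (fun z => f z - h z)%X) by (apply (PS_analytic (cdiff a a)); [now apply absum_diff|exact Ed]).
  assert (H0 : hp p (fun z => f z - h z)%X 0).
  { intros r Hr. rewrite (cm_ext r _ (fun _ => 0)); [rewrite cm_const; lra|]. intros t. unfold pw.
    rewrite E by (unfold inD; rewrite Cnorm_circ; lra). replace (f (circ r t) - f (circ r t))%X with C0 by ring.
    rewrite Cnorm_0. apply rpow_npos. lra. }
  pose proof (Np_le p 0 _ ltac:(lra) An (Rle_refl 0) H0) as L. rewrite rpow_npos in L by lra.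
  destruct (Hp_norm_spec p _ ltac:(lra) (hp_is_Hp p _ _ ltac:(lra) An H0)) as [N0 _].
  unfold Rdist. rewrite Rminus_0_r, Rabs_pos_eq by assumption. lra.
Qed.

(** Vanishing of n coefficients is n linear conditions, and n + 1 independent members of M are at
    hand; independence makes the combination nonzero, so it can be normalised. *)
Lemma unit_vector_vanishing (p : R) (M : (Cx -> Cx) -> Prop) (n : nat) : 1 <= p -> closed_subspace p M ->
  infinite_dimensional M -> exists a, absum a /\ (forall k, (k < n)%nat -> a k = C0) /\ M (PS a) /\
    hp p (PS a) 1 /\ 1 <= rpow (Hp_norm p (PS a)) p.
Proof.
  intros Hp HM Hinf. pose proof HM as [M1 [M0 [_ [Mmul _]]]].
  destruct (Hinf (S n)) as [fs [Hfs Hind]].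
  assert (Hcoef : forall i, exists a, absum a /\ ((i < S n)%nat -> forall z, inD z -> PS a z = fs i z)).
  { intros i. destruct (Compare_dec.lt_dec i (S n)) as [L|L].
    - destruct (analytic_PS (fs i) (proj1 (M1 _ (Hfs i L)))) as [a [Ha E]]. exists a. now split.
    (* An arbitrary summable sequence for the indices out of range, so that [al] is total. *)
    - destruct (analytic_PS _ (proj1 (M1 _ M0))) as [a [Ha _]]. exists a. split; [assumption|]. intros; lia. }
  pose (al := fun i => epsilon (inhabits (fun _ : nat => C0)) (fun a => absum a /\ ((i < S n)%nat -> forall z, inD z -> PS a z = fs i z))).
  assert (Hal : forall i, absum (al i) /\ ((i < S n)%nat -> forall z, inD z -> PS (al i) z = fs i z)).
  { intros i. unfold al. apply epsilon_spec. apply Hcoef. }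
  clearbody al. assert (Ha : forall i, absum (al i)) by (intros i; apply Hal).
  destruct (lin_dep n al) as [c [[i [Hi Hci]] Hc]].
  set (b := fsum al (S n) c). assert (Hb : absum b) by now apply absum_fsum.
  assert (Eb : forall z, inD z -> PS b z = Csum (S n) (fun j => c j * fs j z)%X).
  { intros z Hz. unfold b. rewrite PS_fsum by assumption. apply Csum_ext. intros j Hj. f_equal. now apply Hal. }
  assert (Mb : M (PS b)).
  { apply (closed_ext p M (fun z => Csum (S n) (fun j => c j * fs j z)%X)); try assumption.
    apply (closed_Csum p); assumption. }
  assert (Nz : ~ forall z, inD z -> PS b z = C0).
  { intros Z. apply Hci. apply Hind; [|assumption]. intros z Hz. rewrite <- Eb by assumption. now apply Z. }
  destruct (Hp_norm_spec p (PS b) ltac:(lra) (M1 _ Mb)) as [N0 [N1 N2]]. set (N := Hp_norm p (PS b)) in *.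
  assert (HN : 0 < N).
  { destruct N0 as [|E]; [assumption|]. exfalso. apply Nz. intros z Hz. apply (hp_zero p); try assumption.
    intros eps He. apply (hp_le p (rpow N p)); [|assumption]. rewrite <- E, rpow_npos by lra. lra. }
  assert (HNp : 0 < rpow N p) by now apply rpow_gt0.
  assert (HiN : 0 < / N) by now apply Rinv_0_lt_compat.
  assert (ENp : rpow (/ N) p * rpow N p = 1).
  { rewrite <- rpow_mult by lra. rewrite Rinv_l by lra. apply rpow_base1. }
  set (s := RtoC (/ N)). assert (Es : Cnorm s = / N) by (unfold s; rewrite Cnorm_RtoC; apply Rabs_pos_eq; lra).
  (* The void second summand gives the form required by [absum_lin] and [PS_lin]. *)
  exists (fun k => s * b k + C0 * b k)%X.
  assert (EP : forall z, inD z -> PS (fun k => s * b k + C0 * b k)%X z = (s * PS b z)%X).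
  { intros z Hz. rewrite PS_lin by assumption. ring. }
  assert (Ms : M (PS (fun k => s * b k + C0 * b k)%X)).
  { apply (closed_ext p M (fun z => s * PS b z)%X); try assumption. now apply Mmul. }
  split; [now apply absum_lin|]. split; [|split; [assumption|split]].
  - intros k Hk. unfold b, fsum. rewrite Hc by assumption. ring.
  - apply (hp_ext p 1 (fun z => s * PS b z)%X); [intros; symmetry; now apply EP|].
    apply (hp_le p (rpow (Cnorm s) p * rpow N p)); [rewrite Es; lra|].
    apply hp_scal; [lra|now apply PS_is_analytic|assumption].
  - destruct (Hp_norm_spec p _ ltac:(lra) (M1 _ Ms)) as [_ [L _]]. set (N' := rpow (Hp_norm p (PS (fun k => s * b k + C0 * b k)%X)) p) in *.
    apply (hp_scal p N' (RtoC N)) in L; [|lra|apply PS_is_analytic, absum_lin; assumption].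
    rewrite Cnorm_RtoC, Rabs_pos_eq in L by lra.
    assert (B : rpow N p <= rpow N p * N').
    { apply N2; [apply Rmult_le_pos; [lra|apply rpow_ge0]|].
      refine (hp_ext p _ _ _ _ L). intros z Hz. cbv beta. rewrite EP by assumption. unfold s.
      replace (RtoC N * (RtoC (/ N) * PS b z))%X with (RtoC (N * / N) * PS b z)%X by cx_ring.
      rewrite Rinv_r by lra. ring. }
    nra.
Qed.

(** The norm bound limits all coefficients of all the functions by one constant Q, and the n-th
    function starts at degree n, so it is at most Q |z|^n / (1 - |z|). *)
Lemma local_small (p B : R) (c : nat -> nat -> Cx) : 1 <= p -> 0 < B -> (forall n, absum (c n)) ->
  (forall n, hp p (PS (c n)) B) -> (forall n k, (k < n)%nat -> c n k = C0) ->
  forall R0 eta, 0 <= R0 < 1 -> 0 < eta -> exists N, forall n, (n >= N)%nat -> forall z, Cnorm z <= R0 -> n2 (PS (c n) z) <= eta.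
Proof.
  intros Hp HB Hc Hh H0 R0 eta HR He. set (Q := 2 * rpow B (1 / p)).
  assert (HQ : 0 < Q) by (unfold Q; apply Rmult_lt_0_compat; [lra|now apply rpow_gt0]).
  pose proof (sqrt_lt_R0 eta He) as Hs.
  assert (Hy : 0 < sqrt eta * (1 - R0) / Q) by (apply Rdiv_lt_0_compat; [apply Rmult_lt_0_compat; lra|assumption]).
  destruct (pow_lt_1_zero R0 ltac:(rewrite Rabs_pos_eq; lra) _ Hy) as [N HN]. exists N. intros n Hn z Hz.
  specialize (HN n Hn). rewrite Rabs_pos_eq in HN by (apply pow_le; lra). pose proof (Cnorm_ge0 z) as Nz.
  pose proof (PS_coef_small (c n) Q n z ltac:(unfold inD; lra) ltac:(lra) (fun k => hp_coef (c n) p B k Hp HB (Hc n) (Hh n)) (H0 n)) as L.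
  assert (L2 : Cnorm (PS (c n) z) <= sqrt eta).
  { eapply Rle_trans; [exact L|]. assert (Z1 : Cnorm z ^ n <= R0 ^ n) by (apply pow_incr; lra).
    assert (Z2 : / (1 - Cnorm z) <= / (1 - R0)) by (apply Rinv_le_contravar; lra).
    assert (Z3 : 0 < / (1 - Cnorm z)) by (apply Rinv_0_lt_compat; lra).
    apply Rle_trans with (Q * ((sqrt eta * (1 - R0) / Q) * / (1 - R0))); [|right; field; lra].
    apply Rmult_le_compat_l; [lra|]. apply Rmult_le_compat; [apply pow_le; lra|lra|lra|assumption]. }
  rewrite n2_norm. pose proof (Cnorm_ge0 (PS (c n) z)). rewrite <- (sqrt_sqrt eta) by lra. apply Rmult_le_compat; assumption.
Qed.

Lemma volt_vanishing (a b : nat -> Cx) (n : nat) : (forall k, (k < n)%nat -> a k = C0) -> forall k, (k < n)%nat -> volt a b k = C0.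
Proof.
  intros Ha [|k] Hk; [reflexivity|]. unfold volt, conv. rewrite Csum_zero; [ring|]. intros j Hj. rewrite Ha by lia. ring.
Qed.

(** Linearity of the operator on coefficients: the image of a finite combination of the f_j is the
    same combination of the F_j, to which [gliding_hump] applies. *)
Lemma volt_fsum (a : nat -> nat -> Cx) (b : nat -> Cx) (K : nat) (x : nat -> Cx) :
  volt (fsum a K x) b = fsum (fun j => volt (a j) b) K x.
Proof.
  assert (E : forall d k, conv (fsum a K x) d k = Csum K (fun j => x j * conv (a j) d k)%X).
  { intros d k. induction K as [|K IH]; [apply Csum_zero; intros j _; unfold fsum; simpl; ring|].
    change (Csum (S K) (fun j => x j * conv (a j) d k)%X) with (Csum K (fun j => x j * conv (a j) d k) + x K * conv (a K) d k)%X.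
    rewrite <- IH. unfold conv. rewrite <- Csum_mul, <- Csum_add. apply Csum_ext. intros j _.
    change (fsum a (S K) x j) with (fsum a K x j + x K * a K j)%X. ring. }
  apply functional_extensionality. intros [|k]; unfold fsum at 2; cbn [volt].
  - symmetry. apply Csum_zero. intros j _. ring.
  - rewrite E, <- Csum_mul. apply Csum_ext. intros j _. ring.
Qed.

(** The regularised power has nondecreasing means. Removing eps by the crude inequality for powers
    of sums leaves the factor 2^(p/2), which suffices for locating a lower bound. *)
Lemma cm_pw_incr (p : R) (c : nat -> Cx) (s t : R) : 0 < p -> absum c -> 0 <= s <= t -> t < 1 ->
  cm s (pw p (PS c)) <= Rpower 2 (p / 2) * cm t (pw p (PS c)).
Proof.
  intros Hp Hc Hs Ht. set (q := p / 2). assert (Hq : 0 < q) by (unfold q; lra).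
  assert (Ep : p = 2 * q) by (unfold q; field). pose proof (Rpower_pos 2 q) as H2.
  apply le_epsilon. intros eta He. set (eps := Rpower (eta / Rpower 2 q) (1 / q)).
  assert (Heps : 0 < eps) by apply Rpower_pos.
  assert (Hed : 0 < eta / Rpower 2 q) by now apply Rdiv_lt_0_compat.
  assert (Ee : Rpower 2 q * rpow eps q = eta).
  { unfold eps. rewrite <- (rpow_pos_eq (eta / Rpower 2 q)), rpow_inv' by lra. field. lra. }
  destruct (pow_subharmonic (PS c) _ q eps (hol_PS c Hc) Heps Hq) as [y1 [y2 [L [S HL]]]].
  pose proof (smooth_circont _ _ _ _ s S ltac:(lra)) as Ks. pose proof (smooth_circont _ _ _ _ t S ltac:(lra)) as Kt.
  assert (Kcs : circont s (pw p (PS c))) by (apply cc_pw; [assumption|apply PS_cc; [assumption|lra]]).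
  assert (Kct : circont t (pw p (PS c))) by (apply cc_pw; [assumption|apply PS_cc; [assumption|lra]]).
  apply Rle_trans with (cm s (fun z => Rpower (n2 (PS c z) + eps) q)).
  { apply cm_le; [assumption|assumption|]. intros x. rewrite Ep, pw_n2. pose proof (n2_ge0 (PS c (circ s x))).
    apply rpow_le_Rpower; lra. }
  apply Rle_trans with (cm t (fun z => Rpower (n2 (PS c z) + eps) q)); [exact (cm_nondecr _ _ _ _ S HL s t Hs Ht)|].
  rewrite <- Ee, <- (cm_const t (Rpower 2 q * rpow eps q)), <- cm_scal by assumption.
  rewrite <- cm_add by first [now apply circont_scal | apply circont_const].
  apply cm_le; [assumption|apply circont_add; [now apply circont_scal|apply circont_const]|].
  intros x. rewrite Ep, pw_n2. pose proof (n2_ge0 (PS c (circ t x))).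
  rewrite <- rpow_pos_eq by lra. rewrite <- Rmult_plus_distr_l. apply rpow_add_le; lra.
Qed.

Lemma primitive_volt (a b : nat -> Cx) : absum a -> absum b -> primitive a b (volt a b).
Proof. intros Ha Hb. destruct (volt_series a b Ha Hb) as [H1 [H2 H3]]. now repeat split. Qed.

Theorem theorem1p1 (g : Cx -> Cx) (p : R) (M : (Cx -> Cx) -> Prop) :
  is_BMOA g -> 1 <= p -> p <> 2 ->
  closed_subspace p M -> infinite_dimensional M ->
  (exists c, 0 < c /\ forall f, M f -> Hp_norm p (Tg g f) >= c * Hp_norm p f) ->
  exists N : (Cx -> Cx) -> Prop,
    closed_subspace p N /\ (forall f, N f -> M f) /\ isomorphic_to_lp p N.
Proof.
  intros Hg Hp _ HM Hinf [cc [Hcc Hbelow]].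
  destruct (analytic_PS g (proj1 Hg)) as [b [Hb Eb]].
  destruct (Tg_bounded g b p Hg Hb Eb ltac:(lra)) as [CT [HCT Hbd]].
  pose proof HM as [M1 _].
  assert (Hrc : 0 < rpow cc p) by now apply rpow_gt0.
  (* The lower bound for the operator on M, in terms of coefficients and p-th powers. *)
  assert (Hlow : forall al, absum al -> M (PS al) -> forall B, 0 <= B -> hp p (PS (volt al b)) B ->
            rpow cc p * rpow (Hp_norm p (PS al)) p <= B).
  { intros al Hal Mal B HB HhB.
    pose proof (Tg_series (PS al) g al b Hal Hb (fun z _ => eq_refl) Eb) as ET.
    destruct (volt_series al b Hal Hb) as [Hv _].
    assert (HhT : hp p (Tg g (PS al)) B) by exact (hp_ext p B _ _ ET HhB).
    destruct (Hp_norm_spec p (Tg g (PS al)) ltac:(lra) (hp_is_Hp p B _ ltac:(lra) (PS_analytic _ _ Hv ET) HhT)) as [T0 [_ T2]].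
    destruct (Hp_norm_spec p (PS al) ltac:(lra) (M1 _ Mal)) as [N0 _].
    rewrite <- rpow_mult by lra. eapply Rle_trans; [|exact (T2 B HB HhT)].
    apply rpow_le; [lra|]. apply Rge_le. now apply Hbelow. }
  assert (Hex : forall n, exists a, absum a /\ (forall k, (k < n)%nat -> a k = C0) /\ M (PS a) /\
    hp p (PS a) 1 /\ 1 <= rpow (Hp_norm p (PS a)) p) by (intros n; now apply unit_vector_vanishing).
  destruct (choice _ Hex) as [a Ha]. clear Hex.
  assert (Haa : forall n, absum (a n)) by (intros n; apply Ha).
  set (c := fun n => volt (a n) b).
  assert (Hprim : forall n, primitive (a n) b (c n)) by (intros n; now apply primitive_volt).
  assert (Hca : forall n, absum (c n)) by (intros n; apply Hprim).
  assert (Hah : forall n, hp p (PS (a n)) 1) by (intros n; apply Ha).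
  assert (Hch : forall n, hp p (PS (c n)) CT).
  { intros n r Hr. pose proof (Hbd _ _ (Hprim n) r Hr). pose proof (Hah n r Hr). nra. }
  assert (Hweak : forall eta, 0 < eta -> exists N, forall n, (n >= N)%nat -> forall s, 0 <= s < 1 -> cm s (pw (1 / 2) (PS (c n))) <= eta).
  { apply (Tg_weak g b p 1 Hg Hb Eb Hp Rle_0_1 a c Hprim Hah). intros R0 eta HR He.
    destruct (local_small p 1 a Hp Rlt_0_1 Haa Hah (fun n => proj1 (proj2 (Ha n))) R0 eta HR He) as [N1 H1].
    destruct (local_small p CT c Hp HCT Hca Hch (fun n => volt_vanishing _ _ _ (proj1 (proj2 (Ha n)))) R0 eta HR He) as [N2 H2].
    exists (N1 + N2)%nat. intros n Hn z Hz. split; [apply H1|apply H2]; (lia || assumption). }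
  pose proof (Rpower_pos 2 (p / 2)) as HR2.
  (* Half of the lower bound for the norms of the F_n, reduced by the factor lost in
     [cm_pw_incr]. *)
  set (c1 := rpow cc p / 2 / Rpower 2 (p / 2)). assert (Hc1 : 0 < c1) by (unfold c1; apply Rdiv_lt_0_compat; lra).
  (* Otherwise circles arbitrarily near the boundary have mean below c1, and almost monotonicity
     bounds all means of F_n by half of what [Hlow] demands. *)
  assert (Hsn : forall n, exists s, 0 <= s < 1 /\ forall t, s <= t < 1 -> c1 <= cm t (pw p (PS (c n)))).
  { intros n. apply NNPP. intros Hno.
    assert (Hup : hp p (PS (c n)) (rpow cc p / 2)).
    { intros s Hs. apply Rnot_lt_le. intros Hlt. apply Hno. exists s. split; [assumption|]. intros t Ht.
      pose proof (cm_pw_incr p (c n) s t ltac:(lra) (Hca n) ltac:(lra) ltac:(lra)) as Hmono.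
      apply Rmult_le_reg_l with (Rpower 2 (p / 2)); [assumption|].
      replace (Rpower 2 (p / 2) * c1) with (rpow cc p / 2) by (unfold c1; field; lra). lra. }
    destruct (Ha n) as [_ [_ [Mn [_ Nn]]]].
    pose proof (Hlow (a n) (Haa n) Mn (rpow cc p / 2) ltac:(lra) Hup). nra. }
  destruct (choice _ Hsn) as [sn Hs].
  (* With error c1/2 half of the lower bound c1 survives. *)
  destruct (gliding_hump p CT c (c1 / 2) Hp ltac:(lra) Hca Hch Hweak ltac:(lra)) as [idx Hidx].
  set (a' := fun j => a (idx j)). assert (Ha' : forall j, absum (a' j)) by (intros j; apply Haa).
  assert (Maf : forall j, M (PS (a' j))) by (intros j; apply Ha).
  assert (Ecomb : forall n x z, inD z -> PS (volt (fsum a' n x) b) z = comb c n idx x z).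
  { intros n x z Hz. rewrite volt_fsum. apply (PS_fsum (fun j => volt (a' j) b)); [|assumption]. intros j. apply (Hca (idx j)). }
  assert (Hgh : forall n x s, 0 <= s < 1 ->
     Rabs (cm s (pw p (PS (volt (fsum a' n x) b))) - Rsum n (fun j => rpow (Cnorm (x j)) p * cm s (pw p (PS (c (idx j)))))) <= c1 / 2 * Xsum p x n).
  { intros n x s Hs'. pose proof (Rsum_ge0 n (fun j => rpow (Cnorm (x j)) p) (fun _ _ => rpow_ge0 _ _)) as HX. fold (Xsum p x n) in HX.
    rewrite (cm_ext s _ (pw p (comb c n idx x))).
    2: { intros t. unfold pw. rewrite Ecomb; [reflexivity|]. unfold inD. rewrite Cnorm_circ; lra. }
    (* The l^p norm of x serves as the common bound A for its coordinates, which makes the error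
       proportional to the l^p sum. *)
    rewrite <- (rpow_inv' (Xsum p x n) p) by lra. apply Hidx; [assumption|apply rpow_ge0|].
    intros j Hj. rewrite <- (rpow_inv (Cnorm (x j)) p) by (try apply Cnorm_ge0; lra).
    apply rpow_le; [left; apply Rdiv_lt_0_compat; lra|].
    exact (Rsum_term n j (fun j => rpow (Cnorm (x j)) p) (fun _ => rpow_ge0 _ _) Hj). }
  apply (lp_copy p ((CT + c1 / 2) / rpow cc p) (2 * CT / c1) a' M (fun j => PS (a' j))); try assumption.
  - apply Rdiv_lt_0_compat; lra.
  - apply Rdiv_lt_0_compat; lra.
  - reflexivity.
  - intros n x.
    assert (HX : 0 <= Xsum p x n) by (apply Rsum_ge0; intros; apply rpow_ge0).
    assert (Mf : M (PS (fsum a' n x))).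
    { apply (closed_ext p M (fun z => Csum n (fun j => x j * PS (a' j) z)%X)); try assumption.
      - apply (closed_Csum p); [assumption|]. intros; apply Maf.
      - intros z Hz. now apply PS_fsum. }
    destruct (Hp_norm_spec p _ ltac:(lra) (M1 _ Mf)) as [_ [Nf _]].
    apply (hp_le p (rpow (Hp_norm p (PS (fsum a' n x))) p)); [|assumption].
    apply Rmult_le_reg_l with (rpow cc p); [assumption|].
    replace (rpow cc p * ((CT + c1 / 2) / rpow cc p * Xsum p x n)) with ((CT + c1 / 2) * Xsum p x n) by (field; lra).
    (* The upper estimate for combinations of the f_j comes from the lower bound on the operator,
       the lower estimate below from its boundedness. *)
    apply Hlow; [now apply absum_fsum|assumption|apply Rmult_le_pos; lra|].
    intros s Hs'. pose proof (proj1 (Rabs_le_between _ _) (Hgh n x s Hs')) as B.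
    assert (U : Rsum n (fun j => rpow (Cnorm (x j)) p * cm s (pw p (PS (c (idx j))))) <= CT * Xsum p x n).
    { unfold Xsum. rewrite <- Rsum_scal. apply Rsum_le. intros j _. pose proof (Hch (idx j) s Hs'). pose proof (rpow_ge0 (Cnorm (x j)) p). nra. }
    lra.
  - intros n x B HB HhB.
    (* A single circle beyond the thresholds of the finitely many functions in the combination. *)
    assert (Hmax : exists s, 0 <= s < 1 /\ forall j, (j < n)%nat -> sn (idx j) <= s).
    { clear - Hs. induction n as [|n [s [Hs1 IH]]]; [exists 0; split; [lra|intros; lia]|].
      destruct (Hs (idx n)) as [Hn _]. exists (Rmax s (sn (idx n))).
      pose proof (Rmax_l s (sn (idx n))). pose proof (Rmax_r s (sn (idx n))).
      split; [split; [lra|apply Rmax_lub_lt; lra]|]. intros j Hj. destruct (Nat.eq_dec j n) as [->|Nj]; [assumption|].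
      specialize (IH j ltac:(lia)). lra. }
    destruct Hmax as [s [Hs1 Hs2]].
    pose proof (proj1 (Rabs_le_between _ _) (Hgh n x s Hs1)) as Bd.
    assert (Lw : c1 * Xsum p x n <= Rsum n (fun j => rpow (Cnorm (x j)) p * cm s (pw p (PS (c (idx j)))))).
    { unfold Xsum. rewrite <- Rsum_scal. apply Rsum_le. intros j Hj.
      pose proof (proj2 (Hs (idx j)) s (conj (Hs2 j Hj) (proj2 Hs1))). pose proof (rpow_ge0 (Cnorm (x j)) p). nra. }
    pose proof (Hbd _ _ (primitive_volt _ _ (absum_fsum a' n x Ha') Hb) s Hs1) as Bu.
    specialize (HhB s Hs1).
    apply Rmult_le_reg_l with (c1 / 2); [lra|].
    replace (c1 / 2 * (2 * CT / c1 * B)) with (CT * B) by (field; lra).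
    apply Rle_trans with (CT * cm s (pw p (PS (fsum a' n x)))); [lra|]. apply Rmult_le_compat_l; lra.
Qed.
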